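(* Let $T>0$, $q\in(1,\infty)$, and let $\mathcal{Z}_q:=L^q_w(0,T;V)\cap L^q(0,T;H_{loc})\cap\mathbb{D}([0,T];U')\cap\mathbb{D}([0,T];H_w)$, equipped with the supremum $\mathcal{T}$ of the corresponding four topologies. Let $(X_n)_{n\in\mathbb{N}}$ be a sequence of càdlàg $\mathbb{F}$-adapted $U'$-valued processes (indexed by $[0,T]$) such that (a) there exists a positive constant $C_1$ such that $\sup_{n\in\mathbb{N}}\mathbb{E}\bigl[\sup_{s\in[0,T]}|X_n(s)|_H\bigr]\le C_1$; (b) there exists a positive constant $C_2$ such that $\sup_{n\in\mathbb{N}}\mathbb{E}\bigl[\int_0^T\|X_n(s)\|_V^q\,ds\bigr]\le C_2$; (c) $(X_n)_{n\in\mathbb{N}}$ satisfies the Aldous condition [A] in $U'$. Let $\tilde{\mathbb{P}}_n$ be the law of $X_n$ on $\mathcal{Z}_q$. Then for every $\varepsilon>0$ there exists a compact subset $K_\varepsilon$ of $\mathcal{Z}_q$ such that $\tilde{\mathbb{P}}_n(K_\varepsilon)\ge1-\varepsilon$ for all $n\in\mathbb{N}$.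
   Context: $(\Omega,\mathcal{F},\mathbb{P})$ is a probability space with filtration $\mathbb{F}=(\mathcal{F}_t)_{t\in[0,T]}$ satisfying the usual hypotheses. In (a), (b), $|x|_H:=\infty$ if $x\in U'\setminus H$ and $\|x\|_V:=\infty$ if $x\in U'\setminus V$. $d\in\{2,3\}$ and $\mathcal{O}\subset\mathbb{R}^d$ is an open connected (possibly unbounded) set with smooth boundary. $\mathcal{V}:=\{u\in C_c^\infty(\mathcal{O},\mathbb{R}^d):\operatorname{div}u=0\}$; $H$ is the closure of $\mathcal{V}$ in $L^2(\mathcal{O},\mathbb{R}^d)$ (norm $|\cdot|_H$), $V$ the closure of $\mathcal{V}$ in $H^1(\mathcal{O},\mathbb{R}^d)$ with $\|u\|_V^2=|u|_H^2+\|\nabla u\|_{L^2}^2$, and, for $m>0$, $V_m$ the closure of $\mathcal{V}$ in $H^m(\mathcal{O},\mathbb{R}^d)$. Fix $m>1$ and a Hilbert space $U\subset V_m$, dense in $V_m$, with compact embedding $U\hookrightarrow V_m$ (such $U$ exists). With $H\cong H'$ one has $U\hookrightarrow V\hookrightarrow H\cong H'\hookrightarrow U'$. $(\mathcal{O}_R)_{R\in\mathbb{N}}$ is a sequence of bounded open subsets of $\mathcal{O}$ with regular boundaries, $\mathcal{O}_R\subset\mathcal{O}_{R+1}$, $\bigcup_R\mathcal{O}_R=\mathcal{O}$. $H_{\mathcal{O}_R}$ and $V_{\mathcal{O}_R}$ are the spaces of restrictions to $\mathcal{O}_R$ of elements of $H$, $V$, with the $L^2(\mathcal{O}_R)$ and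 $H^1(\mathcal{O}_R)$ norms; the embeddings $V_{\mathcal{O}_R}\hookrightarrow H_{\mathcal{O}_R}$ are compact. Function spaces: - $\mathbb{D}([0,T];U')$: càdlàg functions $[0,T]\to U'$ with the Skorokhod topology. - $L^q_w(0,T;V)$: the space $L^q(0,T;V)$ with its weak topology. - $L^q(0,T;H_{loc})$: measurable $u:[0,T]\to H$ such that for all $R$, $p_{T,R}(u):=\bigl(\int_0^T|u(t)|_{H_{\mathcal{O}_R}}^q\,dt\bigr)^{1/q}<\infty$, with the topology generated by the seminorms $(p_{T,R})_{R\in\mathbb{N}}$. - $\mathbb{D}([0,T];H_w)$: weakly càdlàg functions $u:[0,T]\to H$, with the weakest topology such that for all $h\in H$ the map $u\mapsto(u(\cdot)|h)_H\in\mathbb{D}([0,T];\mathbb{R})$ (Skorokhod topology) is continuous. Aldous condition [A] in $U'$: for every $\varepsilon>0$ and $\eta>0$ there exists $\delta>0$ such that for every sequence $(\tau_n)_{n\in\mathbb{N}}$ of $\mathbb{F}$-stopping times with $\tau_n\le T$, $$\sup_{n\in\mathbb{N}}\sup_{0\le\theta\le\delta}\mathbb{P}\bigl\{\|X_n(\tau_n+\theta)-X_n(\tau_n)\|_{U'}\ge\eta\bigr\}\le\varepsilon,$$ with the convention $X_n(t):=X_n(T)$ for $t>T$. *)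

(* Defs.v *)
From HB Require Import structures.
From mathcomp Require Import all_boot all_order all_algebra.
From mathcomp Require Import all_classical all_reals all_analysis.

Set Implicit Arguments.
Unset Strict Implicit.
Unset Printing Implicit Defensive.

Import Order.TTheory GRing.Theory Num.Theory.
Import numFieldNormedType.Exports.

Local Open Scope classical_set_scope.
Local Open Scope ring_scope.

Definition rV_display : measure_display. Proof. exact. Qed.

Section rV_measurable.
Context {R : realType} (n : nat).

Definition rV_coord (i : 'I_n) (x : 'rV[R]_n) : R := x ord0 i.

Let rV_set0 : g_sigma_preimage rV_coord set0.
Proof. exact: sigma_algebra0. Qed.

Let rV_setC A : g_sigma_preimage rV_coord A -> g_sigma_preimage rV_coord (~` A).
Proof. exact: sigma_algebraC. Qed.

Let rV_bigcup (F : _^nat) : (forall i, g_sigma_preimage rV_coord (F i)) ->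
  g_sigma_preimage rV_coord (\bigcup_i (F i)).
Proof. exact: sigma_algebra_bigcup. Qed.

HB.instance Definition _ := @isMeasurable.Build rV_display
  'rV[R]_n (g_sigma_preimage rV_coord) rV_set0 rV_setC rV_bigcup.

Lemma measurable_rV_coord (i : 'I_n) : measurable_fun setT (rV_coord i).
Proof.
move=> _ Y mY; rewrite setTI; apply: sub_sigma_algebra => /=.
rewrite -bigcup_seq/=; exists i => /=; first by rewrite mem_index_enum.
by exists Y => //; rewrite setTI.
Qed.

Lemma measurable_to_rV d (T : measurableType d) (f : T -> 'rV[R]_n) :
  (forall i, measurable_fun setT (rV_coord i \o f)) -> measurable_fun setT f.
Proof.
move=> mf _ A mA; rewrite setTI.
move: A mA; apply: smallest_sub.
  split => /=; first by rewrite preimage_set0.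
  - by move=> A mA; rewrite setTD -preimage_setC; exact: measurableC.
  - by move=> F mF; rewrite preimage_bigcup; exact: bigcupT_measurable.
move=> A; rewrite -bigcup_seq => -[i _] [B mB <-] /=.
by rewrite setTI -comp_preimage -[X in measurable X]setTI; exact: mf.
Qed.

End rV_measurable.

Section product_image.
Context {R : realType} d1 d2 d3 (T1 : measurableType d1) (T2 : measurableType d2)
  (T3 : measurableType d3).
Variables (m1 : {sigma_finite_measure set T1 -> \bar R})
  (m2 : {sigma_finite_measure set T2 -> \bar R}).
Variables (f : T1 * T2 -> T3) (g : T3 -> T1 * T2).
Hypotheses (mf : measurable_fun setT f) (mg : measurable_fun setT g)
  (fK : cancel f g).

Let prodmu := [the {measure set _ -> \bar R} of (m1 \x m2)%E].

(* The library's sigma-finite structure on m1 \x m2 is only inferred for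
   probability measures. *)
Let prodmu_sigma_finite : sigma_finite setT prodmu.
Proof.
have /sigma_finiteP[F [TF ndF Foo]] := sigma_finiteT m1.
have /sigma_finiteP[G [TG ndG Goo]] := sigma_finiteT m2.
exists (fun n => F n `*` G n).
  rewrite -setXTT TF TG predeqE => -[x y]; split.
    move=> [/= [n _ Fnx] [k _ Gky]]; exists (maxn n k) => //; split.
    - by move: x Fnx; exact/subsetPset/ndF/leq_maxl.
    - by move: y Gky; exact/subsetPset/ndG/leq_maxr.
  by move=> [n _ []/= ? ?]; split; exists n.
move=> k; have [? ?] := Foo k; have [? ?] := Goo k.
split; first exact: measurableX.
by rewrite /prodmu /= product_measure1E// lte_mul_pinfty// ge0_fin_numE.
Qed.

Definition product_image of measurable_fun setT f & measurable_fun setT g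
  & cancel f g : set T3 -> \bar R := pushforward prodmu f.

Let nu := product_image mf mg fK.

Let nu0 : nu set0 = 0%E.
Proof. by rewrite /nu /product_image /pushforward preimage_set0 measure0. Qed.

Let nu_ge0 A : (0 <= nu A)%E.
Proof. exact: measure_ge0. Qed.

Let nu_sigma_additive : semi_sigma_additive nu.
Proof.
have mP A : measurable A -> measurable (f @^-1` A).
  by move=> mA; rewrite -[X in measurable X]setTI; exact: mf.
move=> F mF tF mUF; rewrite /nu /product_image /pushforward preimage_bigcup.
apply: measure_semi_sigma_additive.
- by move=> k; exact: mP.
- apply/trivIsetP => /= i j _ _ ij; rewrite -preimage_setI.
  by move/trivIsetP : tF => /(_ _ _ _ _ ij) ->//; rewrite preimage_set0.
- by rewrite -preimage_bigcup; exact: mP.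
Qed.

HB.instance Definition _ := isMeasure.Build _ _ _ nu
  nu0 nu_ge0 nu_sigma_additive.

Let nu_sigma_finite : sigma_finite setT nu.
Proof.
have [F TF mF] := prodmu_sigma_finite.
exists (fun k => g @^-1` F k).
  by rewrite -preimage_bigcup -TF preimage_setT.
move=> k; split.
  by rewrite -[X in measurable X]setTI; apply: mg => //; exact: (mF k).1.
rewrite /nu /product_image /pushforward -comp_preimage.
rewrite (_ : _ @^-1` _ = F k); first exact: (mF k).2.
by apply/seteqP; split => p /=; rewrite fK.
Qed.

HB.instance Definition _ := Measure_isSigmaFinite.Build _ _ _ nu
  nu_sigma_finite.

Definition product_image_measure : {sigma_finite_measure set T3 -> \bar R} :=
  [the {sigma_finite_measure set _ -> \bar R} of nu].

End product_image.

Section lebesgue_rV.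
Context {R : realType}.

Definition rV_cons n (p : R * 'rV[R]_n) : 'rV[R]_n.+1 :=
  row_mx (const_mx p.1 : 'rV_1) p.2.

Definition rV_uncons n (v : 'rV[R]_n.+1) : R * 'rV[R]_n :=
  (v ord0 ord0, \row_i v ord0 (lift ord0 i)).

Lemma rV_consK n : cancel (@rV_cons n) (@rV_uncons n).
Proof.
move=> [x v]; rewrite /rV_uncons /rV_cons /=; congr pair.
  rewrite (_ : (ord0 : 'I_n.+1) = lshift n (ord0 : 'I_1)); last exact/val_inj.
  by rewrite (@row_mxEl _ 1 1 n) mxE.
apply/rowP => i; rewrite mxE.
rewrite (_ : lift ord0 i = rshift 1 i); last exact/val_inj.
by rewrite (@row_mxEr _ 1 1 n).
Qed.

Lemma measurable_rV_cons n : measurable_fun setT (@rV_cons n).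
Proof.
apply: measurable_to_rV => i.
have [->|] := eqVneq i ord0.
  apply: (eq_measurable_fun fst); last exact: measurable_fst.
  by move=> p _; have /(congr1 fst) := rV_consK p.
rewrite eq_sym => /unlift_some[k -> _].
apply: (eq_measurable_fun (rV_coord k \o snd)).
  by move=> p _; have /(congr1 snd)/rowP/(_ k) := rV_consK p; rewrite mxE.
apply: measurableT_comp; last exact: measurable_snd.
exact: measurable_rV_coord.
Qed.

Lemma measurable_rV_uncons n : measurable_fun setT (@rV_uncons n).
Proof.
apply/measurable_fun_pairP; split; first exact: measurable_rV_coord.
apply: measurable_to_rV => i.
apply: (eq_measurable_fun (rV_coord (lift ord0 i))).
  by move=> v _; rewrite /rV_coord /= mxE.
exact: measurable_rV_coord.
Qed.

Definition rV_measure0 : {sigma_finite_measure set 'rV[R]_0 -> \bar R} :=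
  [the {sigma_finite_measure set _ -> \bar R} of \d_(0 : 'rV[R]_0)].

Fixpoint rV_lebesgue n : {sigma_finite_measure set 'rV[R]_n -> \bar R} :=
  if n is m.+1 then
    product_image_measure (@lebesgue_measure R) (rV_lebesgue m)
      (@measurable_rV_cons m) (@measurable_rV_uncons m) (@rV_consK m)
  else rV_measure0.

End lebesgue_rV.

Section continuous_dual.
Context {R : realType} {U : normedModType R}.

Definition bounded_linear (f : U -> R^o) : Prop :=
  linear f /\ exists M : R, forall u, `|f u| <= M * `|u|.

Definition bounded_linear_pred : {pred U -> R^o} :=
  fun f => `[< bounded_linear f >].

Lemma bounded_linear_submod : submod_closed bounded_linear_pred.
Proof.
split; first apply/asboolP.
  split; first by move=> a u v; rewrite /= scaler0 addr0.
  by exists 0 => u; rewrite normr0 mul0r.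
move=> a f g /asboolP[lf [M Mf]] /asboolP[lg [N Ng]]; apply/asboolP; split.
  move=> b u v /=; rewrite !fctE lf lg.
  by rewrite !scalerDr !scalerA (mulrC a b) addrACA.
exists (`|a| * M + N) => u; rewrite !fctE.
rewrite (le_trans (ler_normD _ _))// mulrDl lerD//.
by rewrite normrZ -mulrA ler_wpM2l.
Qed.

HB.instance Definition _ :=
  GRing.isSubmodClosed.Build R (U -> R^o) bounded_linear_pred
    bounded_linear_submod.

End continuous_dual.

Section dual_type.
Context {R : realType} (U : normedModType R).

Record dual := Dual {
  dual_fun :> U -> R^o;
  dual_funP : dual_fun \in bounded_linear_pred }.

HB.instance Definition _ := [isSub for dual_fun].
HB.instance Definition _ := [Choice of dual by <:].
HB.instance Definition _ := [SubChoice_isSubLmodule of dual by <:].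

Definition dual_norm (x : dual) : R :=
  sup [set `|x u| | u in [set u : U | `|u| <= 1]].

Lemma dual_bounded_linear (x : dual) : bounded_linear x.
Proof. by case: x => f /= /asboolP. Qed.

Let dual_norm_has_sup (x : dual) :
  has_sup [set `|x u| | u in [set u : U | `|u| <= 1]].
Proof.
have [_ [M Mx]] := dual_bounded_linear x.
split; first by exists `|x 0|; exists 0 => //=; rewrite normr0.
exists (Num.max M 0) => _ [u /= u1 <-]; rewrite (le_trans (Mx u))//.
rewrite (@le_trans _ _ (Num.max M 0 * `|u|))//.
  by rewrite ler_wpM2r// le_max lexx.
by rewrite ler_piMr// le_max lexx orbT.
Qed.

Let le_dual_norm (x : dual) u : `|u| <= 1 -> `|x u| <= dual_norm x.
Proof.
by move=> u1; apply: ub_le_sup; [exact: (dual_norm_has_sup x).2|exists u].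
Qed.

Let dual_norm_le (x : dual) M :
  (forall u, `|u| <= 1 -> `|x u| <= M) -> dual_norm x <= M.
Proof.
move=> xM; apply: ge_sup; first exact: (dual_norm_has_sup x).1.
by move=> _ [u /= u1 <-]; exact: xM.
Qed.

Let dual_normD (x y : dual) : dual_norm (x + y) <= dual_norm x + dual_norm y.
Proof.
apply: dual_norm_le => u u1.
by rewrite (le_trans (ler_normD _ _))// lerD// le_dual_norm.
Qed.

Let dual_normZ_le (a : R) (x : dual) : dual_norm (a *: x) <= `|a| * dual_norm x.
Proof.
apply: dual_norm_le => u u1.
by rewrite [leLHS]normrZ ler_wpM2l// le_dual_norm.
Qed.

Let dual_norm_eq0 (x : dual) : dual_norm x = 0 -> x = 0.
Proof.
move=> x0; apply/val_inj/funext => u /=.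
have [lx _] := dual_bounded_linear x.
have xZ a v : x (a *: v) = a *: x v.
  have := lx a v 0; rewrite !addr0 => ->.
  suff -> : x 0 = 0 by rewrite addr0.
  by have := lx (- 1) 0 0; rewrite scaler0 addr0 scaleN1r addNr.
have [->|u0] := eqVneq u 0; first by have := xZ 0 0; rewrite !scale0r.
have : `|x (`|u|^-1 *: u)| <= 0.
  by rewrite -x0 le_dual_norm// normrZ normfV normr_id mulVf// normr_eq0.
rewrite normr_le0 xZ scaler_eq0 invr_eq0 normr_eq0 (negbTE u0) /=.
by move/eqP.
Qed.

Let dual_normZ (a : R) (x : dual) : dual_norm (a *: x) = `|a| * dual_norm x.
Proof.
apply/eqP; rewrite eq_le dual_normZ_le/=.
have [->|a0] := eqVneq a 0.
  by rewrite normr0 mul0r -(@mul0r _ (dual_norm x)) (le_trans _ (le_dual_norm _ (u:=0) _))// ?normr0// mul0r.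
rewrite -ler_pdivlMl ?normr_gt0// -normfV (le_trans _ (dual_normZ_le _ _))//.
by rewrite scalerA mulVf// scale1r.
Qed.

HB.instance Definition _ := @Lmodule_isNormed.Build R dual dual_norm
  dual_normD dual_normZ dual_norm_eq0.

End dual_type.

Section euclidean.
Context {R : realType} {d : nat}.
Implicit Types (x y : 'rV[R]_d) (f g : 'rV[R]_d -> R) (O A : set 'rV[R]_d).

Definition dotp x y : R := \sum_(i < d) x ord0 i * y ord0 i.

Definition enorm x : R := Num.sqrt (dotp x x).

Definition pdiff (i : 'I_d) f : 'rV[R]_d -> R := fun x => 'D_(delta_mx ord0 i) f x.

Definition pdiffs (s : seq 'I_d) f : 'rV[R]_d -> R := foldr pdiff f s.

Definition smooth f : Prop := forall s : seq 'I_d,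
  continuous (pdiffs s f) /\
  forall i x, derivable (pdiffs s f) x (delta_mx ord0 i).

Definition lipschitzian f : Prop :=
  exists k : R, forall x y, `|f x - f y| <= k * enorm (x - y).

(* Locally O lies strictly above the graph, in some direction e, of a function
   of class C of the variables orthogonal to e. *)
Definition has_boundary_of_class (C : ('rV[R]_d -> R) -> Prop) O : Prop :=
  forall x, (closure O `&` closure (~` O)) x ->
  exists (r : R) (e : 'rV[R]_d) (g : 'rV[R]_d -> R),
    [/\ 0 < r, enorm e = 1, C g, forall y (s : R), g (y + s *: e) = g y &
        forall y, enorm (y - x) < r -> (O y <-> g y < dotp y e)].

End euclidean.

Section sobolev.
Context {R : realType} {d : nat}.
Local Notation E := 'rV[R]_d.
Local Notation leb := (@rV_lebesgue R d).
Implicit Types (A O : set E) (f v w : E -> E) (g h : E -> R).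

Definition component (i : 'I_d) f : E -> R := fun x => f x ord0 i.

Definition test_function O (phi : E -> R) : Prop :=
  smooth phi /\
  exists K, [/\ compact K, K `<=` O & forall x, ~ K x -> phi x = 0].

Definition divergence f : E -> R := fun x => \sum_(i < d) pdiff i (component i f) x.

Definition div_free_test O : set (E -> E) :=
  [set v | (forall i, test_function O (component i v)) /\
           (forall x, divergence v x = 0)].

(* Elements of the L^2 and Sobolev spaces over A are represented by functions
   on the whole of R^d; values outside A are irrelevant, and functions that
   agree a.e. on A stand for the same element. *)
Definition ae_eq_on A f w : Prop := {ae leb, forall x, A x -> f x = w x}.

Definition sqL2 A g : \bar R := (\int[leb]_(x in A) ((g x) ^+ 2)%:E)%E.

Definition L2 A g : Prop := measurable_fun A g /\ (sqL2 A g < +oo)%E.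

Definition L2v A : set (E -> E) := [set f | forall i, L2 A (component i f)].

Definition L2_norm A f : \bar R :=
  ((\sum_(i < d) sqL2 A (component i f)) `^ 2^-1)%E.

Definition L2_inner A f w : R := \int[leb]_(x in A) dotp (f x) (w x).

(* h is the weak derivative of g on A along the list of directions s *)
Definition weak_derivative A (s : seq 'I_d) g h : Prop :=
  L2 A h /\
  forall phi, test_function A phi ->
    \int[leb]_(x in A) (g x * pdiffs s phi x) =
    (-1) ^+ size s * \int[leb]_(x in A) (h x * phi x).

Definition multi_index k (a : {ffun 'I_d -> 'I_k.+1}) : seq 'I_d :=
  flatten [seq nseq (a i) i | i <- enum 'I_d].

(* Squared Gagliardo seminorm of order s in ]0, 1[ *)
Definition gagliardo A (s : R) g : \bar R :=
  (\int[leb]_(x in A) \int[leb]_(y in A)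
    ((g x - g y) ^+ 2 / enorm (x - y) `^ (d%:R + 2 * s))%:E)%E.

(* Squared norm of H^m(A, R^d), with the Sobolev-Slobodeckij seminorm of order
   m - k of the derivatives of order k = floor m when m is not an integer. Weak
   derivatives are unique a.e., so that each infimum is over at most one value;
   it is +oo when there is no weak derivative in L^2. For m = 1 this is
   |f|_{L^2}^2 + |grad f|_{L^2}^2. *)
Definition sqHm (m : R) A f : \bar R :=
  let k := Num.truncn m in
  (\sum_(i < d) \sum_(a : {ffun 'I_d -> 'I_k.+1} | (\sum_j a j <= k)%N)
    ereal_inf
      [set (sqL2 A h + if (k%:R < m)%R && ((\sum_j a j)%N == k)
                       then gagliardo A (m - k%:R)%R h else 0)
      | h in weak_derivative A (multi_index a) (component i f)])%E.

Definition Hm_norm (m : R) A f : \bar R := (sqHm m A f `^ 2^-1)%E.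

Definition Hm (m : R) A : set (E -> E) :=
  [set f | L2v A f /\ (sqHm m A f < +oo)%E].

Definition closure_in (S : set (E -> E)) (N : (E -> E) -> \bar R)
    (D : set (E -> E)) : set (E -> E) :=
  [set f | S f /\ forall e : R, 0 < e -> exists2 v, D v & (N (f \- v)%R < e%:E)%E].

Definition spaceH O : set (E -> E) :=
  closure_in (L2v O) (L2_norm O) (div_free_test O).

Definition spaceV (m : R) O : set (E -> E) :=
  closure_in (Hm m O) (Hm_norm m O) (div_free_test O).

(* D, with the norm N, is mapped compactly by i to D', with the norm N'. For
   the spaces of restrictions to a subdomain, a restriction is represented by
   any of its extensions, and N, N' are norms over the subdomain. *)
Definition compact_map (X : Type) (D : set X) (N : X -> \bar R)
    (i : X -> E -> E) (D' : set (E -> E)) (N' : (E -> E) -> \bar R) : Prop :=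
  forall a : nat -> X, (forall k, D (a k)) ->
  (exists C : R, forall k, (N (a k) <= C%:E)%E) ->
  exists s : nat -> nat, {homo s : k l / (k < l)%N} /\
  exists2 f, D' f & N' (i (a (s k)) \- f) @[k --> \oo] --> 0%E.

End sobolev.

Section hilbert.
Context {R : realType} (U : normedModType R).

Definition hilbert_norm : Prop := exists ip : U -> U -> R,
  [/\ forall u v, ip u v = ip v u,
      forall a u v w, ip (a *: u + v) w = a * ip u w + ip v w &
      forall u, ip u u = `|u| ^+ 2].

Context {d : nat}.

(* j realizes U as a linear subspace of V_m, dense and compactly embedded *)
Definition dense_compact_subspace (m : R) (O : set 'rV[R]_d)
    (j : U -> 'rV[R]_d -> 'rV[R]_d) : Prop :=
  [/\ forall u, spaceV m O (j u),
      forall (a : R) u v, ae_eq_on O (j (a *: u + v)) (a \*: j u \+ j v),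
      forall u, ae_eq_on O (j u) (cst 0) -> u = 0,
      forall f, spaceV m O f -> forall e : R, 0 < e ->
        exists u, (Hm_norm m O (f \- j u)%R < e%:E)%E &
      compact_map setT (fun u => `|u|%:E) j (spaceV m O) (Hm_norm m O)].

End hilbert.

(* Along U -> V_m -> V -> H = H' -> U', an element x of U' lies in H when it is
   the functional u |-> (f, j u)_{L^2} for some f in H. As j has dense range in
   H, the field f is unique a.e. *)
Section chain.
Context {R : realType} {d : nat} {U : normedModType R}.
Variables (O : set 'rV[R]_d) (j : U -> 'rV[R]_d -> 'rV[R]_d).
Implicit Types (x h : dual U).

Definition fields x : set ('rV[R]_d -> 'rV[R]_d) :=
  [set f | spaceH O f /\ forall u, x u = L2_inner O f (j u)].

Definition inH x : Prop := exists f, fields x f.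

Definition field_of x : 'rV[R]_d -> 'rV[R]_d := xget (cst 0) (fields x).

Definition inV x : Prop := inH x /\ spaceV 1 O (field_of x).

(* normH O is |.|_H and, for A included in O, normH A is |.|_{H_A} *)
Definition normH (A : set 'rV[R]_d) x : \bar R :=
  if `[< inH x >] then L2_norm A (field_of x) else +oo%E.

Definition normV x : \bar R :=
  if `[< inV x >] then Hm_norm 1 O (field_of x) else +oo%E.

Definition innerH x h : R := L2_inner O (field_of x) (field_of h).

End chain.

Section time_functions.
Context {R : realType}.
Variable T : R.

(* A function on [0, T] is represented by its extension to R that is constant on
   either side of [0, T]. *)
Definition extend S (u : R -> S) : R -> S := fun t => u (Num.max 0 (Num.min t T)).

Definition is_extended S (u : R -> S) : Prop := extend u = u.

Definition cadlag (S : topologicalType) (u : R -> S) : Prop :=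
  forall t, u s @[s --> t^'+] --> u t /\ exists l : S, u s @[s --> t^'-] --> l.

Definition time_change (l : R -> R) : Prop :=
  [/\ l 0 = 0, l T = T,
      {in `[0, T] &, {homo l : s t / s < t}} & {within `[0, T], continuous l}].

Definition skorokhod_dist (S : normedModType R) (x y : R -> S) : R :=
  inf [set r | 0 <= r /\ exists l, time_change l /\
    forall t, t \in `[0, T] -> `|l t - t| <= r /\ `|x t - y (l t)| <= r].

End time_functions.

(* The topology generated by the balls of a family of pseudometrics *)
Definition ball_topology {R : realType} {S I : Type}
  (dist : I -> S -> S -> \bar R) : Type := S.

Section ball_topology.
Context {R : realType} {S : choiceType} {I : Type}.
Variable dist : I -> S -> S -> \bar R.
Local Notation B := (ball_topology dist).

Definition ball_subbase : set (set B) :=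
  [set A | exists i x (r : R), 0 < r /\ A = [set y | (dist i x y < r%:E)%E]].

HB.instance Definition _ := Choice.on B.
HB.instance Definition _ := isSubBaseTopological.Build B ball_subbase id.

End ball_topology.

Section skorokhod.
Context {R : realType}.
Variables (T : R) (S : normedModType R).

Definition skorokhod_fun : Type := [set x : R -> S | is_extended T x /\ cadlag x].

Definition skorokhod : Type :=
  ball_topology (fun (_ : unit) (x y : skorokhod_fun) =>
    (skorokhod_dist T (set_val x) (set_val y))%:E).
HB.instance Definition _ := Topological.on skorokhod.
End skorokhod.

Section function_spaces.
Context {R : realType} {d : nat} {U : normedModType R}.
Variables (O : set 'rV[R]_d) (j : U -> 'rV[R]_d -> 'rV[R]_d).
Variables (OR : nat -> set 'rV[R]_d) (T q : R).
Local Notation U' := (dual U).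
Local Notation leb1 := (@lebesgue_measure R).
Implicit Types u v : R -> U'.

(* Strong (Bochner) measurability on [0, T], with values in the space of those
   x in U' such that N x is finite, normed by N *)
Definition strongly_measurable (N : U' -> \bar R) u : Prop :=
  exists s : nat -> R -> U',
    (forall n, [/\ finite_set (range (s n)),
                   forall y, measurable (s n @^-1` [set y]) &
                   forall t, (N (s n t) < +oo)%E]) /\
    {ae leb1, forall t, t \in `[0, T] -> N (u t - s n t) @[n --> \oo] --> 0%E}.

Definition Lq_norm (N : U' -> \bar R) u : \bar R :=
  ((\int[leb1]_(t in `[0%R, T]) (N (u t) `^ q)) `^ q^-1)%E.

Definition LqV : set (R -> U') :=
  [set u | strongly_measurable (normV O j) u /\
           (Lq_norm (normV O j) u < +oo)%E].

(* Continuous linear functionals on L^q(0, T; V): boundedness makes them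
   insensitive to changes on null sets. *)
Definition LqV_functional (L : (R -> U') -> R) : Prop :=
  (forall (a : R) u v, LqV u -> LqV v -> L (a \*: u \+ v) = a * L u + L v) /\
  exists C : R, forall u, LqV u -> (`|L u|%:E <= C%:E * Lq_norm (normV O j) u)%E.

Definition LqV_weak : Type :=
  sup_topology (fun L : {L | LqV_functional L} =>
    Topological.on (initial_topology (fun u : LqV => sval L (set_val u) : R))).
HB.instance Definition _ := Topological.on LqV_weak.

Definition LqHloc_set : set (R -> U') :=
  [set u | [/\ forall t, t \in `[0, T] -> inH O j (u t),
               strongly_measurable (normH O j O) u &
               forall r, (Lq_norm (normH O j (OR r)) u < +oo)%E]].

Definition LqHloc : Type :=
  ball_topology (fun (r : nat) (u v : LqHloc_set) =>
    Lq_norm (normH O j (OR r)) (set_val u \- set_val v)).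
HB.instance Definition _ := Topological.on LqHloc.

Definition weakly_cadlag u : Prop :=
  (forall t, inH O j (u t)) /\
  forall t,
    (forall h, inH O j h -> innerH O j (u s) h @[s --> t^'+] --> innerH O j (u t) h) /\
    exists2 l, inH O j l &
      forall h, inH O j h -> innerH O j (u s) h @[s --> t^'-] --> innerH O j l h.

Definition DHw_set : set (R -> U') :=
  [set u | is_extended T u /\ weakly_cadlag u].

Lemma DHw_inner_subproof (h : {h : U' | inH O j h}) (u : DHw_set) :
  (fun t => innerH O j (set_val u t) (sval h) : R^o) \in
    [set x : R -> R^o | is_extended T x /\ cadlag x].
Proof.
have [eu [_ cu]] := set_valP u.
rewrite inE; split; last first.
  move=> t; have [cr [l _ cl]] := cu t; split; first exact: cr (svalP h).
  by exists (innerH O j l (sval h)); exact: cl (svalP h).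
by apply/funext => t; rewrite /extend /= -[X in _ = innerH _ _ (X t) _]eu.
Qed.

Definition DHw_inner h (u : DHw_set) : skorokhod T R^o :=
  exist (fun x => x \in [set x | is_extended T x /\ cadlag x]) _
    (DHw_inner_subproof h u).

Definition DHw : Type :=
  sup_topology (fun h : {h : U' | inH O j h} =>
    Topological.on (initial_topology (DHw_inner h))).
HB.instance Definition _ := Topological.on DHw.

Definition Zq_set : set (R -> U') :=
  [set u | [/\ LqV u, LqHloc_set u, is_extended T u /\ cadlag u & DHw_set u]].

Definition Zq_LqV (u : Zq_set) : LqV_weak :=
  exist (fun v => v \in LqV) (set_val u)
    (mem_set (let: And4 c _ _ _ := set_valP u in c)).

Definition Zq_LqHloc (u : Zq_set) : LqHloc :=
  exist (fun v => v \in LqHloc_set) (set_val u)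
    (mem_set (let: And4 _ c _ _ := set_valP u in c)).

Definition Zq_skorokhod (u : Zq_set) : skorokhod T U' :=
  exist (fun v => v \in [set v | is_extended T v /\ cadlag v]) (set_val u)
    (mem_set (let: And4 _ _ c _ := set_valP u in c)).

Definition Zq_DHw (u : Zq_set) : DHw :=
  exist (fun v => v \in DHw_set) (set_val u)
    (mem_set (let: And4 _ _ _ c := set_valP u in c)).

Definition Zq : Type :=
  sup_topology (fun i : 'I_4 => match val i with
    | 0 => Topological.on (initial_topology Zq_LqV)
    | 1 => Topological.on (initial_topology Zq_LqHloc)
    | 2 => Topological.on (initial_topology Zq_skorokhod)
    | _ => Topological.on (initial_topology Zq_DHw)
    end).
HB.instance Definition _ := Topological.on Zq.

Definition Zq_val (z : Zq) : R -> U' := set_val (z : Zq_set).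

End function_spaces.

Section processes.
Context {dd : measure_display} {Omega : measurableType dd} {R : realType}.
Variables (T : R) (F : R -> set (set Omega)).

(* F is a filtration indexed by [0, T]; its values outside [0, T] are irrelevant *)
Definition filtration : Prop :=
  (forall t, t \in `[0, T] ->
    sigma_algebra setT (F t) /\ F t `<=` measurable) /\
  (forall s t, 0 <= s -> s <= t -> t <= T -> F s `<=` F t).

Definition usual_hypotheses (P : {measure set Omega -> \bar R}) : Prop :=
  (forall t, t \in `[0, T[ -> F t = \bigcap_(s in `]t, T]) F s) /\
  (forall A, P.-negligible A -> F 0 A).

Definition stopping_time (tau : Omega -> R) : Prop :=
  forall t, t \in `[0, T] -> F t [set w | tau w <= t].

Definition adapted (S : topologicalType) (X : R -> Omega -> S) : Prop :=
  forall t, t \in `[0, T] -> forall G, open G -> F t (X t @^-1` G).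

(* The trajectory on [0, T], with the convention X(t) = X(T) for t > T *)
Definition trajectory (S : Type) (X : R -> Omega -> S) (w : Omega) : R -> S :=
  extend T (fun t => X t w).

Definition cadlag_process (S : topologicalType) (X : R -> Omega -> S) : Prop :=
  forall w, cadlag (trajectory X w).

Definition aldous (P : {measure set Omega -> \bar R}) (S : normedModType R)
    (X : nat -> R -> Omega -> S) : Prop :=
  forall eps eta : R, 0 < eps -> 0 < eta -> exists2 delta : R, 0 < delta &
  forall tau : nat -> Omega -> R,
    (forall n, stopping_time (tau n) /\ forall w, 0 <= tau n w <= T) ->
    (ereal_sup [set P [set w | eta <=
        `|trajectory (X n) w (tau n w + theta) - trajectory (X n) w (tau n w)| ]%R
      | n in [set: nat] & theta in `[0%R, delta]] <= eps%:E)%E.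

End processes.

Section law.
Context {dd : measure_display} {Omega : measurableType dd} {R : realType} {d : nat}
  {U : normedModType R}.
Variables (O : set 'rV[R]_d) (j : U -> 'rV[R]_d -> 'rV[R]_d).
Variables (OR : nat -> set 'rV[R]_d) (T q : R).
Variables (P : {measure set Omega -> \bar R}) (X : R -> Omega -> dual U).

(* The law of X on Z_q is the image of P under w |-> trajectory T X w. The trajectory
   need not lie in Z_q for every w; such w are outside every path_event. *)
Definition path_event (A : set (Zq O j OR T q)) : set Omega :=
  [set w | exists2 z, A z & Zq_val z = trajectory T X w].

Definition law (A : set (Zq O j OR T q)) : \bar R := P (path_event A).

End law.

(* Main.v *)
(* The path events are the sets of cadlag paths u with sup_t |u(t)|_H <= C1,
   int_0^T |u|_V^q <= C2 and, for every k, cadlag modulus at most 1/(k+1) for a mesh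
   delta_k. Such a set K is compact in Z_q: balls of H are compact in U', as U is
   compactly embedded in V_m, so that an ultrafilter on K converges in the Skorokhod
   topology of U' by an Arzela-Ascoli argument. The bounds then upgrade the convergence.
   Elements of H are limits of functionals from U, which gives convergence in D(H_w);
   Mazur's lemma with the uniform convexity of L^q(0, T; V) gives weak convergence in
   L^q(0, T; V); and an Ehrling inequality |x|_{H_R} <= e |x|_V + C |x|_{U'}, from the
   compactness of V_R -> H_R, gives convergence in L^q(0, T; H_loc).

   By Markov's inequality the first two bounds hold with high probability. For the third,
   the Aldous condition is applied on dyadic grids to the successive times at which the
   path has moved by 2 eta: averaging over the increments after two such times shows that
   they are rarely close, hence that there are few of them. The events on the grids
   decrease to the event that the modulus of the cadlag path is small. The distances
   |X_s - X_t|_{U'} are adapted because the norm of H-valued elements is a supremum over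
   countably many evaluations and null sets belong to the filtration. *)

Require Import Defs.
From HB Require Import structures.
From mathcomp Require Import all_boot all_order all_algebra.
From mathcomp Require Import all_classical all_reals all_analysis.
From mathcomp Require Import measurable_realfun.
From mathcomp Require Import ring lra zify.

Set Implicit Arguments.
Unset Strict Implicit.
Unset Printing Implicit Defensive.

Import Order.TTheory GRing.Theory Num.Theory.
Import numFieldNormedType.Exports.

Local Open Scope classical_set_scope.
Local Open Scope ring_scope.

(** * Midpoint hulls and Mazur-type limits *)

(** The analysis on paths sees the norms of H, of V and of the local spaces only as norms on [U']
    with values in [[0, +oo]]; for V it adds the parallelogram law and the closedness of balls in
    [U'], for H the compactness of balls. Compactness in Z_q is tested on ultrafilters, whereas
    Fatou and Mazur speak of sequences: these are extracted from the sets of the ultrafilter once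
    its Skorokhod limit is known.

    On the concrete side, Sobolev norms are infima over weak derivatives. The infimum is evaluated
    by minimality: among all functions with given pairings against test functions, an [L^2] limit of
    test functions has the least norm, and the derivatives of elements of V are such limits. The
    field of an element of H is an arbitrary choice up to null sets, so every statement on H or V
    goes through a family of [L^2] functions that represents the element.

    Elements of V_m enter through test fields: these must lie in V_m to be approximated from [U]. As
    [m] may be fractional, this rests on a kernel estimate for their Gagliardo seminorm. *)

Lemma natSinv_lt {R : realType} (e : R) : 0 < e ->
  exists N, forall n, (N <= n)%N -> n.+1%:R^-1 < e.
Proof.
by move=> e0; have [N _ NP] := near_infty_natSinv_lt (PosNum e0); exists N.
Qed.

Section midpoint_hull.
Context {R : realType} {M : lmodType R}.
Implicit Types (x y : M) (A B P : set M) (z : nat -> M).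

Definition mid x y : M := 2^-1 *: (x + y).

(** Convex combinations with dyadic weights, as an inductive closure: a property stable under
    midpoints passes to all of them by induction, with no bookkeeping of weights. *)
Inductive midhull A : set M :=
| midhull_in x : A x -> midhull A x
| midhull_mid x y : midhull A x -> midhull A y -> midhull A (mid x y).

Definition tail z n : set M := [set z k | k in [set k | (n <= k)%N]].

Lemma midhull_sub A P : A `<=` P ->
  (forall x y, P x -> P y -> P (mid x y)) -> midhull A `<=` P.
Proof. by move=> AP Pm x; elim=> [y /AP//|? ? _ ? _ ?]; exact: Pm. Qed.

Lemma midhullS A B : A `<=` B -> midhull A `<=` midhull B.
Proof.
by move=> AB; apply: midhull_sub => [x /AB|]; [exact: midhull_in|exact: midhull_mid].
Qed.

Lemma tailS z n k : (n <= k)%N -> tail z k `<=` tail z n.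
Proof. by move=> nk _ [l /= kl <-]; exists l => //=; exact: leq_trans kl. Qed.

(* Near-minimisers of [Phi] on the hulls of the tails: the minima increase to a
   finite limit, so that no midpoint can be much better than its endpoints. *)
Lemma midhull_minimizing z (Phi : M -> R) (B : R) :
  (forall x, 0 <= Phi x) -> (forall n, Phi (z n) <= B) ->
  exists p : nat -> M, (forall n, midhull (tail z n) (p n)) /\
    forall e : R, 0 < e -> exists N, forall n k, (N <= n)%N -> (N <= k)%N ->
      2^-1 * (Phi (p n) + Phi (p k)) - Phi (mid (p n) (p k)) < e.
Proof.
move=> Phi0 PhiB.
pose S n := Phi @` midhull (tail z n).
have S0 n : S n !=set0.
  by exists (Phi (z n)), (z n) => //; apply: midhull_in; exists n => /=.
have Slb n : has_lbound (S n) by exists 0 => _ [x _ <-].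
pose D n := inf (S n).
have Dle n k x : (n <= k)%N -> midhull (tail z k) x -> D n <= Phi x.
  by move=> nk kx; apply: ge_inf => //; exists x => //; exact: midhullS (tailS nk) _ kx.
have Dnd n k : (n <= k)%N -> D n <= D k.
  by move=> nk; apply: lb_le_inf => // _ [x kx <-]; exact: Dle kx.
have Dub : has_ubound (range D).
  exists B => _ [n _ <-]; apply: le_trans (PhiB n); apply: Dle (leqnn n) _.
  by apply: midhull_in; exists n => /=.
have hp n : exists x, midhull (tail z n) x /\ Phi x < D n + n.+1%:R^-1.
  have [||_ [x nx <-] ?] := @inf_adherent _ (S n) n.+1%:R^-1; last by exists x.
    by rewrite invr_gt0.
  by split.
have [p pP] := choice hp; exists p; split=> [n|e e0]; first exact: (pP n).1.
have e4 : 0 < e / 4 by rewrite divr_gt0.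
have [|_ [N1 _ <-] hN1] := @sup_adherent _ (range D) _ e4.
  by split=> //; exists (D 0%N), 0%N.
have [N2 inv] := natSinv_lt e4.
exists (maxn N1 N2) => n k; rewrite !geq_max => /andP[N1n N2n] /andP[N1k N2k].
have Dsup l : D l <= sup (range D) by apply: ub_le_sup => //; exists l.
have := (pP n).2; have := (pP k).2; have := inv _ N2n; have := inv _ N2k.
have := Dsup n; have := Dsup k.
have : D N1 <= Phi (mid (p n) (p k)).
  apply: (@Dle _ N1) => //; apply: midhull_mid.
    exact: midhullS (tailS N1n) _ (pP n).1.
  exact: midhullS (tailS N1k) _ (pP k).1.
move: (D k) (D n) k.+1%:R^-1 n.+1%:R^-1 hN1 e0 => a b c f; lra.
Qed.

End midpoint_hull.

(** * Limits along ultrafilters *)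

Section ultrafilters.

(** For an ultrafilter a cluster point is a limit: if the preimage of a neighbourhood were not in
    [F], its complement would be, against clustering. *)
Lemma ultra_cvg (Z : Type) (X : topologicalType) (F : set_system Z)
    (f : Z -> X) (K : set X) : UltraFilter F ->
  compact K -> F (f @^-1` K) -> exists2 x, K x & f @ F --> x.
Proof.
move=> UF cK FK; have [x [Kx Fx]] := cK (f @ F) _ FK.
exists x => // A Ax; have [//|FA] := in_ultra_setVsetC (f @^-1` A) UF.
by have [y [/=]] := Fx (~` A) A FA Ax.
Qed.

Lemma ultra_nat (Z : Type) (F : set_system Z) (n : Z -> nat) (M : nat) :
  UltraFilter F -> F [set z | (n z < M)%N] -> exists N, F [set z | n z = N].
Proof.
move=> UF; elim: M => [FM|M IH FM].
  by exfalso; apply: (@filter_not_empty _ F); apply: filterS FM.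
have [FN|FN] := in_ultra_setVsetC [set z | n z = M] UF; first by exists M.
apply: IH; apply: filterS2 FM FN => z /=; rewrite ltnS leq_eqVlt => /orP[/eqP //|//].
Qed.

End ultrafilters.

(** * Subdivisions of [0, T] *)

Section cut_points.
Context {R : realType}.
Implicit Types (T dlt : R) (N : nat) (t : nat -> R).

(** The subdivisions in the definition of the cadlag modulus. The last cell too must have length at
    least [dlt]. *)
Definition cut_points T dlt N t :=
  [/\ t 0%N = 0, t N = T & forall i, (i < N)%N -> t i + dlt <= t i.+1].

Lemma cut_points_le T dlt N t i k : 0 <= dlt -> cut_points T dlt N t ->
  (i <= k <= N)%N -> t i + (k - i)%:R * dlt <= t k.
Proof.
move=> d0 [_ _ tS]; elim: k => [|k IH] /andP[ik kN].
  by move: ik; rewrite leqn0 => /eqP ->; rewrite subnn mul0r addr0.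
move: ik; rewrite leq_eqVlt => /orP[/eqP ->|]; first by rewrite subnn mul0r addr0.
rewrite ltnS => ik; rewrite subSn// -natr1 mulrDl mul1r addrA.
by rewrite (le_trans _ (tS _ kN))// lerD2r IH// ik ltnW.
Qed.

Lemma cut_points_homo T dlt N t i k : 0 <= dlt -> cut_points T dlt N t ->
  (i <= k <= N)%N -> t i <= t k.
Proof.
move=> d0 ct ikN; rewrite (le_trans _ (cut_points_le d0 ct ikN))//.
by rewrite lerDl mulr_ge0.
Qed.

Lemma cut_points_ge0 T dlt N t i : 0 <= dlt -> cut_points T dlt N t ->
  (i <= N)%N -> 0 <= t i.
Proof. by move=> d0 ct iN; rewrite -(let: And3 a _ _ := ct in a) (cut_points_homo d0 ct). Qed.

Lemma cut_points_leT T dlt N t i : 0 <= dlt -> cut_points T dlt N t ->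
  (i <= N)%N -> t i <= T.
Proof.
by move=> d0 ct iN; rewrite -(let: And3 _ a _ := ct in a) (cut_points_homo d0 ct)// iN leqnn.
Qed.

Lemma cut_points_find T dlt N t s : cut_points T dlt N t -> 0 <= s < T ->
  exists2 i, (i < N)%N & t i <= s < t i.+1.
Proof.
move=> [t0 tN _] /andP[s0 sT].
have : s < t N by rewrite tN.
elim: N {tN} => [|N IH]; first by rewrite t0 ltNge s0.
move=> sN; have [/IH[i iN ?]|Ns] := ltP s (t N); first by exists i => //; exact: ltnW.
by exists N => //; rewrite Ns.
Qed.

Lemma cut_points_findl T dlt N t s : cut_points T dlt N t -> 0 < s <= T ->
  exists2 i, (i < N)%N & t i < s <= t i.+1.
Proof.
move=> [t0 tN _] /andP[s0 sT].
have : s <= t N by rewrite tN.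
elim: N {tN} => [|N IH]; first by rewrite t0 leNgt s0.
move=> sN; have [/IH[i iN ?]|Ns] := leP s (t N); first by exists i => //; exact: ltnW.
by exists N => //; rewrite Ns.
Qed.

(** The number of cells is at most [T / dlt], hence constant on a set of the ultrafilter; each cut
    point then has a limit in the compact [[0, T]], and the gap condition is closed. *)
Lemma cut_points_ultra (Z : Type) (F : set_system Z) T dlt (n : Z -> nat)
    (t : Z -> nat -> R) : UltraFilter F -> 0 < dlt ->
  F [set z | cut_points T dlt (n z) (t z)] ->
  exists N s, [/\ cut_points T dlt N s, F [set z | n z = N] &
    forall i, (i <= N)%N -> t ^~ i @ F --> (s i : R)].
Proof.
move=> UF d0 Fct.
have [|N FN] := @ultra_nat _ _ n (Num.truncn (T / dlt)).+1 UF.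
  apply: filterS Fct => z /= ct.
  have := @cut_points_le _ _ _ _ 0 (n z) (ltW d0) ct (leqnn _).
  have [-> -> _] := ct; rewrite subn0 add0r -ler_pdivlMr// => nT.
  by rewrite ltnS truncn_ge_nat// (le_trans _ nT)// ler0n.
have Fct' : F [set z | n z = N /\ cut_points T dlt N (t z)].
  by apply: filterS2 FN Fct => z /= <-.
have lim i : (i <= N)%N -> exists s : R, t ^~ i @ F --> s.
  move=> iN; have [|s _ sP] := @ultra_cvg _ _ F (t ^~ i) `[0, T] UF (@segment_compact _ _ _).
    apply: filterS Fct' => z [_ ct] /=.
    by rewrite in_itv/= (cut_points_ge0 (ltW d0) ct)// (cut_points_leT (ltW d0) ct).
  by exists s.
have /choice[s sP] i : exists s : R, (i <= N)%N -> t ^~ i @ F --> s.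
  by case: (leqP i N) => [/lim[s ?]|_]; [exists s|exists 0].
exists N, s; split=> //; split.
- apply: (@cvg_unique _ _ (t ^~ 0%N @ F) _ _ _ (sP _ (leq0n N))) => //.
  by apply: cvg_near_cst; apply: filterS Fct' => z [_ []].
- apply: (@cvg_unique _ _ (t ^~ N @ F) _ _ _ (sP _ (leqnn N))) => //.
  by apply: cvg_near_cst; apply: filterS Fct' => z [_ []].
- move=> i iN; rewrite -subr_ge0.
  have cv : (fun z => t z i.+1 - (t z i + dlt)) @ F --> s i.+1 - (s i + dlt).
    apply: cvgB; first exact: sP.
    by apply: cvgD; [exact/sP/ltnW|exact: cvg_cst].
  apply: (closed_cvg [set x : R | 0 <= x] (@closed_ge R 0) _ _ cv).
  by apply: filterS Fct' => z [_ [_ _ /(_ i iN)]] /=; rewrite subr_ge0.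
Qed.

End cut_points.

(** * Compactness in the Skorokhod topology *)

Section piecewise_linear.
Context {R : realType}.
Implicit Types (a b x e : R) (s t : nat -> R).

Definition clamp a b x : R := Num.max 0 (Num.min (x - a) (b - a)).

(** [clamp] is the length of the part of a cell to the left of [x], so this sums slope times length
    travelled: the map that is affine on cells and sends [s i] to [t i]. As a sum, it is continuous
    and monotone term by term. *)
Definition pw_linear N s t x : R :=
  \sum_(i < N) (t i.+1 - t i) / (s i.+1 - s i) * clamp (s i) (s i.+1) x.

Lemma continuous_clamp a b : continuous (clamp a b).
Proof.
move=> x; apply: (@continuous_max _ _ (cst 0) (fun y => Num.min (y - a) (b - a))).
  exact: cvg_cst.
by apply: (@continuous_min _ _ (fun y => y - a) (cst (b - a))); [apply: cvgB; [exact: cvg_id|exact: cvg_cst]|exact: cvg_cst].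
Qed.

Lemma continuous_pw_linear N s t : continuous (pw_linear N s t).
Proof.
apply: continuous_big => [|i _ x]; first exact: add_continuous.
by apply: cvgM; [exact: cvg_cst|exact: continuous_clamp].
Qed.

Lemma clamp_homo a b : {homo clamp a b : x y / x <= y}.
Proof. by move=> x y xy; rewrite /clamp le_max2 ?lexx// le_min2 ?lexx// lerD2r. Qed.

Lemma clamp_lt a b x y : a <= x -> x < b -> x < y -> clamp a b x < clamp a b y.
Proof.
move=> ax xb xy; rewrite /clamp.
have -> : Num.max 0 (Num.min (x - a) (b - a)) = x - a.
  by rewrite min_l ?max_r ?subr_ge0// lerD2r ltW.
rewrite lt_max lt_min; apply/orP; right.
by rewrite !ltrD2r xy xb.
Qed.

Variables (T dlt : R) (N : nat) (s t : nat -> R).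
Hypotheses (dlt0 : 0 < dlt) (cs : cut_points T dlt N s) (ct : cut_points T dlt N t).

Let gap_gt0 u i : cut_points T dlt N u -> (i < N)%N -> 0 < u i.+1 - u i.
Proof. by move=> [_ _ uS] /uS; rewrite subr_gt0; apply: lt_le_trans; rewrite ltrDl. Qed.

Lemma pw_linearE k x : (k < N)%N -> s k <= x <= s k.+1 ->
  pw_linear N s t x = t k + (t k.+1 - t k) / (s k.+1 - s k) * (x - s k).
Proof.
move=> kN /andP[kx xk].
rewrite /pw_linear -(big_mkord xpredT (fun i =>
  (t i.+1 - t i) / (s i.+1 - s i) * clamp (s i) (s i.+1) x)).
rewrite (@big_cat_nat _ _ _ k)//=; last exact: ltnW.
rewrite [X in _ + X]big_ltn// [X in _ + (_ + X)]big_nat_cond [X in _ + (_ + X)]big1 ?addr0; last first.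
  move=> i /andP[/andP[ki iN] _].
  have xi : x <= s i by apply: le_trans xk _; apply: (cut_points_homo (ltW dlt0) cs); rewrite ki ltnW.
  rewrite /clamp max_l ?mulr0// ge_min; apply/orP; left; by rewrite subr_le0.
congr (_ + _); last first.
  by rewrite /clamp min_l ?lerD2r// max_r ?subr_ge0.
have [t0 _ _] := ct.
transitivity (t k - t 0%N); last by rewrite t0 subr0.
rewrite -telescope_sumr//.
apply: eq_big_nat => i /andP[_ ik].
have iN : (i < N)%N by exact: ltn_trans kN.
have ix : s i.+1 <= x by apply: le_trans kx; apply: (cut_points_homo (ltW dlt0) cs); rewrite ik ltnW.
rewrite /clamp min_r ?lerD2r// max_r; last exact/ltW/gap_gt0.
by rewrite divfK// gt_eqF// gap_gt0.
Qed.

Lemma pw_linear_lt x y : 0 <= x -> x < T -> x < y ->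
  pw_linear N s t x < pw_linear N s t y.
Proof.
move=> x0 xT xy.
have [k kN /andP[kx xk]] : exists2 k, (k < N)%N & s k <= x < s k.+1.
  by apply: (cut_points_find cs); rewrite x0.
rewrite /pw_linear (bigD1 (Ordinal kN))//= [ltRHS](bigD1 (Ordinal kN))//=.
rewrite ltr_leD//.
  by rewrite ltr_pM2l ?divr_gt0 ?gap_gt0// clamp_lt.
apply: ler_sum => i _; rewrite ler_pM2l ?divr_gt0 ?gap_gt0//.
by apply: clamp_homo; exact: ltW.
Qed.

Lemma pw_linear_cut k : (k <= N)%N -> pw_linear N s t (s k) = t k.
Proof.
case: k => [|k] kN.
  have [s0 sN _] := cs; have [t0 tN _] := ct.
  case: N kN cs ct gap_gt0 pw_linearE sN => [*|M _ cs' _ gp pE _].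
    by rewrite /pw_linear big_ord0 t0.
  rewrite (@pE 0%N)// ?subrr ?mulr0 ?addr0// lexx /=.
  by rewrite ltW// -subr_gt0; exact: (gp s 0%N).
rewrite (@pw_linearE k)//; last by rewrite lexx andbT ltW// -subr_gt0 gap_gt0.
by rewrite divfK ?gt_eqF ?gap_gt0// addrC subrK.
Qed.

Lemma pw_linear_itv k x : (k < N)%N -> s k <= x < s k.+1 ->
  t k <= pw_linear N s t x < t k.+1.
Proof.
move=> kN /andP[kx xk]; rewrite (pw_linearE kN) ?kx ?(ltW xk)//.
have gs := gap_gt0 cs kN; have gt := gap_gt0 ct kN.
rewrite lerDl mulr_ge0 ?subr_ge0// ?ltW ?divr_gt0//=.
by rewrite -ltrBrDl -mulrA gtr_pMr// mulrC ltr_pdivrMr// mul1r ltrD2r.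
Qed.

(** On a cell, the displacement is a convex combination of the displacements of the two ends. *)
Lemma pw_linear_dist e x : (forall i, (i <= N)%N -> `|t i - s i| <= e) ->
  x \in `[0, T] -> `|pw_linear N s t x - x| <= e.
Proof.
move=> he; rewrite in_itv/= => /andP[x0].
rewrite le_eqVlt => /orP[/eqP ->|xT].
  have [s0 sN _] := cs.
  by rewrite -{1 2}sN pw_linear_cut// he.
have [k kN /andP[kx xk]] : exists2 k, (k < N)%N & s k <= x < s k.+1.
  by apply: (cut_points_find cs); rewrite x0.
rewrite (pw_linearE kN) ?kx ?(ltW xk)//.
have gs := gap_gt0 cs kN.
pose c := (x - s k) / (s k.+1 - s k).
have c0 : 0 <= c by rewrite divr_ge0 ?subr_ge0// ltW// -subr_gt0.
have c1 : c <= 1 by rewrite ler_pdivrMr// mul1r lerD2r ltW.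
have xE : x = s k + c * (s k.+1 - s k).
  by rewrite /c divfK ?gt_eqF// addrC subrK.
have -> : t k + (t k.+1 - t k) / (s k.+1 - s k) * (x - s k) - x =
    (1 - c) * (t k - s k) + c * (t k.+1 - s k.+1).
  by rewrite {2}xE mulrAC -mulrA -/c; ring.
clearbody c; rewrite (le_trans (ler_normD _ _))// !normrM [`|c|]ger0_norm// ger0_norm ?subr_ge0//.
have h1 := he k (ltnW kN); have h2 := he _ kN.
have : (1 - c) * `|t k - s k| <= (1 - c) * e by rewrite ler_wpM2l// subr_ge0.
have : c * `|t k.+1 - s k.+1| <= c * e by rewrite ler_wpM2l.
lra.
Qed.

Lemma pw_linear_time_change : time_change T (pw_linear N s t).
Proof.
have [s0 sN _] := cs; have [t0 tN _] := ct.
split.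
- by rewrite -{1}s0 pw_linear_cut.
- by rewrite -{1}sN pw_linear_cut.
- move=> x y; rewrite !in_itv/= => /andP[x0 xT] /andP[y0 yT] xy.
  by apply: pw_linear_lt => //; exact: lt_le_trans yT.
- exact/continuous_subspaceT/continuous_pw_linear.
Qed.

End piecewise_linear.

Section skorokhod_compactness.
Context {R : realType} {E : normedModType R}.
Implicit Types (T dlt eta e : R) (u v y : R -> E) (K : set E).

(* Paths whose cadlag modulus for the mesh [dlt] is attained and at most [eta] *)
Definition regular_on T dlt eta u : Prop := exists N t, cut_points T dlt N t /\
  forall i s s', (i < N)%N -> t i <= s < t i.+1 -> t i <= s' < t i.+1 ->
    `|u s - u s'| <= eta.

(** For [0 <= e], membership of [e] in the set whose infimum is [skorokhod_dist]; a witness is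
    easier to handle than the infimum. *)
Definition skorokhod_close T e u v : Prop := exists l, time_change T l /\
  forall t, t \in `[0, T] -> `|l t - t| <= e /\ `|u t - v (l t)| <= e.

Lemma extend_id T u t : t \in `[0, T] -> extend T u t = u t.
Proof. by rewrite in_itv/= => /andP[t0 tT]; rewrite /extend min_l// max_r. Qed.

Lemma extend_gt T u t : 0 <= T -> T <= t -> extend T u t = u T.
Proof. by move=> T0 Tt; rewrite /extend min_r// max_r. Qed.

Lemma extend_lt T u t : t <= 0 -> extend T u t = u 0.
Proof. by move=> t0; rewrite /extend max_l// ge_min t0. Qed.

Lemma extend_extend T u : 0 <= T -> is_extended T (extend T u).
Proof.
move=> T0; apply/funext => t; rewrite /extend; congr (u _).
have [tT|/ltW tT] := leP t T; last by rewrite (max_r T0) min_l// max_r.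
have [t0|/ltW t0] := leP t 0; first by rewrite min_l// max_l.
by rewrite min_l// max_r.
Qed.

Lemma distD3 (a b c d : E) : `|a - d| <= `|a - b| + `|b - c| + `|c - d|.
Proof.
by rewrite (le_trans (ler_distD c _ _))// lerD2r ler_distD.
Qed.

Lemma closed_normB (x : E) e : closed [set z : E | `|z - x| <= e].
Proof.
have -> : [set z : E | `|z - x| <= e] = (fun z => `|z - x|) @^-1` [set r | r <= e] by [].
apply: preimage_closed; last exact: closed_le.
by move=> z _; apply: cvg_norm; apply: cvgB; [exact: cvg_id|exact: cvg_cst].
Qed.

(** Small oscillation on the cell that contains [t] gives right continuity. For the left limit,
    compactness of [K] provides a candidate along an ultrafilter finer than the left neighbourhoods,
    and small oscillation on the cell to the left of [t] makes it a limit. *)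
Lemma regular_cadlag T u K : 0 < T -> compact K -> is_extended T u ->
  (forall t, K (u t)) ->
  (forall e, 0 < e -> exists2 dlt, 0 < dlt & regular_on T dlt e u) -> cadlag u.
Proof.
move=> T0 cK ue Ku hr t; split.
  have [t0|t0] := ltP t 0.
    rewrite -ue extend_lt ?ltW//.
    apply: cvg_near_cst; near=> s; rewrite -ue !extend_lt//.
    by near: s; exact: nbhs_right_le.
  have [tT|tT] := leP T t.
    rewrite -ue extend_gt// ?ltW//.
    apply: cvg_near_cst; near=> s; rewrite -ue !extend_gt// ?ltW//.
    by apply: le_lt_trans tT _; near: s; exact: nbhs_right_gt.
  apply/cvgrPdist_le => e e0.
  have [dlt d0 [N [c [cc hc]]]] := hr _ e0.
  have [i iN /andP[cit tci]] := cut_points_find cc (introT andP (conj t0 tT)).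
  near=> s; apply: (hc i) => //; first by rewrite cit.
  apply/andP; split; last by near: s; exact: nbhs_right_lt.
  by apply: le_trans cit _; near: s; exact: nbhs_right_ge.
have [t0|t0] := leP t 0.
  exists (u 0); apply: cvg_near_cst; near=> s; rewrite -ue !extend_lt//.
  by apply: le_trans t0; near: s; exact: nbhs_left_le.
have [tT|tT] := ltP T t.
  exists (u T); apply: cvg_near_cst; near=> s; rewrite -ue !extend_gt// ltW//.
have [G [UG tG]] := @ultraFilterLemma _ (t^'-) _.
have [|l Kl ul] := @ultra_cvg _ _ G u K UG cK; first by apply: filterS filterT => s _ /=.
exists l; apply/cvgrPdist_le => e e0.
have [dlt d0 [N [c [cc hc]]]] := hr _ e0.
have [i iN /andP[cit tci]] := cut_points_findl cc (introT andP (conj t0 tT)).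
near=> s; have cis : c i <= s < c i.+1.
  apply/andP; split; first by near: s; exact: nbhs_left_ge.
  by apply: lt_le_trans tci; near: s; exact: nbhs_left_lt.
apply: (closed_cvg _ (@closed_normB (u s) e) _ _ ul).
apply: tG; near=> r; apply: (hc i) => //; apply/andP; split.
  by near: r; exact: nbhs_left_ge.
by apply: lt_le_trans tci; near: r; exact: nbhs_left_lt.
Unshelve. all: by end_near. Qed.

(* An ultrafilter of regular paths converges pointwise to some [y], whose
   right limits form the limit path; it converges uniformly up to the time change
   carrying the limit cut points to those of the paths. *)
Lemma regular_ultra_cvg T (dlt eta : nat -> R) K (Z : Type) (F : set_system Z)
    (u : Z -> R -> E) :
  UltraFilter F -> 0 < T -> compact K ->
  (forall k, 0 < dlt k) -> (forall k, 0 < eta k) ->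
  (forall e, 0 < e -> exists k, eta k <= e) ->
  (forall t, F [set z | K (u z t)]) ->
  (forall k, F [set z | regular_on T (dlt k) (eta k) (u z)]) ->
  exists v, [/\ is_extended T v, cadlag v, forall t, K (v t),
    forall k, regular_on T (dlt k) (eta k) v &
    forall e, 0 < e -> F [set z | skorokhod_close T e v (u z)]].
Proof.
move=> UF T0 cK d0 eta0 etac FK Freg.
have FP : ProperFilter F by exact: ultra_proper.
have /choice[y yP] t : exists x, K x /\ u ^~ t @ F --> x.
  by have [x Kx xP] := ultra_cvg UF cK (FK t); exists x.
have /choice[Ns /= NsP] k : exists Nt : nat * (nat -> R) * (Z -> nat -> R),
    let N := Nt.1.1 in let s := Nt.1.2 in let t := Nt.2 in
  [/\ cut_points T (dlt k) N s,
      F [set z | cut_points T (dlt k) N (t z) /\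
        forall i a b, (i < N)%N -> t z i <= a < t z i.+1 -> t z i <= b < t z i.+1 ->
        `|u z a - u z b| <= eta k] &
      forall i, (i <= N)%N -> t ^~ i @ F --> (s i : R)].
  have /choice[n nP] z : exists nt : nat * (nat -> R),
      regular_on T (dlt k) (eta k) (u z) ->
      cut_points T (dlt k) nt.1 nt.2 /\ forall i a b, (i < nt.1)%N ->
        nt.2 i <= a < nt.2 i.+1 -> nt.2 i <= b < nt.2 i.+1 -> `|u z a - u z b| <= eta k.
    have [[N [t Nt]]|h] := pselect (regular_on T (dlt k) (eta k) (u z)).
      by exists (N, t).
    by exists (0%N, fun=> 0).
  have [||N [s [cs FN sP]]] :=
      @cut_points_ultra R Z F T (dlt k) (fun z => (n z).1) (fun z => (n z).2) UF => //.
    by apply: filterS (Freg k) => z /nP[].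
  exists (N, s, fun z => (n z).2); split=> //=.
  by apply: filterS2 FN (Freg k) => z /= <- /nP.
pose N k := (Ns k).1.1; pose s k := (Ns k).1.2; pose t k := (Ns k).2.
have cs k : cut_points T (dlt k) (N k) (s k) by have [] := NsP k.
have tF k : F [set z | cut_points T (dlt k) (N k) (t k z) /\
        forall i a b, (i < N k)%N -> t k z i <= a < t k z i.+1 ->
        t k z i <= b < t k z i.+1 -> `|u z a - u z b| <= eta k] by have [] := NsP k.
have ts k i : (i <= N k)%N -> (t k) ^~ i @ F --> (s k i : R) by have [_ _] := NsP k; apply.
clearbody N s t.
(* Only interior points of a limit cell are sure to lie in the corresponding cell of [u z]. So [y]
   is controlled on open cells only, and must be replaced by right limits. *)
have tin k i a : (i < N k)%N -> s k i < a < s k i.+1 ->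
    F [set z | t k z i <= a < t k z i.+1].
  move=> iN /andP[ia ai].
  have h1 : F [set z | t k z i < a] := @cvgr_lt _ _ F _ _ _ (ts k i (ltnW iN)) a ia.
  have h2 : F [set z | a < t k z i.+1] := @cvgr_gt _ _ F _ _ _ (ts k i.+1 iN) _ ai.
  by apply: filterS2 (h1 _) (h2 _) => z /= h1' h2'; rewrite h2' (ltW h1').
have yreg k i a b : (i < N k)%N -> s k i < a < s k i.+1 -> s k i < b < s k i.+1 ->
    `|y a - y b| <= eta k.
  move=> iN ha hb.
  have cv : (fun z => u z a - u z b) @ F --> y a - y b.
    by apply: cvgB; exact: (yP _).2.
  have := closed_cvg _ (@closed_normB 0 (eta k)) _ _ cv; rewrite /= subr0; apply.
  apply: filterS3 (tF k) (tin _ _ _ iN ha) (tin _ _ _ iN hb) => z /= [_ h] ha' hb'.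
  by rewrite subr0; exact: h ha' hb'.
have /choice[r rP] a : exists x, K x /\ forall k i b, (i < N k)%N ->
    s k i <= a < s k i.+1 -> s k i < b < s k i.+1 -> `|x - y b| <= eta k.
  have [G [UG aG]] := @ultraFilterLemma _ (a^'+) _.
  have [|l Kl yl] := @ultra_cvg _ _ G y K UG cK.
    by apply: filterS filterT => b _; exact: (yP b).1.
  exists l; split=> // k i b iN /andP[ia ai] hb.
  apply: (closed_cvg _ (@closed_normB (y b) (eta k)) _ _ yl).
  apply: aG; near=> x; apply: (yreg k i) => //; apply/andP; split.
    by apply: le_lt_trans ia _; near: x; exact: nbhs_right_gt.
  by near: x; exact: nbhs_right_lt.
have sgap k i : (i < N k)%N -> s k i < s k i.+1.
  by move=> iN; have [_ _ /(_ _ iN)] := cs k; apply: lt_le_trans; rewrite ltrDl.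
have s0T k i a : (i < N k)%N -> s k i <= a < s k i.+1 -> 0 <= a < T.
  move=> iN /andP[ia ai].
  have h0 := cut_points_ge0 (ltW (d0 k)) (cs k) (ltnW iN).
  have h1 := cut_points_leT (ltW (d0 k)) (cs k) iN.
  by rewrite (le_trans h0 ia) (lt_le_trans ai h1).
have rreg k i a b : (i < N k)%N -> s k i <= a < s k i.+1 ->
    s k i <= b < s k i.+1 -> `|r a - r b| <= eta k.
  move=> iN ha hb.
  suff h (e : R) : 0 < e -> `|r a - r b| <= e + eta k.
    by apply/ler_addgt0Pl => e; exact: h.
  move=> e0.
  have [l lk] := etac _ (divr_gt0 e0 (ltr0n R 2)).
  (* [r c] is compared with [y] slightly to the right of [c], still inside this cell of level [k]
     and inside the cell containing [c] at a level [l] of small oscillation. *)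
  have ex c : s k i <= c < s k i.+1 -> exists2 c', s k i < c' < s k i.+1 & `|r c - y c'| <= e / 2.
    move=> icc; have c0T := s0T _ _ _ iN icc; move: icc => /andP[ic ci].
    have [n nN /andP[nc cn]] := cut_points_find (cs l) c0T.
    pose m := Num.min (s k i.+1) (s l n.+1).
    have cm : c < m by rewrite lt_min ci.
    have [cm1 cm2] : c < (c + m) / 2 /\ (c + m) / 2 < m by move: cm; lra.
    have : m <= s k i.+1 by rewrite ge_min lexx.
    have : m <= s l n.+1 by rewrite ge_min lexx orbT.
    move=> m1 m2; exists ((c + m) / 2).
      by rewrite (le_lt_trans ic cm1) (lt_le_trans cm2).
    apply: le_trans lk; apply: (rP c).2 nN _ _; first by rewrite nc.
    by rewrite (le_lt_trans nc cm1) (lt_le_trans cm2).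
  have [a' ha' hra] := ex _ ha; have [b' hb' hrb] := ex _ hb.
  have := yreg _ _ _ _ iN ha' hb'.
  rewrite distrC in hrb.
  have := distD3 (r a) (y a') (y b') (r b).
  move: hra hrb; lra.
(* Cells are open on the right, so [T] lies in none of them; there the pointwise limit is kept. *)
pose v := extend T (fun a => if a < T then r a else y T).
have ve : is_extended T v by apply: extend_extend; exact: ltW.
have vr a : 0 <= a < T -> v a = r a.
  by move=> /andP[a0 aT]; rewrite /v extend_id ?in_itv/= ?a0 ?aT ?ltW.
have vT : v T = y T by rewrite /v extend_gt ?ltxx// ltW.
have Kv a : K (v a).
  by rewrite /v /extend; case: ifP => _; [exact: (rP _).1|exact: (yP _).1].
have vreg k : regular_on T (dlt k) (eta k) v.
  exists (N k), (s k); split=> // i a b iN ha hb.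
  by rewrite !vr; [exact: rreg ha hb|exact: s0T iN hb|exact: s0T iN ha].
exists v; split=> //.
  apply: regular_cadlag cK ve Kv _ => // e e0.
  have [k ke] := etac _ e0; exists (dlt k) => //.
  have [n [c [cc hc]]] := vreg k; exists n, c; split=> // i a b iN ha hb.
  by apply: le_trans ke; exact: hc ha hb.
move=> e e0; have [k ke] := etac _ (divr_gt0 e0 (ltr0n _ 3)).
have FT : F [set z | `|y T - u z T| <= e].
  by have /cvgrPdist_le := (yP T).2; apply.
have Fs : F [set z | forall i : 'I_(N k).+1, `|s k i - t k z i| <= e].
  apply: filter_forall => i.
  by have /cvgrPdist_le/(_ _ e0) := ts k i (ltn_ord i); apply.
(* One sample point inside each cell: pointwise convergence at these finitely many points becomes
   uniform closeness at the cost of three terms [eta k], whence [e / 3] above. *)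
pose m i := (s k i + s k i.+1) / 2.
have hm i : (i < N k)%N -> s k i < m i < s k i.+1.
  by move=> /sgap; rewrite /m => ?; apply/andP; split; lra.
have Fm : F [set z | forall i : 'I_(N k), t k z i <= m i < t k z i.+1].
  by apply: filter_forall => i; apply: tin => //; exact: hm.
have Fy : F [set z | forall i : 'I_(N k), `|y (m i) - u z (m i)| <= eta k].
  apply: filter_forall => i.
  by have /cvgrPdist_le/(_ _ (eta0 k)) := (yP (m i)).2; apply.
apply: filterS3 (filterI FT Fs) (filterI Fm Fy) (tF k) => z /= [hT hs] [hmz hy] [ct hu].
exists (pw_linear (N k) (s k) (t k z)); split.
  exact: (pw_linear_time_change (d0 k) (cs k) ct).
move=> a a0T; split.
  apply: (pw_linear_dist (d0 k) (cs k) ct) a0T => i iN.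
  by rewrite distrC; have := hs (Ordinal (iN : (i < (N k).+1)%N)).
move: a0T; rewrite in_itv/= => /andP[a0]; rewrite le_eqVlt => /orP[/eqP ->|aT].
  by have [_ -> _ _] := pw_linear_time_change (d0 k) (cs k) ct; rewrite vT.
have [i iN ia] := cut_points_find (cs k) (introT andP (conj a0 aT)).
have hl := pw_linear_itv (d0 k) (cs k) ct iN ia.
have h1 := hu i _ _ iN (hmz (Ordinal iN)) hl.
have h2 := hy (Ordinal iN).
have h3 := (rP a).2 k i (m i) iN ia (hm i iN).
rewrite vr ?a0//; set w := u z (pw_linear _ _ _ a) in h1 *.
have := distD3 (r a) (y (m i)) (u z (m i)) w.
move: h1 h2 h3 ke => /=; lra.
Unshelve. all: by end_near. Qed.

End skorokhod_compactness.

(** * Regularity tested on dyadic grids *)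

Section grid.
Context {R : realType} {E : normedModType R}.
Implicit Types (T dlt eta e : R) (u v : R -> E).

Definition grid T m (a : nat) : R := T * a%:R / (2 ^ m)%:R.

(** A condition on finitely many values of the path, hence an event for a process; for cadlag paths,
    its validity at all levels amounts to [regular_on]. *)
Definition grid_regular T dlt eta m u : Prop := exists N t, cut_points T dlt N t /\
  forall i (a b : 'I_(2 ^ m).+1), (i < N)%N -> t i <= grid T m a < t i.+1 ->
    t i <= grid T m b < t i.+1 -> `|u (grid T m a) - u (grid T m b)| <= eta.

Lemma regular_on_grid T dlt eta m u : regular_on T dlt eta u -> grid_regular T dlt eta m u.
Proof. by move=> [N [t [ct ut]]]; exists N, t; split=> // i a b iN; exact: ut. Qed.

Lemma grid_refine T m n (a : nat) : (m <= n)%N -> grid T m a = grid T n (2 ^ (n - m) * a)%N.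
Proof.
move=> mn; rewrite /grid -{2}(subnK mn) expnD !natrM.
have h k : (2 ^ k)%:R != 0 :> R by rewrite pnatr_eq0 expn_eq0.
by field; rewrite !h.
Qed.

Lemma grid_dense T (x y : R) : 0 < T -> 0 <= x -> x < y -> y <= T ->
  exists m (a : 'I_(2 ^ m).+1), x < grid T m a < y.
Proof.
move=> T0 x0 xy yT.
have [M hM] : exists M, forall n, (M <= n)%N -> n.+1%:R^-1 < (y - x) / T.
  by apply: natSinv_lt; rewrite divr_gt0// subr_gt0.
have pw : (0 : R) < (2 ^ M)%:R by rewrite ltr0n expn_gt0.
have hM2 : T / (2 ^ M)%:R < y - x.
  rewrite ltr_pdivrMr// -ltr_pdivrMl ?subr_gt0// in hM *.
  have := hM M (leqnn _); rewrite ltr_pdivlMr// -[X in X * _]invrK => h.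
  have : M.+1%:R <= (2 ^ M)%:R :> R by rewrite ler_nat ltn_expl.
  move: h; rewrite invrK -ltr_pdivlMl ?ltr0n// invrK => h h2.
  rewrite ltr_pdivrMl ?subr_gt0//.
  have : (y - x) * M.+1%:R <= (y - x) * (2 ^ M)%:R by rewrite ler_pM2l// subr_gt0.
  by rewrite mulrC in h; lra.
pose a := (Num.truncn (x * (2 ^ M)%:R / T)).+1.
have xa : x < grid T M a.
  by rewrite /grid ltr_pdivlMr// -ltr_pdivrMl// mulrC truncnS_gt.
have ay : grid T M a < y.
  have : (Num.truncn (x * (2 ^ M)%:R / T))%:R <= x * (2 ^ M)%:R / T.
    by rewrite truncn_le divr_ge0 ?mulr_ge0// ltW.
  rewrite ler_pdivlMr// mulrC -ler_pdivrMr// => h.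
  rewrite /grid /a -natr1 mulrDr mulr1 mulrDl; move: hM2 h; lra.
have aM : (a < (2 ^ M).+1)%N.
  have : grid T M a < T by exact: lt_le_trans yT.
  rewrite /grid ltr_pdivrMr// ltr_pM2l// ltr_nat => /ltnW; by rewrite ltnS.
by exists M, (Ordinal aM); rewrite xa.
Qed.

(** The subdivisions of the grids converge along an ultrafilter on the levels. Right continuity
    moves two points of a limit cell to grid points interior to it, which a common finer grid then
    compares. *)
Lemma grid_regularP T dlt eta u : 0 < T -> 0 < dlt -> cadlag u ->
  (forall m, grid_regular T dlt eta m u) -> regular_on T dlt eta u.
Proof.
move=> T0 d0 cu /choice[N /choice[t Nt]].
have [G [UG ooG]] := @ultraFilterLemma nat \oo _.
have [|M [s [cs GM ts]]] := @cut_points_ultra R nat G T dlt N t UG d0.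
  by apply: filterS filterT => m _; exact: (Nt m).1.
have tin i x : (i < M)%N -> s i < x < s i.+1 -> G [set m | t m i <= x < t m i.+1].
  move=> iN /andP[ia ai].
  have h1 : G [set z | t z i < x] := @cvgr_lt _ _ G _ _ _ (ts i (ltnW iN)) x ia.
  have h2 : G [set z | x < t z i.+1] := @cvgr_gt _ _ G _ _ _ (ts i.+1 iN) x ai.
  by apply: filterS2 (h1 _) (h2 _) => z /= h1' h2'; rewrite h2' (ltW h1').
exists M, s; split=> // i x y iM hx hy.
suff h e : 0 < e -> `|u x - u y| <= e + eta by apply/ler_addgt0Pl => e; exact: h.
move=> e0.
have sge := cut_points_ge0 (ltW d0) cs (ltnW iM).
have sle := cut_points_leT (ltW d0) cs iM.
have ex z : s i <= z < s i.+1 -> exists k, exists2 a : 'I_(2 ^ k).+1,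
    s i < grid T k a < s i.+1 & `|u z - u (grid T k a)| <= e / 2.
  move=> /andP[iz zi].
  have [/cvgrPdist_le/(_ _ (divr_gt0 e0 (ltr0n _ 2))) [r /= r0 hr] _] := cu z.
  have [|||k [a /andP[za az]]] := @grid_dense T z (Num.min (s i.+1) (z + r)) T0.
  - exact: le_trans iz.
  - by rewrite lt_min zi ltrDl.
  - by rewrite ge_min sle.
  exists k, a.
    rewrite (le_lt_trans iz za)/= (lt_le_trans az)//.
    by rewrite ge_min lexx.
  apply: hr => //=; rewrite distrC gtr0_norm ?subr_gt0// ltrBlDl.
  by rewrite (lt_le_trans az)// ge_min lexx orbT.
have [k [a hak hua]] := ex _ hx; have [l [b hbl hub]] := ex _ hy.
have : `|u (grid T k a) - u (grid T l b)| <= eta.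
  have [m [[[/= Mm hta] htb] klm]] := filter_ex (filterI (filterI (filterI GM
    (tin _ _ iM hak)) (tin _ _ iM hbl)) (ooG _ (nbhs_infty_ge (maxn k l)))).
  move: klm; rewrite /= geq_max => /andP[km lm].
  have ok j (c : 'I_(2 ^ j).+1) : (j <= m)%N -> (2 ^ (m - j) * c < (2 ^ m).+1)%N.
    move=> jm; rewrite ltnS -{2}(subnK jm) expnD leq_mul2l; apply/orP; right.
    by rewrite -ltnS.
  rewrite (grid_refine T a km) (grid_refine T b lm).
  have := (Nt m).2 i (Ordinal (ok _ a km)) (Ordinal (ok _ b lm)); apply => /=.
  - by rewrite Mm.
  - by rewrite -(grid_refine T a km).
  - by rewrite -(grid_refine T b lm).
rewrite distrC in hub.
have := distD3 (u x) (u (grid T k a)) (u (grid T l b)) (u y).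
move: hua hub; lra.
Qed.

Lemma time_change_surj T l (y : R) : 0 < T -> time_change T l -> y \in `[0, T] ->
  exists2 t : R, t \in `[0, T] & l t = y.
Proof.
move=> T0 [l0 lT _ lc]; rewrite in_itv/= => /andP[y0 yT].
have [|t tT <-] := @IVT _ l 0 T y (ltW T0) lc; last by exists t.
by rewrite l0 lT ge_min y0 le_max yT orbT.
Qed.

(** The time change moves [y] by at most [e], less than its distance to every cut point, so the time
    matched with [y] lies in the same cell of [v]. *)
Lemma skorokhod_close_off_cuts T dlt N t eta e u v (y : R) :
  0 < T -> cut_points T dlt N t ->
  (forall i s s', (i < N)%N -> t i <= s < t i.+1 -> t i <= s' < t i.+1 ->
    `|v s - v s'| <= eta) ->
  skorokhod_close T e v u -> y \in `[0, T] -> (forall i, (i <= N)%N -> e < `|y - t i|) ->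
  `|u y - v y| <= e + eta.
Proof.
move=> T0 ct hv [l [lc hl]] yT hy.
have [x xT lx] := time_change_surj T0 lc yT.
have [xy vu] := hl x xT; rewrite lx in xy vu.
have y0T : 0 <= y < T.
  move: (yT); rewrite in_itv/= => /andP[-> yleT]; rewrite lt_neqAle yleT andbT.
  apply/eqP => yE; have := hy N (leqnn _); have [_ -> _] := ct.
  by rewrite yE subrr normr0 ltNge (le_trans _ xy).
have [i iN /andP[iy yi]] := cut_points_find ct y0T.
have h1 := hy i (ltnW iN); have h2 := hy _ iN.
move: h1 h2; rewrite ger0_norm ?subr_ge0// ler0_norm ?subr_le0 ?(ltW yi)// => h1 h2.
move: (xy); rewrite ler_norml => /andP[h3 h4].
have hx : t i <= x < t i.+1 by apply/andP; split; lra.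
have := hv i x y iN hx (introT andP (conj iy yi)).
rewrite distrC in vu.
have := ler_distD (v x) (u y) (v y).
move: vu; lra.
Qed.

End grid.

(** * Weak compactness in L^q(0, T; V) *)

Section powR_uniform_convexity.
Context {R : realType}.
Variable q : R.
Hypothesis q1 : 1 < q.

Let q0 : 0 < q. Proof. exact: lt_trans q1. Qed.

(** Midpoint convexity defect of the power [q] on the pair [1], [s]; it decreases strictly on []0,
    1]], to 0 at 1. *)
Let gap (s : R) : R := 2^-1 * (1 + s `^ q) - (2^-1 * (1 + s)) `^ q.

Let dgap (x : R) : R :=
  2^-1 * (q * x `^ (q - 1)) - 2^-1 * (q * (2^-1 * (1 + x)) `^ (q - 1)).

Let one_powR (p : R) : 1 `^ p = 1 :> R. Proof. by rewrite powR1. Qed.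

Let gap_derive (x : R) : 0 < x -> is_derive x (1 : R) gap (dgap x).
Proof.
move=> x0.
have hp (y : R) : 0 < y -> is_derive y (1 : R) (@powR R ^~ q) (q * y `^ (q - 1)).
  move=> y0; apply: DeriveDef; first by apply: derivable_powR; rewrite in_itv/= y0.
  by rewrite -derive1E powR_derive1// in_itv/= y0.
have h1 := hp x x0.
have m0 : 0 < 2^-1 * (1 + x) by rewrite mulr_gt0// addr_gt0.
have h2 := hp _ m0.
have h3 : is_derive x 1 (fun s : R => 2^-1 * (1 + s)) 2^-1.
  by apply: is_derive_eq; rewrite add0r -[RHS]mulr1.
have h4 := @is_derive1_comp _ (@powR R ^~ q) (fun s : R => 2^-1 * (1 + s)) x _ _ h2 h3.
rewrite /gap; apply: is_derive_eq.
by rewrite /dgap add0r mul1r [X in _ - X]mulrC.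
Qed.

Let gap_lt (x y : R) : 0 < x -> x < y -> y <= 1 -> gap y < gap x.
Proof.
move=> x0 xy y1.
have cg : {within `[x, y], continuous gap}.
  apply: derivable_within_continuous => z; rewrite in_itv/= => /andP[xz _].
  by have [] := gap_derive (lt_le_trans x0 xz).
have hd (z : R) : z \in `]x, y[ -> is_derive z (1 : R) gap (dgap z).
  by rewrite in_itv/= => /andP[xz _]; apply: gap_derive; exact: lt_trans xz.
have [c] := MVT xy hd cg.
rewrite in_itv/= => /andP[xc cy] E.
rewrite -subr_lt0 E nmulr_rlt0 ?subr_gt0// subr_lt0 ltr_pM2l ?invr_gt0// ltr_pM2l//.
have c0 := lt_trans x0 xc.
by apply: gt0_ltr_powR; rewrite ?nnegrE ?subr_gt0 ?(ltW c0)//; lra.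
Qed.

Let gap1 : gap 1 = 0.
Proof. by rewrite /gap !one_powR (_ : 2^-1 * (1 + 1) = 1 :> R) ?one_powR ?subrr//; field. Qed.

Let gap0 : 0 < gap 0.
Proof.
rewrite /gap powR0 ?gt_eqF// addr0 mulr1 -mulr_powRB1// subr_gt0.
rewrite gtr_pMr// -[ltRHS](one_powR (q - 1)).
by apply: gt0_ltr_powR; rewrite ?nnegrE ?subr_gt0 ?invr_ge0//; lra.
Qed.

Let gap_ge0 (s : R) : 0 <= s -> s <= 1 -> 0 <= gap s.
Proof.
rewrite le_eqVlt => /orP[/eqP <- _|s0]; first exact: ltW gap0.
rewrite le_eqVlt => /orP[/eqP ->|s1]; first by rewrite gap1.
by rewrite -gap1 ltW// gap_lt.
Qed.

Let gap_lower (h : R) : 0 < h -> h < 1 ->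
  exists2 c : R, 0 < c & forall s : R, 0 <= s -> s <= 1 - h -> c <= gap s.
Proof.
move=> h0 h1; exists (Num.min (gap 0) (gap (1 - h))).
  rewrite lt_min gap0/= -gap1 gap_lt//; lra.
move=> s; rewrite le_eqVlt => /orP[/eqP <- _|s0]; first by rewrite ge_min lexx.
rewrite le_eqVlt => /orP[/eqP ->|s1]; rewrite ge_min ?lexx ?orbT//.
by rewrite [X in _ || X](ltW (gap_lt _ _ _)) ?orbT//; move: h0; lra.
Qed.

(* Normalising the longer side to 1: if the shorter one, [s], is away from 1 the
   strict convexity of [x `^ q] gives the gap, otherwise the parallelogram law does. *)
Let normalized (e : R) : 0 < e -> exists2 c : R, 0 < c & forall s m d : R,
  0 <= s -> s <= 1 -> 0 <= m -> m <= 2^-1 * (1 + s) ->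
  4 * m ^+ 2 + d ^+ 2 <= 2 + 2 * s ^+ 2 -> e <= d ->
  c <= 2^-1 * (1 + s `^ q) - m `^ q.
Proof.
move=> e0.
pose a := Num.min e 1.
have a0 : 0 < a by rewrite lt_min e0/=.
have a1 : a <= 1 by rewrite ge_min lexx orbT.
have ae : a <= e by rewrite ge_min lexx.
(* For [s <= 1] and [d >= a], the parallelogram inequality bounds [m] by [k]; capping [a] at 1 keeps
   the number under the root positive. *)
pose k : R := Num.sqrt (1 - a ^+ 2 / 4).
have a2 : 0 < a ^+ 2 by rewrite exprn_gt0.
have a21 : a ^+ 2 <= 1 by rewrite expr_le1// ltW.
have k2 : k ^+ 2 = 1 - a ^+ 2 / 4 by rewrite sqr_sqrtr//; lra.
have k0 : 0 <= k by exact: sqrtr_ge0.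
have k1 : k < 1 by rewrite -(@ltr_pXn2r _ 2)// ?nnegrE// expr1n k2; lra.
have kq1 : k `^ q < 1.
  by rewrite -[ltRHS](one_powR q); apply: gt0_ltr_powR; rewrite ?nnegrE.
pose b := k `^ q.
have b0 : 0 <= b by exact: powR_ge0.
(* The power of [r] is halfway between that of [k] and 1. For [s > r] the bound of [m] by [k] leaves
   a defect of at least [(1 - b) / 4]; for [s <= r] the strict convexity does the work. *)
pose r := (2^-1 * (1 + b)) `^ q^-1.
have r0 : 0 < r by rewrite powR_gt0//; lra.
have rq : r `^ q = 2^-1 * (1 + b) by rewrite -powRrM mulVf ?gt_eqF// powRr1//; lra.
have r1 : r < 1.
  rewrite ltNge; apply/negP => r1; have : (1 : R) `^ q <= r `^ q.
    by apply: ge0_ler_powR; rewrite ?nnegrE// ltW.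
  by rewrite one_powR rq leNgt => /negP; apply; rewrite /b; lra.
have [||c c0 hc] := @gap_lower (1 - r); [lra|lra|].
exists (Num.min c (4^-1 * (1 - b))); first by rewrite lt_min c0/= /b; lra.
move=> s m d s0 s1 m0 ms hp ed.
have [sr|rs] := leP s r.
  rewrite ge_min; apply/orP; left.
  apply: le_trans (hc s s0 _) _; first by lra.
  rewrite /gap lerD2l lerN2; apply: ge0_ler_powR; rewrite ?nnegrE//; first exact: ltW.
  by lra.
rewrite ge_min; apply/orP; right.
have mk : m `^ q <= b.
  apply: ge0_ler_powR; rewrite ?nnegrE//; first exact: ltW.
  rewrite -(@ler_pXn2r _ 2)// ?nnegrE// k2.
  have : a ^+ 2 <= d ^+ 2 by rewrite ler_pXn2r// ?nnegrE ?(ltW a0)//; lra.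
  have : s ^+ 2 <= 1 by rewrite expr_le1.
  move: hp; set x := m ^+ 2; set y := d ^+ 2; set z := s ^+ 2; set w := a ^+ 2; lra.
have : r `^ q <= s `^ q.
  by apply: ge0_ler_powR; rewrite ?nnegrE// ?ltW.
rewrite rq; move: mk kq1; rewrite -/b; lra.
Qed.

Lemma powR_mid_le (a b m : R) : 0 <= a -> 0 <= b -> 0 <= m ->
  m <= 2^-1 * (a + b) -> m `^ q <= 2^-1 * (a `^ q + b `^ q).
Proof.
move=> a0 b0 m0 mab.
wlog ab : a b a0 b0 mab / b <= a.
  by move=> h; have [/h|/ltW/h] := leP b a; [exact|rewrite addrC (addrC (b `^ q)); apply=> //; rewrite addrC].
apply: (@le_trans _ _ ((2^-1 * (a + b)) `^ q)).
  by apply: ge0_ler_powR; rewrite ?nnegrE ?mulr_ge0 ?addr_ge0// ltW.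
have [aE|aN0] := eqVneq a 0.
  have -> : b = 0 by apply/eqP; rewrite eq_le b0 andbT -aE.
  by rewrite aE addr0 mulr0 powR0 ?gt_eqF// addr0 mulr0.
have a00 : 0 < a by rewrite lt_neqAle eq_sym aN0.
have := @gap_ge0 (b / a) (divr_ge0 b0 a0) _; rewrite ler_pdivrMr// mul1r => /(_ ab).
rewrite /gap subr_ge0 => h.
have -> : 2^-1 * (a + b) = a * (2^-1 * (1 + b / a)) by field.
have bE : b = a * (b / a) by field.
rewrite powRM// ?mulr_ge0 ?addr_ge0 ?divr_ge0//.
rewrite {2}bE powRM// ?divr_ge0//.
have -> x y : 2^-1 * (x + x * y) = x * (2^-1 * (1 + y)) :> R by ring.
by rewrite ler_wpM2l// powR_ge0.
Qed.

(** Here [a], [b], [m], [d] stand for the Hilbert norms of two vectors, of their midpoint and of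
    their difference. The inequality is linear in the powers, so it integrates in time. Either [d]
    is small compared with the larger side, and the term in [e] absorbs it, or after normalization
    the convexity defect is at least [c], while [d] is at most twice the larger side: whence the
    constant. *)
Lemma powR_uniform_convex (e : R) : 0 < e -> exists2 C : R, 0 <= C &
  forall a b m d : R, 0 <= a -> 0 <= b -> 0 <= m -> 0 <= d ->
  m <= 2^-1 * (a + b) -> d <= a + b ->
  4 * m ^+ 2 + d ^+ 2 <= 2 * a ^+ 2 + 2 * b ^+ 2 ->
  d `^ q <= e * (a `^ q + b `^ q) + C * (2^-1 * (a `^ q + b `^ q) - m `^ q).
Proof.
move=> e0.
pose e' := e `^ q^-1.
have e'0 : 0 < e' by rewrite powR_gt0.
have e'q : e' `^ q = e by rewrite -powRrM mulVf ?gt_eqF// powRr1// ltW.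
have [c c0 hc] := normalized e'0.
exists (2 `^ q / c); first by rewrite divr_ge0 ?powR_ge0// ltW.
move=> a b m d a0 b0 m0 d0 mab dab hp.
wlog ab : a b a0 b0 mab dab hp / b <= a.
  move=> h; have [/h|/ltW ba] := leP b a; first exact.
  by rewrite (addrC (a `^ q)); apply: h => //; lra.
have mq := powR_mid_le a0 b0 m0 mab.
have [de|ed] := leP d (e' * a).
  apply: (@le_trans _ _ (e * a `^ q)).
    rewrite -e'q -powRM// ?(ltW e'0)//.
    by apply: ge0_ler_powR; rewrite ?nnegrE ?mulr_ge0// ltW.
  rewrite mulrDr -addrA lerDl addr_ge0 ?mulr_ge0 ?powR_ge0 ?(ltW e0) ?invr_ge0 ?(ltW c0)//.
  by rewrite subr_ge0.
have a00 : 0 < a.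
  rewrite lt_neqAle a0 andbT; apply/negP => /eqP a0E; move: ab dab ed.
  by rewrite -a0E mulr0; lra.
have [s0 s1] : 0 <= b / a /\ b / a <= 1.
  by rewrite divr_ge0// ler_pdivrMr// mul1r.
have h := hc (b / a) (m / a) (d / a) s0 s1.
have {h} : c <= 2^-1 * (1 + (b / a) `^ q) - (m / a) `^ q.
  apply: h.
  - by rewrite divr_ge0.
  - by rewrite ler_pdivrMr// -mulrA mulrDl mul1r divfK ?gt_eqF.
  - rewrite !expr_div_n -(@ler_pM2r _ (a ^+ 2)) ?exprn_gt0//.
    have aN0 : a != 0 by rewrite gt_eqF.
    rewrite (_ : _ * a ^+ 2 = 4 * m ^+ 2 + d ^+ 2); last by field.
    by rewrite (_ : _ * a ^+ 2 = 2 * a ^+ 2 + 2 * b ^+ 2)//; field.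
  - by rewrite ler_pdivlMr// ltW.
have aq : 0 < a `^ q by rewrite powR_gt0.
have aN0 : a != 0 by rewrite gt_eqF.
have E (x : R) : 0 <= x -> x `^ q = a `^ q * (x / a) `^ q.
  by move=> x0; rewrite -powRM ?divr_ge0//; congr (_ `^ _); field.
rewrite -(ler_pM2l aq) mulrBr -(E m m0) => h1.
have h2 : 2^-1 * (a `^ q + b `^ q) = a `^ q * (2^-1 * (1 + (b / a) `^ q)).
  by rewrite (E b b0); ring.
rewrite -h2 in h1.
apply: (@le_trans _ _ (2 `^ q * a `^ q)).
  by rewrite -powRM//; apply: ge0_ler_powR; rewrite ?nnegrE ?mulr_ge0//; [exact: ltW|lra].
apply: (@le_trans _ _ (2 `^ q / c * (2^-1 * (a `^ q + b `^ q) - m `^ q))).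
  rewrite -[leRHS]mulrA ler_wpM2l ?powR_ge0// -ler_pdivrMl ?invr_gt0// invrK mulrC.
  by rewrite mulrC; lra.
by rewrite lerDr mulr_ge0 ?addr_ge0 ?powR_ge0// ltW.
Qed.

End powR_uniform_convexity.

(** * Monotonicity of integrals of nonnegative functions *)

Section integral_monotone.
Context {d} {T : measurableType d} {R : realType}.
Variable mu : {measure set T -> \bar R}.
Import HBNNSimple.
Local Open Scope ereal_scope.

(* No measurability: the integral of a nonnegative function is a supremum over
   the simple functions below it. *)
Lemma ae_le_nonneg_integral (D : set T) (f g : T -> \bar R) :
  (forall x, D x -> 0 <= f x) -> (forall x, D x -> 0 <= g x) ->
  {ae mu, forall x, D x -> f x <= g x} ->
  \int[mu]_(x in D) f x <= \int[mu]_(x in D) g x.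
Proof.
move=> f0 g0 [N [mN N0 fgN]].
rewrite !ge0_integralE//; apply: ge_ereal_sup => _ [h /= hf <-].
have mNC : measurable (~` N) by exact: measurableC.
pose h' := [the {nnsfun T >-> R} of proj_nnsfun h mNC].
apply: (@le_trans _ _ (sintegral mu h')); last first.
  apply: ereal_sup_ubound; exists h' => //= x.
  rewrite /h' /= /mindic indicE.
  have [Nx|Nx] := pselect (N x).
    rewrite memNset; last by move=> /(_ Nx).
    rewrite mulr0.
    by rewrite /patch; case: ifPn => // /set_mem; exact: g0.
  rewrite mem_set// mulr1 (le_trans (hf x))// /patch; case: ifPn => // /set_mem Dx.
  by apply: contrapT => fg; apply/Nx/fgN => /= h1; apply/fg/h1.
rewrite -!integralT_nnsfun.
apply: ae_ge0_le_integral => //.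
- by move=> x _; rewrite lee_fin.
- exact/measurable_EFinP.
- by move=> x _; rewrite lee_fin.
- exact/measurable_EFinP.
- exists N; split=> // x /= hx; apply: contrapT => Nx; apply: hx => _.
  by rewrite lee_fin /mindic indicE mem_set// mulr1.
Qed.

Lemma le_nonneg_integral (D : set T) (f g : T -> \bar R) :
  (forall x, D x -> 0 <= f x) -> (forall x, D x -> f x <= g x) ->
  \int[mu]_(x in D) f x <= \int[mu]_(x in D) g x.
Proof.
move=> f0 fg; apply: ae_le_nonneg_integral => // [x Dx|].
  exact: le_trans (f0 _ Dx) (fg _ Dx).
by apply: aeW => x; exact: fg.
Qed.

End integral_monotone.

(** * Distance to a closed set and measurability of cadlag processes *)

Section distance.
Context {R : realType} {E : normedModType R}.
Variable B : set E.
Hypothesis B0 : B !=set0.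

Definition dist_to (x : E) : R := inf [set `|x - b| | b in B].

Let dists_lbound x : has_lbound [set `|x - b| | b in B].
Proof. by exists 0 => _ [b _ <-]. Qed.

Let dists_nonempty x : [set `|x - b| | b in B] !=set0.
Proof. by have [b Bb] := B0; exists `|x - b|, b. Qed.

Lemma dist_to_le x y : dist_to x <= dist_to y + `|x - y|.
Proof.
rewrite -lerBlDr; apply: lb_le_inf => // _ [b Bb <-].
rewrite lerBlDr (@le_trans _ _ `|x - b|)//; first by apply: ge_inf => //; exists b.
by rewrite (le_trans (ler_distD y _ _))// addrC.
Qed.

Lemma continuous_dist_to : continuous dist_to.
Proof.
move=> x; apply/cvgrPdist_le => e e0.
have /cvgrPdist_le/(_ e e0) : y @[y --> x] --> x by exact: cvg_id.
apply: filterS => y xy; rewrite ler_norml; apply/andP; split.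
  rewrite lerNl opprB lerBlDl (le_trans (dist_to_le y x))// lerD2l.
  by rewrite distrC.
by rewrite lerBlDl (le_trans (dist_to_le x y))// lerD2l.
Qed.

Lemma dist_to_eq0 x : closed B -> (dist_to x == 0) = `[< B x >].
Proof.
move=> cB; apply/idP/asboolP => [/eqP x0|Bx].
  apply: cB => A /nbhs_ballP[e /= e0 hA].
  have [//|_ [b Bb <-] xb] := @inf_adherent _ [set `|x - b| | b in B] e e0.
  exists b; split=> //; apply: hA => /=; rewrite -ball_normE/=.
  by move: xb; rewrite -/(dist_to x) x0 add0r.
rewrite eq_le lb_le_inf ?andbT//; last by move=> _ [b _ <-].
by apply: ge_inf => //; exists x => //; rewrite subrr normr0.
Qed.

End distance.

Section measurable_processes.
Context {d} {Om : measurableType d} {R : realType} {E : normedModType R}.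

Definition open_measurable_map (f : Om -> E) : Prop :=
  forall G, open G -> measurable (f @^-1` G).

Lemma measurable_comp_continuous (f : Om -> E) (g : E -> R) :
  open_measurable_map f -> continuous g -> measurable_fun setT (g \o f).
Proof.
move=> mf cg; apply: (measurability _ (RGenOInfty.measurableE R)).
move=> /= _ [_ [a ->]] <-; rewrite setTI comp_preimage; apply: mf.
by apply: open_comp; [move=> x _; exact: cg|exact: interval_open].
Qed.

Lemma measurable_preimage_closed (f : Om -> E) (B : set E) :
  open_measurable_map f -> closed B -> measurable (f @^-1` B).
Proof.
move=> mf cB; rewrite -[B]setCK preimage_setC; apply: measurableC.
by apply: (mf (~` B)); exact: closed_openC.
Qed.

Let idx m (s : R) : nat := Num.truncn (s * (2 ^ m)%:R).

Let measurable_idx m k : measurable [set s : R | idx m s = k].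
Proof.
have mle n : measurable [set s : R | (idx m s <= n)%N].
  have pw : (0 : R) < (2 ^ m)%:R by rewrite ltr0n expn_gt0.
  rewrite (_ : [set _ | _] = `]-oo, (n.+1%:R / (2 ^ m)%:R)[%classic); first exact: measurable_itv.
  by apply/seteqP; split => s /=; rewrite truncn_le_nat in_itv/= ltr_pdivlMr.
case: k => [|k].
  rewrite (_ : [set _ | _] = [set s | (idx m s <= 0)%N]); first exact: mle.
  by apply/seteqP; split => s /=; rewrite leqn0 => /eqP.
rewrite (_ : [set _ | _] = [set s | (idx m s <= k.+1)%N] `\` [set s | (idx m s <= k)%N]).
  exact: measurableD.
apply/seteqP; split => s /=; first by move=> ->; split => //; rewrite ltnn.
move=> [h1 /negP]; rewrite -ltnNge => h2; apply/eqP; by rewrite eqn_leq h1 h2.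
Qed.

(** Time is discretized from the right by dyadic points, which gives jointly measurable
    approximations; right continuity makes them converge. The distance to [B] turns a claim on
    [E]-valued maps into one on real functions. *)
Lemma measurable_cadlag_closed (Y : R -> Om -> E) (B : set E) : closed B ->
  (forall w t, Y s w @[s --> t^'+] --> Y t w) ->
  (forall t, open_measurable_map (Y t)) ->
  (forall w t, t <= 0 -> Y t w = Y 0 w) ->
  measurable [set p : R * Om | B (Y p.1 p.2)].
Proof.
move=> cB rY mY Y0.
have [->|/set0P B0] := eqVneq B set0; first exact: measurable0.
pose f (p : R * Om) := dist_to B (Y p.1 p.2).
suff mf : measurable_fun setT f.
  rewrite (_ : [set _ | _] = f @^-1` [set 0]).
    by rewrite -[X in measurable X]setTI; apply: mf => //; exact: measurable_set1.
  apply/seteqP; split => p /=.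
    by move=> /asboolP; rewrite -dist_to_eq0// => /eqP.
  by move/eqP; rewrite /f dist_to_eq0// => /asboolP.
pose t m k : R := k.+1%:R / (2 ^ m)%:R.
pose h m (p : R * Om) := dist_to B (Y (t m (idx m p.1)) p.2).
apply: (@measurable_fun_cvg _ _ _ _ h) => [m|[s w] _].
  move=> _ A mA; rewrite setTI.
  rewrite (_ : _ @^-1` _ = \bigcup_k ([set s : R | idx m s = k] `*`
      ((dist_to B \o Y (t m k)) @^-1` A))).
    apply: bigcupT_measurable => k; apply: measurableX; first exact: measurable_idx.
    rewrite -[X in measurable X]setTI.
    by apply: measurable_comp_continuous => //; exact: continuous_dist_to.
  apply/seteqP; split => -[s w] /=.
    by move=> As; exists (idx m s) => //=; split.
  by move=> [k _ [/= <-]].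
apply: (@cvg_comp _ _ _ _ (dist_to B) _ (nbhs (Y s w))); last exact: continuous_dist_to.
(* [Num.truncn] sends negative reals to 0, so for [s < 0] the grid times tend to 0 instead of [s];
   the process takes the same value at both. *)
pose s' := Num.max 0 s.
have -> : Y s w = Y s' w.
  by rewrite /s'; have [//|/ltW s0] := leP 0 s; rewrite ?max_r// Y0.
have st m : s' < t m (idx m s).
  have pw : (0 : R) < (2 ^ m)%:R by rewrite ltr0n expn_gt0.
  by rewrite /s' gt_max divr_gt0//= /t ltr_pdivlMr// truncnS_gt.
have ts m : t m (idx m s) <= s' + ((2 ^ m)%:R)^-1.
  have pw : (0 : R) < (2 ^ m)%:R by rewrite ltr0n expn_gt0.
  rewrite /t -natr1 mulrDl mul1r lerD2r ler_pdivrMr//.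
  rewrite /s' /idx; have [s0|s0] := leP 0 s.
    by rewrite truncn_le mulr_ge0// ltW.
  rewrite mul0r (_ : Num.truncn _ = 0%N)//.
  apply/eqP; rewrite -leqn0 truncn_le_nat (lt_trans _ ltr01)//.
  by rewrite nmulr_rlt0.
move=> A /(rY w s') [e /= e0 hA].
have [N hN] := natSinv_lt e0.
exists N => //= m Nm; apply: hA => //=.
rewrite distrC gtr0_norm ?subr_gt0// ltrBlDl (le_lt_trans (ts m))// ltrD2l.
apply: le_lt_trans (hN m Nm).
by rewrite lef_pV2 ?posrE ?ltr0n ?expn_gt0// ler_nat ltn_expl.
Qed.

Lemma measurable_lsc (f : Om -> \bar R) :
  (forall C : R, measurable [set w | (f w <= C%:E)%E]) -> measurable_fun setT f.
Proof.
move=> mf; apply: (measurability _ (ErealGenOInfty.measurableE R)).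
move=> /= _ [_ [a ->]] <-; rewrite setTI.
rewrite (_ : _ @^-1` _ = ~` [set w | (f w <= a%:E)%E]); first exact: measurableC.
by apply/seteqP; split => w /=; rewrite in_itv/= andbT ltNge => /negP.
Qed.

End measurable_processes.

Section measurable_paths.
Context {R : realType} {E : normedModType R}.

Lemma measurable_fun_path (n : E -> \bar R) (u : R -> E) (T : R) :
  (forall C : R, closed [set x | (n x <= C%:E)%E]) ->
  0 <= T -> is_extended T u -> cadlag u -> measurable_fun setT (fun t => n (u t)).
Proof.
move=> cn T0 ue cu; apply: measurable_lsc => C.
pose Y (s : R) (w : unit) := u s.
have := @measurable_cadlag_closed _ unit R E Y _ (cn C).
move=> /(_ _ _ _)/(measurable_ysection tt); rewrite (_ : ysection _ _ = [set t | (n (u t) <= C%:E)%E]).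
  apply=> //.
  - by move=> w t; exact: (cu t).1.
  - by move=> w t t0; rewrite /Y -ue !extend_lt.
by apply/seteqP; split => s; rewrite /ysection/= ?inE.
Qed.

End measurable_paths.

Local Notation leb := lebesgue_measure.

(** The form in which [normH] and [normV] are used: a norm on a subspace, set to [+oo] outside of
    it. *)
Record ext_norm {R : realType} {E : lmodType R} (n : E -> \bar R) : Prop := ExtNorm {
  ext_ge0 : forall x, (0 <= n x)%E;
  ext_Z : forall (a : R) x, (n (a *: x)%R = `|a|%:E * n x)%E;
  ext_D : forall x y, (n (x + y)%R <= n x + n y)%E }.

(** A Hilbert norm on a subspace of [E], lower semicontinuous for the norm of [E]; this last
    property stands in for the weak closedness of balls. *)
Record ext_hilbert {R : realType} {E : normedModType R} (n : E -> \bar R) : Prop :=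
  ExtHilbert {
  ext_hilbert_norm :> ext_norm n;
  ext_parallelogram : forall x y, (n x < +oo)%E -> (n y < +oo)%E ->
    fine (n (x + y)) ^+ 2 + fine (n (x - y)) ^+ 2 <=
    2 * fine (n x) ^+ 2 + 2 * fine (n y) ^+ 2;
  ext_closed : forall C : R, closed [set x | (n x <= C%:E)%E] }.

Section ext_norm.
Context {R : realType} {E : lmodType R} (n : E -> \bar R) (En : ext_norm n).
Local Open Scope ereal_scope.

Lemma ext_0 : n 0%R = 0.
Proof. by rewrite -(scale0r (0%R : E)) (ext_Z En) normr0 mul0e. Qed.

Lemma ext_N x : n (- x)%R = n x.
Proof. by rewrite -scaleN1r (ext_Z En) normrN normr1 mul1e. Qed.

Lemma ext_B x y : n (x - y)%R <= n x + n y.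
Proof. by rewrite (le_trans (ext_D En _ _))// ext_N. Qed.

Lemma ext_fin x : n x < +oo -> exists2 a : R, (0 <= a)%R & n x = a%:E.
Proof.
have := ext_ge0 En x; case: (n x) => [a|//|//]; rewrite lee_fin => a0 _.
by exists a.
Qed.

Lemma ext_mid x y : n (mid x y) <= 2^-1%:E * (n x + n y).
Proof.
rewrite /mid (ext_Z En) gtr0_norm ?invr_gt0//.
by apply: lee_wpmul2l; [rewrite lee_fin invr_ge0|exact: ext_D].
Qed.

Lemma ext_mid_le x y C : n x <= C -> n y <= C -> n (mid x y) <= C.
Proof.
move=> xC yC; have C0 : 0 <= C by exact: le_trans (ext_ge0 En x) xC.
rewrite (le_trans (ext_mid x y))//.
case: C C0 xC yC => [c|_ _ _|//]; last by rewrite leey.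
move=> c0 xc yc.
have [a a0 xa] := ext_fin (le_lt_trans xc (ltry _)).
have [b b0 yb] := ext_fin (le_lt_trans yc (ltry _)).
move: xc yc; rewrite xa yb -EFinD -EFinM !lee_fin; lra.
Qed.

End ext_norm.

Lemma ext_lsc {R : realType} {E : normedModType R} (n : E -> \bar R) (x : E) (u : nat -> E) :
  (forall C : R, closed [set y | (n y <= C%:E)%E]) -> u @ \oo --> x ->
  (n x <= limn_einf (n \o u))%E.
Proof.
move=> cn ux.
have hr (r : R) : (r%:E < n x)%E -> (r%:E <= limn_einf (n \o u))%E.
  move=> rx.
  have [N _ hN] : \forall k \near \oo, (r%:E < n (u k))%E.
    apply: (ux [set y | (r%:E < n y)%E]); apply: open_nbhs_nbhs; split => //.
    rewrite (_ : [set _ | _] = ~` [set y | (n y <= r%:E)%E]); first exact: closed_openC.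
    by apply/seteqP; split => y /=; rewrite ltNge => /negP.
  rewrite limn_einf_lim (cvg_lim _ (@cvg_einfs_sup _ _))//.
  apply: (@le_trans _ _ (einfs (n \o u) N)); last by apply: ereal_sup_ubound; exists N.
  by apply: le_ereal_inf_tmp => _ [k /= Nk <-]; apply: ltW; exact: hN.
case E0 : (n x) => [a| |]; last by rewrite leNye.
  apply/lee_subgt0Pr => e e0; rewrite -EFinB; apply: hr.
  by rewrite E0 lte_fin ltrBlDr ltrDl.
by rewrite (eq_infty (x := limn_einf _))// => r; apply: hr; rewrite E0 ltry.
Qed.

Lemma poweR_le_root {R : realType} (x : \bar R) (q C : R) : (0 <= x)%E -> 0 < q -> 0 <= C ->
  (x `^ q <= C%:E)%E = (x <= (C `^ q^-1)%:E)%E.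
Proof.
move=> x0 q0 C0; have qi : 0 < q^-1 by rewrite invr_gt0.
case: x x0 => [x|_|//].
  rewrite !lee_fin => x0; apply/idP/idP => h.
    have := ge0_ler_powR (ltW qi) (powR_ge0 x q : _ \is Num.nneg) C0 h.
    by rewrite -powRrM mulfV ?gt_eqF// powRr1.
  have := ge0_ler_powR (ltW q0) (x0 : _ \is Num.nneg) (powR_ge0 C q^-1) h.
  by rewrite -powRrM mulVf ?gt_eqF// powRr1.
by rewrite poweRyr ?gt_eqF// !leNgt !ltry.
Qed.

Lemma closed_poweR {R : realType} {E : normedModType R} (n : E -> \bar R) (q : R) :
  0 < q -> (forall x, 0 <= n x)%E -> (forall C : R, closed [set x | (n x <= C%:E)%E]) ->
  forall C : R, closed [set x | (n x `^ q <= C%:E)%E].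
Proof.
move=> q0 n0 cn C; have [C0|C0] := leP 0 C.
  rewrite (_ : [set _ | _] = [set x | (n x <= (C `^ q^-1)%:E)%E])//.
  by apply/seteqP; split => x /=; rewrite poweR_le_root.
rewrite (_ : [set _ | _] = set0); first exact: closed0.
rewrite -subset0 => x /= xC; have : (0%:E <= C%:E)%E.
  by apply: le_trans xC; exact: poweR_ge0.
by rewrite lee_fin leNgt C0.
Qed.

(** * The integral of the q-th power of the norm along a path *)

Section energy.
Context {R : realType} {E : normedModType R} (T q : R) (n : E -> \bar R).
Hypotheses (T0 : 0 < T) (q1 : 1 < q) (Hn : ext_hilbert n).
Local Open Scope ereal_scope.

Let q0 : (0 < q)%R. Proof. exact: lt_trans q1. Qed.
Let En : ext_norm n := Hn.

Definition energy (u : R -> E) : \bar R := \int[leb]_(t in `[0%R, T]) (n (u t) `^ q).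

Definition finite_energy (u : R -> E) : Prop :=
  [/\ is_extended T u, cadlag u & energy u < +oo].

Lemma energy_ge0 u : 0 <= energy u.
Proof. by apply: integral_ge0 => t _; exact: poweR_ge0. Qed.

Lemma measurable_energy u : is_extended T u -> cadlag u ->
  measurable_fun setT (fun t => n (u t) `^ q).
Proof.
move=> eu cu; apply: (@measurable_fun_path _ _ (fun x => n x `^ q) u T) => //; last exact: ltW.
exact: closed_poweR q0 (ext_ge0 En) (ext_closed Hn).
Qed.

Lemma cadlag_lin (a : R) (u v : R -> E) : cadlag u -> cadlag v -> cadlag (a \*: u \+ v)%R.
Proof.
move=> cu cv t; have [u1 [l ul]] := cu t; have [v1 [k vk]] := cv t; split.
  by apply: cvgD => //; exact: cvgZr.
by exists (a *: l + k)%R; apply: cvgD => //; exact: cvgZr.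
Qed.

Lemma extended_lin (a : R) (u v : R -> E) : is_extended T u -> is_extended T v ->
  is_extended T (a \*: u \+ v)%R.
Proof.
move=> eu ev; apply/funext => t.
by rewrite -[in RHS]eu -[in RHS]ev.
Qed.

Lemma poweR_le2 (x y : \bar R) : 0 <= x -> x <= y -> x `^ q <= y `^ q.
Proof.
move=> x0 xy; apply: (gt0_ler_poweR (ltW q0)) => //.
  by rewrite in_itv/= x0 leey.
by rewrite in_itv/= (le_trans x0 xy) leey.
Qed.

Lemma poweR_add_le (x y : \bar R) : 0 <= x -> 0 <= y ->
  (x + y) `^ q <= (2 `^ q)%:E * (x `^ q + y `^ q).
Proof.
move=> x0 y0; wlog xy : x y x0 y0 / y <= x.
  by move=> h; have [/h|/ltW/h] := leP y x; [exact|rewrite addeC (addeC (y `^ q)); exact].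
apply: (@le_trans _ _ ((2%:E * x) `^ q)).
  apply: poweR_le2; first exact: adde_ge0.
  by rewrite -[2%R]/(1 + 1)%R EFinD ge0_muleDl ?lee_fin// !mul1e leeD2l.
rewrite poweRM ?lee_fin// poweR_EFin lee_wpmul2l ?lee_fin ?powR_ge0//.
by rewrite leeDl// poweR_ge0.
Qed.

Lemma energy_lin_le (a : R) (u v : R -> E) :
  is_extended T u -> cadlag u -> is_extended T v -> cadlag v ->
  energy (a \*: u \+ v)%R <= (2 `^ q)%:E * ((`|a| `^ q)%:E * energy u + energy v).
Proof.
move=> eu cu ev cv.
have mu := measurable_energy eu cu; have mv := measurable_energy ev cv.
have mD : measurable (`[0%R, T]%classic : set R) by exact: measurable_itv.
rewrite /energy -ge0_integralZl_EFin ?powR_ge0//; last 2 first.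
- by move=> t _; exact: poweR_ge0.
- exact: measurable_funTS.
rewrite -ge0_integralD//; last 4 first.
- by move=> t _; rewrite mule_ge0 ?poweR_ge0// lee_fin powR_ge0.
- by apply: measurable_funeM; exact: measurable_funTS.
- by move=> t _; exact: poweR_ge0.
- exact: measurable_funTS.
rewrite -ge0_integralZl_EFin ?powR_ge0//; last 2 first.
- by move=> t _; rewrite adde_ge0 ?mule_ge0 ?poweR_ge0// lee_fin powR_ge0.
- apply: emeasurable_funD; last exact: measurable_funTS.
  by apply: measurable_funeM; exact: measurable_funTS.
apply: le_nonneg_integral => t _; first exact: poweR_ge0.
have := poweR_le2 (ext_ge0 En _) (ext_D En (a *: u t)%R (v t)).
move=> /le_trans; apply.
rewrite (le_trans (poweR_add_le (ext_ge0 En _) (ext_ge0 En _)))//.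
by rewrite (ext_Z En) poweRM ?(ext_ge0 En) ?lee_fin// poweR_EFin.
Qed.

Lemma finite_energy_lin (a : R) (u v : R -> E) : finite_energy u -> finite_energy v ->
  finite_energy (a \*: u \+ v)%R.
Proof.
move=> [eu cu fu] [ev cv fv]; split; [exact: extended_lin|exact: cadlag_lin|].
rewrite (le_lt_trans (energy_lin_le _ eu cu ev cv))//.
rewrite lte_mul_pinfty ?lee_fin ?powR_ge0// lte_add_pinfty//.
by rewrite lte_mul_pinfty ?lee_fin ?powR_ge0.
Qed.

(** Lower semicontinuity of [n] at almost every time, then Fatou's lemma. *)
Lemma fatou_energy (u : nat -> R -> E) (v : R -> E) (C : \bar R) :
  (forall k, is_extended T (u k)) -> (forall k, cadlag (u k)) ->
  {ae leb, forall t : R, t \in `[0%R, T] -> u ^~ t @ \oo --> v t} ->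
  (forall k, energy (u k) <= C) -> energy v <= C.
Proof.
move=> eu cu uv uC.
apply: (@le_trans _ _ (\int[leb]_(t in `[0%R, T]) limn_einf (fun k => n (u k t) `^ q))).
  apply: ae_le_nonneg_integral => [t _|t _|]; first exact: poweR_ge0.
    rewrite limn_einf_lim (cvg_lim _ (@cvg_einfs_sup _ _))//.
    apply: (@le_trans _ _ (einfs (fun k => n (u k t) `^ q) 0%N)).
      by apply: le_ereal_inf_tmp => _ [k _ <-]; exact: poweR_ge0.
    by apply: ereal_sup_ubound; exists 0%N.
  case: uv => N [mN N0 hN]; exists N; split=> // t /= ht; apply: hN => /= uv.
  apply: ht => Tt.
  have := @ext_lsc _ _ (fun x => n x `^ q) (v t) (u ^~ t).
  by apply; [exact: closed_poweR q0 (ext_ge0 En) (ext_closed Hn)|exact: uv].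
apply: (@le_trans _ _ (limn_einf (fun k => energy (u k)))).
  apply: fatou => // [k|k t _]; last exact: poweR_ge0.
  by apply: measurable_funTS; exact: measurable_energy.
rewrite limn_einf_lim (cvg_lim _ (@cvg_einfs_sup _ _))//.
apply: ge_ereal_sup => _ [k _ <-].
by apply: le_trans (uC k); apply: ereal_inf_lbound; exists k => //=.
Qed.

End energy.

Section energy_weak.
Context {R : realType} {E : normedModType R} (T q : R) (n : E -> \bar R).
Hypotheses (T0 : 0 < T) (q1 : 1 < q) (Hn : ext_hilbert n).
Local Open Scope ereal_scope.
Local Notation energy := (energy T q n).
Local Notation finite_energy := (finite_energy T q n).

Let q0 : (0 < q)%R. Proof. exact: lt_trans q1. Qed.
Let En : ext_norm n := Hn.

Let mD : measurable (`[0%R, T]%classic : set R).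
Proof. exact: measurable_itv. Qed.

Lemma ext_hilbert_mid (x y : E) : n x < +oo -> n y < +oo ->
  (4 * fine (n (mid x y)) ^+ 2 + fine (n (x - y)%R) ^+ 2 <=
   2 * fine (n x) ^+ 2 + 2 * fine (n y) ^+ 2)%R.
Proof.
move=> xf yf; apply: le_trans (ext_parallelogram Hn xf yf).
rewrite lerD2r /mid (ext_Z En) gtr0_norm ?invr_gt0//.
have [a a0 ->] := ext_fin En (le_lt_trans (ext_D En x y) (lte_add_pinfty xf yf)).
by rewrite -EFinM/= exprMn; nra.
Qed.

(** The defect is written without subtraction, so that the inequality makes sense for infinite norms
    and can be integrated as it stands. *)
Lemma ext_uniform_convex (e : R) : (0 < e)%R -> exists2 C : R, (0 <= C)%R &
  forall x y : E, n (x - y)%R `^ q + C%:E * n (mid x y) `^ q <=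
    (e + C / 2)%:E * (n x `^ q + n y `^ q).
Proof.
move=> e0; have [C C0 hC] := powR_uniform_convex q1 e0.
exists C => // x y.
have eC : (0 < e + C / 2)%R by rewrite ltr_pwDl// divr_ge0.
have [xf|] := ltP (n x) +oo; last first.
  rewrite leye_eq => /eqP ->; rewrite poweRyr ?gt_eqF// addye.
    by rewrite gt0_muley ?leey.
  by rewrite gt_eqF// (lt_le_trans _ (poweR_ge0 _ _)).
have [yf|] := ltP (n y) +oo; last first.
  rewrite leye_eq => /eqP ->; rewrite poweRyr ?gt_eqF// addey.
    by rewrite gt0_muley ?leey.
  by rewrite gt_eqF// (lt_le_trans _ (poweR_ge0 _ _)).
have hp := ext_hilbert_mid xf yf.
have hm := ext_mid En x y; have hB := ext_B En x y.
have [a a0 xa] := ext_fin En xf; have [b b0 yb] := ext_fin En yf.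
have [m m0 me] : exists2 m : R, (0 <= m)%R & n (mid x y) = m%:E.
  by apply: (ext_fin En); rewrite (le_lt_trans hm)// xa yb ltry.
have [d d0 de] : exists2 m : R, (0 <= m)%R & n (x - y)%R = m%:E.
  by apply: (ext_fin En); rewrite (le_lt_trans hB)// xa yb ltry.
move: hp hm hB; rewrite xa yb me de !poweR_EFin -!(EFinD,EFinM) !lee_fin /= => hp hm hB.
have := hC a b m d a0 b0 m0 d0 hm hB hp.
set A := (a `^ q)%R; set B := (b `^ q)%R; set M := (m `^ q)%R; set D := (d `^ q)%R.
lra.
Qed.

Lemma ext_mid_poweR (x y : E) : n (mid x y) `^ q <= 2^-1%:E * (n x `^ q + n y `^ q).
Proof.
have [xf|] := ltP (n x) +oo; last first.
  rewrite leye_eq => /eqP ->; rewrite poweRyr ?gt_eqF// addye.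
    by rewrite gt0_muley ?leey// lte_fin invr_gt0.
  by rewrite gt_eqF// (lt_le_trans _ (poweR_ge0 _ _)).
have [yf|] := ltP (n y) +oo; last first.
  rewrite leye_eq => /eqP ->; rewrite poweRyr ?gt_eqF// addey.
    by rewrite gt0_muley ?leey// lte_fin invr_gt0.
  by rewrite gt_eqF// (lt_le_trans _ (poweR_ge0 _ _)).
have hm := ext_mid En x y.
have [a a0 xa] := ext_fin En xf; have [b b0 yb] := ext_fin En yf.
have [m m0 me] : exists2 m : R, (0 <= m)%R & n (mid x y) = m%:E.
  by apply: (ext_fin En); rewrite (le_lt_trans hm)// xa yb ltry.
move: hm; rewrite xa yb me !poweR_EFin -!EFinD -!EFinM !lee_fin => hm.
exact: powR_mid_le.
Qed.

Lemma mid_fun (u v : R -> E) t : (mid u v) t = mid (u t) (v t). Proof. by []. Qed.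

Lemma finite_energy_mid (u v : R -> E) : finite_energy u -> finite_energy v ->
  finite_energy (mid u v).
Proof.
move=> fu fv.
have f0 : finite_energy (fun _ => 0%R).
  split=> [||]; first exact/funext.
    by move=> t; split; [exact: cvg_cst|exists 0%R; exact: cvg_cst].
  rewrite /energy; under eq_integral do rewrite (ext_0 En) poweR0r ?gt_eqF//.
  by rewrite integral0 ltry.
have -> : mid u v = (2^-1 \*: (1 \*: u \+ v) \+ (fun=> 0))%R.
  by apply/funext => t; rewrite mid_fun /mid /= scale1r addr0.
by apply: finite_energy_lin => //; exact: finite_energy_lin.
Qed.

Lemma energy_mid_le (u v : R -> E) : finite_energy u -> finite_energy v ->
  energy (mid u v) <= 2^-1%:E * (energy u + energy v).
Proof.
move=> [eu cu fu] [ev cv fv].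
have mu := measurable_energy T0 q1 Hn eu cu; have mv := measurable_energy T0 q1 Hn ev cv.
rewrite /energy -ge0_integralD//; last 4 first.
- by move=> t _; exact: poweR_ge0.
- exact: measurable_funTS.
- by move=> t _; exact: poweR_ge0.
- exact: measurable_funTS.
rewrite -ge0_integralZl_EFin ?invr_ge0//; last 2 first.
- by move=> t _; rewrite adde_ge0 ?poweR_ge0.
- by apply: emeasurable_funD; exact: measurable_funTS.
by apply: le_nonneg_integral => t _; [exact: poweR_ge0|exact: ext_mid_poweR].
Qed.

Lemma energy_uniform_convex (e : R) : (0 < e)%R -> exists2 C : R, (0 <= C)%R &
  forall u v, finite_energy u -> finite_energy v ->
  (fine (energy (u \- v)%R) <= e * (fine (energy u) + fine (energy v)) +
    C * (2^-1 * (fine (energy u) + fine (energy v)) - fine (energy (mid u v))))%R.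
Proof.
move=> e0; have [C C0 hC] := ext_uniform_convex e0.
exists C => // u v fu fv.
have [em cm fm] := finite_energy_mid fu fv.
have [ed cd fd] : finite_energy (u \- v)%R.
  have -> : (u \- v = (-1) \*: v \+ u)%R.
    by apply/funext => t /=; rewrite scaleN1r addrC.
  exact: finite_energy_lin.
have [eu cu gu] := fu; have [ev cv gv] := fv.
have mu := measurable_energy T0 q1 Hn eu cu; have mv := measurable_energy T0 q1 Hn ev cv.
have mm := measurable_energy T0 q1 Hn em cm; have md := measurable_energy T0 q1 Hn ed cd.
have : energy (u \- v)%R + C%:E * energy (mid u v) <= (e + C / 2)%:E * (energy u + energy v).
  rewrite /energy -ge0_integralZl_EFin//; last 2 first.
  - by move=> t _; exact: poweR_ge0.
  - exact: measurable_funTS.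
  rewrite -!ge0_integralD//; last 8 first.
  - by move=> t _; exact: poweR_ge0.
  - exact: measurable_funTS.
  - by move=> t _; exact: poweR_ge0.
  - exact: measurable_funTS.
  - by move=> t _; exact: poweR_ge0.
  - exact: measurable_funTS.
  - by move=> t _; rewrite mule_ge0 ?poweR_ge0// lee_fin.
  - by apply: measurable_funeM; exact: measurable_funTS.
  rewrite -ge0_integralZl_EFin; last 4 first.
  - exact: mD.
  - by move=> t _; rewrite adde_ge0 ?poweR_ge0.
  - by apply: emeasurable_funD; exact: measurable_funTS.
  - by rewrite addr_ge0 ?divr_ge0// ltW.
  apply: le_nonneg_integral => t _; last exact: hC.
  by rewrite adde_ge0 ?mule_ge0 ?poweR_ge0// lee_fin.
have fin w : energy w < +oo -> energy w \is a fin_num.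
  by move=> h; rewrite ge0_fin_numE ?energy_ge0.
rewrite -{1}(fineK (fin _ gu)) -{1}(fineK (fin _ gv)) -{1}(fineK (fin _ fm)) -{1}(fineK (fin _ fd)).
rewrite -!(EFinD,EFinM) lee_fin /=.
set a := fine _; set b := fine _; set c := fine _; set d := fine _; lra.
Qed.

(* Mazur's lemma in L^q(0, T; V): uniform convexity makes suitable midpoint
   combinations of the tails converge in norm, and by lower semicontinuity their
   limit is the limit [0] of the combinations in the weaker norm. *)
Lemma energy_weak_cvg (L : (R -> E) -> R) (u : nat -> R -> E) (v : R -> E) (c B C : R) :
  (forall (a : R) p r, finite_energy p -> finite_energy r ->
    L (a \*: p \+ r)%R = (a * L p + L r)%R) ->
  (forall p, finite_energy p -> `|L p|%:E <= C%:E * energy p `^ q^-1) ->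
  (forall k, finite_energy (u k)) -> finite_energy v ->
  (forall k, energy (u k) <= B%:E) ->
  {ae lebesgue_measure, forall t : R, t \in `[0%R, T] -> u ^~ t @ \oo --> v t} ->
  (0 < c)%R -> (forall k, L v + c <= L (u k))%R -> False.
Proof.
move=> Llin Lbnd fu fv uB uv c0 Lc.
pose w k := (u k \- v)%R.
have wE k : w k = ((-1) \*: v \+ u k)%R.
  by apply/funext => t /=; rewrite scaleN1r addrC.
have fw k : finite_energy (w k) by rewrite wE; exact: finite_energy_lin.
have Lw k : (c <= L (w k))%R by rewrite wE Llin// mulN1r addrC lerBrDl.
have fin p : finite_energy p -> energy p \is a fin_num.
  by move=> [_ _ h]; rewrite ge0_fin_numE ?energy_ge0.
pose B' := fine ((2 `^ q)%:E * ((`|-1| `^ q)%:E * energy v + B%:E)).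
have wB k : (fine (energy (w k)) <= B')%R.
  apply: fine_le; first exact: fin.
    by rewrite fin_numM ?fin_numD ?fin_numM ?fin.
  rewrite wE; have [? ? _] := fv; have [? ? _] := fu k.
  rewrite (le_trans (energy_lin_le T0 q1 Hn _ _ _ _ _))// lee_wpmul2l ?lee_fin ?powR_ge0//.
  by rewrite leeD2l.
have [p [ph pgap]] := midhull_minimizing (fun x => fine_ge0 (energy_ge0 T q n x)) wB.
have hull : midhull [set w k | k in setT] `<=`
    [set x | [/\ finite_energy x, fine (energy x) <= B' & c <= L x]%R].
  apply: midhull_sub => [_ [k _ <-]|x y [fx xB Lx] [fy yB Ly]]; first by split.
  split; first exact: finite_energy_mid.
    have := energy_mid_le fx fy.
    rewrite -(fineK (fin _ fx)) -(fineK (fin _ fy)) -(fineK (fin _ (finite_energy_mid fx fy))).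
    rewrite -EFinD -EFinM lee_fin /= => /le_trans; apply.
    by move: xB yB; set a := fine _; set b := fine _; lra.
  have -> : mid x y = (2^-1 \*: (x : R -> E) \+ ((- 2^-1) \*: (y : R -> E) \+ y))%R.
    apply/funext => t; rewrite mid_fun /mid /= scalerDr; congr (_ + _)%R.
    rewrite -[X in _ = (_ + X)%R]scale1r -scalerDl; congr (_ *: _)%R.
    by field.
  rewrite !Llin//; last first.
    by apply: finite_energy_lin.
  by move: Lx Ly; lra.
have pS k : [/\ finite_energy (p k), fine (energy (p k)) <= B' & c <= L (p k)]%R.
  by apply: hull; apply: midhullS (ph k) => _ [l _ <-]; exists l.
have B'0 : (0 <= B')%R by apply: le_trans (wB 0%N); rewrite fine_ge0// energy_ge0.
have small (e : R) : (0 < e)%R -> exists k, (fine (energy (p k)) <= e)%R.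
  move=> e0.
  (* All combinations have energy at most [B'], so the [e1] term contributes at most [e / 2]; the
     midpoint defect, below [e / (2 (K + 1))] and multiplied by [K], contributes the other half. *)
  pose e1 := (e / (4 * (B' + 1)))%R.
  have e10 : (0 < e1)%R by rewrite divr_gt0// mulr_gt0//; lra.
  have [K K0 hK] := energy_uniform_convex e10.
  have e20 : (0 < e / (2 * (K + 1)))%R by rewrite divr_gt0// mulr_gt0//; lra.
  have [N hN] := pgap _ e20.
  exists N.
  have fB k : finite_energy (p N \- p (N + k)%N)%R.
    have [f1 _ _] := pS N; have [f2 _ _] := pS (N + k)%N.
    have -> : (p N \- p (N + k)%N = (-1) \*: (p (N + k)%N : R -> E) \+ p N)%R.
      by apply/funext => t /=; rewrite scaleN1r addrC.
    exact: finite_energy_lin.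
  have [fpN pNB _] := pS N.
  rewrite -lee_fin fineK ?fin//.
  (* At almost every time the hulls of the tails shrink to 0, so [p N - p (N + k)] tends to [p N],
     and the Cauchy bound passes to [p N] itself. *)
  apply: (@fatou_energy R E T q n T0 q1 Hn (fun k => p N \- p (N + k)%N)%R) => [k|k| |k].
  - by have [] := fB k.
  - by have [] := fB k.
  - case: uv => S [mS S0 hS]; exists S; split=> // t /= ht; apply: hS => /= uv.
    apply: ht => tT; have {}uv := uv tT.
    suff h0 : (fun k => p (N + k)%N t) @ \oo --> 0%R.
      by rewrite -[X in _ --> X]subr0; apply: cvgB => //; exact: cvg_cst.
    have wt : w ^~ t @ \oo --> 0%R.
      by rewrite -(subrr (v t)); apply: cvgB => //; exact: cvg_cst.
    apply/cvgr0Pnorm_le => r r0.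
    have /cvgr0Pnorm_le/(_ r r0) [M _ hM] := wt.
    exists M => //= k Mk.
    have : midhull (tail w M) `<=` [set x : R -> E | (`|x t| <= r)%R].
      apply: midhull_sub => [_ [l /= Ml <-]|x y /= xr yr]; first exact: hM.
      rewrite /mid /= normrZ gtr0_norm ?invr_gt0// ler_pdivrMl//.
      by rewrite (le_trans (ler_normD _ _))// mulr2n mulrDl !mul1r lerD.
    apply; apply: midhullS (ph (N + k)%N); apply: tailS.
    by rewrite (leq_trans Mk)// leq_addl.
  - have [fNk NkB _] := pS (N + k)%N; have [_ _ fBk] := fB k.
    rewrite -(fineK (fin _ (fB k))) lee_fin (le_trans (hK _ _ fpN fNk))//.
    have h1 : (e1 * (fine (energy (p N)) + fine (energy (p (N + k)%N))) <= e / 2)%R.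
      apply: (@le_trans _ _ (e1 * (2 * (B' + 1)))%R).
        by rewrite ler_wpM2l ?ltW//; lra.
      have B1 : (B' + 1 != 0)%R by rewrite gt_eqF//; lra.
      by rewrite /e1 (_ : _ / _ * _ = e / 2)%R//; field.
    have h2 : (K * (2^-1 * (fine (energy (p N)) + fine (energy (p (N + k)%N))) -
        fine (energy (mid (p N) (p (N + k)%N)))) <= e / 2)%R.
      apply: (@le_trans _ _ (K * (e / (2 * (K + 1))))%R).
        by rewrite ler_wpM2l// ltW// hN// leq_addr.
      rewrite mulrCA ler_pM2l// invfM mulrCA ler_piMr// ler_pdivrMr; lra.
    by move: h1 h2; lra.
(* An [L^q] norm at most [b] makes [L (p k)] at most [c / 2], against [c <= L (p k)], which holds on
   the whole hull. *)
pose b := (c / (2 * (`|C| + 1)))%R.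
have b0 : (0 < b)%R by rewrite divr_gt0// mulr_gt0// ltr_wpDl.
have [k] := small (b `^ q)%R (powR_gt0 _ b0).
have [fk _ Lk] := pS k; move=> kb.
have : (c%:E <= `|C|%:E * b%:E).
  rewrite (@le_trans _ _ `|L (p k)|%:E)//; first by rewrite lee_fin (le_trans Lk)// ler_norm.
  rewrite (le_trans (Lbnd _ fk))// (@le_trans _ _ (`|C|%:E * energy (p k) `^ q^-1))//.
    by rewrite lee_wpmul2r ?poweR_ge0// lee_fin ler_norm.
  rewrite lee_wpmul2l// ?lee_fin// -(fineK (fin _ fk)) poweR_EFin lee_fin.
  rewrite -[leRHS]powRr1 ?(ltW b0)// -(@mulfV _ q) ?gt_eqF// powRrM.
  by apply: ge0_ler_powR; rewrite ?nnegrE ?invr_ge0 ?(ltW q0) ?powR_ge0 ?fine_ge0 ?energy_ge0.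
rewrite -EFinM lee_fin /b mulrCA ler_pMr// invfM mulrCA.
have : (`|C| / (`|C| + 1) <= 1)%R by rewrite ler_pdivrMr ?mul1r ?lerDl// ltr_wpDl.
by lra.
Qed.

End energy_weak.

(** * Compactness in Z_q *)

Section separability.
Context {R : realType} {E : normedModType R} (n : E -> \bar R) (Hn : ext_hilbert n).
Let En : ext_norm n := Hn.

Lemma midxx (x : E) : mid x x = x.
Proof.
rewrite /mid -{1 2}[x]scale1r -scalerDl scalerA -[1 + 1]/(2%:R).
by rewrite mulVf ?scale1r.
Qed.

(** Near-minimizers of the squared norm on the hulls of the tails are Cauchy for [n] by the
    parallelogram law, and tend to [y] in [E]. As balls of [n] are closed in [E], the Cauchy bound
    on [p N - p k] passes to [p N - y]. *)
Lemma ext_mazur (z : nat -> E) (y : E) (B : R) : z @ \oo --> y ->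
  (forall k, (n (z k) <= B%:E)%E) ->
  forall e : R, 0 < e -> exists2 p, midhull (range z) p & (n (p - y)%R <= e%:E)%E.
Proof.
move=> zy zB.
have B0 : 0 <= B by rewrite -lee_fin (le_trans (ext_ge0 En (z 0%N))).
pose Phi x := fine (n x) ^+ 2.
have PhiB k : Phi (z k) <= B ^+ 2.
  have [a a0 za] := ext_fin En (le_lt_trans (zB k) (ltry _)).
  have := zB k; rewrite /Phi za lee_fin /= => aB.
  by rewrite ler_pXn2r.
have [p [ph pgap]] := midhull_minimizing (fun x => sqr_ge0 (fine (n x))) PhiB.
have pB k : (n (p k) <= B%:E)%E.
  move: (ph k); apply: (@midhull_sub _ _ _ [set x | (n x <= B%:E)%E]).
    by move=> _ [l _ <-]; exact: zB.
  by move=> x x' /=; exact: ext_mid_le.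
have py : p @ \oo --> y.
  apply/cvgrPdist_le => e e0; have /cvgrPdist_le/(_ e e0) [M _ hM] := zy.
  exists M => // k Mk.
  have : midhull (tail z M) `<=` [set x | `|y - x| <= e].
    apply: midhull_sub => [_ [l /= Ml <-]|x x' /= xr yr]; first exact: hM.
    have -> : y - mid x x' = mid (y - x) (y - x').
      by rewrite -{1}(midxx y) /mid addrACA -opprD scalerBr.
    rewrite /mid normrZ gtr0_norm ?invr_gt0// ler_pdivrMl//.
    by rewrite (le_trans (ler_normD _ _))// mulr2n mulrDl !mul1r lerD.
  by apply; apply: midhullS (ph k); exact: tailS.
move=> e e0.
have e40 : 0 < e ^+ 2 / 4 by rewrite divr_gt0// exprn_gt0.
have [N hN] := pgap _ e40.
exists (p N); first by apply: midhullS (ph N) => _ [l _ <-]; exists l.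
have cv : (fun k => p N - p k) @ \oo --> p N - y by apply: cvgB => //; exact: cvg_cst.
apply: (closed_cvg [set x | (n x <= e%:E)%E] (ext_closed Hn (C := e)) _ _ cv).
exists N => // k /= Nk.
have := hN N k (leqnn _) Nk; rewrite /Phi.
have lty l : (n (p l) < +oo)%E by rewrite (le_lt_trans (pB l))// ltry.
have := ext_hilbert_mid Hn (lty N) (lty k).
have := ext_B En (p N) (p k).
have [a a0 ->] := ext_fin En (lty N); have [b b0 ->] := ext_fin En (lty k).
move=> h; have := le_lt_trans h (ltry _) => /(ext_fin En)[c c0 cE]; rewrite cE /=.
set m := fine _ ^+ 2 => h1 h2; rewrite lee_fin -(@ler_pXn2r _ 2) ?nnegrE ?(ltW e0)//.
by move: h1 h2; set x := a ^+ 2; set y' := b ^+ 2; set z' := c ^+ 2; set w := e ^+ 2; lra.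
Qed.

Let unpair (k : nat) : nat * nat := odflt (0%N, 0%N) (unpickle k).

Let pairK a b : exists k, unpair k = (a, b).
Proof. by exists (pickle (a, b)); rewrite /unpair pickleK. Qed.

(* Up to scaling, combinations of a dense sequence of the unit ball for the norm
   of [E] approximate in [n], by Mazur's lemma. *)
Lemma ext_separable (K : set E) : compact K -> [set x | (n x <= 1%:E)%E] `<=` K ->
  exists e : nat -> E, (forall k, (n (e k) < +oo)%E) /\
    forall x, (n x < +oo)%E -> forall r : R, 0 < r -> exists k, (n (x - e k)%R < r%:E)%E.
Proof.
move=> cK AK; pose A : set E := [set x | (n x <= 1%:E)%E].
have cA : compact A := subclosed_compact (ext_closed Hn (C := 1)) cK AK.
have A0 : A 0 by rewrite /A /= (ext_0 En) lee_fin.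
have /choice[s sP] (m : nat) : exists s : seq E, {in s, forall x, A x} /\
    forall y, A y -> exists2 x, x \in s & `|y - x| < m.+1%:R^-1.
  move: cA; rewrite compact_cover => /(_ E A (fun x => ball x m.+1%:R^-1)) [].
  - by move=> x _; exact: ball_open.
  - by move=> x Ax; exists x => //; exact: ballxx.
  move=> D DA AD; exists (finmap.enum_fset D); split=> [x xD|y /AD[x xD]].
    by have := DA x xD; rewrite inE.
  by rewrite -ball_normE /= distrC => ?; exists x.
(* Enumerates all the finite nets; the default value 0 of [nth] belongs to [A]. *)
pose e0 k := let: (m, i) := unpair k in nth 0 (s m) i.
have e0A k : A (e0 k).
  rewrite /e0; case: (unpair k) => m i.
  have [im|im] := ltnP i (size (s m)); last by rewrite nth_default.
  by apply: (sP m).1; exact: mem_nth.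
(* Level [l] enumerates iterated midpoints of depth [l]; the points of lower levels survive because
   a point is its own midpoint. *)
pose h := fix h l := if l isn't l'.+1 then e0 else
  fun k => let: (a, b) := unpair k in mid (h l' a) (h l' b).
have hA l k : A (h l k).
  elim: l k => [|l IH] k /=; first exact: e0A.
  by case: (unpair k) => a b; apply: ext_mid_le => //; exact: IH.
have hS l l' k : (l <= l')%N -> exists k', h l' k' = h l k.
  elim: l' => [|l' IH]; first by rewrite leqn0 => /eqP ->; exists k.
  rewrite leq_eqVlt => /orP[/eqP ->|/IH[a ha]]; first by exists k.
  have [b hb] := pairK a a; exists b; rewrite /= hb.
  by rewrite ha midxx.
have hull x : midhull (range e0) x -> exists l k, h l k = x.
  elim=> [_ [k _ <-]|a b _ [l [k <-]] _ [l' [k' <-]]]; first by exists 0%N, k.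
  have [c hc] := hS _ _ k (leq_maxl l l'); have [d hd] := hS _ _ k' (leq_maxr l l').
  by have [i hi] := pairK c d; exists (maxn l l').+1, i; rewrite /= hi hc hd.
(* The integer factor [c] undoes the scaling of an element of finite norm into the unit ball [A]. *)
pose e k := let: (c, k') := unpair k in let: (l, i) := unpair k' in c%:R *: h l i.
exists e; split=> [k|x xf r r0].
  rewrite /e; case: (unpair k) => c k'; case: (unpair k') => l i.
  by rewrite (ext_Z En) lte_mul_pinfty ?lee_fin// (le_lt_trans (hA l i))// ltry.
have [a a0 xa] := ext_fin En xf.
pose c := (Num.truncn a).+1.
have c0 : 0 < c%:R :> R by rewrite ltr0n.
have ac : a <= c%:R by rewrite ltW// truncnS_gt.
pose y := c%:R^-1 *: x.
have Ay : A y.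
  rewrite /A /= (ext_Z En) xa gtr0_norm ?invr_gt0// -EFinM lee_fin.
  by rewrite ler_pdivrMl// mulr1.
have /choice[z zP] (m : nat) : exists z, range e0 z /\ `|y - z| < m.+1%:R^-1.
  have [x' x's yx'] := (sP m).2 y Ay; exists x'; split=> //.
  have [k hk] := pairK m (index x' (s m)); exists k => //.
  by rewrite /e0 hk nth_index.
have zy : z @ \oo --> y.
  apply/cvgrPdist_lt => d d0; have [N hN] := natSinv_lt d0.
  by exists N => // k Nk; exact: lt_trans (zP k).2 (hN k Nk).
have zB k : (n (z k) <= 1%:E)%E by have [[i _ <-] _] := zP k; exact: e0A.
have rc0 : 0 < r / (2 * c%:R) by rewrite divr_gt0// mulr_gt0.
have [p pz pe] := ext_mazur zy zB rc0.
have [l [i hi]] : exists l k, h l k = p.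
  by apply: hull; apply: midhullS pz => _ [k _ <-]; have [] := zP k.
have [k' hk'] := pairK l i; have [k hk] := pairK c k'.
exists k; rewrite /e hk hk' hi.
have -> : x - c%:R *: p = - (c%:R *: (p - y)).
  rewrite scalerBr opprB; congr (_ - _).
  by rewrite /y scalerA mulfV ?gt_eqF// scale1r.
rewrite (ext_N En) (ext_Z En) gtr0_norm//.
have := lee_wpmul2l (_ : (0 <= c%:R%:E)%E) pe.
rewrite lee_fin ltW// => /(_ isT) /le_lt_trans; apply.
rewrite -EFinM lte_fin.
have -> : c%:R * (r / (2 * c%:R)) = r / 2 by field; rewrite gt_eqF.
by rewrite ltr_pdivrMr// ltr_pMr// ltr1n.
Qed.

End separability.

(** * Convergence in the topologies that define Z_q *)

Section generated_topologies.

(** The subbase consists of balls around all centres, so the test sets are the balls that contain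
    [x], not only those centred at [x]. *)
Lemma cvg_ball_topology {R : realType} {S : choiceType} {I : Type}
    (dist : I -> S -> S -> \bar R) (F : set_system (ball_topology dist))
    (x : ball_topology dist) : Filter F ->
  (forall i y (r : R), 0 < r -> (dist i y x < r%:E)%E ->
    F [set z | (dist i y z < r%:E)%E]) -> F --> x.
Proof.
move=> FF h A; rewrite nbhsE => -[_ [[B sB <-] [C BC Cx] sBA]].
rewrite nbhs_filterE; apply: filterS sBA _; apply: (@filterS _ _ _ C).
  by move=> ? ?; exists C.
have /sB [D sD IDeC] := BC; rewrite -IDeC; apply: filter_bigI => G DG.
have /sD := DG; rewrite inE => -[i [y [r [r0 GE]]]].
rewrite GE; apply: h => //.
by move: Cx; rewrite -IDeC => /(_ G DG); rewrite GE.
Qed.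

Lemma cvg_initial_topology {S : choiceType} {T : topologicalType} (f : S -> T)
    (F : set_system (initial_topology f)) (x : initial_topology f) : Filter F ->
  f @ F --> f x -> F --> x.
Proof.
move=> FF Ffx A; rewrite nbhsE => -[_ [[B oB <-] Bx] sBA].
by apply: filterS sBA _; apply: Ffx; exact: open_nbhs_nbhs.
Qed.

End generated_topologies.

Section skorokhod_topology.
Context {R : realType}.
Variables (T : R) (T0 : 0 < T).

Lemma time_change_comp (k l : R -> R) : time_change T k -> time_change T l ->
  time_change T (k \o l).
Proof.
move=> [k0 kT kh kc] [l0 lT lh lc].
have lI (t : R) : t \in `[0, T] -> l t \in `[0, T].
  move=> tI; have := tI; rewrite in_itv/= => /andP[t0 tT].
  have le (s s' : R) : s \in `[0, T] -> s' \in `[0, T] -> s <= s' -> l s <= l s'.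
    move=> sI s'I; rewrite le_eqVlt => /orP[/eqP ->//|ss']; exact/ltW/lh.
  by rewrite in_itv/= -[X in X <= _]l0 -[X in _ && (_ <= X)]lT !le// in_itv/= ?lexx ?ltW.
split.
- by rewrite /= l0.
- by rewrite /= lT.
- by move=> s t sI tI st; apply: kh; [exact: lI|exact: lI|exact: lh].
- apply/subspace_continuousP => t tI A /= kA.
  have /subspace_continuousP/(_ t tI) lt := lc.
  have /subspace_continuousP/(_ (l t) (lI t tI)) kt := kc.
  have := lt _ (kt _ kA); rewrite /= !nbhs_simpl/= /within/=.
  apply: filter_app; apply: filterS filterT => s _ h sI.
  by apply: h => //; exact: lI.
Qed.

Context {S : normedModType R}.
Implicit Types (x y : R -> S).

(** Times at which the norm exceeds every integer would accumulate at some [s], but the one-sided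
    limits bound the path near [s]. *)
Lemma cadlag_bounded x : cadlag x -> exists M : R, forall t : R, t \in `[0, T] -> `|x t| <= M.
Proof.
move=> cx; apply: contrapT => hM.
have /choice[t tP] (k : nat) : exists t : R, t \in `[0, T] /\ k%:R < `|x t|.
  apply: contrapT => h; apply: hM; exists k%:R => t tT; rewrite leNgt.
  by apply/negP => kt; apply: h; exists t.
have [G [UG ooG]] := @ultraFilterLemma nat \oo _.
have [|s _ ts] := @ultra_cvg _ _ G t `[0, T] UG (@segment_compact _ _ _).
  by apply: filterS filterT => k _ /=; exact: (tP k).1.
suff [M] : exists M : R, \forall r \near s, `|x r| <= M.
  move=> /ts GM; have {}GM : G [set k | `|x (t k)| <= M] := GM.
  have [k [kM Mk]] := filter_ex (filterI GM (ooG _ (nbhs_infty_ge (Num.truncn M).+1))).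
  move: kM; rewrite /= leNgt (lt_trans _ (tP k).2)// (lt_le_trans (truncnS_gt _))//.
  by rewrite ler_nat.
have [xr [l xl]] := cx s.
have : \forall r \near s^'+, `|x r| <= `|x s| + 1.
  have /cvgrPdist_le/(_ 1 ltr01) := xr; apply: filterS => r h.
  rewrite -lerBlDl (le_trans _ h)// distrC (le_trans _ (ler_dist_dist _ _))// ler_norm//.
have : \forall r \near s^'-, `|x r| <= `|l| + 1.
  have /cvgrPdist_le/(_ 1 ltr01) := xl; apply: filterS => r h.
  rewrite -lerBlDl (le_trans _ h)// distrC (le_trans _ (ler_dist_dist _ _))// ler_norm//.
move=> [d1 /= d10 h1] [d2 /= d20 h2].
exists (Num.max (`|x s| + 1) (`|l| + 1)).
exists (Num.min d1 d2); first by rewrite /= lt_min d10.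
move=> r /=; rewrite lt_min => /andP[r1 r2].
have [rs|sr|->] := ltgtP r s.
- by rewrite le_max (h1 r r1 rs) orbT.
- by rewrite le_max (h2 r r2 sr).
- by rewrite le_max lerDl ler01.
Qed.

(** Makes the set under the infimum in [skorokhod_dist] nonempty, so that its elements approach the
    infimum. *)
Lemma skorokhod_close_bounded x y : cadlag x -> cadlag y ->
  exists2 M : R, 0 <= M & skorokhod_close T M x y.
Proof.
move=> /cadlag_bounded[M hM] /cadlag_bounded[N hN].
have z0 : (0 : R) \in `[0, T] by rewrite in_itv/= lexx ltW.
exists (M + N).
  by rewrite addr_ge0// (le_trans _ (hM _ z0), le_trans _ (hN _ z0)).
exists id; split.
  by split=> //; apply: continuous_subspaceT => z; exact: cvg_id.
move=> t tT; rewrite subrr normr0 addr_ge0//; last 2 first.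
- by rewrite (le_trans _ (hM _ z0)).
- by rewrite (le_trans _ (hN _ z0)).
by split=> //; rewrite (le_trans (ler_normB _ _))// lerD ?hM ?hN.
Qed.

Lemma skorokhod_close_trans x y z (a b : R) : skorokhod_close T a x y ->
  skorokhod_close T b y z -> skorokhod_close T (a + b) x z.
Proof.
move=> [k [tk hk]] [l [tl hl]]; exists (l \o k); split; first exact: time_change_comp.
move=> t tT; have [h1 h2] := hk t tT.
have kT : k t \in `[0, T].
  have [k0 kT kh _] := tk.
  move: (tT); rewrite !in_itv/= => /andP[t0 tleT]; apply/andP; split.
    move: t0; rewrite le_eqVlt => /orP[/eqP <-|t0]; first by rewrite k0.
    by rewrite -k0 ltW// kh ?in_itv/= ?lexx// ltW.
  move: tleT; rewrite le_eqVlt => /orP[/eqP ->|tleT]; first by rewrite kT.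
  by rewrite -[leRHS]kT ltW// kh ?in_itv/= ?lexx ?andbT// ltW.
have [h3 h4] := hl _ kT; split.
  by rewrite (le_trans (ler_distD (k t) _ _))// addrC lerD.
by rewrite (le_trans (ler_distD (y (k t)) _ _))// lerD.
Qed.

(** A ball around [y] that contains [x] leaves a margin [r - a], half of which is granted to the
    distance from [x] to the path; composing the time changes adds up the two. *)
Lemma cvg_skorokhod (Z : Type) (F : set_system Z) (f : Z -> skorokhod T S) (x : skorokhod T S) :
  Filter F -> (forall e : R, 0 < e -> F [set z | skorokhod_close T e (set_val x) (set_val (f z))]) ->
  f @ F --> x.
Proof.
move=> FF h; apply: cvg_ball_topology => _ y r r0 yx.
have cf (w : skorokhod T S) : cadlag (set_val w) := (set_valP w).2.
have lbd (w w' : R -> S) : has_lbound [set r | 0 <= r /\ exists l, time_change T l /\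
    forall t, t \in `[0, T] -> `|l t - t| <= r /\ `|w t - w' (l t)| <= r].
  by exists 0 => a [].
have [||a [a0 ya] ar] := @inf_adherent _ [set r | 0 <= r /\ exists l, time_change T l /\
    forall t, t \in `[0, T] -> `|l t - t| <= r /\ `|set_val y t - set_val x (l t)| <= r]
    (r - skorokhod_dist T (set_val y) (set_val x)).
- by rewrite subr_gt0 -lte_fin.
- have [M M0 hM] := skorokhod_close_bounded (cf y) (cf x).
  by split; [exists M|exact: lbd].
move: ar; rewrite addrC subrK => ar.
have ra0 : 0 < (r - a) / 2 by rewrite divr_gt0// subr_gt0.
suff sub : [set z | skorokhod_close T ((r - a) / 2) (set_val x) (set_val (f z))] `<=`
    [set z | ((skorokhod_dist T (set_val y) (set_val (f z)))%:E < r%:E)%E].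
  exact: (filterS sub (h _ ra0)).
move=> z /= xz; rewrite lte_fin.
apply: (@le_lt_trans _ _ (a + (r - a) / 2)); last by move: ar; lra.
apply: ge_inf; first exact: lbd.
split; first by rewrite addr_ge0// ltW.
exact: skorokhod_close_trans ya xz.
Qed.

End skorokhod_topology.

(** * Strong measurability of paths of finite energy *)

Section strong_measurability.
Context {R : realType} {E : normedModType R} (T q : R) (n : E -> \bar R).
Hypotheses (T0 : 0 < T) (q1 : 1 < q) (Hn : ext_hilbert n).
Variables (e : nat -> E).
Hypotheses (ef : forall k, (n (e k) < +oo)%E)
  (ed : forall x, (n x < +oo)%E -> forall r : R, 0 < r ->
    exists k, (n (x - e k)%R < r%:E)%E).
Let En : ext_norm n := Hn.

Lemma finite_energy_ae u : finite_energy T q n u ->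
  {ae lebesgue_measure, forall t : R, t \in `[0, T] -> (n (u t) < +oo)%E}.
Proof.
move=> [eu cu fu].
have mu := measurable_energy T0 q1 Hn eu cu.
have : lebesgue_measure.-integrable `[0, T] (fun t => (n (u t) `^ q)%E).
  apply/integrableP; split; first exact: measurable_funTS.
  by under eq_integral do rewrite gee0_abs ?poweR_ge0//.
move=> /integrable_ae => /(_ (measurable_itv _)) [N [mN N0 hN]].
exists N; split=> // t /= ht; apply: hN => /= h; apply: ht => tT.
have := h tT; rewrite ge0_fin_numE ?poweR_ge0// => /lty_poweRy; apply.
by rewrite gt_eqF// (lt_trans _ q1).
Qed.

(** A point closest to [u t] for [n] among 0 and the first [k] members of the dense sequence, which
    is a simple function of [t]. Starting from 0 keeps the values in the domain of [n]. *)
Fixpoint nearest (u : R -> E) k (t : R) : E := if k isn't k'.+1 then 0 else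
  if (n (u t - e k')%R < n (u t - nearest u k' t)%R)%E then e k' else nearest u k' t.

Lemma nearest_simple u : is_extended T u -> cadlag u -> forall k,
  [/\ finite_set (range (nearest u k)),
      forall y, measurable (nearest u k @^-1` [set y]),
      forall t, (n (nearest u k t) < +oo)%E &
      measurable_fun setT (fun t => n (u t - nearest u k t)%R)].
Proof.
move=> eu cu.
have mB (x : E) : measurable_fun setT (fun t => n (u t - x)%R).
  apply: (@measurable_fun_path _ _ n (u \- cst x) T (ext_closed Hn) (ltW T0)).
    by apply/funext => t; rewrite -[in RHS]eu.
  move=> t; have [ur [l ul]] := cu t; split; first by apply: cvgB => //; exact: cvg_cst.
  by exists (l - x); apply: cvgB => //; exact: cvg_cst.
elim=> [|k [fk mk nk mfk]]; split=> //=.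
- apply: (@sub_finite_set _ _ [set 0]); last exact: finite_set1.
  by move=> _ [t _ <-].
- move=> y; have [->|y0] := eqVneq y 0.
    by rewrite (_ : _ @^-1` _ = setT)//; apply/seteqP; split.
  rewrite (_ : _ @^-1` _ = set0)//; apply/seteqP; split=> // t /= yE.
  by move: y0; rewrite -yE eqxx.
- by move=> t; rewrite (ext_0 En).
- apply: (@sub_finite_set _ _ (range (nearest u k) `|` [set e k])).
    by move=> _ [t _ <-]; case: ifP => _; [right|left; exists t].
  by rewrite finite_setU; split.
- move=> y; set A := [set t | (n (u t - e k)%R < n (u t - nearest u k t)%R)%E].
  have mA : measurable A.
    by rewrite -[A]setTI; exact: measurable_lte.
  rewrite (_ : _ @^-1` _ = (A `&` [set t | e k = y]) `|` (~` A `&` (nearest u k @^-1` [set y]))).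
    apply: measurableU; apply: measurableI => //; last exact: measurableC.
    have [->|ey] := eqVneq (e k) y.
      by rewrite (_ : [set _ | _] = setT)//; apply/seteqP; split.
    rewrite (_ : [set _ | _] = set0)//; apply/seteqP; split=> // t /= yE.
    by move: ey; rewrite yE eqxx.
  apply/seteqP; split => t /=; case: ifPn => h.
  - by move=> ->; left.
  - by move=> hy; right; split=> //; apply/negP.
  - by move=> [[]|[]].
  - by move=> [[]|[]] //; rewrite /A /= (negbTE h).
- by move=> t; case: ifP.
- rewrite (_ : (fun t => _) = (fun t => mine (n (u t - e k)%R) (n (u t - nearest u k t)%R))).
    exact: measurable_mine.
  by apply/funext => t; rewrite /mine; case: ifP.
Qed.

Lemma nearest_cvg u t : (n (u t) < +oo)%E -> (n (u t - nearest u k t)%R @[k --> \oo] --> 0)%E.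
Proof.
move=> ut.
have le k l : (k < l)%N -> (n (u t - nearest u l t)%R <= n (u t - e k)%R)%E.
  elim: l => // l IH; rewrite ltnS leq_eqVlt => /orP[/eqP ->|/IH h] /=.
    by case: ifPn => //; rewrite -leNgt.
  by case: ifPn => // /ltW /le_trans; apply.
apply/fine_cvgP; split.
  have [k hk] := ed ut ltr01; exists k.+1 => // l /= kl.
  rewrite ge0_fin_numE ?(ext_ge0 En)//.
  by rewrite (le_lt_trans (le _ _ kl))// (lt_trans hk)// ltry.
apply/cvgr0Pnorm_le => r r0; have [k hk] := ed ut r0.
exists k.+1 => // l /= kl.
have := le_lt_trans (le _ _ kl) hk => h.
have [a a0 aE] := ext_fin En (lt_trans h (ltry _)).
by move: h; rewrite aE /= lte_fin ger0_norm// => /ltW.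
Qed.

End strong_measurability.

(** * Estimates near a Skorokhod limit *)

Section path_estimates.
Context {R : realType} {E : normedModType R} (T q : R) (nH nV nR : E -> \bar R).
Hypotheses (T0 : 0 < T) (q1 : 1 < q) (Hn : ext_hilbert nV) (Rn : ext_norm nR).
Hypothesis HC : forall C : R, compact [set x | (nH x <= C%:E)%E].
Hypothesis ehrling : forall e : R, 0 < e -> exists2 C : R, 0 <= C &
  forall x, (nR x <= e%:E * nV x + (C * `|x|)%:E)%E.
Let En : ext_norm nV := Hn.
Let q0 : 0 < q. Proof. exact: lt_trans q1. Qed.

(** The cut points of [v] for all the oscillations [1 / (m + 1)] form a countable set. At any other
    time, the closeness ends up below the distance to the finitely many cut points of a given
    level. *)
Lemma ae_cvg_skorokhod (v : R -> E) (u : nat -> R -> E) :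
  (forall e : R, 0 < e -> exists2 dlt, 0 < dlt & regular_on T dlt e v) ->
  (forall k, skorokhod_close T k.+1%:R^-1 v (u k)) ->
  {ae lebesgue_measure, forall t : R, t \in `[0, T] -> u ^~ t @ \oo --> v t}.
Proof.
move=> rv uv.
have /choice[f fP] (m : nat) : exists Nt : nat * (nat -> R), exists2 dlt, 0 < dlt &
    cut_points T dlt Nt.1 Nt.2 /\
    forall i s s', (i < Nt.1)%N -> Nt.2 i <= s < Nt.2 i.+1 -> Nt.2 i <= s' < Nt.2 i.+1 ->
    `|v s - v s'| <= m.+1%:R^-1.
  have [dlt d0 [N [t h]]] := rv m.+1%:R^-1 ltac:(by rewrite invr_gt0).
  by exists (N, t), dlt.
pose S := \bigcup_m \bigcup_i [set (f m).2 i].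
have cS : countable S.
  by do 2 apply: bigcup_countable => // *; exact: finite_set_countable.
exists S; split.
- exact: countable_measurable.
- exact: countable_lebesgue_measure0.
move=> t /= ht; apply: contrapT => St; apply: ht => tT.
apply/cvgrPdist_le => e e0.
have [m hm] := natSinv_lt (divr_gt0 e0 (ltr0n R 2)).
have [dlt d0 [ct cv]] := fP m.
have [r r0 hr] : exists2 r : R, 0 < r & forall i, (i <= (f m).1)%N -> r < `|t - (f m).2 i|.
  elim: (f m).1 => [|N [r r0 IH]].
    have h : 0 < `|t - (f m).2 0%N| by rewrite normr_gt0 subr_eq0; apply/eqP => tE; apply: St; exists m => //; exists 0%N.
    exists (`|t - (f m).2 0%N| / 2); first by rewrite divr_gt0.
    by move=> i; rewrite leqn0 => /eqP ->; rewrite ltr_pdivrMr// ltr_pMr// ltr1n.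
  have h : 0 < `|t - (f m).2 N.+1| by rewrite normr_gt0 subr_eq0; apply/eqP => tE; apply: St; exists m => //; exists N.+1.
  exists (Num.min r (`|t - (f m).2 N.+1| / 2)); first by rewrite lt_min r0 divr_gt0.
  move=> i; rewrite leq_eqVlt => /orP[/eqP ->|/IH h2].
    by rewrite gt_min ltr_pdivrMr// ltr_pMr// ltr1n orbT.
  by rewrite gt_min h2.
have re0 : 0 < Num.min r (e / 2) by rewrite lt_min r0 divr_gt0.
have [k hk] := natSinv_lt re0.
exists k => // l /= kl.
have := hk l kl; rewrite lt_min => /andP[lr le].
rewrite distrC.
have := @skorokhod_close_off_cuts _ _ _ _ _ _ _ _ _ _ _ T0 ct cv (uv l) tT.
move=> /(_ (fun i iN => lt_trans lr (hr i iN))).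
have := hm m (leqnn _); set a := m.+1%:R^-1; set b := l.+1%:R^-1 in le *.
by move: le; lra.
Qed.

Lemma small_powR (K a : R) : 0 < a -> exists2 b : R, 0 < b &
  forall c, 0 <= c -> c <= b -> K * c `^ q <= a.
Proof.
move=> a0; exists ((a / (`|K| + 1)) `^ q^-1).
  by rewrite powR_gt0// divr_gt0// ltr_wpDl.
move=> c c0 cb; have cq : c `^ q <= a / (`|K| + 1).
  have x0 : 0 <= a / (`|K| + 1) by rewrite divr_ge0 ?addr_ge0// ltW.
  move: cb; set x := a / _ in x0 * => cb.
  rewrite -(powRr1 x0) -(@mulVf _ q) ?gt_eqF// powRrM.
  by apply: ge0_ler_powR; rewrite ?nnegrE ?(ltW q0) ?powR_ge0.
apply: (@le_trans _ _ (`|K| * c `^ q)); first by rewrite ler_wpM2r ?powR_ge0// ler_norm.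
apply: (@le_trans _ _ (`|K| * (a / (`|K| + 1)))); first by rewrite ler_wpM2l.
by rewrite mulrCA ler_piMr ?ltW// ltr_pdivrMr ?mul1r ?ltrDl ?ltr01// ltr_wpDl.
Qed.

Lemma bounded_on_ball (C : R) : exists2 M : R, 0 <= M &
  forall x, (nH x <= C%:E)%E -> `|x| <= M.
Proof.
have [M [_ hM]] := compact_bounded (@HC C).
exists (`|M| + 1); first by rewrite addr_ge0.
move=> x xC; apply: (hM (`|M| + 1)) xC.
by rewrite (le_lt_trans (ler_norm _))// ltrDl.
Qed.

Lemma energy_sub_le (u v : R -> E) (C : R) : is_extended T u -> cadlag u ->
  is_extended T v -> cadlag v -> (energy T q nV u <= C%:E)%E ->
  (energy T q nV v <= C%:E)%E ->
  (energy T q nV (v \- u)%R <= (2 `^ q * (2 * C))%:E)%E.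
Proof.
move=> eu cu ev cv uC vC.
have -> : v \- u = (-1) \*: u \+ v.
  by apply/funext => t /=; rewrite scaleN1r addrC.
rewrite (le_trans (energy_lin_le T0 q1 Hn _ eu cu ev cv))//.
rewrite EFinM lee_wpmul2l ?lee_fin ?powR_ge0// normrN normr1 powR1 mul1e.
by rewrite mulrDl mul1r EFinD leeD.
Qed.

(* Away from the cut points of [v] a path Skorokhod-close to [v] is uniformly close;
   near them both are bounded, on a set of small measure. *)
Lemma local_energy_small (v : R -> E) (C1 C2 : R) : is_extended T v -> cadlag v ->
  (forall t, (nH (v t) <= C1%:E)%E) -> (energy T q nV v <= C2%:E)%E ->
  (forall e : R, 0 < e -> exists2 dlt, 0 < dlt & regular_on T dlt e v) ->
  forall a : R, 0 < a -> exists2 e : R, 0 < e & forall u, is_extended T u -> cadlag u ->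
  (forall t, (nH (u t) <= C1%:E)%E) -> (energy T q nV u <= C2%:E)%E ->
  skorokhod_close T e v u ->
  exists G : R -> \bar R, [/\ measurable_fun setT G, forall t, (0 <= G t)%E,
    forall t : R, t \in `[0, T] -> (nR (v t - u t)%R `^ q <= G t)%E &
    (\int[lebesgue_measure]_(t in `[0%R, T]) G t <= a%:E)%E].
Proof.
move=> ev cv vC1 vC2 rv a a0.
have a30 : 0 < a / 3 by rewrite divr_gt0.
have [M M0 hM] := bounded_on_ball C1.
(* Ehrling's inequality gives an energy term, made small by [ep], and a term in the norm of [U'].
   The latter is made small by [b] away from the cut points, and by [e], the width of the
   exceptional intervals, near them. Each of the three gets [a / 3]. *)
have [ep ep0 hep] := small_powR (2 `^ q * (2 `^ q * (2 * C2))) a30.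
have [C C0 hC] := ehrling ep0.
have [b b0 hb] := small_powR (2 `^ q * C `^ q * T) a30.
have [dlt d0 [N [t [ct hv]]]] := rv (b / 2) ltac:(by rewrite divr_gt0).
pose A3 := 2 `^ q * C `^ q * (2 * M) `^ q.
have A30 : 0 <= A3 by rewrite !mulr_ge0 ?powR_ge0.
(* The second bound makes [N + 1] intervals of length [2 e], with weight [A3], contribute at most
   [a / 3]. *)
pose e := Num.min (b / 2) (a / 3 / (2 * N.+1%:R * (A3 + 1))).
have e0 : 0 < e by rewrite lt_min divr_gt0//= divr_gt0// !mulr_gt0// ltr_wpDl.
exists e => // u eu cu uC1 uC2 vu.
pose I (i : 'I_N.+1) : set R := `[t i - e, t i + e]%classic.
pose bad (s : R) : R := \sum_(i < N.+1) \1_(I i) s.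
pose A1 := 2 `^ q * ep `^ q.
pose A2 := 2 `^ q * C `^ q * b `^ q.
have A10 : 0 <= A1 by rewrite mulr_ge0 ?powR_ge0.
have A20 : 0 <= A2 by rewrite !mulr_ge0 ?powR_ge0.
(* A majorant made of [nV] along a cadlag path and of indicators, so that it is measurable. *)
pose G s : \bar R := (A1%:E * nV (v s - u s)%R `^ q + (A2%:E + (A3 * bad s)%:E))%E.
have ed : is_extended T (v \- u).
  by apply/funext => s; rewrite -[in RHS]ev -[in RHS]eu.
have cd : cadlag (v \- u).
  have -> : v \- u = (-1) \*: u \+ v.
    by apply/funext => s /=; rewrite scaleN1r addrC.
  exact: cadlag_lin.
have md := measurable_energy T0 q1 Hn ed cd.
have bad0 s : 0 <= bad s by apply: sumr_ge0 => i _; rewrite indicE.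
have hB s : 0 <= A3 * bad s by rewrite mulr_ge0.
have hA s : (0 <= A2%:E + (A3 * bad s)%:E)%E by rewrite adde_ge0 ?lee_fin.
have mI i : measurable (I i) by exact: measurable_itv.
have mbad : measurable_fun setT bad.
  by apply: measurable_sum => i; exact: measurable_indic.
have mb : measurable_fun setT (fun s => (A3 * bad s)%:E).
  by apply/measurable_EFinP; apply: measurable_funM => //; exact: measurable_cst.
have mG : measurable_fun setT G.
  apply: emeasurable_funD; first exact: measurable_funeM.
  by apply: emeasurable_funD => //; exact: measurable_cst.
exists G; split=> //.
- move=> s; apply: adde_ge0; first by rewrite mule_ge0 ?poweR_ge0 ?lee_fin.
  exact: hA.
- move=> s sT.
  have ns : `|v s - u s| `^ q <= b `^ q + (2 * M) `^ q * bad s.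
    have [hs|[i hi]] : (forall i, (i <= N)%N -> e < `|s - t i|) \/
        exists i : 'I_N.+1, `|s - t i| <= e.
      have [h|h] := pselect (exists i : 'I_N.+1, `|s - t i| <= e); first by right.
      left=> i iN; rewrite ltNge; apply/negP => hi; apply: h.
      by exists (Ordinal (iN : (i < N.+1)%N)).
    - have h := skorokhod_close_off_cuts T0 ct hv vu sT hs.
      rewrite (@le_trans _ _ (b `^ q))//; last by rewrite lerDl mulr_ge0 ?powR_ge0.
      apply: ge0_ler_powR; rewrite ?nnegrE ?(ltW q0) ?(ltW b0)//.
      rewrite distrC (le_trans h)//.
      have : e <= b / 2 by rewrite ge_min lexx.
      by lra.
    - rewrite (@le_trans _ _ ((2 * M) `^ q * bad s))//; last by rewrite lerDr powR_ge0.
      have b1 : 1 <= bad s.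
        have Ii : I i s by rewrite /I /= in_itv/= -ler_distl.
        rewrite /bad (bigD1 i)//= indicE mem_set// lerDl.
        by apply: sumr_ge0 => k _; rewrite indicE.
      rewrite (@le_trans _ _ ((2 * M) `^ q))//; last by rewrite ler_peMr ?powR_ge0.
      apply: ge0_ler_powR; rewrite ?nnegrE ?(ltW q0) ?mulr_ge0//.
      by rewrite (le_trans (ler_normB _ _))// mulr2n mulrDl mul1r lerD// hM.
  have h := poweR_le2 q1 (ext_ge0 Rn _) (hC (v s - u s)).
  rewrite (le_trans h)//.
  have p1 : (0 <= ep%:E * nV (v s - u s)%R)%E.
    by rewrite mule_ge0 ?(ext_ge0 En)// lee_fin ltW.
  have p2 : (0 <= (C * `|v s - u s|)%:E)%E by rewrite lee_fin mulr_ge0.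
  rewrite (le_trans (poweR_add_le q1 p1 p2))//.
  rewrite /G ge0_muleDr ?poweR_ge0//.
  rewrite poweRM ?(ext_ge0 En) ?lee_fin ?(ltW ep0)// !poweR_EFin muleA -EFinM.
  apply: leeD => //; rewrite powRM// -!EFinM -EFinD lee_fin.
  rewrite mulrA (le_trans (ler_wpM2l _ ns)) ?mulr_ge0 ?powR_ge0//.
  by rewrite mulrDr lerD2l /A3 mulrA.
- rewrite /G ge0_integralD//=; last 3 first.
  + by move=> s _; rewrite mule_ge0 ?poweR_ge0// lee_fin.
  + by apply: measurable_funeM; exact: measurable_funTS.
  + by apply: measurable_funTS; apply: emeasurable_funD => //; exact: measurable_cst.
  rewrite ge0_integralZl_EFin//; last 2 first.
  + by move=> s _; exact: poweR_ge0.
  + exact: measurable_funTS.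
  have h1 : (A1%:E * energy T q nV (v \- u)%R <= (a / 3)%:E)%E.
    rewrite (le_trans (lee_wpmul2l _ (energy_sub_le eu cu ev cv uC2 vC2))) ?lee_fin//.
    rewrite (le_trans _ (hep _ (ltW ep0) (lexx _)))// le_eqVlt; apply/orP; left.
    by apply/eqP; rewrite /A1; ring.
  have mT : lebesgue_measure (`[0, T]%classic : set R) = T%:E.
    by rewrite lebesgue_measure_itv /= lte_fin T0 sube0.
  have h2 : (\int[lebesgue_measure]_(s in `[0%R, T]) A2%:E <= (a / 3)%:E)%E.
    rewrite integral_cst//= mT -EFinM lee_fin.
    rewrite (le_trans _ (hb _ (ltW b0) (lexx _)))// le_eqVlt; apply/orP; left.
    by apply/eqP; rewrite /A2; ring.
  have h3 : (\int[lebesgue_measure]_(s in `[0%R, T]) (A3 * bad s)%:E <= (a / 3)%:E)%E.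
    rewrite (_ : (fun s => _) = fun s => (A3%:E * (bad s)%:E)%E); last by apply/funext => s; rewrite EFinM.
    rewrite ge0_integralZl_EFin//; last 2 first.
      by move=> s _; rewrite lee_fin.
      by apply: measurable_funTS; apply/measurable_EFinP.
    rewrite (_ : (fun s => _) = fun s => (\sum_(i < N.+1) (\1_(I i) s)%:E)%E); last first.
      by apply/funext => s; rewrite /bad -sumEFin.
    rewrite ge0_integral_sum//; last first.
      move=> i; apply: measurable_funTS.
      by apply: (measurable_EFinP setT (\1_(I i) : R -> R)).2; exact: measurable_indic.
    have h i : (\int[lebesgue_measure]_(s in `[0%R, T]) (\1_(I i) s)%:E <= (2 * e)%:E)%E.
      rewrite integral_indic; [|exact: measurable_itv|exact: mI].
      apply: (@le_trans _ _ (lebesgue_measure (I i))).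
        by apply: measureIl; [exact: mI|exact: measurable_itv].
      rewrite /I lebesgue_measure_itv /= lte_fin; case: ifP => _.
        by rewrite -EFinB lee_fin; lra.
      by rewrite lee_fin; move: e0; lra.
    apply: (@le_trans _ _ (A3%:E * (\sum_(i < N.+1) (2 * e)%:E))%E).
      by rewrite lee_wpmul2l ?lee_fin//; apply: lee_sum => i _; exact: h.
    rewrite sumEFin sumr_const card_ord -EFinM lee_fin -mulr_natl.
    have : e <= a / 3 / (2 * N.+1%:R * (A3 + 1)) by rewrite ge_min lexx orbT.
    rewrite ler_pdivlMr ?mulr_gt0// ?ltr_wpDl// => he.
    rewrite (le_trans _ he)//.
    have : 0 <= N.+1%:R * (2 * e) by rewrite !mulr_ge0// ltW.
    by set x := N.+1%:R; nra.
  rewrite ge0_integralD//=; last 2 first.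
  + by move=> s _; rewrite lee_fin.
  + exact: measurable_funTS.
  rewrite (le_trans (leeD h1 (leeD h2 h3)))// -!EFinD lee_fin.
  by lra.
Qed.

End path_estimates.

(** * Perturbation of L^q norms *)

Section integral_perturbation.
Context {d} {T : measurableType d} {R : realType}.
Variables (mu : {measure set T -> \bar R}) (D : set T) (mD : measurable D).
Import HBNNSimple.
Local Open Scope ereal_scope.

(** A simple function [h] below [F + G] is at most [k + G], where [k], the positive part of [h - G],
    is measurable and below [F]. So [F] is only compared with measurable functions. *)
Lemma ge0_integral_subadditive (F G : T -> \bar R) :
  (forall x, 0 <= F x) -> (forall x, 0 <= G x) -> measurable_fun D G ->
  \int[mu]_(x in D) (F x + G x) <= \int[mu]_(x in D) F x + \int[mu]_(x in D) G x.
Proof.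
move=> F0 G0 mG.
rewrite ge0_integralE; last by move=> x _; exact: adde_ge0.
apply: ge_ereal_sup => _ [h /= hFG <-].
rewrite -integralT_nnsfun.
pose g := G \_ D; pose k x := maxe ((h x)%:E - g x) 0.
have g0 x : 0 <= g x by apply: erestrict_ge0.
have mg : measurable_fun setT g by exact/(measurable_restrictT _ mD).1.
have mk : measurable_fun setT k.
  apply: measurable_maxe; last exact: measurable_cst.
  by apply: emeasurable_funB => //; apply/measurable_EFinP.
have k0 x : 0 <= k x by rewrite /k le_max lexx orbT.
have gF x : g x = +oo -> True by [].
have kF x : k x <= (F \_ D) x.
  rewrite /k ge_max erestrict_ge0// andbT.
  have := hFG x; rewrite /g /patch; case: ifPn => // _.
    by case: (G x) (G0 x) => [c|_|//]; [move=> _ h1; rewrite leeBlDr|rewrite /= leNye].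
  by rewrite sube0.
have hk x : (h x)%:E <= k x + g x.
  rewrite /k; case: (g x) (g0 x) => [c c0| _|//]; last by rewrite addey ?leey// -ltNye (lt_le_trans (ltNyr 0))// le_max lexx orbT.
  by rewrite -leeBlDr// le_max lexx.
apply: (@le_trans _ _ (\int[mu]_x (k x + g x))).
  by apply: le_nonneg_integral => x _; [rewrite lee_fin|exact: hk].
rewrite ge0_integralD//; apply: leeD.
  by rewrite [leRHS]integral_mkcond; apply: le_nonneg_integral => x _ //; exact: kF.
by rewrite [leRHS]integral_mkcond.
Qed.

Lemma integralZ_le (F : T -> \bar R) (e : R) : (forall x, 0 <= F x) -> (0 < e)%R ->
  \int[mu]_(x in D) (e%:E * F x) <= e%:E * \int[mu]_(x in D) F x.
Proof.
move=> F0 e0; rewrite ge0_integralE; last by move=> x _; rewrite mule_ge0// lee_fin ltW.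
apply: ge_ereal_sup => _ [h /= hF <-].
rewrite -integralT_nnsfun -lee_pdivrMl// -ge0_integralZl_EFin//; last 3 first.
  by move=> x _; rewrite lee_fin.
  by apply/measurable_EFinP.
  by rewrite invr_ge0 ltW.
rewrite [leRHS]integral_mkcond; apply: le_nonneg_integral => x _.
  by rewrite -EFinM lee_fin mulr_ge0// invr_ge0 ltW.
rewrite lee_pdivrMl//; apply: le_trans (hF x) _.
by rewrite /patch; case: ifPn => // _; rewrite mule0.
Qed.

(** In each of the cases [y < s x] and [s x <= y], one of the two terms suffices. For small [s] the
    factor of the power of [x] is close to 1, which lets [y] be treated as a perturbation. *)
Lemma poweR_add_split (q s : R) (x y : \bar R) : (0 < q)%R -> (0 < s)%R -> 0 <= x -> 0 <= y ->
  (x + y) `^ q <= ((1 + s) `^ q)%:E * x `^ q + ((1 + s^-1) `^ q)%:E * y `^ q.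
Proof.
move=> q0 s0 x0 y0.
have le2 (a b : \bar R) : 0 <= a -> a <= b -> a `^ q <= b `^ q.
  move=> a0 ab; apply: (gt0_ler_poweR (ltW q0)) => //.
    by rewrite in_itv/= a0 leey.
  by rewrite in_itv/= (le_trans a0 ab) leey.
have [h|/ltW h] := leP y (s%:E * x).
  apply: (@le_trans _ _ (((1 + s) `^ q)%:E * x `^ q)); last first.
    by rewrite leeDl// mule_ge0 ?poweR_ge0// lee_fin powR_ge0.
  rewrite -poweR_EFin -poweRM ?lee_fin// ?addr_ge0 ?(ltW s0)//.
  apply: le2; first exact: adde_ge0.
  by rewrite EFinD ge0_muleDl ?lee_fin ?(ltW s0)// mul1e leeD2l.
apply: (@le_trans _ _ (((1 + s^-1) `^ q)%:E * y `^ q)); last first.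
  by rewrite leeDr// mule_ge0 ?poweR_ge0// lee_fin powR_ge0.
have si : (0 <= s^-1)%R by rewrite invr_ge0 ltW.
rewrite -poweR_EFin -poweRM ?lee_fin// ?addr_ge0//.
apply: le2; first exact: adde_ge0.
rewrite EFinD ge0_muleDl ?lee_fin// mul1e addeC leeD2l//.
have := lee_wpmul2l (_ : 0 <= (s^-1)%:E) h.
by rewrite lee_fin => /(_ si); rewrite muleA -EFinM mulVf ?gt_eqF// mul1e.
Qed.

(* Only the perturbation [G] needs to be measurable. *)
Lemma Lq_perturbation (q r : R) (F : T -> \bar R) : (0 < q)%R -> (0 < r)%R ->
  (forall x, 0 <= F x) -> (\int[mu]_(x in D) F x `^ q) `^ q^-1 < r%:E ->
  exists2 a : R, (0 < a)%R & forall H g G : T -> \bar R, measurable_fun D G ->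
    (forall x, 0 <= H x) -> (forall x, 0 <= g x) -> (forall x, 0 <= G x) ->
    (forall x, D x -> H x <= F x + g x) -> (forall x, D x -> g x `^ q <= G x) ->
    \int[mu]_(x in D) G x <= a%:E ->
    (\int[mu]_(x in D) H x `^ q) `^ q^-1 < r%:E.
Proof.
move=> q0 r0 F0 Fr.
have qi0 : (0 < q^-1)%R by rewrite invr_gt0.
have I0 : 0 <= \int[mu]_(x in D) F x `^ q by apply: integral_ge0 => x _; exact: poweR_ge0.
have [c c0 IE] : exists2 c : R, (0 <= c)%R & \int[mu]_(x in D) F x `^ q = (c `^ q)%:E.
  have : \int[mu]_(x in D) F x `^ q < +oo.
    by apply: (@lty_poweRy _ _ q^-1); [rewrite gt_eqF|exact: lt_trans Fr (ltry _)].
  case: (integral mu D _) I0 => [b|//|//]; rewrite lee_fin => b0 _.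
  by exists (b `^ q^-1)%R; [exact: powR_ge0|rewrite -powRrM mulVf ?gt_eqF// powRr1].
rewrite IE poweR_EFin -powRrM mulfV ?gt_eqF// powRr1// lte_fin in Fr.
(* [c] is the norm of [F]; this [s] keeps [(1 + s) c] below [r], and the remaining room is left to
   [G]. *)
pose s := ((r - c) / (2 * (c + 1)))%R.
have c1 : (0 < c + 1)%R by rewrite ltr_wpDl.
have s0 : (0 < s)%R by rewrite divr_gt0 ?subr_gt0// mulr_gt0.
have sc : ((1 + s) * c < r)%R.
  have : (s * c <= (r - c) / 2)%R.
    rewrite /s invfM mulrA -mulrA ler_piMr ?divr_ge0 ?subr_ge0 ?(ltW Fr)//.
    by rewrite mulrC ler_pdivrMr// mul1r lerDl.
  by move: Fr; lra.
pose b := ((1 + s) * c)%R.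
have b0 : (0 <= b)%R by rewrite mulr_ge0// addr_ge0// ltW.
have bq : (b `^ q < r `^ q)%R by apply: gt0_ltr_powR; rewrite ?nnegrE ?(ltW r0).
pose K := ((1 + s^-1) `^ q)%R.
have K0 : (0 < K)%R by rewrite powR_gt0// addr_gt0// invr_gt0.
exists ((r `^ q - b `^ q) / 2 / K)%R; first by rewrite !divr_gt0// subr_gt0.
move=> H g G mG H0 g0 G0 HFg gG IG.
have HI : \int[mu]_(x in D) H x `^ q <= (b `^ q)%:E + ((r `^ q - b `^ q) / 2)%:E.
  apply: (@le_trans _ _ (\int[mu]_(x in D) (((1 + s) `^ q)%:E * F x `^ q + K%:E * G x))).
    apply: le_nonneg_integral => x Dx; first exact: poweR_ge0.
    apply: (@le_trans _ _ ((F x + g x) `^ q)).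
      apply: (gt0_ler_poweR (ltW q0)); rewrite ?in_itv/= ?leey ?H0 ?adde_ge0//.
      exact: HFg.
    rewrite (le_trans (poweR_add_split q0 s0 (F0 x) (g0 x)))// leeD2l//.
    by rewrite lee_wpmul2l ?lee_fin ?(ltW K0)// gG.
  apply: le_trans (ge0_integral_subadditive _ _ _) _.
  - by move=> x; rewrite mule_ge0 ?poweR_ge0// lee_fin powR_ge0.
  - by move=> x; rewrite mule_ge0// lee_fin ltW.
  - exact: measurable_funeM.
  apply: leeD; last first.
    rewrite ge0_integralZl_EFin ?(ltW K0)//.
    rewrite (le_trans (lee_wpmul2l _ IG)) ?lee_fin ?(ltW K0)//.
    by rewrite mulrCA mulfV ?mulr1 ?gt_eqF.
  pose e := ((1 + s) `^ q)%R.
  have e0 : (0 < e)%R by rewrite powR_gt0// addr_gt0.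
  have := integralZ_le (fun x => poweR_ge0 (F x) q) e0.
  move=> /le_trans; apply; rewrite IE -EFinM lee_fin /b powRM// ?addr_ge0// ltW//.
have [y y0 yE] : exists2 y : R, (0 <= y)%R & \int[mu]_(x in D) H x `^ q = y%:E.
  have H1 : 0 <= \int[mu]_(x in D) H x `^ q by apply: integral_ge0 => x _; exact: poweR_ge0.
  move: HI H1; case: (integral mu D _) => [y|//|//]; rewrite lee_fin => _ y0.
  by exists y.
rewrite yE -EFinD lee_fin in HI.
rewrite yE poweR_EFin lte_fin -[ltRHS]powRr1 ?(ltW r0)// -(@mulfV _ q) ?gt_eqF// powRrM.
by apply: gt0_ltr_powR; rewrite ?nnegrE ?powR_ge0//; move: HI bq; lra.
Qed.

End integral_perturbation.

Section dual_evaluation.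
Context {R : realType} {U : normedModType R}.

Lemma dual_scale (x : dual U) (a : R) w : x (a *: w) = a * x w.
Proof.
have [lx _] := dual_bounded_linear x.
have x0 : x 0 = 0 by have := lx (- 1) 0 0; rewrite scaler0 addr0 scaleN1r addNr.
by have := lx a w 0; rewrite !addr0 x0 addr0.
Qed.

Lemma dual_ball_le (x : dual U) u : `|u| <= 1 -> `|x u| <= `|x|.
Proof.
move=> u1; apply: ub_le_sup; last by exists u.
have [_ [M Mx]] := dual_bounded_linear x.
exists (Num.max M 0) => _ [w /= w1 <-]; rewrite (le_trans (Mx w))//.
rewrite (@le_trans _ _ (Num.max M 0 * `|w|))//.
  by rewrite ler_wpM2r// le_max lexx.
by rewrite ler_piMr// le_max lexx orbT.
Qed.

Lemma dual_norm_leP (x : dual U) (M : R) :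
  (forall u, `|u| <= 1 -> `|x u| <= M) -> `|x| <= M.
Proof.
move=> xM; apply: ge_sup; last by move=> _ [u /= u1 <-]; exact: xM.
by exists `|x 0|; exists 0 => //=; rewrite normr0.
Qed.

Lemma dual_apply_le (x : dual U) w : `|x w| <= `|x| * `|w|.
Proof.
have [->|w0] := eqVneq w 0.
  by rewrite -[X in x X](scale0r (0 : U)) dual_scale mul0r !normr0 mulr0.
have wn : 0 < `|w| by rewrite normr_gt0.
have := @dual_ball_le x (`|w|^-1 *: w).
rewrite normrZ normfV normr_id mulVf ?gt_eqF// => /(_ (lexx _)).
by rewrite dual_scale normrM normfV normr_id mulrC ler_pdivrMr.
Qed.

End dual_evaluation.

(** * Paths in Z_q and compactness *)

Section path_space.
Context {R : realType} {d : nat} {U : normedModType R}.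
Variables (O : set 'rV[R]_d) (j : U -> 'rV[R]_d -> 'rV[R]_d).
Variables (OR : nat -> set 'rV[R]_d) (T q : R).
Hypotheses (T0 : 0 < T) (q1 : 1 < q).
Local Notation nH := (normH O j O).
Local Notation nV := (normV O j).
Local Notation nR r := (normH O j (OR r)).
Hypotheses (hV : ext_hilbert nV) (hH : ext_norm nH) (hR : forall r, ext_norm (nR r)).
Hypotheses (HV : forall x, (nH x <= nV x)%E) (RH : forall r x, (nR r x <= nH x)%E).
Hypothesis inHP : forall x, (nH x < +oo)%E <-> inH O j x.
Hypothesis HC : forall C : R, compact [set x | (nH x <= C%:E)%E].
Hypothesis ehrling : forall r (e : R), 0 < e -> exists2 C : R, 0 <= C &
  forall x, (nR r x <= e%:E * nV x + (C * `|x|)%:E)%E.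
Hypothesis inner_approx : forall h, inH O j h -> forall e : R, 0 < e ->
  exists w : U, forall x, inH O j x -> `|innerH O j x h - x w| <= e * fine (nH x).
Let q0 : 0 < q. Proof. by rewrite (lt_trans _ q1). Qed.

Lemma HC_closed (C : R) : closed [set x | (nH x <= C%:E)%E].
Proof. apply: compact_closed; [exact: norm_hausdorff|exact: HC]. Qed.

(** On a ball of H, the inner product with [h] is uniformly approximated by the evaluation at some
    [w] in [U], which is Lipschitz for the norm of [U']. *)
Lemma inner_uniform h (C : R) : inH O j h -> forall e : R, 0 < e -> exists2 b : R, 0 < b &
  forall x y, (nH x <= C%:E)%E -> (nH y <= C%:E)%E -> `|x - y| <= b ->
  `|innerH O j x h - innerH O j y h| <= e.
Proof.
move=> ih e e0; have D0 : 0 < `|C| + 1 by rewrite ltr_wpDl.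
have [w hw] := inner_approx ih (divr_gt0 e0 (mulr_gt0 (ltr0n _ 4) D0)).
have W0 : 0 < `|w| + 1 by rewrite ltr_wpDl.
exists (e / 2 / (`|w| + 1)); first by rewrite !divr_gt0.
have hx x : (nH x <= C%:E)%E -> `|innerH O j x h - x w| <= e / 4.
  move=> xC; have [a a0 xa] := ext_fin hH (le_lt_trans xC (ltry _)).
  have ix : inH O j x by apply/inHP; rewrite xa ltry.
  have := hw x ix; rewrite xa /= => /le_trans; apply.
  rewrite invfM (mulrA e) -mulrA ler_piMr ?divr_ge0 ?(ltW e0)//.
  rewrite mulrC ler_pdivrMr// mul1r.
  by move: xC; rewrite xa lee_fin; have := ler_norm C; lra.
move=> x y /hx hx1 /hx hy1 xy.
have : `|(x - y) w| <= e / 2.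
  rewrite (le_trans (dual_apply_le _ _))// -(@divfK _ (`|w| + 1) _ (e / 2)) ?gt_eqF//.
  by apply: ler_pM => //; rewrite lerDl.
rewrite -[(x - y) w]/(x w - y w).
have -> : innerH O j x h - innerH O j y h =
  (innerH O j x h - x w) - (innerH O j y h - y w) + (x w - y w) by ring.
move=> h2; rewrite (le_trans (ler_normD _ _))//.
rewrite (le_trans (lerD (ler_normB _ _) (lexx _)))//.
move: hx1 hy1 h2; lra.
Qed.

Lemma cvg_inner (F : set_system R) (u : R -> dual U) x h (C : R) : Filter F ->
  (forall t, (nH (u t) <= C%:E)%E) -> (nH x <= C%:E)%E -> inH O j h ->
  u @ F --> x -> innerH O j (u s) h @[s --> F] --> innerH O j x h.
Proof.
move=> FF uC xC ih ux; apply/cvgrPdist_le => e e0.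
have [b b0 hb] := inner_uniform C ih e0.
by near=> s; apply: hb => //; near: s; move/cvgrPdist_le : ux; apply.
Unshelve. all: by end_near. Qed.

Let exists_dense : exists e : nat -> dual U, (forall k, (nV (e k) < +oo)%E) /\
  forall x, (nV x < +oo)%E -> forall r : R, 0 < r -> exists k, (nV (x - e k)%R < r%:E)%E.
Proof.
have h1 : [set x | (nV x <= 1%:E)%E] `<=` [set x | (nH x <= 1%:E)%E].
  by move=> x /= x1; exact: le_trans (HV x) x1.
exact: (ext_separable hV (@HC 1) h1).
Qed.

Lemma finite_energy_strong u : finite_energy T q nV u ->
  strongly_measurable T nV u /\ strongly_measurable T nH u.
Proof.
move=> fu; have [eu cu _] := fu; have [e [ef ed]] := exists_dense.
have sm k := nearest_simple T0 hV ef eu cu k.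
have cv : {ae lebesgue_measure, forall t : R, t \in `[0, T] ->
    nV (u t - nearest nV e u k t) @[k --> \oo] --> 0%E}.
  apply: (@filterS _ _ (ae_filter_ringOfSetsType _)) (finite_energy_ae T0 q1 hV fu) => t h tT.
  exact (nearest_cvg hV ed (h tT)).
split; exists (nearest nV e u); split.
- by move=> k; have [? ? ? _] := sm k; split.
- exact: cv.
- move=> k; have [? ? h _] := sm k; split => // t.
  exact: le_lt_trans (HV _) (h t).
apply: (@filterS _ _ (ae_filter_ringOfSetsType _)) cv => t h tT; apply: squeeze_cvge (cvg_cst _) (h tT).
by apply: nearW => k; rewrite HV (ext_ge0 hH).
Qed.

Lemma finite_energy_LqV u : finite_energy T q nV u -> LqV O j T q u.
Proof.
move=> fu; split; first exact: (finite_energy_strong fu).1.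
by have [_ _ h] := fu; exact: poweR_lty.
Qed.

(** A path that is cadlag in [U'] and stays in a ball of H is weakly cadlag in H: its left limits
    remain in the ball, which is closed, and inner products are continuous there. *)
Lemma path_in_Zq u (C : R) : finite_energy T q nV u ->
  (forall t, (nH (u t) <= C%:E)%E) -> Zq_set O j OR T q u.
Proof.
move=> fu uC; have [eu cu lu] := fu.
have ix x : (nH x <= C%:E)%E -> inH O j x.
  by move=> xC; apply/inHP; exact: le_lt_trans xC (ltry _).
split; first exact: finite_energy_LqV.
- split; [by move=> t _; exact: ix|exact: (finite_energy_strong fu).2|].
  move=> r; apply: poweR_lty; apply: le_lt_trans lu.
  apply: le_nonneg_integral => t _; first exact: poweR_ge0.
  by apply: poweR_le2 => //; [exact: (ext_ge0 (hR r))|exact: le_trans (RH _ _) (HV _)].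
- by [].
split => //; split; first by move=> t; exact: ix.
move=> t; have [cr [l cl]] := cu t; split.
  by move=> h ih; exact: cvg_inner cr.
have lC : (nH l <= C%:E)%E.
  apply: (closed_cvg [set x | (nH x <= C%:E)%E] (HC_closed (C := C)) _ _ cl).
  by apply: nearW => s /=.
exists l; first exact: ix.
by move=> h ih; exact: cvg_inner cl.
Qed.

Lemma compact_Zq (C1 C2 : R) (dlt eta : nat -> R) :
  (forall k, 0 < dlt k) -> (forall k, 0 < eta k) ->
  (forall e : R, 0 < e -> exists k, eta k <= e) ->
  compact [set z : Zq O j OR T q | [/\ forall t, (nH (Zq_val z t) <= C1%:E)%E,
    (energy T q nV (Zq_val z) <= C2%:E)%E &
    forall k, regular_on T (dlt k) (eta k) (Zq_val z)]].
Proof.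
move=> d0 e0 ek; rewrite compact_ultra => F UF FK; set K := (X in F X) in FK.
have FP : ProperFilter F by exact: ultra_proper.
have FK1 : F [set z | forall t, (nH (Zq_val z t) <= C1%:E)%E].
  by apply: filterS FK => z [].
have FK2 : F [set z | (energy T q nV (Zq_val z) <= C2%:E)%E].
  by apply: filterS FK => z [].
have zE (z : Zq O j OR T q) : is_extended T (Zq_val z) /\ cadlag (Zq_val z).
  by have [_ _ + _] := set_valP (z : Zq_set O j OR T q).
have [|k|v [ev cv v1 v2 v3]] := regular_ultra_cvg (u := @Zq_val _ _ _ O j OR T q)
    UF T0 (@HC C1) d0 e0 ek.
- by move=> t; apply: filterS FK1 => z; exact.
- by apply: filterS FK => z [_ _]; exact.
have rv (e : R) : 0 < e -> exists2 dlt, 0 < dlt & regular_on T dlt e v.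
  move=> /ek [k hk]; exists (dlt k) => //.
  have [N [t [ct h]]] := v2 k; exists N, t; split => // i s s' iN hs hs'.
  exact: le_trans (h i s s' iN hs hs') hk.
(* Passage to sequences: any set of the ultrafilter contains paths that are [1 / (k + 1)]-close to
   [v] and of bounded energy, hence a sequence converging to [v] at almost every time. *)
have extract (A : set (Zq O j OR T q)) : F A -> exists z : nat -> Zq O j OR T q,
    (forall k, A (z k)) /\ (forall k, (energy T q nV (Zq_val (z k)) <= C2%:E)%E) /\
    {ae lebesgue_measure, forall t : R, t \in `[0%R, T] ->
      (fun k => Zq_val (z k) t) @ \oo --> v t}.
  move=> FA.
  have /choice[z zP] (k : nat) : exists z, [/\ A z, (energy T q nV (Zq_val z) <= C2%:E)%E &
      skorokhod_close T k.+1%:R^-1 v (Zq_val z)].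
    have : F (A `&` ([set z | (energy T q nV (Zq_val z) <= C2%:E)%E] `&`
        [set z | skorokhod_close T k.+1%:R^-1 v (Zq_val z)])).
      apply: filterI => //; apply: filterI => //; apply: v3.
      by rewrite invr_gt0.
    by move=> /filter_ex [z [h1 [h2 h3]]]; exists z.
  exists z; split; first by move=> k; case: (zP k).
  split; first by move=> k; case: (zP k).
  by apply: (ae_cvg_skorokhod T0 rv) => k; case: (zP k).
have Ev : (energy T q nV v <= C2%:E)%E.
  have [z [_ [zC zv]]] := extract _ filterT.
  apply: (fatou_energy T0 q1 hV) zC => //.
  - by move=> k; exact: (zE _).1.
  - by move=> k; exact: (zE _).2.
have fv : finite_energy T q nV v by split=> //; exact: le_lt_trans Ev (ltry _).
have Zv := path_in_Zq fv v1.
pose z0 : Zq O j OR T q := exist (fun u => u \in Zq_set O j OR T q) v (mem_set Zv).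
exists z0; split; first by split.
apply/cvg_sup => -[[|[|[|[|//]]]] i4] /=; apply: cvg_initial_topology.
- apply/cvg_sup => -[L [Llin [B Lbnd]]]; apply: cvg_initial_topology.
  change (L (Zq_val z) @[z --> F] --> L v).
  (* The signs 1 and -1 give the two halves of the convergence of [L]. If the set were not in the
     ultrafilter, its complement would contain a sequence along which [s * L] stays [c] above its
     value at [v], which [energy_weak_cvg] excludes. *)
  have key (s : R) : s ^+ 2 = 1 -> forall c : R, 0 < c ->
      F [set z : Zq O j OR T q | s * L (Zq_val z) < s * L v + c].
    move=> s1 c c0; have [//|] := in_ultra_setVsetC
      [set z : Zq O j OR T q | s * L (Zq_val z) < s * L v + c] UF.
    move=> /extract [z [zc [zC zv]]]; exfalso.
    have Bs : `|s| = 1 by apply/eqP; rewrite -sqr_norm_eq1 s1.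
    have h1 (a : R) p r : finite_energy T q nV p -> finite_energy T q nV r ->
        s * L (a \*: p \+ r) = a * (s * L p) + s * L r.
      by move=> /finite_energy_LqV hp /finite_energy_LqV hr; rewrite Llin// mulrDr !mulrA (mulrC s).
    have h2 p : finite_energy T q nV p ->
        (`|s * L p|%:E <= B%:E * energy T q nV p `^ q^-1)%E.
      by move=> /finite_energy_LqV hp; rewrite normrM Bs mul1r; exact: Lbnd.
    have h3 k : finite_energy T q nV (Zq_val (z k)).
      by split; [exact: (zE _).1|exact: (zE _).2|exact: le_lt_trans (zC k) (ltry _)].
    have h4 k : s * L v + c <= s * L (Zq_val (z k)) by rewrite leNgt; apply/negP => /zc.
    exact (energy_weak_cvg T0 q1 hV h1 h2 h3 fv zC zv c0 h4).
  apply/cvgrPdist_lt => c c0.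
  apply: filterS2 (key 1 _ c c0) (key (-1) _ c c0); rewrite ?expr1n ?sqrrN ?expr1n// => z.
  by rewrite /= !mul1r !mulN1r ltr_norml => h1 h2; apply/andP; split; lra.
- apply: cvg_ball_topology => r y rho rho0 yv.
  have yv' : ((\int[lebesgue_measure]_(t in `[0%R, T])
      (nR r (set_val y t - v t)%R) `^ q) `^ q^-1 < rho%:E)%E := yv.
  have mI : measurable (`[0, T]%classic : set (measurableTypeR R)) by exact: measurable_itv.
  have [a a0 ha] := @Lq_perturbation _ (measurableTypeR R) R lebesgue_measure _ mI q rho
    (fun t => nR r (set_val y t - v t)) q0 rho0 (fun t => ext_ge0 (hR r) _) yv'.
  have [e e1 he] := local_energy_small T0 q1 hV (hR r) HC (@ehrling r)
    ev cv v1 Ev rv a0.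
  change (F [set z : Zq O j OR T q |
    (Lq_norm T q (nR r) (set_val y \- Zq_val z)%R < rho%:E)%E]).
  apply: filterS3 FK1 FK2 (v3 e e1) => z z1 z2 z3.
  have [G [mG G0 gG IG]] := he _ (zE z).1 (zE z).2 z1 z2 z3.
  apply: (ha _ (fun t => nR r (v t - Zq_val z t)) G) => //.
  + exact: measurable_funTS.
  + by move=> t; exact: (ext_ge0 (hR r)).
  + by move=> t; exact: (ext_ge0 (hR r)).
  move=> t _; apply: le_trans (ext_D (hR r) _ _).
  by rewrite le_eqVlt; apply/orP; left; apply/eqP; congr (nR r _); rewrite addrA subrK.
- by apply: cvg_skorokhod => // e he; exact: v3.
apply/cvg_sup => -[h ih]; apply: cvg_initial_topology.
apply: cvg_skorokhod => // e he.
(* The time change that works in [U'] also works for the scalar path of inner products with [h]. *)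
have [b b0 hb] := inner_uniform C1 ih he.
have m0 : 0 < Num.min b e by rewrite lt_min b0.
change (F [set z : Zq O j OR T q | @skorokhod_close _ R^o T e
  (fun t => innerH O j (v t) h) (fun t => innerH O j (Zq_val z t) h)]).
apply: filterS2 FK1 (v3 _ m0) => z z1 [l [lt lP]]; exists l; split => // t tT.
have [h1 h2] := lP t tT; split; first by rewrite (le_trans h1)// ge_min lexx orbT.
have h3 : `|v t - Zq_val z (l t)| <= b by rewrite (le_trans h2)// ge_min lexx.
exact: hb (v1 t) (z1 (l t)) h3.
Qed.

End path_space.

(** * Test functions on R^d *)

Section row_space.
Context {R : realType}.
Local Open Scope ring_scope.

Lemma rV_coord_le n (x : 'rV[R]_n) i : `|x ord0 i| <= `|x|.
Proof.
rewrite [leRHS]mx_normrE; apply: (le_trans _ (le_bigmax _ _ (ord0, i))).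
by [].
Qed.

Lemma rV_norm_le n (x : 'rV[R]_n) (r : R) : 0 <= r ->
  (forall i, `|x ord0 i| <= r) -> `|x| <= r.
Proof.
move=> r0 h; rewrite [leLHS]mx_normrE; apply/bigmax_leP; split => //= -[a b] _ /=.
by rewrite (ord1 a).
Qed.

Lemma rV_norm_lt n (x : 'rV[R]_n) (r : R) : 0 < r ->
  (forall i, `|x ord0 i| < r) -> `|x| < r.
Proof.
move=> r0 h; rewrite [ltLHS]mx_normrE; apply/bigmax_ltP; split => //= -[a b] _ /=.
by rewrite (ord1 a).
Qed.

Definition cube n (x : 'rV[R]_n) (r : R) : set 'rV[R]_n :=
  [set y | forall i, `|y ord0 i - x ord0 i| <= r].

Lemma measurable_cube n (x : 'rV[R]_n) (r : R) : measurable (cube x r).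
Proof.
rewrite (_ : cube x r = \bigcap_(i in [set: 'I_n]) (rV_coord i @^-1` `[x ord0 i - r, x ord0 i + r])).
  apply: fin_bigcap_measurable => // i _; rewrite -[X in measurable X]setTI.
  by apply: measurable_rV_coord => //; exact: measurable_itv.
apply/seteqP; split => y /= h i.
  by move=> _; have := h i; rewrite /rV_coord /= in_itv/= ler_distl.
by have := h i I; rewrite /rV_coord /= in_itv/= ler_distl.
Qed.

Lemma rV_lebesgueE n (A : set 'rV[R]_n.+1) :
  rV_lebesgue n.+1 A = (lebesgue_measure \x rV_lebesgue n)%E (@rV_cons R n @^-1` A).
Proof. by []. Qed.

Lemma rV_cons0 n (p : R * 'rV[R]_n) : rV_cons p ord0 ord0 = p.1.
Proof. by have /(congr1 fst) := rV_consK p. Qed.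

Lemma rV_consS n (p : R * 'rV[R]_n) i : rV_cons p ord0 (lift ord0 i) = p.2 ord0 i.
Proof. by have /(congr1 snd)/rowP/(_ i) := rV_consK p; rewrite mxE. Qed.

Lemma rV_lebesgue_cube n (x : 'rV[R]_n) (r : R) : 0 <= r ->
  rV_lebesgue n (cube x r) = ((2 * r) ^+ n)%:E.
Proof.
move=> r0; elim: n x => [|n IH] x.
  rewrite /= /dirac indicE mem_set ?expr0// => i.
  by case: i.
rewrite rV_lebesgueE (_ : _ @^-1` _ = `[x ord0 ord0 - r, x ord0 ord0 + r]%classic `*`
  cube (\row_i x ord0 (lift ord0 i)) r).
  rewrite product_measure1E//; last exact: measurable_cube.
  rewrite IH; have := lebesgue_measure_itv `[x ord0 ord0 - r, x ord0 ord0 + r].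
  move=> /= ->; rewrite lte_fin; have [r0'|r0'] := ltP (x ord0 ord0 - r) (x ord0 ord0 + r); last first.
    have -> : r = 0 by move: r0 r0'; lra.
    by rewrite mul0e mulr0 expr0n.
  by rewrite -EFinB -EFinM exprS; congr (_ * _)%:E; ring.
apply/seteqP; split => -[a v] /=.
  move=> h; split.
    by have := h ord0; rewrite rV_cons0 /= in_itv/= -ler_distl.
  by move=> i /=; have := h (lift ord0 i); rewrite rV_consS mxE.
move=> [h1 h2] i; have [->|] := eqVneq i ord0.
  by rewrite rV_cons0; move: h1; rewrite in_itv/= -ler_distl.
rewrite eq_sym => /unlift_some[k -> _]; rewrite rV_consS.
by have := h2 k; rewrite mxE.
Qed.

(** The sigma-algebra is generated by the coordinates, which makes cubes measurable. An open set is
    the countable union of the cubes of rational centre and radius [1 / (k + 1)] that it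
    contains. *)
Lemma open_rV_measurable n (G : set 'rV[R]_n) : open G -> measurable G.
Proof.
move=> oG.
pose B (p : 'rV[rat]_n * nat) : set 'rV[R]_n := cube (map_mx ratr p.1) p.2.+1%:R^-1.
have -> : G = \bigcup_(p in [set p | B p `<=` G]) B p.
  apply/seteqP; split => [x Gx|x [p pG] /pG //].
  have /nbhs_ballP[e e0 eG] := open_nbhs_nbhs (conj oG Gx).
  have e4 : 0 < e / 2 by rewrite divr_gt0.
  have [k hk] : exists k : nat, k.+1%:R^-1 < e / 2.
    by have [k _ hk] := near_infty_natSinv_lt (PosNum e4); exists k; exact: (hk k (leqnn k)).
  have k0 : 0 < k.+1%:R^-1 :> R by rewrite invr_gt0.
  have /choice[c hc] (i : 'I_n) : exists c : rat, `|ratr c - x ord0 i| < k.+1%:R^-1.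
    have lt : x ord0 i - k.+1%:R^-1 < x ord0 i + k.+1%:R^-1 by rewrite ltrBlDr -addrA ltrDl addr_gt0.
    have [c] := rat_in_itvoo lt.
    by rewrite in_itv/= => h; exists c; rewrite ltr_distl.
  exists (\row_i c i, k).
    move=> y yB; apply: eG; rewrite -ball_normE /=.
    apply: rV_norm_lt => // i; rewrite !mxE.
    have := yB i; rewrite /= !mxE => h1; have h2 := hc i.
    rewrite -(subrK (ratr (c i)) (x ord0 i)) -addrA (le_lt_trans (ler_normD _ _))//.
    by rewrite distrC (distrC _ (y ord0 i)) (lt_le_trans (ltr_leD h2 h1))// [leRHS](splitr e) lerD// ltW.
  by move=> i /=; rewrite !mxE distrC ltW.
rewrite (_ : \bigcup_(p in _) _ = \bigcup_m (if @unpickle ('rV[rat]_n * nat)%type m is Some p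
    then if `[< B p `<=` G >] then B p else set0 else set0)).
  apply: bigcup_measurable => m _; case: unpickle => // p; case: ifPn => // _.
  exact: measurable_cube.
apply/seteqP; split => y.
  by move=> [p pG By]; exists (pickle p) => //; rewrite pickleK; case: asboolP.
by move=> [m _]; case: unpickle => // p; case: asboolP => // pG By; exists p.
Qed.

Lemma continuous_rV_measurable n (f : 'rV[R]_n -> R) : continuous f ->
  measurable_fun setT f.
Proof.
move=> /continuousP cf; apply: (measurability _ (RGenOpens.measurableE R)).
move=> _ [_ [a [b ->] <-]]; rewrite setTI; apply: open_rV_measurable; apply: cf.
exact: interval_open.
Qed.

Lemma compact_rV_cube n (K : set 'rV[R]_n) : compact K ->
  exists2 M : R, 0 <= M & K `<=` cube 0 M.
Proof.
move=> cK; have [M [_ hM]] := compact_bounded cK.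
exists (`|M| + 1); first by rewrite addr_ge0.
move=> x Kx i; rewrite mxE subr0; apply: le_trans (rV_coord_le x i) _.
by apply: (hM (`|M| + 1)) Kx; rewrite (le_lt_trans (ler_norm _))// ltrDl.
Qed.

End row_space.

(** * Integration by parts on R^n *)

Section integration_by_parts.
Context {R : realType}.
Local Notation leb := lebesgue_measure.
Local Notation ei i := (delta_mx (ord0 : 'I_1) i).

Lemma rV_addE n (x y : 'rV[R]_n) i : (x + y) ord0 i = x ord0 i + y ord0 i.
Proof. by rewrite mxE. Qed.

Lemma rV_eqP n (x y : 'rV[R]_n) : (forall i, x ord0 i = y ord0 i) -> x = y.
Proof. by move=> h; apply/matrixP => i k; rewrite (ord1 i). Qed.

Lemma rV_subE n (x y : 'rV[R]_n) i : (x - y) ord0 i = x ord0 i - y ord0 i.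
Proof. by rewrite !mxE. Qed.

Lemma rV_scaleE n (a : R) (x : 'rV[R]_n) i : (a *: x) ord0 i = a * x ord0 i.
Proof. by rewrite mxE. Qed.

Lemma rV_consE n (a b : R) (v w : 'rV[R]_n) (t : R) :
  t *: rV_cons (a, v) + rV_cons (b, w) = rV_cons (t * a + b, t *: v + w).
Proof.
apply: rV_eqP => i; have [->|] := eqVneq i ord0.
  by rewrite rV_addE rV_scaleE !rV_cons0.
by rewrite eq_sym => /unlift_some[k -> _]; rewrite rV_addE rV_scaleE !rV_consS rV_addE rV_scaleE.
Qed.

Lemma rV_cons_delta0 n : ei ord0 = rV_cons (1, 0 : 'rV[R]_n).
Proof.
apply: rV_eqP => i; have [->|] := eqVneq i ord0; first by rewrite rV_cons0 mxE !eqxx.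
by rewrite eq_sym => /unlift_some[k -> _]; rewrite rV_consS !mxE.
Qed.

Lemma rV_cons_deltaS n (k : 'I_n) : ei (lift ord0 k) = rV_cons (0, ei k : 'rV[R]_n).
Proof.
apply: rV_eqP => i; have [->|] := eqVneq i ord0; first by rewrite rV_cons0 mxE.
rewrite eq_sym => /unlift_some[l -> _]; rewrite rV_consS !mxE.
by congr (_ && _)%:R; apply/eqP/eqP => [/lift_inj|->].
Qed.

Lemma rV_cons_lipschitz n (a b : R) (v w : 'rV[R]_n) (r : R) : 0 <= r ->
  `|a - b| <= r -> `|v - w| <= r -> `|rV_cons (a, v) - rV_cons (b, w)| <= r.
Proof.
move=> r0 ab vw; apply: rV_norm_le => // i; have [->|] := eqVneq i ord0.
  by rewrite rV_subE !rV_cons0.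
rewrite eq_sym => /unlift_some[k -> _]; rewrite rV_subE !rV_consS.
by apply: le_trans vw; have := rV_coord_le (v - w) k; rewrite rV_subE.
Qed.

Lemma continuous_consl n (v : 'rV[R]_n) : continuous (fun a : R => rV_cons (a, v)).
Proof.
move=> a; apply/cvgrPdist_le => e e0; apply: filterS (nbhsx_ballx a _ e0) => b.
rewrite -ball_normE /= => /ltW ab; apply: rV_cons_lipschitz => //; first exact: ltW.
by rewrite subrr normr0 ltW.
Qed.

Lemma continuous_consr n (a : R) : continuous (fun v : 'rV[R]_n => rV_cons (a, v)).
Proof.
move=> v; apply/(@cvgrPdist_le _ _ _ _ (nbhs_filter v)) => e e0.
apply: filterS (nbhsx_ballx v _ e0) => w; rewrite -ball_normE /= => /ltW vw.
by apply: rV_cons_lipschitz; rewrite ?subrr ?normr0 ?(ltW e0).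
Qed.

Lemma compact_cube n (x : 'rV[R]_n) (r : R) : compact (cube x r).
Proof.
have := @rV_compact R n (fun i => `[x ord0 i - r, x ord0 i + r]%classic)
  (fun i => @segment_compact _ _ _).
rewrite (_ : [set _ | _] = cube x r)//.
by apply/seteqP; split => y h i; have := h i; rewrite /= in_itv/= ler_distl.
Qed.

Lemma continuous_cube_bounded n (g : 'rV[R]_n -> R) (M : R) : continuous g ->
  exists2 B : R, 0 <= B & forall x, cube 0 M x -> `|g x| <= B.
Proof.
move=> cg; have := continuous_compact (continuous_subspaceT cg) (@compact_cube n 0 M).
move=> /compact_bounded [B [_ hB]]; exists (`|B| + 1); first by rewrite addr_ge0.
move=> x xM; apply: (hB (`|B| + 1)); last by exists x.
by rewrite (le_lt_trans (ler_norm _))// ltrDl.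
Qed.

Lemma integrable_cube n (g : 'rV[R]_n -> R) (M : R) : continuous g ->
  (forall x, ~ cube 0 M x -> g x = 0) ->
  (rV_lebesgue n).-integrable setT (EFin \o g).
Proof.
move=> cg gM; have mg := continuous_rV_measurable cg.
wlog M0 : M gM / 0 <= M.
  move=> h; apply: (h (Num.max M 0)); last by rewrite le_max lexx orbT.
  move=> x hx; apply: gM => h'; apply: hx => i; rewrite (le_trans (h' i))//.
  by rewrite le_max lexx.
have [B B0 hB] := continuous_cube_bounded M cg.
have mc := measurable_cube (0 : 'rV[R]_n) M.
apply/integrableP; split; first exact/measurable_EFinP.
apply: (@le_lt_trans _ _ (\int[rV_lebesgue n]_x (B%:E * (\1_(cube 0 M) x)%:E))%E).
  apply: le_nonneg_integral => x _; first exact: abse_ge0.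
  rewrite /= lee_fin; have [xM|xM] := pselect (cube 0 M x); last by rewrite gM// normr0 mulr_ge0.
  by rewrite indicE mem_set// mulr1 hB.
rewrite ge0_integralZl_EFin//; last first.
  by apply/measurable_EFinP; exact: measurable_indic.
rewrite (_ : (\int[_]_x _)%E = rV_lebesgue n (cube 0 M)); last by rewrite integral_indic// setIT.
by rewrite rV_lebesgue_cube// -EFinM ltry.
Qed.

Lemma pdiff_outside n (F : 'rV[R]_n -> R) (M : R) i :
  (forall x, ~ cube 0 M x -> F x = 0) -> forall x, ~ cube 0 M x -> pdiff i F x = 0.
Proof.
move=> FM x xM; rewrite /pdiff (@near_eq_derive _ _ _ F (cst 0)).
  exact: derive_cst.
have oC : open (~` cube 0 M : set 'rV[R]_n).
  by apply: closed_openC; apply: compact_closed; [exact: norm_hausdorff|exact: compact_cube].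
by have := open_nbhs_nbhs (conj oC xM); apply: filterS => y /FM.
Qed.

Lemma pdiff_cons0 n (F : 'rV[R]_n.+1 -> R) (a : R) (v : 'rV[R]_n) :
  pdiff ord0 F (rV_cons (a, v)) = 'D_1 (fun b : R => F (rV_cons (b, v)) : R^o) a.
Proof.
rewrite /pdiff /derive rV_cons_delta0; set f := (fun h => _); set g := (fun h => _).
suff -> : f = g by [].
by apply/funext => t; rewrite /f /g /shift /= rV_consE scaler0 add0r.
Qed.

Lemma derivable_cons0 n (F : 'rV[R]_n.+1 -> R) (a : R) (v : 'rV[R]_n) :
  derivable F (rV_cons (a, v)) (ei ord0) -> derivable (fun b : R => F (rV_cons (b, v)) : R^o) a 1.
Proof.
rewrite /derivable rV_cons_delta0; set f := (fun h => _); set g := (fun h => _).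
suff -> : f = g by [].
by apply/funext => t; rewrite /f /g /shift /= rV_consE scaler0 add0r.
Qed.

Lemma pdiff_consS n (F : 'rV[R]_n.+1 -> R) (a : R) (v : 'rV[R]_n) k :
  pdiff (lift ord0 k) F (rV_cons (a, v)) = pdiff k (fun w => F (rV_cons (a, w))) v.
Proof.
rewrite /pdiff /derive rV_cons_deltaS; set f := (fun h => _); set g := (fun h => _).
suff -> : f = g by [].
by apply/funext => t; rewrite /f /g /shift /= rV_consE mulr0 add0r.
Qed.

Lemma derivable_consS n (F : 'rV[R]_n.+1 -> R) (a : R) (v : 'rV[R]_n) k :
  derivable F (rV_cons (a, v)) (ei (lift ord0 k)) ->
  derivable (fun w => F (rV_cons (a, w))) v (ei k).
Proof.
rewrite /derivable rV_cons_deltaS; set f := (fun h => _); set g := (fun h => _).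
suff -> : f = g by [].
by apply/funext => t; rewrite /f /g /shift /= rV_consE mulr0 add0r.
Qed.

Lemma integral_derive_compact (f : R -> R) (M : R) :
  (forall a, derivable f a 1) -> continuous (fun a => 'D_1 f a) ->
  (forall a, M < `|a| -> f a = 0) -> (\int[leb]_a ('D_1 f a)%:E = 0)%E.
Proof.
move=> df cf fM; pose N := `|M| + 1.
have N0 : 0 < N by rewrite ltr_wpDl.
have MN : M < N by rewrite (le_lt_trans (ler_norm _))// ltrDl.
have NN : - N < N by rewrite (lt_trans _ N0)// oppr_lt0.
have cF : continuous f by move=> a; apply: differentiable_continuous; apply/derivable1_diffP.
have -> : (\int[leb]_a ('D_1 f a)%:E = \int[leb]_(a in `[(- N)%R, N]) ('D_1 f a)%:E)%E.
  rewrite [RHS]integral_mkcond; apply: eq_integral => a _; rewrite /patch.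
  case: ifPn => //; rewrite mem_setE in_itv/= -ler_norml -ltNge => aN.
  rewrite (@near_eq_derive _ _ _ f (cst 0)) ?derive_cst//.
  have : \forall b \near a, N < `|b|.
    apply: (@cvgr_gt _ _ (nbhs a) _ (fun b : R => `|b|) `|a|) => //.
    by apply: cvg_norm; exact: cvg_id.
  by apply: filterS => b Nb; apply: fM; exact: lt_trans MN Nb.
rewrite (@continuous_FTC2 _ _ f)//.
- by rewrite !fM ?subee// ?normrN gtr0_norm.
- exact: continuous_subspaceT.
- by split; [move=> x _; exact: df|apply: cvg_at_right_filter; exact: cF|
    apply: cvg_at_left_filter; exact: cF].
- by move=> x _; rewrite derive1E.
Qed.

Lemma integral_rV_cons n (f : 'rV[R]_n.+1 -> \bar R) :
  (rV_lebesgue n.+1).-integrable setT f ->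
  [/\ (leb \x rV_lebesgue n)%E.-integrable setT (f \o @rV_cons R n),
    (\int[rV_lebesgue n.+1]_x f x = \int[leb]_a \int[rV_lebesgue n]_v f (rV_cons (a, v)))%E &
    (\int[rV_lebesgue n.+1]_x f x = \int[rV_lebesgue n]_v \int[leb]_a f (rV_cons (a, v)))%E].
Proof.
move=> If; have mf := measurable_int _ If.
have mcons : measurable_fun setT (@rV_cons R n : measurableTypeR R * 'rV[R]_n -> 'rV[R]_n.+1).
  exact: measurable_rV_cons.
have E1 : (\int[rV_lebesgue n.+1]_x `|f x| =
    \int[leb \x rV_lebesgue n]_p `|(f \o @rV_cons R n) p|)%E.
  have := ge0_integral_pushforward mcons (leb \x rV_lebesgue n)%E (D := setT) (f := fun x => `|f x|%E).
  rewrite preimage_setT => <-//; exact: measurableT_comp.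
have Ic : (leb \x rV_lebesgue n)%E.-integrable setT (f \o @rV_cons R n).
  apply/integrableP; split; first exact: measurableT_comp.
  by rewrite -E1; move/integrableP : If => [].
have E2 : (\int[rV_lebesgue n.+1]_x f x = \int[leb \x rV_lebesgue n]_p (f \o @rV_cons R n) p)%E.
  have := @integral_pushforward _ _ _ _ R _ mcons (leb \x rV_lebesgue n)%E setT f.
  by rewrite preimage_setT => <-.
split=> //.
  by rewrite E2 -integral12_prod_meas1.
by rewrite E2 -integral21_prod_meas1.
Qed.

(** Induction on the dimension. In the first direction the inner integral is that of the derivative
    of a compactly supported function of one variable; in the others it vanishes on each slice by
    induction. The two cases use the two orders of integration. *)
Lemma integral_pdiff n (F : 'rV[R]_n -> R) i (M : R) :
  (forall x, derivable F x (ei i)) -> continuous (pdiff i F) ->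
  (forall x, ~ cube 0 M x -> F x = 0) -> (\int[rV_lebesgue n]_x (pdiff i F x)%:E = 0)%E.
Proof.
elim: n => [|n IH] in F i *; first by case: i.
move=> dF cF FM.
have [Ic Exy Eyx] := integral_rV_cons (integrable_cube cF (pdiff_outside i FM)).
have [i0|] := eqVneq i ord0.
  rewrite Eyx; apply: integral0_eq => v _; subst i.
  under eq_integral do rewrite /= pdiff_cons0.
  apply: (@integral_derive_compact _ M).
  - by move=> a; apply: derivable_cons0; exact: dF.
  - rewrite (_ : 'D_(1 : R) _ = (fun a => pdiff ord0 F (rV_cons (a, v)))); last first.
        by apply/funext => a; rewrite pdiff_cons0.
    by move=> a; apply: continuous_comp; [exact: continuous_consl|exact: cF].
  - move=> a Ma; apply: FM => h; have := h ord0.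
    by rewrite rV_cons0 mxE subr0 leNgt Ma.
rewrite eq_sym => /unlift_some[k ik _]; subst i.
rewrite Exy; apply: integral0_eq => a _.
under eq_integral do rewrite /= pdiff_consS.
apply: IH.
- by move=> v; apply: derivable_consS; exact: dF.
- rewrite (_ : pdiff k _ = (fun v => pdiff (lift ord0 k) F (rV_cons (a, v)))); last first.
    by apply/funext => v; rewrite pdiff_consS.
  by move=> v; apply: continuous_comp; [exact: continuous_consr|exact: cF].
move=> v vM; apply: FM => h; apply: vM => l.
by have := h (lift ord0 l); rewrite rV_consS !mxE.
Qed.

End integration_by_parts.

(** * Test functions and weak derivatives *)

Section test_functions.
Context {R : realType} {d : nat}.
Local Notation E := 'rV[R]_d.
Local Notation leb := (@rV_lebesgue R d).
Local Notation ei i := (delta_mx (ord0 : 'I_1) i).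
Implicit Types (O A : set E) (f g phi : E -> R).

Lemma continuous_add f g : continuous f -> continuous g -> continuous (fun x => f x + g x).
Proof.
move=> cf cg x; apply: (@cvgD _ _ _ _ (nbhs_filter x) f g); [exact: cf|exact: cg].
Qed.

Lemma continuous_mul f g : continuous f -> continuous g -> continuous (fun x => f x * g x).
Proof.
move=> cf cg x; apply: (@cvgM _ _ _ (nbhs_filter x) f g); [exact: cf|exact: cg].
Qed.

Lemma pdiffs_rcons (s : seq 'I_d) i f : pdiffs (rcons s i) f = pdiffs s (pdiff i f).
Proof. by rewrite /pdiffs foldr_rcons. Qed.

Lemma smooth_pdiff i f : smooth f -> smooth (pdiff i f).
Proof. by move=> sf s; rewrite -pdiffs_rcons; exact: sf. Qed.

Lemma smooth_continuous f : smooth f -> continuous f.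
Proof. by move=> /(_ [::])[]. Qed.

Lemma smooth_derivable f : smooth f -> forall i x, derivable f x (ei i).
Proof. by move=> /(_ [::])[]. Qed.

Lemma pdiff_lin (a : R) f g i : (forall x, derivable f x (ei i)) ->
  (forall x, derivable g x (ei i)) ->
  pdiff i (fun x => a * f x + g x) = (fun x => a * pdiff i f x + pdiff i g x).
Proof.
move=> df dg; apply/funext => x; rewrite /pdiff.
rewrite -[LHS]/('D_(ei i) ((a *: (f : E -> R^o)) + (g : E -> R^o)) x).
by rewrite deriveD ?deriveZ//; exact: derivableZ.
Qed.

Lemma derivable_lin (a : R) f g i : (forall x, derivable f x (ei i)) ->
  (forall x, derivable g x (ei i)) ->
  forall x, derivable (fun x => a * f x + g x) x (ei i).
Proof.
move=> df dg x; apply: (@derivableD _ _ _ ((a *: (f : E -> R^o))) (g : E -> R^o)) => //.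
exact: derivableZ.
Qed.

Lemma pdiffs_lin (a : R) f g s : smooth f -> smooth g ->
  pdiffs s (fun x => a * f x + g x) = (fun x => a * pdiffs s f x + pdiffs s g x).
Proof.
move=> sf sg; elim: s => //= i s ->.
by apply: pdiff_lin => x; [apply: (sf s).2|apply: (sg s).2].
Qed.

Lemma smooth_lin (a : R) f g : smooth f -> smooth g -> smooth (fun x => a * f x + g x).
Proof.
move=> sf sg s; rewrite pdiffs_lin//; split.
  apply: continuous_add; last exact: (sg s).1.
  by apply: (@continuous_mul (cst a)); [exact: cst_continuous|exact: (sf s).1].
by move=> i x; apply: derivable_lin => y; [apply: (sf s).2|apply: (sg s).2].
Qed.

Lemma pdiff_zero_outside f i (K : set E) : compact K -> (forall x, ~ K x -> f x = 0) ->
  forall x, ~ K x -> pdiff i f x = 0.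
Proof.
move=> cK fK x xK; rewrite /pdiff (@near_eq_derive _ _ _ f (cst 0)).
  exact: derive_cst.
have oC : open (~` K) by apply: closed_openC; apply: compact_closed => //; exact: norm_hausdorff.
by have := open_nbhs_nbhs (conj oC xK); apply: filterS => y /fK.
Qed.

Lemma test_pdiff O i phi : test_function O phi -> test_function O (pdiff i phi).
Proof.
move=> [sp [K [cK KO pK]]]; split; first exact: smooth_pdiff.
by exists K; split => //; exact: pdiff_zero_outside cK pK.
Qed.

Lemma test_pdiffs O s phi : test_function O phi -> test_function O (pdiffs s phi).
Proof. by move=> tp; elim: s => [|i s IH]; [exact: tp|exact: test_pdiff]. Qed.

Lemma test_lin O (a : R) f g : test_function O f -> test_function O g ->
  test_function O (fun x => a * f x + g x).
Proof.
move=> [sf [K [cK KO fK]]] [sg [L [cL LO gL]]]; split; first exact: smooth_lin.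
exists (K `|` L); split; first exact: compactU.
  by rewrite subUset.
by move=> x /not_orP[xK xL]; rewrite fK// gL// mulr0 addr0.
Qed.

Lemma test_sub O A phi : O `<=` A -> test_function O phi -> test_function A phi.
Proof.
move=> OA [sp [K [cK KO pK]]]; split => //; exists K; split => //.
exact: subset_trans KO OA.
Qed.

Lemma test_integrable O g phi : continuous g -> test_function O phi ->
  leb.-integrable setT (fun x => (g x * phi x)%:E).
Proof.
move=> cg [sp [K [cK KO pK]]]; have [M M0 KM] := compact_rV_cube cK.
apply: (@integrable_cube _ _ (fun x => g x * phi x) M).
  by apply: continuous_mul => //; exact: smooth_continuous.
by move=> x xM; rewrite pK ?mulr0// => /KM.
Qed.

Lemma test_L2 O A phi : measurable A -> test_function O phi -> L2 A phi.
Proof.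
move=> mA tp; have cp := smooth_continuous tp.1; split.
  by apply: measurable_funTS; exact: continuous_rV_measurable.
have := test_integrable cp tp; move/integrableS => /(_ _ measurableT mA (@subsetT _ _)).
move=> /integrableP[_]; apply: le_lt_trans; apply: le_nonneg_integral => x _.
  by rewrite lee_fin sqr_ge0.
by rewrite /= lee_fin -expr2 ler_norm.
Qed.

Lemma ibp O g phi i : smooth g -> test_function O phi ->
  \int[leb]_x (g x * pdiff i phi x) = - \int[leb]_x (pdiff i g x * phi x).
Proof.
move=> sg tp; have [sp [K [cK KO pK]]] := tp; have [M M0 KM] := compact_rV_cube cK.
have dg := @smooth_derivable _ sg i; have dp := @smooth_derivable _ sp i.
pose F x := g x * phi x.
have FE : pdiff i F = (fun x => g x * pdiff i phi x + pdiff i g x * phi x).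
  apply/funext => x; rewrite /pdiff -[LHS]/('D_(ei i) ((g : E -> R^o) * (phi : E -> R^o)) x).
  by rewrite deriveM//; congr (_ + _); exact: mulrC.
have I1 : leb.-integrable setT (fun x => (g x * pdiff i phi x)%:E).
  exact: test_integrable (smooth_continuous sg) (test_pdiff i tp).
have I2 : leb.-integrable setT (fun x => (pdiff i g x * phi x)%:E).
  exact: test_integrable (smooth_continuous (smooth_pdiff i sg)) tp.
have : \int[leb]_x (pdiff i F x) = 0.
  rewrite /Rintegral (@integral_pdiff _ _ F i M)//.
  - move=> x; apply: (@derivableM _ _ (g : E -> R^o) (phi : E -> R^o)).
      exact: dg.
    exact: dp.
  - rewrite FE; apply: continuous_add; apply: continuous_mul.
    + exact: smooth_continuous.
    + exact: (smooth_continuous (smooth_pdiff i sp)).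
    + exact: (smooth_continuous (smooth_pdiff i sg)).
    + exact: smooth_continuous.
  by move=> x xM; rewrite /F pK ?mulr0// => /KM.
rewrite FE RintegralD// => /eqP; rewrite addr_eq0 => /eqP.
by [].
Qed.

Lemma integral_test O g phi : test_function O phi ->
  \int[leb]_(x in O) (g x * phi x) = \int[leb]_x (g x * phi x).
Proof.
move=> [_ [K [_ KO pK]]]; rewrite Rintegral_mkcond; apply: eq_Rintegral => x _.
rewrite /patch; case: ifPn => //; rewrite notin_setE => xO.
by rewrite pK ?mulr0// => /KO.
Qed.

(** Each integration by parts moves the outermost derivative of [phi] onto [g], below those that
    follow it; whence the reversal of [s]. *)
Lemma test_weak_derivative O s g phi : smooth g -> test_function O phi ->
  \int[leb]_(x in O) (g x * pdiffs s phi x) =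
  (-1) ^+ size s * \int[leb]_(x in O) (pdiffs (rev s) g x * phi x).
Proof.
move=> sg tp; rewrite (integral_test _ (test_pdiffs s tp)) (integral_test _ tp).
elim: s => [|i s IH] in g sg *; first by rewrite mul1r.
rewrite /= (ibp i sg (test_pdiffs s tp)) (IH _ (smooth_pdiff i sg)).
by rewrite rev_cons pdiffs_rcons exprS -mulrA mulN1r.
Qed.

End test_functions.

Section lipschitz.
Context {R : realType}.
Local Notation ei i := (delta_mx (ord0 : 'I_1) i).

Lemma rV_unconsK n : cancel (@rV_uncons R n) (@rV_cons R n).
Proof.
move=> v; apply: rV_eqP => i; have [->|] := eqVneq i ord0; first by rewrite rV_cons0.
by rewrite eq_sym => /unlift_some[k -> _]; rewrite rV_consS mxE.
Qed.

(** One coordinate is changed at a time, by the mean value theorem; each change costs [B] times the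
    sup norm. *)
Lemma pdiff_lipschitz n (F : 'rV[R]_n -> R) (B : R) : 0 <= B ->
  (forall i x, derivable F x (ei i)) -> (forall i x, `|pdiff i F x| <= B) ->
  forall x y, `|F x - F y| <= n%:R * B * `|x - y|.
Proof.
move=> B0; elim: n => [|n IH] in F *; move=> dF FB x y.
  by rewrite (_ : x = y) ?subrr ?normr0 ?mul0r//; apply: rV_eqP => -[].
rewrite -(rV_unconsK x) -(rV_unconsK y).
case: (rV_uncons x) => a v; case: (rV_uncons y) => b w.
have ab : `|a - b| <= `|rV_cons (a, v) - rV_cons (b, w)|.
  by have := rV_coord_le (rV_cons (a, v) - rV_cons (b, w)) ord0; rewrite rV_subE !rV_cons0.
have vw : `|v - w| <= `|rV_cons (a, v) - rV_cons (b, w)|.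
  apply: rV_norm_le => // i.
  have := rV_coord_le (rV_cons (a, v) - rV_cons (b, w)) (lift ord0 i).
  by rewrite !rV_subE !rV_consS.
rewrite -(subrK (F (rV_cons (b, v))) (F (rV_cons (a, v)))) -addrA.
apply: le_trans (ler_normD _ _) _; rewrite -natr1 -mulrA mulrDl mul1r [leRHS]addrC lerD//; last first.
  apply: le_trans (IH (fun u => F (rV_cons (b, u))) _ _ v w) _.
  - by move=> i u; apply: derivable_consS; exact: dF.
  - by move=> i u; rewrite -pdiff_consS; exact: FB.
  by rewrite -mulrA ler_wpM2l// ler_wpM2l.
pose f b := F (rV_cons (b, v)).
have df c : derivable (f : R -> R^o) c 1 by apply: derivable_cons0; exact: dF.
have key (p r : R) : p < r -> `|f p - f r| <= B * `|p - r|.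
  move=> pr; have [||c _ hc] := @MVT R f (fun c => 'D_1 (f : R -> R^o) c) p r pr.
  - by move=> c _; apply: DeriveDef.
  - apply: continuous_subspaceT => c; apply: differentiable_continuous.
    exact/derivable1_diffP.
  by rewrite distrC hc normrM (distrC p) ler_wpM2r// -pdiff_cons0.
apply: (@le_trans _ _ (B * `|a - b|)); last by rewrite ler_wpM2l.
rewrite -/(f a) -/(f b); have [/key//|/key h|->] := ltgtP a b; last by rewrite !subrr normr0 mulr0.
by rewrite distrC (distrC a).
Qed.

End lipschitz.

(** * Gagliardo seminorms of test functions *)

Section shells.
Context {R : realType} {d : nat}.
Local Notation E := 'rV[R]_d.
Local Notation leb := (@rV_lebesgue R d).

(** The series of the [g k] dominates [F], as one of its terms does at each point, and its integral
    is bounded by a geometric series. *)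
Lemma integral_geometric_cover (g : nat -> E -> R) (F : E -> \bar R) (C rho : R) :
  0 <= rho < 1 -> 0 <= C -> (forall k, measurable_fun setT (g k)) -> (forall k y, 0 <= g k y) ->
  (forall y, 0 <= F y)%E -> (forall y, exists k, (F y <= (g k y)%:E)%E) ->
  (forall k, (\int[leb]_y (g k y)%:E <= (C * rho ^+ k)%:E)%E) ->
  (\int[leb]_y F y <= (C / (1 - rho))%:E)%E.
Proof.
move=> /andP[r0 r1] C0 mg g0 F0 Fg Ig.
have r1' : 0 < 1 - rho by rewrite subr_gt0.
apply: (@le_trans _ _ (\int[leb]_y (\sum_(k <oo) (g k y)%:E))%E).
  apply: le_nonneg_integral => y _ //; have [k hk] := Fg y; apply: (le_trans hk).
  rewrite (@nneseriesD1 _ _ k) ?leeDl//.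
    by apply: nneseries_ge0 => l _ _; rewrite lee_fin.
  by move=> l _; rewrite lee_fin.
rewrite integral_nneseries//; last 2 first.
  by move=> k; apply/measurable_EFinP.
  by move=> k y _; rewrite lee_fin.
apply: lime_le.
  by apply: is_cvg_nneseries => k _ _; apply: integral_ge0 => y _; rewrite lee_fin.
apply: nearW => n; apply: (@le_trans _ _ (C * (1 - rho ^+ n) / (1 - rho))%:E).
  elim: n => [|n IH]; first by rewrite big_nil expr0 subrr mulr0 mul0r.
  rewrite big_nat_recr//=; apply: le_trans (leeD IH (Ig n)) _.
  rewrite -EFinD lee_fin le_eqVlt; apply/orP; left; apply/eqP; rewrite exprS.
  by field; rewrite gt_eqF.
rewrite lee_fin ler_pM2r ?invr_gt0// ler_piMr//.
by rewrite lerBlDr lerDl exprn_ge0.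
Qed.

Lemma integral_cube_scale (a r : R) (x : E) : 0 <= a -> 0 <= r ->
  (\int[leb]_y (a * \1_(cube x r) y)%:E = (a * (2 * r) ^+ d)%:E)%E.
Proof.
move=> a0 r0; have mc := measurable_cube x r.
under eq_integral do rewrite EFinM.
rewrite ge0_integralZl_EFin//; last first.
  by apply/measurable_EFinP; exact: measurable_indic.
rewrite (_ : (\int[_]_y _)%E = leb (cube x r)); last by rewrite integral_indic// setIT.
by rewrite rV_lebesgue_cube.
Qed.

Lemma powR_exprn (u r : R) k : 0 < u -> (u ^+ k) `^ r = (u `^ r) ^+ k.
Proof.
move=> u0; rewrite -powR_mulrn ?ltW// -powRrM mulrC powRrM powR_mulrn//.
exact: powR_ge0.
Qed.

(* The integrand is the worst case of [(h x - h y) ^+ 2 / |x - y| ^ p] for a bounded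
   Lipschitz function [h]; it vanishes at [z = 0], where [0 / 0 = 0]. *)
Definition kernel (p : R) (z : E) : R := Num.min (`|z| ^+ 2) 1 / `|z| `^ p.

Lemma kernel_ge0 p z : 0 <= kernel p z.
Proof. by rewrite divr_ge0 ?powR_ge0// le_min sqr_ge0 ler01. Qed.

(** The kernel is of order [2 - d - 2 s] near 0 and of order [- d - 2 s] at infinity. Over dyadic
    shells its integrals decrease geometrically, with ratios [r1 = 2^-(2 - 2 s)] inwards and
    [r2 = 2^-(2 s)] outwards, both below 1 as [0 < s < 1]. *)
Lemma kernel_integrable (s : R) : 0 < s -> s < 1 -> exists2 C : R, 0 <= C &
  forall x : E, (\int[leb]_y (kernel (d%:R + 2 * s) (y - x))%:E <= C%:E)%E.
Proof.
move=> s0 s1; pose p := d%:R + 2 * s; pose th : R := 2^-1.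
have th0 : 0 < th by rewrite invr_gt0.
have th1 : th < 1 by rewrite invf_lt1// ltr1n.
have p0 : 0 <= p by rewrite addr_ge0// mulr_ge0// ltW.
pose r1 := th `^ (2 - 2 * s); pose r2 := (2 `^ (2 * s))^-1.
have r1_0 : 0 < r1 by rewrite powR_gt0.
have r2_0 : 0 < r2 by rewrite invr_gt0 powR_gt0.
have r1_1 : r1 < 1.
  have one : 1 `^ (2 - 2 * s) = 1 :> R by rewrite powR1.
  rewrite -[ltRHS]one; apply: gt0_ltr_powR; rewrite ?nnegrE ?(ltW th0)//.
  by move: s1; lra.
have r2_1 : r2 < 1.
  have one : 1 `^ (2 * s) = 1 :> R by rewrite powR1.
  rewrite invf_lt1 ?powR_gt0// -[ltLHS]one; apply: gt0_ltr_powR; rewrite ?nnegrE ?mulr_gt0 ?ltr1n//.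
have upow (u : R) : 0 < u -> u `^ p = u ^+ d * u `^ (2 * s).
  move=> u0; rewrite /p powRD; last by rewrite (gt_eqF u0) implybT.
  by rewrite powR_mulrn// ltW.
pose C1 := 2 ^+ d / th `^ p; pose C2 : R := 4 ^+ d.
have C1_0 : 0 <= C1 by rewrite divr_ge0 ?powR_ge0 ?exprn_ge0.
have C2_0 : 0 <= C2 by rewrite exprn_ge0.
(* Bounds of the kernel on the inner and on the outer shell of index [k]; [g x k] serves both at
   once. *)
pose a1 k := (th ^+ k) ^+ 2 / (th ^+ k.+1) `^ p; pose a2 (k : nat) : R := ((2 ^+ k) `^ p)^-1.
have a1_0 k : 0 <= a1 k by rewrite divr_ge0 ?sqr_ge0 ?powR_ge0.
have a2_0 k : 0 <= a2 k by rewrite invr_ge0 powR_ge0.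
pose g (x : E) (k : nat) (y : E) := a1 k * \1_(cube x (th ^+ k)) y + a2 k * \1_(cube x (2 ^+ k.+1)) y.
have I1 k : a1 k * (2 * th ^+ k) ^+ d = C1 * r1 ^+ k.
  rewrite /a1 /C1 /r1 -powR_exprn// (exprS th k); set u := th ^+ k.
  have u0 : 0 < u by rewrite exprn_gt0.
  rewrite powRM ?(ltW th0) ?(ltW u0)// !upow//.
  rewrite powRD; last by rewrite (gt_eqF u0) implybT.
  rewrite powRN powR_mulrn ?(ltW u0)// exprMn.
  by field; rewrite !gt_eqF ?powR_gt0// ?exprn_gt0.
have I2 k : a2 k * (2 * 2 ^+ k.+1) ^+ d = C2 * r2 ^+ k.
  rewrite /a2 /C2 /r2 exprVn -powR_exprn// (exprS _ k); set u : R := 2 ^+ k.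
  have u0 : 0 < u by rewrite exprn_gt0.
  rewrite upow// mulrA exprMn (_ : 2 * 2 = 4 :> R); last by rewrite -natrM.
  by field; rewrite !gt_eqF ?powR_gt0// ?exprn_gt0.
pose rho : R := Num.max r1 r2.
have rho01 : 0 <= rho < 1 by rewrite le_max (ltW r1_0)/= gt_max r1_1 r2_1.
have rho0 : 0 <= rho by case/andP : rho01.
exists ((C1 + C2) / (1 - rho)).
  case/andP : rho01 => _ h; apply: divr_ge0; first exact: addr_ge0.
  by rewrite subr_ge0 ltW.
move=> x; apply: (@integral_geometric_cover (g x)) => //.
- exact: addr_ge0.
- move=> k; apply: measurable_funD; apply: measurable_funM => //; apply: measurable_indic;
    exact: measurable_cube.
- by move=> k y; rewrite addr_ge0// mulr_ge0.
- by move=> y; rewrite lee_fin kernel_ge0.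
- move=> y; set z := y - x.
  have cz r : 0 <= r -> `|z| <= r -> \1_(cube x r) y = 1 :> R.
    move=> r0 zr; rewrite indicE mem_set// => i.
    by have := rV_coord_le z i; rewrite /z rV_subE => /le_trans; apply.
  have [z0|z0] := eqVneq z 0.
    exists 0%N; rewrite lee_fin /kernel z0 normr0 expr0n /= min_l// mul0r.
    by rewrite addr_ge0// mulr_ge0.
  have nz : 0 < `|z| by rewrite normr_gt0.
  have [z1|z1] := leP `|z| 1.
    have [k0 hk0] : exists k, th ^+ k.+1 < `|z|.
      have th1' : `|th| < 1 by rewrite gtr0_norm.
      have [k _ hk] := (cvgrPdist_lt _ _).1 (cvg_geometric 1 th1') _ nz.
      exists k; have := hk k.+1 (leqW (leqnn k)).
      by rewrite /geometric /= sub0r normrN mul1r ger0_norm// exprn_ge0// ltW.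
    have [k hk kmin] := ex_minnP (ex_intro (fun k => th ^+ k.+1 < `|z|) k0 hk0).
    have zk : `|z| <= th ^+ k.
      case: k kmin {hk} => [|k] kmin; first by rewrite expr0.
      by rewrite leNgt; apply/negP => /kmin; rewrite ltnn.
    exists k; rewrite lee_fin /g (cz (th ^+ k)) ?exprn_ge0 ?(ltW th0)//.
    apply: (@le_trans _ _ (a1 k)); last by rewrite mulr1 lerDl mulr_ge0.
    rewrite /kernel min_l; last by rewrite expr_le1.
    rewrite ler_pM ?sqr_ge0 ?invr_ge0 ?powR_ge0//.
      by rewrite ler_pXn2r// nnegrE ?exprn_ge0 ?(ltW th0).
    rewrite lef_pV2 ?posrE ?powR_gt0// ?exprn_gt0//.
    by apply: ge0_ler_powR; rewrite ?nnegrE ?exprn_ge0 ?(ltW th0) ?(ltW hk).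
  have [k0 hk0] : exists k, `|z| <= 2 ^+ k.+1.
    exists (Num.trunc `|z|); apply: ltW; rewrite (lt_le_trans (truncnS_gt _))//.
    by rewrite -natrX ler_nat ltnW// ltn_expl.
  have [k hk kmin] := ex_minnP (ex_intro (fun k => `|z| <= 2 ^+ k.+1) k0 hk0).
  have zk : 2 ^+ k <= `|z|.
    case: k kmin {hk} => [|k] kmin; first by rewrite expr0 ltW.
    by rewrite leNgt; apply/negP => /ltW/kmin; rewrite ltnn.
  exists k; rewrite lee_fin /g (cz (2 ^+ k.+1)) ?exprn_ge0//.
  apply: (@le_trans _ _ (a2 k)); last by rewrite mulr1 lerDr mulr_ge0.
  rewrite /kernel min_r; last by rewrite expr_ge1// ltW.
  rewrite mul1r lef_pV2 ?posrE ?powR_gt0// ?exprn_gt0//.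
  by apply: ge0_ler_powR; rewrite ?nnegrE ?exprn_ge0.
move=> k; rewrite /g.
under eq_integral do rewrite EFinD.
rewrite ge0_integralD//; last 4 first.
- by move=> y _; rewrite lee_fin mulr_ge0.
- apply/measurable_EFinP; apply: measurable_funM => //; apply: measurable_indic; exact: measurable_cube.
- by move=> y _; rewrite lee_fin mulr_ge0.
- apply/measurable_EFinP; apply: measurable_funM => //; apply: measurable_indic; exact: measurable_cube.
rewrite !integral_cube_scale ?exprn_ge0 ?(ltW th0)// I1 I2 -EFinD lee_fin mulrDl.
rewrite lerD// ler_wpM2l// lerXn2r// ?nnegrE ?(ltW r1_0) ?(ltW r2_0)//.
- by rewrite le_max lexx.
- by rewrite le_max lexx orbT.
Qed.

Lemma sqr_le_of_abs (a b : R) : `|a| <= b -> a ^+ 2 <= b ^+ 2.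
Proof.
by move=> ab; rewrite -(real_normK (num_real a)) lerXn2r// nnegrE (le_trans _ ab).
Qed.

Lemma enorm_ge (x : E) : `|x| <= enorm x.
Proof.
apply: rV_norm_le => [|i]; first exact: sqrtr_ge0.
rewrite -sqrtr_sqr /enorm ler_sqrt /dotp; last first.
  by apply: sumr_ge0 => k _; rewrite -expr2 sqr_ge0.
rewrite (bigD1 i)//= -expr2 lerDl; apply: sumr_ge0 => k _.
by rewrite -expr2 sqr_ge0.
Qed.

Lemma test_bounded (O : set E) phi : test_function O phi ->
  exists2 B : R, 0 <= B & forall x, `|phi x| <= B.
Proof.
move=> [sp [K [cK _ pK]]]; have [M M0 KM] := compact_rV_cube cK.
have [B B0 hB] := continuous_cube_bounded M (smooth_continuous sp).
exists B => // x; have [/KM/hB//|xK] := pselect (K x).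
by rewrite pK// normr0.
Qed.

Lemma test_lipschitz (O : set E) phi : test_function O phi ->
  exists2 L : R, 0 <= L & forall x y, `|phi x - phi y| <= L * `|x - y|.
Proof.
move=> tp; have /choice[B hB] (i : 'I_d) : exists B : R, 0 <= B /\
    forall x, `|pdiff i phi x| <= B.
  by have [B B0 hB] := test_bounded (test_pdiff i tp); exists B.
have B0 i : 0 <= B i by case: (hB i).
exists (d%:R * \sum_i B i); first by rewrite mulr_ge0// sumr_ge0.
apply: pdiff_lipschitz; first exact: sumr_ge0.
  by move=> i x; exact: (smooth_derivable tp.1).
move=> i x; have [_ /(_ x)/le_trans] := hB i; apply.
by rewrite (bigD1 i)//= lerDl sumr_ge0.
Qed.

(** For [x] in a cube around the support, boundedness and the Lipschitz property bound the integrand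
    by a multiple of the kernel at [y - x]. For [x] farther away, only [y] near the support counts
    and [|x - y| >= |x| / 2], so the inner integral is at most a multiple of the kernel at [x],
    which is again integrable. *)
Lemma gagliardo_test (O A : set E) (s : R) phi : 0 < s -> s < 1 -> test_function O phi ->
  (gagliardo A s phi < +oo)%E.
Proof.
move=> s0 s1 tp; have [sp [K [cK KO pK]]] := tp.
have [M' M'0 KM'] := compact_rV_cube cK; pose M : R := M' + 1.
have M1 : 1 <= M by rewrite lerDr.
have M0 : 0 <= M by rewrite (le_trans _ M1).
have pM x : M < `|x| -> phi x = 0.
  move=> xM; apply: pK => /KM' xM'; move: xM; rewrite ltNge => /negP; apply.
  apply: rV_norm_le => // i; have := xM' i; rewrite mxE subr0 => /le_trans; apply.
  by rewrite lerDl.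
have [B B0 hB] := test_bounded tp; have [L L0 hL] := test_lipschitz tp.
(* Covers both bounds of the squared increment, by the Lipschitz constant [L] and by [2 * B]. *)
pose c := L ^+ 2 + 4 * B ^+ 2.
have c0 : 0 <= c by rewrite addr_ge0 ?mulr_ge0 ?sqr_ge0.
pose p := d%:R + 2 * s; have p0 : 0 < p by rewrite ltr_wpDl// mulr_gt0.
have [C C0 hC] := kernel_integrable s0 s1.
have hc x y : (phi x - phi y) ^+ 2 <= c * Num.min (`|x - y| ^+ 2) 1.
  rewrite minr_pMr// le_min mulr1; apply/andP; split.
    apply: le_trans (sqr_le_of_abs (hL x y)) _.
    by rewrite exprMn ler_wpM2r ?sqr_ge0// lerDl mulr_ge0 ?sqr_ge0.
  have h : `|phi x - phi y| <= 2 * B.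
    by rewrite (le_trans (ler_normB _ _))// mulr2n mulrDl mul1r lerD.
  apply: le_trans (sqr_le_of_abs h) _.
  by rewrite exprMn -natrX lerDr sqr_ge0.
pose F x y := (phi x - phi y) ^+ 2 / enorm (x - y) `^ p.
have F0 x y : 0 <= F x y by rewrite divr_ge0 ?sqr_ge0 ?powR_ge0.
have near_bound x y : F x y <= c * kernel p (y - x).
  have [->|xy] := eqVneq x y.
    by rewrite /F subrr expr0n mul0r mulr_ge0 ?kernel_ge0.
  have nxy : 0 < `|x - y| by rewrite normr_gt0 subr_eq0.
  rewrite /F /kernel mulrA distrC ler_pM ?sqr_ge0 ?invr_ge0 ?powR_ge0//.
  rewrite lef_pV2 ?posrE ?powR_gt0//; last exact: lt_le_trans nxy (enorm_ge _).
  by apply: (ge0_ler_powR (ltW p0)); rewrite ?nnegrE ?(le_trans _ (enorm_ge _))// enorm_ge.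
have far_bound x y : 2 * M < `|x| ->
    F x y <= (B ^+ 2 * 2 `^ p * kernel p x) * \1_(cube 0 M) y.
  move=> xM.
  have px : phi x = 0 by apply: pM; apply: le_lt_trans xM; rewrite ler_peMl// ler1n.
  have [yM|yM] := ltP M `|y|.
    rewrite /F px pM// subrr expr0n mul0r mulr_ge0// ?mulr_ge0 ?sqr_ge0 ?powR_ge0 ?kernel_ge0//.
  rewrite indicE mem_set/= ?mulr1; last first.
    by move=> i; rewrite mxE subr0; exact: le_trans (rV_coord_le _ _) yM.
  have x0 : 0 < `|x| by apply: le_lt_trans xM; rewrite mulr_ge0.
  have xy : `|x| / 2 <= `|x - y|.
    have := lerB_dist x y; move: xM yM; lra.
  rewrite /F px sub0r sqrrN /kernel min_r; last first.
    rewrite expr_ge1// ltW// (le_lt_trans _ xM)//; move: M1; lra.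
  rewrite mul1r -mulrA ler_pM ?sqr_ge0 ?invr_ge0 ?powR_ge0//.
    exact: sqr_le_of_abs.
  have -> : 2 `^ p / `|x| `^ p = ((`|x| / 2) `^ p)^-1.
    have -> : `|x| `^ p = 2 `^ p * (`|x| / 2) `^ p.
      by rewrite -powRM ?divr_ge0// mulrC divfK// pnatr_eq0.
    by rewrite invfM mulrA mulfV ?mul1r// gt_eqF// powR_gt0.
  rewrite lef_pV2 ?posrE ?powR_gt0 ?divr_gt0//; last first.
    by apply: lt_le_trans (enorm_ge _); apply: lt_le_trans xy; rewrite divr_gt0.
  apply: (ge0_ler_powR (ltW p0)); rewrite ?nnegrE ?divr_ge0 ?sqrtr_ge0//.
  exact: le_trans xy (enorm_ge _).
pose a := c * C + 1; pose b := B ^+ 2 * 2 `^ p * (2 * M) ^+ d + 1.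
have a0 : 0 <= a by rewrite addr_ge0// mulr_ge0.
have b0 : 0 < b by rewrite ltr_wpDl// ?mulr_ge0 ?sqr_ge0 ?powR_ge0 ?exprn_ge0// mulr_ge0.
have inner x : (\int[leb]_(y in A) (F x y)%:E <=
    b%:E * (kernel p x)%:E + (a * \1_(cube 0 (2 * M)) x)%:E)%E.
  have -> : (\int[leb]_(y in A) (F x y)%:E = \int[leb]_y (((fun y => (F x y)%:E) \_ A) y))%E.
    exact: integral_mkcond.
  have AF y : ((((fun y => (F x y)%:E) \_ A) y) <= (F x y)%:E)%E.
    by rewrite /patch; case: ifPn => // _; rewrite lee_fin.
  have A0 y : (0 <= (((fun y => (F x y)%:E) \_ A) y))%E.
    by rewrite /patch; case: ifPn => // _; rewrite lee_fin.
  have [xM|xM] := leP `|x| (2 * M).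
    rewrite indicE mem_set/= ?mulr1; last first.
      by move=> i; rewrite mxE subr0; exact: le_trans (rV_coord_le _ _) xM.
    apply: (@le_trans _ _ a%:E); last first.
      by rewrite leeDr// mule_ge0 ?lee_fin ?kernel_ge0 ?(ltW b0).
    apply: (@le_trans _ _ (\int[leb]_y (c%:E * (kernel p (y - x))%:E))%E).
      apply: le_nonneg_integral => y _ //; apply: le_trans (AF y) _.
      by rewrite -EFinM lee_fin.
    have [c_0|cn0] := eqVneq c 0.
      by rewrite c_0 integral0_eq ?lee_fin// => y _; rewrite mul0e.
    apply: (@le_trans _ _ (c%:E * \int[leb]_y (kernel p (y - x))%:E)%E).
      apply: integralZ_le => //; last by rewrite lt_neqAle eq_sym cn0.
      by move=> y; rewrite lee_fin kernel_ge0.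
    apply: le_trans (lee_wpmul2l _ (hC x)) _; first by rewrite lee_fin.
    by rewrite -EFinM lee_fin lerDl.
  apply: (@le_trans _ _ (\int[leb]_y ((B ^+ 2 * 2 `^ p * kernel p x) * \1_(cube 0 M) y)%:E)%E).
    by apply: le_nonneg_integral => y _ //; apply: le_trans (AF y) _; rewrite lee_fin far_bound.
  rewrite integral_cube_scale ?mulr_ge0 ?sqr_ge0 ?powR_ge0 ?kernel_ge0//.
  apply: (@le_trans _ _ (b * kernel p x)%:E); last first.
    by rewrite EFinM leeDl// lee_fin mulr_ge0.
  rewrite lee_fin mulrAC ler_wpM2r ?kernel_ge0// lerDl//.
rewrite /gagliardo integral_mkcond.
apply: (@le_lt_trans _ _ (\int[leb]_x (b%:E * (kernel p x)%:E + (a * \1_(cube 0 (2 * M)) x)%:E))%E).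
  apply: le_nonneg_integral => x _.
    by rewrite /patch; case: ifPn => // _; apply: integral_ge0 => y _; rewrite lee_fin; exact: F0.
  rewrite /patch; case: ifPn => _; first exact: inner.
  by rewrite adde_ge0 ?mule_ge0 ?lee_fin ?kernel_ge0 ?(ltW b0)// mulr_ge0.
apply: (@le_lt_trans _ _ (\int[leb]_x (b%:E * (kernel p x)%:E) +
    \int[leb]_x (a * \1_(cube 0 (2 * M)) x)%:E)%E).
  apply: ge0_integral_subadditive => //.
- by move=> x; rewrite mule_ge0 ?lee_fin ?kernel_ge0 ?(ltW b0).
- by move=> x; rewrite lee_fin mulr_ge0.
- apply/measurable_EFinP; apply: measurable_funM => //; apply: measurable_indic; exact: measurable_cube.
rewrite lte_add_pinfty//; last by rewrite integral_cube_scale ?mulr_ge0// ltry.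
apply: (@le_lt_trans _ _ (b%:E * \int[leb]_x (kernel p x)%:E)%E).
  by apply: integralZ_le => // y; rewrite lee_fin kernel_ge0.
have := hC 0; under eq_integral do rewrite subr0.
by move=> h; rewrite lte_mul_pinfty ?lee_fin ?(ltW b0)// (le_lt_trans h)// ltry.
Qed.

End shells.

(** * Semi-inner products and L^2 *)

(* Only semidefinite, as functions that agree a.e. are not identified *)
Record prehilbert {R : realType} {W : lmodType R} (S : set W) (ip : W -> W -> R) : Prop :=
  PreHilbert {
  ph_0 : S 0;
  ph_lin : forall (a : R) x y, S x -> S y -> S (a *: x + y);
  ph_C : forall x y, S x -> S y -> ip x y = ip y x;
  ph_linl : forall (a : R) x y z, S x -> S y -> S z -> ip (a *: x + y) z = a * ip x z + ip y z;
  ph_ge0 : forall x, S x -> 0 <= ip x x;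
  ph_complete : forall u : nat -> W, (forall k, S (u k)) ->
    (forall e : R, 0 < e -> exists N, forall k l, (N <= k)%N -> (N <= l)%N ->
      ip (u k - u l) (u k - u l) <= e) ->
    exists2 x, S x & forall e : R, 0 < e -> exists N, forall k, (N <= k)%N ->
      ip (u k - x) (u k - x) <= e }.

Section prehilbert.
Context {R : realType} {W : lmodType R} (S : set W) (ip : W -> W -> R).
Hypothesis P : prehilbert S ip.
Implicit Types x y z : W.

Definition ip_norm x : R := Num.sqrt (ip x x).

Lemma ph_D x y : S x -> S y -> S (x + y).
Proof. by move=> Sx Sy; rewrite -[x]scale1r; exact: ph_lin P _ _ _ Sx Sy. Qed.

Lemma ph_Z (a : R) x : S x -> S (a *: x).
Proof. by move=> Sx; rewrite -[a *: x]addr0; exact: ph_lin P _ _ _ Sx (ph_0 P). Qed.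

Lemma ph_B x y : S x -> S y -> S (x - y).
Proof. by move=> Sx Sy; apply: ph_D => //; rewrite -scaleN1r; exact: ph_Z. Qed.

Lemma ip_Dl x y z : S x -> S y -> S z -> ip (x + y) z = ip x z + ip y z.
Proof. by move=> Sx Sy Sz; rewrite -{1}[x]scale1r (ph_linl P)// mul1r. Qed.

Lemma ip_0l z : S z -> ip 0 z = 0.
Proof.
by move=> Sz; have := ip_Dl (ph_0 P) (ph_0 P) Sz; rewrite addr0 => /eqP; rewrite -subr_eq0 opprD addNKr oppr_eq0 => /eqP.
Qed.

Lemma ip_Zl (a : R) x z : S x -> S z -> ip (a *: x) z = a * ip x z.
Proof.
by move=> Sx Sz; rewrite -[a *: x]addr0 (ph_linl P) ?ip_0l ?addr0//; exact: ph_0 P.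
Qed.

Lemma ip_Bl x y z : S x -> S y -> S z -> ip (x - y) z = ip x z - ip y z.
Proof.
move=> Sx Sy Sz; rewrite -scaleN1r ip_Dl ?ip_Zl//; last exact: ph_Z.
by rewrite mulN1r.
Qed.

Lemma ip_Dr x y z : S x -> S y -> S z -> ip x (y + z) = ip x y + ip x z.
Proof.
move=> Sx Sy Sz; rewrite (ph_C P Sx (ph_D Sy Sz)) ip_Dl//.
by rewrite (ph_C P Sy Sx) (ph_C P Sz Sx).
Qed.

Lemma ip_Zr (a : R) x z : S x -> S z -> ip x (a *: z) = a * ip x z.
Proof. by move=> Sx Sz; rewrite (ph_C P Sx (ph_Z a Sz)) ip_Zl// (ph_C P Sz Sx). Qed.

Lemma ip_Br x y z : S x -> S y -> S z -> ip x (y - z) = ip x y - ip x z.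
Proof.
move=> Sx Sy Sz; rewrite -scaleN1r ip_Dr ?ip_Zr//; last exact: ph_Z.
by rewrite mulN1r.
Qed.

Lemma ip_sqrD x y : S x -> S y -> ip (x + y) (x + y) = ip x x + 2 * ip x y + ip y y.
Proof.
move=> Sx Sy; have Sxy := ph_D Sx Sy.
by rewrite ip_Dl// !ip_Dr// (ph_C P Sy Sx); ring.
Qed.

Lemma ip_sqrB x y : S x -> S y -> ip (x - y) (x - y) = ip x x - 2 * ip x y + ip y y.
Proof.
move=> Sx Sy; have Sxy := ph_B Sx Sy.
by rewrite ip_Bl// !ip_Br// (ph_C P Sy Sx); ring.
Qed.

Lemma ip_norm_ge0 x : 0 <= ip_norm x.
Proof. exact: sqrtr_ge0. Qed.

Lemma ip_norm_sqr x : S x -> ip_norm x ^+ 2 = ip x x.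
Proof. by move=> Sx; rewrite sqr_sqrtr// (ph_ge0 P). Qed.

Lemma ip_norm_le x (a : R) : S x -> 0 <= a -> (ip_norm x <= a) = (ip x x <= a ^+ 2).
Proof.
by move=> Sx a0; rewrite -(ip_norm_sqr Sx) ler_pXn2r// nnegrE ip_norm_ge0.
Qed.

(** The quadratic polynomial [t |-> ip (x + t y) (x + t y)] is nonnegative. When [ip y y = 0] it is
    affine in [t], which forces [ip x y = 0]. *)
Lemma ip_cauchy_schwarz x y : S x -> S y -> `|ip x y| <= ip_norm x * ip_norm y.
Proof.
move=> Sx Sy; rewrite /ip_norm -sqrtrM ?(ph_ge0 P)// -sqrtr_sqr ler_sqrt ?mulr_ge0 ?(ph_ge0 P)//.
have key (t : R) : 0 <= ip x x + 2 * t * ip x y + t ^+ 2 * ip y y.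
  have := ph_ge0 P (ph_D Sx (ph_Z t Sy)).
  by rewrite ip_sqrD ?ip_Zr ?ip_Zl//; try exact: ph_Z; rewrite mulrA expr2 mulrA.
have [y0|yn] := eqVneq (ip y y) 0.
  have [->|xy] := eqVneq (ip x y) 0; first by rewrite expr0n mulr_ge0 ?(ph_ge0 P).
  have := key (- (ip x x + 1) / (2 * ip x y)).
  rewrite y0 mulr0 addr0; set c := ip x y in xy *.
  rewrite (_ : 2 * _ * c = - (ip x x + 1)); last by field.
  by move=> h; exfalso; move: h; lra.
have y0 : 0 < ip y y by rewrite lt_neqAle eq_sym yn (ph_ge0 P).
have := key (- ip x y / ip y y).
rewrite (_ : _ + _ = ip x x - ip x y ^+ 2 / ip y y); last by field.
by rewrite subr_ge0 ler_pdivrMr.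
Qed.

Lemma ip_normD x y : S x -> S y -> ip_norm (x + y) <= ip_norm x + ip_norm y.
Proof.
move=> Sx Sy; rewrite ip_norm_le ?addr_ge0 ?ip_norm_ge0//; last exact: ph_D.
rewrite ip_sqrD// sqrrD !ip_norm_sqr// lerD2r lerD2l mulr_natl mulr2n.
by rewrite -mulr2n ler_pMn2r// (le_trans (ler_norm _))// ip_cauchy_schwarz.
Qed.

Lemma ip_normZ (a : R) x : S x -> ip_norm (a *: x) = `|a| * ip_norm x.
Proof.
move=> Sx; rewrite /ip_norm ip_Zl ?ip_Zr//; last exact: ph_Z.
by rewrite mulrA -expr2 sqrtrM ?sqr_ge0// sqrtr_sqr.
Qed.

Lemma ip_normN x : S x -> ip_norm (- x) = ip_norm x.
Proof. by move=> Sx; rewrite -scaleN1r ip_normZ// normrN1 mul1r. Qed.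

Lemma ip_normB x y : S x -> S y -> ip_norm (x - y) <= ip_norm x + ip_norm y.
Proof.
move=> Sx Sy; rewrite -[leRHS](congr1 _ (ip_normN Sy)) ip_normD//.
by rewrite -scaleN1r; exact: ph_Z.
Qed.

Lemma ip_norm0 : ip_norm 0 = 0.
Proof. by rewrite /ip_norm ip_0l ?sqrtr0//; exact: ph_0 P. Qed.

Lemma ip_norm_dist x y z : S x -> S y -> S z ->
  ip_norm (x - z) <= ip_norm (x - y) + ip_norm (y - z).
Proof.
move=> Sx Sy Sz; rewrite (_ : x - z = (x - y) + (y - z)); last by rewrite addrA subrK.
by apply: ip_normD; exact: ph_B.
Qed.

Lemma ip_norm_distC x y : S x -> S y -> ip_norm (x - y) = ip_norm (y - x).
Proof. by move=> Sx Sy; rewrite -opprB ip_normN//; exact: ph_B. Qed.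

(* Banach-Saks: the near-minimal convex combinations of the tails are Cauchy. *)
Lemma ip_weak_limit (h : nat -> W) (B : R) : (forall k, S (h k)) ->
  (forall k, ip (h k) (h k) <= B) ->
  exists p x, [/\ forall k, midhull (tail h k) (p k), forall k, S (p k), S x,
    ip x x <= B &
    forall e : R, 0 < e -> exists N, forall k, (N <= k)%N -> ip_norm (p k - x) <= e].
Proof.
move=> Sh hB.
pose Phi x : R := if `[< S x >] then ip x x else 0.
have PhiE x : S x -> Phi x = ip x x by move=> Sx; rewrite /Phi; case: asboolP.
have Phi0 x : 0 <= Phi x by rewrite /Phi; case: asboolP => // /(ph_ge0 P).
have PhiB k : Phi (h k) <= B by rewrite PhiE.
have Smid x y : S x -> S y -> S (mid x y) by move=> Sx Sy; apply: ph_Z; exact: ph_D.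
have midE x y : S x -> S y -> 2^-1 * (ip x x + ip y y) - ip (mid x y) (mid x y) =
    2^-1 ^+ 2 * ip (x - y) (x - y).
  move=> Sx Sy; have Sxy := ph_D Sx Sy; rewrite /mid ip_Zl ?ip_Zr//; last exact: ph_Z.
  by rewrite ip_sqrD// ip_sqrB//; field.
have [p [ph pgap]] := midhull_minimizing Phi0 PhiB.
have Sp k : S (p k).
  by have := ph k; apply: midhull_sub => [_ [l _ <-]|]; [exact: Sh|exact: Smid].
have pB k : ip (p k) (p k) <= B.
  suff [] : S (p k) /\ ip (p k) (p k) <= B by [].
  have := ph k; apply: (@midhull_sub _ _ _ [set x | S x /\ ip x x <= B]).
    by move=> _ [l _ <-].
  move=> x y /= [Sx xB] [Sy yB]; split; first exact: Smid.
  have := midE x y Sx Sy; have := ph_ge0 P (ph_B Sx Sy).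
  move: xB yB; set a := ip (x - y) _; move: (ip x x) (ip y y) (ip (mid x y) _) => b c f.
  by move=> h1 h2 h3 h4; lra.
have [|x Sx xP] := ph_complete P Sp.
  move=> e e0; have e4 : 0 < 2^-1 ^+ 2 * e by rewrite mulr_gt0// exprn_gt0// invr_gt0.
  have [N hN] := pgap _ e4; exists N => k l Nk Nl.
  have := hN k l Nk Nl; rewrite !PhiE ?midE//; last exact: Smid.
  by rewrite ltr_pM2l ?exprn_gt0 ?invr_gt0// => /ltW.
have px (e : R) : 0 < e -> exists N, forall k, (N <= k)%N -> ip_norm (p k - x) <= e.
  move=> e0; have [|N hN] := xP (e ^+ 2); first by rewrite exprn_gt0.
  by exists N => k /hN h1; rewrite ip_norm_le ?(ltW e0)//; exact: ph_B.
exists p, x; split => //.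
have B0 : 0 <= B by rewrite (le_trans _ (hB 0%N))// (ph_ge0 P).
rewrite -(sqr_sqrtr B0) -ip_norm_le ?sqrtr_ge0//.
apply/ler_addgt0Pr => e /px [N hN].
rewrite (_ : x = p N - (p N - x)); last by rewrite opprB addrC subrK.
rewrite (le_trans (ip_normB _ _))//; first exact: ph_B.
rewrite lerD ?hN// ip_norm_le ?sqrtr_ge0// sqr_sqrtr//.
Qed.

Lemma midhull_functional_limit (L : W -> R) (h p : nat -> W) (l : R) :
  (forall x y, S x -> S y -> L (mid x y) = mid (L x : R^o) (L y)) ->
  (forall k, S (h k)) -> (forall k, midhull (tail h k) (p k)) ->
  (forall e : R, 0 < e -> exists N, forall k, (N <= k)%N -> `|L (h k) - l| <= e) ->
  forall e : R, 0 < e -> exists N, forall k, (N <= k)%N -> `|L (p k) - l| <= e.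
Proof.
move=> Lmid Sh ph hl e /hl [N hN]; exists N => k Nk.
suff [] : S (p k) /\ `|L (p k) - l| <= e by [].
have : midhull (tail h N) (p k) by apply: midhullS (ph k); exact: tailS.
apply: (@midhull_sub _ _ _ [set x | S x /\ `|L x - l| <= e]).
  by move=> _ [n /= Nn <-]; split; [exact: Sh|exact: hN].
move=> x y /= [Sx xl] [Sy yl]; split; first by apply: ph_Z; exact: ph_D.
rewrite Lmid// /mid (_ : _ - l = 2^-1 * ((L x - l) + (L y - l))); last first.
  by rewrite -[_ *: _]/(_ * _); field.
rewrite normrM gtr0_norm ?invr_gt0// ler_pdivrMl// mulr_natl mulr2n.
by rewrite (le_trans (ler_normD _ _))// lerD.
Qed.

End prehilbert.

(** * Completeness of L^2 *)

Section riesz_fischer.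
Context {dd} {T : measurableType dd} {R : realType}.
Variables (mu : {measure set T -> \bar R}) (D : set T) (mD : measurable D).
Local Notation sq g := (\int[mu]_(x in D) ((g x) ^+ 2)%:E)%E.

Lemma geometric_increments_cvg (y : nat -> R) (c r : R) : 0 <= c -> 0 <= r -> r < 1 ->
  (forall k, `|y k.+1 - y k| <= c * r ^+ k) -> cvgn y.
Proof.
move=> c0 r0 r1 yc.
have : cvgn (series (telescope y)).
  apply: normed_cvg; apply: (@series_le_cvg _ _ (geometric c r)) => //.
  - by move=> k /=.
  - by move=> k; rewrite /geometric /= mulr_ge0// exprn_ge0.
  - by apply: is_cvg_geometric_series; rewrite ger0_norm.
rewrite telescopeK => h.
have yE : y = (fun k => (y k - y 0%N) + y 0%N) by apply/funext => k; rewrite subrK.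
by rewrite yE; apply: is_cvgD; [exact: h|exact: is_cvg_cst].
Qed.

Lemma measurable_sq (g : T -> R) : measurable_fun D g -> measurable_fun D (fun x => ((g x) ^+ 2)%:E).
Proof. by move=> mg; apply/measurable_EFinP; exact: measurable_funX. Qed.

(** Squared increments of integral at most [8^-k], weighted by [4^k], sum to an integrable function
    [S]; where [S] is finite, the increments are at most its root times [2^-k]. *)
Lemma cauchy_subsequence (g : nat -> T -> R) : (forall n, measurable_fun D (g n)) ->
  (forall e : R, 0 < e -> exists N, forall k l, (N <= k)%N -> (N <= l)%N ->
    (sq (fun x => g k x - g l x) <= e%:E)%E) ->
  exists n : nat -> nat, (forall k, (k <= n k)%N) /\
    {ae mu, forall x, D x -> cvgn (fun k => g (n k) x)}.
Proof.
move=> mg cg.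
have /choice[N NP] (k : nat) : exists N, forall m l, (N <= m)%N -> (N <= l)%N ->
    (sq (fun x => g m x - g l x) <= (8^-1 ^+ k)%:E)%E.
  by apply: cg; rewrite exprn_gt0// invr_gt0.
pose n k := (k + \sum_(i < k.+1) N i)%N.
have nN k : (N k <= n k)%N by rewrite /n big_ord_recr/= addnA leq_addl.
have nS k : (n k <= n k.+1)%N.
  by rewrite /n [X in (_ <= _ + X)%N]big_ord_recr/= leq_add// leq_addr.
exists n; split; first by move=> k; rewrite leq_addr.
pose f k x := (4 ^+ k * (g (n k.+1) x - g (n k) x) ^+ 2)%:E.
have f0 k x : (0 <= f k x)%E by rewrite /f lee_fin mulr_ge0 ?sqr_ge0// exprn_ge0.
have mf k : measurable_fun D (f k).
  apply/measurable_EFinP; apply: measurable_funM => //.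
  by apply: measurable_funX; exact: measurable_funB.
have If k : (\int[mu]_(x in D) f k x <= (2^-1 ^+ k)%:E)%E.
  rewrite /f; under eq_integral do rewrite EFinM.
  rewrite ge0_integralZl_EFin ?exprn_ge0//; last 2 first.
    by move=> x _; rewrite lee_fin sqr_ge0.
    by apply: measurable_sq; exact: measurable_funB.
  have := NP k (n k.+1) (n k) (leq_trans (nN k) (nS k)) (nN k).
  move=> /(@lee_wpmul2l _ (4 ^+ k)%:E); rewrite lee_fin exprn_ge0// => /(_ isT) /le_trans; apply.
  rewrite -EFinM lee_fin -exprMn (_ : 4 / 8 = 2^-1)//.
  by field.
pose S x := (\sum_(k <oo) f k x)%E.
have mS : measurable_fun D S.
  by apply: ge0_emeasurable_sum => // k x _ _; exact: f0.
have S0 x : (0 <= S x)%E by apply: nneseries_ge0 => k _ _; exact: f0.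
have IS : (\int[mu]_(x in D) S x <= 2%:E)%E.
  rewrite integral_nneseries//.
  apply: lime_le; first by apply: is_cvg_nneseries => k _ _; exact: integral_ge0.
  apply: nearW => k; apply: (@le_trans _ _ (2 - 2 * 2^-1 ^+ k)%:E); last first.
    by rewrite lee_fin lerBlDr lerDl mulr_ge0// exprn_ge0.
  elim: k => [|k IH]; first by rewrite big_nil expr0 mulr1 subrr.
  rewrite big_nat_recr//=; apply: le_trans (leeD IH (If k)) _.
  rewrite -EFinD lee_fin exprS (mulrA 2) mulfV// mul1r.
  by move: (2^-1 ^+ k) => z; lra.
have iS : mu.-integrable D S.
  apply/integrableP; split => //.
  by under eq_integral do rewrite gee0_abs//; exact: le_lt_trans IS (ltry _).
have [M [mM M0 hM]] := integrable_ae mD iS.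
exists M; split=> // x /= hx; apply: hM => /= h; apply: hx => Dx.
have [s s0 Ss] : exists2 s : R, 0 <= s & S x = s%:E.
  by have := h Dx; have := S0 x; case: (S x) => // s s0 _; exists s.
apply: (@geometric_increments_cvg _ (Num.sqrt s) 2^-1); rewrite ?sqrtr_ge0 ?invr_ge0 ?invf_lt1 ?ltr1n//.
move=> k; have : (f k x <= S x)%E.
  rewrite /S (@nneseriesD1 _ _ k) ?leeDl//.
  by apply: nneseries_ge0 => l _ _; exact: f0.
rewrite Ss lee_fin => fs.
have -> : Num.sqrt s * 2^-1 ^+ k = Num.sqrt (s / 4 ^+ k).
  rewrite sqrtrM//; congr (_ * _).
  rewrite -exprVn (_ : 4^-1 = 2^-1 ^+ 2); last by field.
  by rewrite -exprM mulnC exprM sqrtr_sqr ger0_norm// exprn_ge0// invr_ge0.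
rewrite -sqrtr_sqr ler_sqrt ?divr_ge0 ?exprn_ge0//.
by rewrite ler_pdivlMr ?exprn_gt0// mulrC.
Qed.

(** The upper limit of the subsequence is measurable and is a.e. its limit; Fatou's lemma transfers
    the Cauchy bound to it. *)
Lemma riesz_fischer (g : nat -> T -> R) : (forall n, measurable_fun D (g n)) ->
  (forall e : R, 0 < e -> exists N, forall k l, (N <= k)%N -> (N <= l)%N ->
    (sq (fun x => g k x - g l x) <= e%:E)%E) ->
  exists2 f : T -> R, measurable_fun D f &
    forall e : R, 0 < e -> exists N, forall k, (N <= k)%N ->
    (sq (fun x => g k x - f x) <= e%:E)%E.
Proof.
move=> mg cg; have [n [nk ng]] := cauchy_subsequence mg cg.
pose f x := fine (limn_esup (fun k => (g (n k) x)%:E)).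
have mf : measurable_fun D f.
  apply: (@measurableT_comp _ _ _ _ _ _ fine) => //.
  by apply: measurable_fun_limn_esup => k; apply/measurable_EFinP.
exists f => // e /cg [N hN]; exists N => k Nk.
apply: (@le_trans _ _ (\int[mu]_(x in D) limn_einf (fun l => ((g k x - g (n l) x) ^+ 2)%:E))%E).
  apply: ae_le_nonneg_integral => [x _|x _|]; first by rewrite lee_fin sqr_ge0.
    rewrite limn_einf_lim (cvg_lim _ (@cvg_einfs_sup _ _))//.
    apply: (@le_trans _ _ (einfs (fun l => ((g k x - g (n l) x) ^+ 2)%:E) 0%N)).
      by apply: le_ereal_inf_tmp => _ [l _ <-]; rewrite lee_fin sqr_ge0.
    by apply: ereal_sup_ubound; exists 0%N.
  case: ng => M [mM M0 hM]; exists M; split=> // x /= hx; apply: hM => /= cv.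
  apply: hx => Dx; have cvx := cv Dx.
  have ce : (g (n l) x)%:E @[l --> \oo] --> (limn (fun l => g (n l) x))%:E.
    by apply: cvg_EFin; [exact: nearW|exact: cvx].
  have fE : f x = limn (fun l => g (n l) x).
    by rewrite /f is_cvg_limn_esupE ?(cvg_lim _ ce)//; apply/cvg_ex; eexists; exact: ce.
  have cq : ((g k x - g (n l) x) ^+ 2)%:E @[l --> \oo] --> ((g k x - f x) ^+ 2)%:E.
    apply: cvg_EFin; first exact: nearW.
    rewrite fE; apply: cvgM; apply: cvgB => //; exact: cvg_cst.
  rewrite is_cvg_limn_einfE ?(cvg_lim _ cq)//; apply/cvg_ex; eexists; exact: cq.
apply: (@le_trans _ _ (limn_einf (fun l => sq (fun x => g k x - g (n l) x)))).
  apply: fatou => // [l|l x _]; last by rewrite lee_fin sqr_ge0.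
  by apply: measurable_sq; exact: measurable_funB.
rewrite limn_einf_lim (cvg_lim _ (@cvg_einfs_sup _ _))//.
apply: ge_ereal_sup => _ [l _ <-].
apply: (@le_trans _ _ (sq (fun x => g k x - g (n (maxn l N)) x))).
  by apply: ereal_inf_lbound; exists (maxn l N) => //=; rewrite leq_maxl.
apply: hN => //; apply: leq_trans (nk _); exact: leq_maxr.
Qed.

End riesz_fischer.

(** * Finite families of L^2 functions *)

Section L2_families.
Context {R : realType} {d : nat}.
Local Notation E := 'rV[R]_d.
Local Notation leb := (@rV_lebesgue R d).
Variables (A : set E) (mA : measurable A).

Lemma L2_mul_integrable (g h : E -> R) : L2 A g -> L2 A h ->
  leb.-integrable A (fun x => (g x * h x)%:E).
Proof.
move=> [mg fg] [mh fh]; apply/integrableP; split.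
  by apply/measurable_EFinP; exact: measurable_funM.
apply: (@le_lt_trans _ _ (\int[leb]_(x in A) (((g x) ^+ 2)%:E + ((h x) ^+ 2)%:E))%E).
  apply: le_nonneg_integral => x _ //; rewrite /= -EFinD lee_fin normrM.
  have := sqr_ge0 (`|g x| - `|h x|); rewrite sqrrB !real_normK ?num_real//.
  by move=> h1; have := sqr_ge0 (g x); have := sqr_ge0 (h x); move: h1; lra.
rewrite ge0_integralD//; last 4 first.
- by move=> x _; rewrite lee_fin sqr_ge0.
- by apply/measurable_EFinP; exact: measurable_funX.
- by move=> x _; rewrite lee_fin sqr_ge0.
- by apply/measurable_EFinP; exact: measurable_funX.
exact: lte_add_pinfty.
Qed.

Lemma L2_lin (a : R) (g h : E -> R) : L2 A g -> L2 A h -> L2 A (fun x => a * g x + h x).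
Proof.
move=> [mg fg] [mh fh]; split.
  by apply: measurable_funD => //; exact: measurable_funM.
apply: (@le_lt_trans _ _ (\int[leb]_(x in A)
    ((2 * a ^+ 2)%:E * ((g x) ^+ 2)%:E + 2%:E * ((h x) ^+ 2)%:E))%E).
  apply: le_nonneg_integral => x _; first by rewrite lee_fin sqr_ge0.
  rewrite -!EFinM -EFinD lee_fin.
  by have := sqr_ge0 (a * g x - h x); rewrite sqrrB sqrrD exprMn; lra.
have m1 : measurable_fun A (fun x => ((g x) ^+ 2)%:E).
  by apply/measurable_EFinP; exact: measurable_funX.
have m2 : measurable_fun A (fun x => ((h x) ^+ 2)%:E).
  by apply/measurable_EFinP; exact: measurable_funX.
rewrite ge0_integralD//; last 4 first.
- move=> x _; rewrite -EFinM lee_fin; apply: mulr_ge0; rewrite ?sqr_ge0//.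
  by apply: mulr_ge0; rewrite ?sqr_ge0.
- exact: measurable_funeM.
- by move=> x _; rewrite -EFinM lee_fin; apply: mulr_ge0; rewrite ?sqr_ge0.
- exact: measurable_funeM.
rewrite !ge0_integralZl_EFin//; last 3 first.
- by move=> x _; rewrite lee_fin sqr_ge0.
- by move=> x _; rewrite lee_fin sqr_ge0.
- by apply: mulr_ge0; rewrite ?sqr_ge0.
have a0 : 0 <= 2 * a ^+ 2 by apply: mulr_ge0; rewrite ?sqr_ge0.
by rewrite lte_add_pinfty// lte_mul_pinfty.
Qed.

Lemma L2_0 : L2 A (cst 0).
Proof.
split; first exact: measurable_cst.
rewrite /sqL2 integral0_eq ?ltry// => x _.
by rewrite /cst expr0n.
Qed.

Lemma sqL2E (g : E -> R) : L2 A g -> sqL2 A g = (\int[leb]_(x in A) (g x * g x))%:E.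
Proof.
move=> Lg; have I := L2_mul_integrable Lg Lg.
by rewrite /Rintegral fineK ?integrable_fin_num// /sqL2; apply: eq_integral => x _; rewrite expr2.
Qed.

Section families.
Context {J : finType}.
Local Notation W := (J -> E -> R^o).

(** One notion covers scalar functions ([J] is [unit]), vector fields (['I_d]) and vector fields
    together with their derivatives. *)
Definition L2F : set W := [set h | forall i, L2 A (h i)].

Definition ipL2 (h k : W) : R := \sum_i \int[leb]_(x in A) (h i x * k i x).

Lemma ipL2_diag (h : W) : L2F h -> (ipL2 h h)%:E = (\sum_i sqL2 A (h i))%E.
Proof. by move=> Lh; rewrite /ipL2 -sumEFin; apply: eq_bigr => i _; rewrite sqL2E. Qed.

Lemma ipL2_ge0 (h : W) : 0 <= ipL2 h h.
Proof.
apply: sumr_ge0 => i _; apply: Rintegral_ge0 => x _.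
by rewrite -expr2 sqr_ge0.
Qed.

Lemma L2_prehilbert : prehilbert L2F ipL2.
Proof.
have lin (a : R) (x y : W) : L2F x -> L2F y -> L2F (a *: x + y).
  by move=> Sx Sy i; exact: L2_lin.
split => //.
- by move=> i; exact: L2_0.
- by move=> x y _ _; apply: eq_bigr => i _; apply: eq_Rintegral => t _; rewrite mulrC.
- move=> a x y z Sx Sy Sz; rewrite /ipL2 mulr_sumr -big_split/=; apply: eq_bigr => i _.
  rewrite -RintegralZl//; last exact: L2_mul_integrable.
  rewrite -RintegralD//; last 2 first.
    rewrite (_ : EFin \o _ = fun t => (a%:E * (x i t * z i t)%:E)%E)//.
    by apply: integrableZl => //; exact: L2_mul_integrable.
    exact: L2_mul_integrable.
  by apply: eq_Rintegral => t _; rewrite mulrA -mulrDl.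
- by move=> x _; exact: ipL2_ge0.
move=> u Su cu.
have subS (x y : W) : L2F x -> L2F y -> L2F (x - y).
  by move=> Sx Sy i; have := lin (-1) y x Sy Sx i; rewrite scaleN1r addrC.
have sq_le (x : W) i (e : R) : L2F x -> ipL2 x x <= e -> (sqL2 A (x i) <= e%:E)%E.
  move=> Sx xe; rewrite (sqL2E (Sx i)) lee_fin; apply: le_trans xe.
  rewrite /ipL2 (bigD1 i)//= lerDl; apply: sumr_ge0 => l _; apply: Rintegral_ge0 => t _.
  by rewrite -expr2 sqr_ge0.
have /choice[f fP] (i : J) : exists f : E -> R, measurable_fun A f /\
    forall e : R, 0 < e -> exists N, forall k, (N <= k)%N ->
    (sqL2 A (fun x => (u k i x - f x)%R) <= e%:E)%E.
  have [||f mf fP] := @riesz_fischer _ _ R leb A mA (fun k => u k i); last by exists f.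
    by move=> k; exact: (Su k i).1.
  move=> e /cu [N hN]; exists N => k l Nk Nl.
  exact: (sq_le _ i e (subS _ _ (Su k) (Su l)) (hN k l Nk Nl)).
have Sf : L2F f.
  move=> i; have [mf fi] := fP i; have [N hN] := fi 1 ltr01.
  have L1 : L2 A (fun x => u N i x - f i x).
    split; first by apply: measurable_funB => //; exact: (Su N i).1.
    by rewrite (le_lt_trans (hN N (leqnn N)))// ltry.
  have := L2_lin (-1) L1 (Su N i).
  by rewrite (_ : (fun x => _) = f i)//; apply/funext => x; rewrite mulN1r opprB subrK.
exists f => // e e0.
have e1 : 0 < e / (#|J|.+1%:R) by rewrite divr_gt0.
have /choice[N NP] (i : J) : exists N, forall k, (N <= k)%N ->
    (sqL2 A (fun x => (u k i x - f i x)%R) <= (e / (#|J|.+1%:R))%:E)%E.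
  by have [_ fi] := fP i; exact: fi.
exists (\max_i N i) => k Nk; rewrite -lee_fin ipL2_diag; last exact: subS.
apply: (@le_trans _ _ (\sum_(i : J) (e / (#|J|.+1%:R))%:E)%E).
  by apply: lee_sum => i _; apply: NP; apply: leq_trans Nk; exact: leq_bigmax.
rewrite sumEFin lee_fin sumr_const -[leRHS](@divfK _ #|J|.+1%:R) ?pnatr_eq0//.
by rewrite -[leLHS]mulr_natr ler_wpM2l ?ler_nat ?max_card ?ltW// cardT ltnW.
Qed.

End families.

Definition fam (f : E -> E) : 'I_d -> E -> R^o := fun i => component i f.

Lemma famB (f g : E -> E) : fam (f \- g) = fam f - fam g.
Proof. by apply/funext => i; apply/funext => x; rewrite /fam /component !mxE. Qed.

Lemma fam_lin (a : R) (f g : E -> E) : fam (a \*: f \+ g) = a *: fam f + fam g.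
Proof. by apply/funext => i; apply/funext => x; rewrite /fam /component !mxE. Qed.

Lemma L2_normE (f : E -> E) : L2v A f -> L2_norm A f = (ip_norm ipL2 (fam f))%:E.
Proof.
move=> Lf; rewrite /L2_norm -(ipL2_diag (h := fam f))// poweR_EFin.
by rewrite powR12_sqrt// ipL2_ge0.
Qed.

Lemma L2_innerE (f g : E -> E) : L2v A f -> L2v A g ->
  L2_inner A f g = ipL2 (fam f) (fam g).
Proof.
move=> Lf Lg; rewrite /L2_inner /ipL2 /dotp.
have I i : leb.-integrable A (fun x => (fam f i x * fam g i x)%:E).
  exact: (L2_mul_integrable (Lf i) (Lg i)).
have {1}-> : (fun x => \sum_(i < d) f x ord0 i * g x ord0 i) =
    (fun x => \sum_(i < d) fam f i x * fam g i x) by [].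
elim: (index_enum _) => [|i s IH].
  under eq_Rintegral do rewrite big_nil.
  by rewrite big_nil /Rintegral integral0.
under eq_Rintegral do rewrite big_cons.
rewrite big_cons RintegralD ?IH//; try exact: I.
elim: s {IH} => [|k s IH].
  rewrite (_ : EFin \o _ = cst 0%E); first exact: integrable0.
  by apply/funext => x /=; rewrite big_nil.
rewrite (_ : EFin \o _ = (fun x => (fam f k x * fam g k x)%:E + (\sum_(j <- s) fam f j x * fam g j x)%:E)%E).
  exact: integrableD.
by apply/funext => x /=; rewrite big_cons.
Qed.

End L2_families.

(** * The spaces H and V in the dual of U *)

(* [D v] stacks the components of [v], at the indices [sg i], with further functions
   of [v]; the closure in L^2 of the [D v] is H if there are none, and V if they are
   the first derivatives. *)
Section closure_of_tests.
Context {R : realType} {d : nat}.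
Local Notation E := 'rV[R]_d.
Local Notation leb := (@rV_lebesgue R d).
Variables (O : set E) (mO : measurable O).
Context {J : finType}.
Local Notation W := (J -> E -> R^o).
Variables (D : (E -> E) -> W) (sg : 'I_d -> J).
Local Notation test := (div_free_test O).
Hypotheses (sg_inj : injective sg)
  (D_lin : forall (a : R) v w, test v -> test w -> D (a \*: v \+ w) = a *: D v + D w)
  (test_lin : forall (a : R) v w, test v -> test w -> test (a \*: v \+ w))
  (D_L2 : forall v, test v -> L2F O (D v))
  (D_base : forall v, test v -> forall i, D v (sg i) = component i v).
Local Notation ip := (ipL2 O).
Local Notation nrm := (ip_norm (ipL2 O)).
Let PH {J' : finType} : prehilbert (@L2F R d O J') (@ipL2 R d O J') := L2_prehilbert mO.

Definition test_closure : set W :=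
  [set h | L2F O h /\ forall e : R, 0 < e -> exists2 v, test v & nrm (h - D v) <= e].

Definition base (h : W) : 'I_d -> E -> R^o := fun i => h (sg i).

Lemma base_L2 h : L2F O h -> L2F O (base h).
Proof. by move=> Lh i; exact: Lh. Qed.

Lemma base_lin (a : R) h k : base (a *: h + k) = a *: base h + base k.
Proof. by []. Qed.

Lemma base_norm_le h : nrm (base h) <= nrm h.
Proof.
apply: ler_wsqrtr; rewrite /ipL2.
rewrite -(big_imset (fun i => \int[leb]_(x in O) (h i x * h i x)) (in2W sg_inj)) /=.
rewrite [leRHS](bigID (mem (sg @: predT)))/= lerDl; apply: sumr_ge0 => i _.
by apply: Rintegral_ge0 => x _; rewrite -expr2 sqr_ge0.
Qed.

Lemma test_closure_D v : test v -> test_closure (D v).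
Proof.
move=> tv; split; first exact: D_L2.
by move=> e e0; exists v => //; rewrite subrr (ip_norm0 PH) ltW.
Qed.

Lemma test_closure_lin (a : R) h k : test_closure h -> test_closure k ->
  test_closure (a *: h + k).
Proof.
move=> [Lh hP] [Lk kP]; split; first exact: (ph_lin PH).
move=> e e0; have a1 : 0 < `|a| + 1 by rewrite ltr_wpDl.
have [v tv hv] := hP _ (divr_gt0 (divr_gt0 e0 (ltr0n _ 2)) a1).
have [w tw kw] := kP _ (divr_gt0 e0 (ltr0n _ 2)).
exists (a \*: v \+ w); first exact: test_lin.
have Lhv := ph_B PH Lh (D_L2 tv); have Lkw := ph_B PH Lk (D_L2 tw).
rewrite D_lin// (_ : _ - _ = a *: (h - D v) + (k - D w)); last first.
  by rewrite scalerBr opprD addrACA.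
rewrite (le_trans (ip_normD PH _ Lkw))//; first exact: (ph_Z PH).
rewrite (ip_normZ PH)// [leRHS]splitr lerD//.
apply: (@le_trans _ _ ((`|a| + 1) * nrm (h - D v))).
  by rewrite ler_wpM2r ?ip_norm_ge0// lerDl.
by rewrite mulrC -ler_pdivlMr.
Qed.

Lemma test_closure_closed h : L2F O h ->
  (forall e : R, 0 < e -> exists2 k, test_closure k & nrm (k - h) <= e) -> test_closure h.
Proof.
move=> Lh hP; split => // e e0; have e2 : 0 < e / 2 by rewrite divr_gt0.
have [k [Lk kP] kh] := hP _ e2; have [v tv kv] := kP _ e2; exists v => //.
rewrite (le_trans (ip_norm_dist PH Lh Lk (D_L2 tv)))// [leRHS]splitr lerD//.
by rewrite (ip_norm_distC PH).
Qed.

(** Linear relations between the members of the [D v] are orthogonality relations, and these pass to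
    the closure. *)
Lemma test_closure_orth h k : test_closure h -> L2F O k ->
  (forall v, test v -> ip (D v) k = 0) -> ip h k = 0.
Proof.
move=> [Lh hP] Lk h0; apply/eqP; rewrite -normr_le0; apply/ler_addgt0Pr => e e0.
have k1 : 0 < nrm k + 1 by rewrite ltr_wpDl// ip_norm_ge0.
have [v tv hv] := hP _ (divr_gt0 e0 k1); rewrite add0r.
have -> : ip h k = ip (h - D v) k by rewrite (ip_Bl PH) ?h0 ?subr0//; exact: D_L2.
have Lhv := ph_B PH Lh (D_L2 tv).
rewrite (le_trans (ip_cauchy_schwarz PH Lhv Lk))//.
apply: (@le_trans _ _ (nrm (h - D v) * (nrm k + 1))).
  by rewrite ler_wpM2l ?ip_norm_ge0// lerDl.
by rewrite -ler_pdivlMr.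
Qed.

Context {U : normedModType R} (j : U -> E -> E).
Hypothesis jL2 : forall u, L2v O (j u).

(** Only the base components act on [U]; the other members of [h] record derivatives. *)
Definition represents (x : dual U) (h : W) : Prop := forall u, x u = ip (base h) (fam (j u)).

Lemma represents_lin (a : R) x y h k : L2F O h -> L2F O k -> represents x h ->
  represents y k -> represents (a *: x + y) (a *: h + k).
Proof.
move=> Lh Lk xh yk u; rewrite base_lin (ph_linl PH _ (base_L2 Lh) (base_L2 Lk) (jL2 u)).
by rewrite -xh -yk.
Qed.

(* The [p k] are Banach-Saks means of the [h k]. *)
Lemma test_closure_weak_limit (xs : nat -> dual U) (x : dual U) (h : nat -> W) (B : R) :
  (forall k, test_closure (h k)) -> (forall k, represents (xs k) (h k)) ->
  (forall k, ip (h k) (h k) <= B) ->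
  (forall u (e : R), 0 < e -> exists N, forall k, (N <= k)%N -> `|xs k u - x u| <= e) ->
  exists p y, [/\ forall k, midhull (tail h k) (p k), test_closure y, represents x y,
    ip y y <= B &
    forall e : R, 0 < e -> exists N, forall k, (N <= k)%N -> nrm (p k - y) <= e].
Proof.
move=> Gh xh hB xsx; have Lh k : L2F O (h k) := (Gh k).1.
have [p [y [ph Lp Ly yB py]]] := ip_weak_limit PH Lh hB.
have Gp k : test_closure (p k).
  have := ph k; apply: midhull_sub => [_ [l _ <-] //|a b Ga Gb].
  rewrite /mid -[_ *: _]addr0 scalerDr addr0; apply: test_closure_lin => //.
  rewrite -[2^-1 *: b]addr0; apply: test_closure_lin => //.
  have := test_closure_lin (-1) Ga Ga; by rewrite scaleN1r addNr.
exists p, y; split => //.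
  apply: test_closure_closed => // e /py [N hN]; exists (p N) => //; exact: hN.
move=> u; apply/eqP; rewrite -subr_eq0 -normr_le0; apply/ler_addgt0Pr => e e0.
rewrite add0r; have e2 : 0 < e / 2 by rewrite divr_gt0.
pose L (z : W) := ip (base z) (fam (j u)).
have [||||N1 hN1] := @midhull_functional_limit _ _ _ _ PH L h p (x u) _ _ _ _ (e / 2) e2 => //.
  move=> a b La Lb; rewrite /L /mid.
  have -> : base (2^-1 *: (a + b)) = 2^-1 *: (base a + base b) by [].
  rewrite (ip_Zl PH) ?(ip_Dl PH)//; try exact: base_L2; try exact: jL2.
  by apply: (ph_D PH); exact: base_L2.
  move=> e' e'0; have [N hN] := xsx u e' e'0; exists N => k /hN.
  by rewrite xh.
have j1 : 0 < nrm (fam (j u)) + 1 by rewrite ltr_wpDl// ip_norm_ge0.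
have [N2 hN2] := py _ (divr_gt0 e2 j1).
pose k := maxn N1 N2; have h1 := hN1 k (leq_maxl _ _); have h2 := hN2 k (leq_maxr _ _).
have Lpy := ph_B PH (Lp k) Ly.
have h3 : `|L (p k) - L y| <= e / 2.
  rewrite /L -(ip_Bl PH)//; try exact: base_L2; try exact: jL2.
  rewrite -[base (p k) - base y]/(base (p k - y)).
  rewrite (le_trans (ip_cauchy_schwarz PH (base_L2 Lpy) (jL2 u)))//.
  apply: (@le_trans _ _ (nrm (p k - y) * (nrm (fam (j u)) + 1))).
    by rewrite ler_pM ?ip_norm_ge0 ?base_norm_le// lerDl.
  by rewrite -ler_pdivlMr.
rewrite -/(L y) [leRHS]splitr -(subrK (L (p k)) (x u)) -addrA.
by rewrite (le_trans (ler_normD _ _))// lerD// distrC.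
Qed.

Hypothesis test0 : test (fun=> 0).

Lemma test_closure0 : test_closure 0.
Proof.
have := test_closure_lin (-1) (test_closure_D test0) (test_closure_D test0).
by rewrite scaleN1r addNr.
Qed.

Lemma test_closureZ (a : R) h : test_closure h -> test_closure (a *: h).
Proof. by move=> Gh; have := test_closure_lin a Gh test_closure0; rewrite addr0. Qed.

Lemma represents0 : represents 0 0.
Proof.
move=> u; rewrite -[base 0]/(0 : 'I_d -> E -> R^o) (ip_0l PH)//.
exact: jL2.
Qed.

Lemma representsZ (a : R) x h : L2F O h -> represents x h -> represents (a *: x) (a *: h).
Proof.
move=> Lh xh; have := represents_lin a Lh test_closure0.1 xh represents0.
by rewrite !addr0.
Qed.

(** [M] may be a norm over [O] or over a subdomain. Where an element is represented, [N] is computed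
    on any representing family; elsewhere it is [+oo]. *)
Lemma represented_ext_norm (N : dual U -> \bar R) (M : W -> R) :
  (forall h, 0 <= M h) -> (forall (a : R) h, L2F O h -> M (a *: h) = `|a| * M h) ->
  (forall h k, L2F O h -> L2F O k -> M (h + k) <= M h + M k) ->
  (forall x h, test_closure h -> represents x h -> N x = (M h)%:E) ->
  (forall x, (N x < +oo)%E -> exists2 h, test_closure h & represents x h) ->
  ext_norm N.
Proof.
move=> M0 MZ MD NE Nex.
have N_ge0 x : (0 <= N x)%E.
  have [|h1] := ltP (N x) +oo%E; last by apply: le_trans h1; exact: leey.
  by move=> /Nex [h Gh xh]; rewrite (NE _ _ Gh xh) lee_fin.
have Z (a : R) x : (N x < +oo)%E -> N (a *: x) = (`|a|%:E * N x)%E.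
  move=> /Nex [h Gh xh].
  rewrite (NE _ _ Gh xh) (NE _ _ (test_closureZ a Gh) (representsZ a Gh.1 xh)).
  by rewrite MZ//; exact: Gh.1.
split => //.
- move=> a x; have [->|a0] := eqVneq a 0.
    rewrite scale0r normr0 mul0e (NE _ _ test_closure0 represents0).
    by have := MZ 0 0 test_closure0.1; rewrite scale0r normr0 mul0r => ->.
  have [/Z //|h1] := ltP (N x) +oo%E.
  have -> : N x = +oo%E by apply/eqP; rewrite eq_le leey.
  rewrite gt0_muley ?lte_fin ?normr_gt0//; apply/eqP; rewrite eq_le leey/= leNgt.
  apply/negP => h2; have := Z a^-1 (a *: x) h2; rewrite scalerA mulVf// scale1r => h3.
  move: h1; rewrite h3 leNgt => /negP; apply.
  by rewrite lte_mul_pinfty// lee_fin.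
move=> x y; have [|h1] := ltP (N x) +oo%E; last first.
  have -> : N x = +oo%E by apply/eqP; rewrite eq_le leey.
  by rewrite addye ?leey// gt_eqF// (lt_le_trans _ (N_ge0 y))// ltNyr.
have [|h1] := ltP (N y) +oo%E; last first.
  have -> : N y = +oo%E by apply/eqP; rewrite eq_le leey.
  by rewrite addey ?leey// gt_eqF// (lt_le_trans _ (N_ge0 x))// ltNyr.
move=> /Nex [k Gk yk] /Nex [h Gh xh].
have Ghk := test_closure_lin 1 Gh Gk.
have := represents_lin 1 Gh.1 Gk.1 xh yk; rewrite !scale1r => xyhk.
rewrite scale1r in Ghk.
rewrite (NE _ _ Gh xh) (NE _ _ Gk yk) (NE _ _ Ghk xyhk) -EFinD lee_fin.
by apply: MD; [exact: Gh.1|exact: Gk.1].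
Qed.

Variable N : dual U -> \bar R.
Hypotheses (NE : forall x h, test_closure h -> represents x h -> N x = (nrm h)%:E)
  (Nex : forall x, (N x < +oo)%E -> exists2 h, test_closure h & represents x h).

(** Banach-Saks means of the representing families converge in [L^2], within the same bound, to a
    family that represents [x]. *)
Lemma test_closure_seq_closed (xs : nat -> dual U) (x : dual U) (C : R) :
  (forall k, (N (xs k) <= C%:E)%E) ->
  (forall u (e : R), 0 < e -> exists N, forall k, (N <= k)%N -> `|xs k u - x u| <= e) ->
  (N x <= C%:E)%E.
Proof.
move=> xsC xsx.
have /choice[h hP] k : exists h, test_closure h /\ represents (xs k) h.
  by have [h Gh rh] := Nex (le_lt_trans (xsC k) (ltry _)); exists h.
have hC k : nrm (h k) <= C.
  by have := xsC k; rewrite (NE (hP k).1 (hP k).2) lee_fin.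
have C0 : 0 <= C by rewrite (le_trans (ip_norm_ge0 _ _) (hC 0%N)).
have hB k : ip (h k) (h k) <= C ^+ 2.
  by rewrite -(ip_norm_le PH)//; exact: (hP k).1.1.
have [p [y [_ Gy ry yB _]]] := test_closure_weak_limit (fun k => (hP k).1)
  (fun k => (hP k).2) hB xsx.
by rewrite (NE Gy ry) lee_fin (ip_norm_le PH)//; exact: Gy.1.
Qed.

Lemma test_closure_ext_hilbert : ext_hilbert N.
Proof.
split.
- apply: (@represented_ext_norm N (ip_norm (ipL2 O))) => //.
  + by move=> h; exact: ip_norm_ge0.
  + by move=> a h Lh; exact: (ip_normZ PH).
  + by move=> h k Lh Lk; exact: (ip_normD PH).
- move=> x y /Nex [h Gh xh] /Nex [k Gk yk].
  have Ghk := test_closure_lin 1 Gh Gk; have Ghk' := test_closure_lin (-1) Gk Gh.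
  have := represents_lin 1 Gh.1 Gk.1 xh yk; rewrite !scale1r => r1.
  have := represents_lin (-1) Gk.1 Gh.1 yk xh; rewrite !scaleN1r ![- _ + _]addrC => r2.
  rewrite scale1r in Ghk; rewrite scaleN1r addrC in Ghk'.
  rewrite (NE Gh xh) (NE Gk yk) (NE Ghk r1) (NE Ghk' r2) /=.
  rewrite !(ip_norm_sqr PH)//; try exact: Gh.1; try exact: Gk.1; try exact: Ghk.1; try exact: Ghk'.1.
  rewrite (ip_sqrD PH) ?(ip_sqrB PH)//; try exact: Gh.1; try exact: Gk.1.
  by lra.
move=> C; rewrite closure_id; apply/seteqP; split; first exact: subset_closure.
move=> x /= cx.
have /choice[xs xsP] (k : nat) : exists y, (N y <= C%:E)%E /\ `|x - y| < k.+1%:R^-1.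
  have k0 : 0 < k.+1%:R^-1 :> R by rewrite invr_gt0.
  have [y [yC xy]] := cx _ (nbhsx_ballx x _ k0).
  by exists y; split => //; move: xy; rewrite -ball_normE.
apply: (@test_closure_seq_closed xs x C) => [k|u e e0]; first by case: (xsP k).
have u1 : 0 < `|u| + 1 by rewrite ltr_wpDl.
have [M hM] := natSinv_lt (divr_gt0 e0 u1); exists M => k Mk.
rewrite -[xs k u - x u]/((xs k - x) u) (le_trans (dual_apply_le _ _))//.
apply: (@le_trans _ _ (`|xs k - x| * (`|u| + 1))); first by rewrite ler_wpM2l// lerDl.
rewrite -ler_pdivlMr// distrC ltW// (lt_trans (xsP k).2)//; exact: hM.
Qed.

End closure_of_tests.

(** * Sobolev norms and limits of test functions *)

Section sobolev_tests.
Context {R : realType} {d : nat}.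
Local Notation E := 'rV[R]_d.
Local Notation leb := (@rV_lebesgue R d).
Variables (O : set E) (oO : open O).
Let mO : measurable O := open_rV_measurable oO.
Local Notation test := (div_free_test O).
Local Notation nrm := (ip_norm (ipL2 O)).
Let PH {J' : finType} : prehilbert (@L2F R d O J') (@ipL2 R d O J') := L2_prehilbert mO.

Lemma pdiffs_cst0 (s : seq 'I_d) : pdiffs s (fun=> 0 : R) = (fun=> 0 : R).
Proof.
elim: s => //= i s ->; apply/funext => x; rewrite /pdiff.
exact: (@derive_cst _ E R^o).
Qed.

Lemma test_function0 : test_function O (fun=> 0 : R).
Proof.
split; last by exists set0; split => //; exact: compact0.
move=> s; rewrite pdiffs_cst0; split; first exact: cst_continuous.
by move=> i x; exact: (@derivable_cst _ E R^o).
Qed.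

Lemma component_lin (a : R) (v w : E -> E) i :
  component i (a \*: v \+ w) = (fun x => a * component i v x + component i w x).
Proof. by apply/funext => x; rewrite /component !mxE. Qed.

Lemma component0 i : component i (fun=> 0 : E) = (fun=> 0 : R).
Proof. by apply/funext => x; rewrite /component mxE. Qed.

Lemma div_free_test_lin (a : R) v w : test v -> test w -> test (a \*: v \+ w).
Proof.
move=> [tv dv] [tw dw]; split=> [i|x]; first by rewrite component_lin; exact: test_lin.
have E i : pdiff i (component i (a \*: v \+ w)) x =
    a * pdiff i (component i v) x + pdiff i (component i w) x.
  rewrite component_lin pdiff_lin// => y.
    exact: (smooth_derivable (tv i).1).
  exact: (smooth_derivable (tw i).1).
rewrite /divergence; under eq_bigr do rewrite E.
rewrite big_split/= -mulr_sumr.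
by have := dv x; have := dw x; rewrite /divergence => -> ->; rewrite mulr0 addr0.
Qed.

Lemma div_free_test0 : test (fun=> 0).
Proof.
split=> [i|x]; first by rewrite component0; exact: test_function0.
rewrite /divergence big1// => i _; rewrite component0.
exact: (congr1 (fun f => f x) (pdiffs_cst0 [:: i])).
Qed.

Lemma div_free_test_L2v v : test v -> L2v O v.
Proof. by move=> [tv _] i; exact: test_L2 (tv i). Qed.

Definition sfam (g : E -> R) : unit -> E -> R^o := fun=> g.

Lemma sfam_L2 (g : E -> R) : L2 O g -> L2F O (sfam g).
Proof. by move=> Lg i. Qed.

Lemma ip_sfam (g h : E -> R) : ipL2 O (sfam g) (sfam h) = \int[leb]_(x in O) (g x * h x).
Proof. by rewrite /ipL2 (bigD1 tt)//= big1 ?addr0// => -[]. Qed.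

Lemma sqL2_sfam (g : E -> R) : L2 O g -> sqL2 O g = (nrm (sfam g) ^+ 2)%:E.
Proof. by move=> Lg; rewrite (ip_norm_sqr PH)// ip_sfam sqL2E. Qed.

Lemma sfam_norm_le (J : finType) (h : J -> E -> R^o) i : nrm (sfam (h i)) <= nrm h.
Proof.
apply: ler_wsqrtr; rewrite ip_sfam /ipL2 (bigD1 i)//= lerDl; apply: sumr_ge0 => k _.
by apply: Rintegral_ge0 => x _; rewrite -expr2 sqr_ge0.
Qed.

(** Pairings against test functions determine pairings against such limits; this is how different
    weak derivatives of one function are compared. *)
Definition test_limit (h : E -> R) : Prop := L2 O h /\
  forall e : R, 0 < e -> exists2 phi, test_function O phi & nrm (sfam h - sfam phi) <= e.

Lemma test_limit_orth (h g : E -> R) : test_limit h -> L2 O g ->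
  (forall phi, test_function O phi -> \int[leb]_(x in O) (g x * phi x) = 0) ->
  \int[leb]_(x in O) (g x * h x) = 0.
Proof.
move=> [Lh hP] Lg g0; apply/eqP; rewrite -normr_le0; apply/ler_addgt0Pr => e e0.
have g1 : 0 < nrm (sfam g) + 1 by rewrite ltr_wpDl// ip_norm_ge0.
have [phi tphi hphi] := hP _ (divr_gt0 e0 g1); rewrite add0r.
have Lp : L2F O (sfam phi) by apply: sfam_L2; exact: test_L2 tphi.
have Lh' := sfam_L2 Lh; have Lg' := sfam_L2 Lg.
have Lhp := ph_B PH Lh' Lp.
have -> : \int[leb]_(x in O) (g x * h x) = ipL2 O (sfam g) (sfam h - sfam phi).
  by rewrite (ip_Br PH)// !ip_sfam (g0 phi tphi) subr0.
rewrite (le_trans (ip_cauchy_schwarz PH Lg' Lhp))//.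
apply: (@le_trans _ _ ((nrm (sfam g) + 1) * nrm (sfam h - sfam phi))).
  by rewrite ler_wpM2r ?ip_norm_ge0// lerDl.
by rewrite mulrC -ler_pdivlMr.
Qed.

Lemma test_limit_pairing (h g g' : E -> R) : test_limit h -> L2 O g -> L2 O g' ->
  (forall phi, test_function O phi ->
    \int[leb]_(x in O) (g x * phi x) = \int[leb]_(x in O) (g' x * phi x)) ->
  \int[leb]_(x in O) (g x * h x) = \int[leb]_(x in O) (g' x * h x).
Proof.
move=> hP Lg Lg' gg'; have Lh := hP.1.
have Sg := sfam_L2 Lg; have Sg' := sfam_L2 Lg'; have Sh := sfam_L2 Lh.
have Lgg := ph_B PH Sg Sg'.
apply/eqP; rewrite -subr_eq0 -!ip_sfam -(ip_Bl PH)//; apply/eqP.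
rewrite (_ : sfam g - sfam g' = sfam (g - g' : E -> R^o))// ip_sfam.
apply: test_limit_orth => //; first exact: (Lgg tt).
move=> phi tphi; have Sp := sfam_L2 (test_L2 mO tphi).
by rewrite -ip_sfam (_ : sfam _ = sfam g - sfam g')// (ip_Bl PH)// !ip_sfam gg'// subrr.
Qed.

(* Among the functions with given pairings against tests, limits of tests have
   the smallest norm. *)
Lemma test_limit_min (h g : E -> R) : test_limit h -> L2 O g ->
  (forall phi, test_function O phi ->
    \int[leb]_(x in O) (g x * phi x) = \int[leb]_(x in O) (h x * phi x)) ->
  nrm (sfam h) <= nrm (sfam g).
Proof.
move=> hP Lg gh; have Lh := hP.1; have := test_limit_pairing hP Lg Lh gh.
rewrite -!ip_sfam => e; have Lh' := sfam_L2 Lh; have Lg' := sfam_L2 Lg.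
have := ip_cauchy_schwarz PH Lg' Lh'; rewrite e -(ip_norm_sqr PH Lh') ger0_norm ?sqr_ge0//.
have [->|h0] := eqVneq (nrm (sfam h)) 0; first by rewrite ip_norm_ge0.
by rewrite expr2 ler_pM2r// lt_neqAle eq_sym h0 ip_norm_ge0.
Qed.

Lemma poweR_root_lt (x : \bar R) (e : R) : (0 <= x)%E -> 0 < e ->
  (x `^ 2^-1 < e%:E)%E = (x < (e ^+ 2)%:E)%E.
Proof.
case: x => [x|_ _|//]; last by rewrite poweRyr// ?ltNge ?leey.
rewrite lee_fin => x0 e0; rewrite poweR_EFin !lte_fin powR12_sqrt//.
by rewrite -{1}[e]ger0_norm ?ltW// -sqrtr_sqr ltr_sqrt// exprn_gt0.
Qed.

Lemma gagliardo_ge0 (A : set E) (s : R) (g : E -> R) : (0 <= gagliardo A s g)%E.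
Proof.
apply: integral_ge0 => x _; apply: integral_ge0 => y _.
by rewrite lee_fin divr_ge0 ?sqr_ge0 ?powR_ge0.
Qed.

Lemma sqL2_ge0 (A : set E) (g : E -> R) : (0 <= sqL2 A g)%E.
Proof. by apply: integral_ge0 => x _; rewrite lee_fin sqr_ge0. Qed.

Definition sobolev_term (m : R) (A : set E) (f : E -> E) i
    (a : {ffun 'I_d -> 'I_(Num.truncn m).+1}) : \bar R :=
  let k := Num.truncn m in
  ereal_inf
      [set (sqL2 A h + if (k%:R < m)%R && ((\sum_j a j)%N == k)
                       then gagliardo A (m - k%:R)%R h else 0)%E
      | h in weak_derivative A (multi_index a) (component i f)].

Lemma sqHmE (m : R) (A : set E) (f : E -> E) : sqHm m A f = (\sum_(i < d)
  \sum_(a : {ffun 'I_d -> 'I_(Num.truncn m).+1} | (\sum_j a j <= Num.truncn m)%N)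
    sobolev_term A f i a)%E.
Proof. by []. Qed.

Lemma sobolev_term_ge0 (m : R) (A : set E) (f : E -> E) i (a : {ffun 'I_d -> 'I_(Num.truncn m).+1}) :
  (0 <= sobolev_term A f i a)%E.
Proof.
apply: le_ereal_inf_tmp => _ [h _ <-]; rewrite adde_ge0 ?sqL2_ge0//.
by case: ifP => // _; exact: gagliardo_ge0.
Qed.

Lemma sqHm_ge0 (m : R) (A : set E) (f : E -> E) : (0 <= sqHm m A f)%E.
Proof.
by rewrite sqHmE; apply: sume_ge0 => i _; apply: sume_ge0 => a _; exact: sobolev_term_ge0.
Qed.

Lemma sobolev_term_le (m : R) (A : set E) (f : E -> E) i (a : {ffun 'I_d -> 'I_(Num.truncn m).+1}) :
  (\sum_j a j <= Num.truncn m)%N -> (sobolev_term A f i a <= sqHm m A f)%E.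
Proof.
move=> am; rewrite sqHmE (bigD1 i)//= (bigD1 a)//= -addeA leeDl// adde_ge0//.
  by apply: sume_ge0 => b _; exact: sobolev_term_ge0.
by apply: sume_ge0 => l _; apply: sume_ge0 => b _; exact: sobolev_term_ge0.
Qed.

Lemma Hm_norm_derivative (m : R) (A : set E) (f : E -> E) i (a : {ffun 'I_d -> 'I_(Num.truncn m).+1}) (e : R) :
  (\sum_j a j <= Num.truncn m)%N -> 0 < e -> (Hm_norm m A f < e%:E)%E ->
  exists2 g, weak_derivative A (multi_index a) (component i f) g &
    (sqL2 A g < (e ^+ 2)%:E)%E.
Proof.
move=> am e0; rewrite /Hm_norm poweR_root_lt ?sqHm_ge0// => fe.
have /ereal_inf_lt [_ [g wg <-] ge] := le_lt_trans (sobolev_term_le A f i am) fe.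
exists g => //; apply: le_lt_trans ge; rewrite leeDl//.
by case: ifP => // _; exact: gagliardo_ge0.
Qed.

Definition mi0 k : {ffun 'I_d -> 'I_k.+1} := [ffun=> ord0].

Lemma multi_index0 k : multi_index (mi0 k) = [::].
Proof.
rewrite /multi_index; elim: (enum _) => //= i s ->.
by rewrite ffunE.
Qed.

Lemma sum_mi0 k : (\sum_j mi0 k j = 0)%N.
Proof. by rewrite big1// => j _; rewrite ffunE. Qed.

(* The zeroth-order term of the Sobolev norm controls pairings with limits of
   tests; no uniqueness of weak derivatives is needed. *)
Lemma pairing_le (m : R) (h : 'I_d -> E -> R^o) F (e : R) : (forall i, test_limit (h i)) ->
  L2v O F -> 0 < e -> (Hm_norm m O F < e%:E)%E ->
  `|ipL2 O h (fam F)| <= d%:R * nrm h * e.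
Proof.
move=> hP LF e0 Fe; rewrite {1}/ipL2 (le_trans (ler_norm_sum _ _ _))//.
apply: (@le_trans _ _ (\sum_(i < d) nrm h * e)); last first.
  by rewrite sumr_const card_ord -[leLHS]mulr_natl mulrA.
apply: ler_sum => i _.
have [|g [Lg wg] ge] := @Hm_norm_derivative m O F i (mi0 _) e _ e0 Fe.
  by rewrite sum_mi0.
have -> : \int[leb]_(x in O) (h i x * fam F i x) = \int[leb]_(x in O) (g x * h i x).
  under eq_Rintegral do rewrite mulrC.
  apply: (test_limit_pairing (hP i) (LF i) Lg) => phi tphi.
  by have := wg phi tphi; rewrite multi_index0 /= expr0 mul1r.
rewrite -ip_sfam; have Lg' := sfam_L2 Lg.
have Lh' := sfam_L2 (hP i).1.
rewrite (le_trans (ip_cauchy_schwarz PH Lg' Lh'))// mulrC ler_pM ?ip_norm_ge0 ?sfam_norm_le//.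
by rewrite (ip_norm_le PH Lg' (ltW e0)) -lee_fin ip_sfam -sqL2E// ltW.
Qed.

Lemma weak_derivative_test v i s : test v ->
  weak_derivative O s (component i v) (pdiffs (rev s) (component i v)).
Proof.
move=> [tv _]; split; first exact: test_L2 (test_pdiffs _ (tv i)).
by move=> phi tphi; apply: test_weak_derivative => //; exact: (tv i).1.
Qed.

(** For fractional [m] the terms of top order carry a Gagliardo seminorm of order [m - truncn m],
    which lies in []0, 1[]. *)
Lemma test_sqHm_fin (m : R) v : 0 < m -> test v -> (sqHm m O v < +oo)%E.
Proof.
move=> m0 tv; rewrite sqHmE; apply: lte_sum_pinfty => i _; apply: lte_sum_pinfty => a _.
have tp := test_pdiffs (rev (multi_index a)) (tv.1 i).
apply: (@le_lt_trans _ _ (sqL2 O (pdiffs (rev (multi_index a)) (component i v)) +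
  if ((Num.truncn m)%:R < m)%R && ((\sum_j a j)%N == Num.truncn m)
  then gagliardo O (m - (Num.truncn m)%:R)%R (pdiffs (rev (multi_index a)) (component i v))
  else 0)%E).
  by apply: ereal_inf_lbound; exists (pdiffs (rev (multi_index a)) (component i v)) => //;
    exact: weak_derivative_test.
apply: lte_add_pinfty; first exact: (test_L2 mO tp).2.
case: ifP => // /andP[mk _]; apply: gagliardo_test tp; first by rewrite subr_gt0.
by rewrite ltrBlDl natr1 truncnS_gt.
Qed.

Lemma Hm_norm0 (m : R) : Hm_norm m O (fun=> 0) = 0%E.
Proof.
rewrite /Hm_norm; have -> : sqHm m O (fun=> 0) = 0%E; last by rewrite poweR0r// invr_eq0 pnatr_eq0.
apply/eqP; rewrite eq_le sqHm_ge0 andbT sqHmE.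
apply: sume_le0 => i _; apply: sume_le0 => a _.
apply: ereal_inf_lbound; exists (fun=> 0).
  split; first exact: L2_0.
  move=> phi _; rewrite component0.
  have z (f : E -> R) : \int[leb]_(x in O) (0 * f x) = 0.
    by under eq_Rintegral do rewrite mul0r; rewrite /Rintegral integral0.
  by rewrite !z mulr0.
rewrite /sqL2 integral0_eq ?add0e; last by move=> x _; rewrite expr0n.
case: ifP => // _; rewrite /gagliardo integral0_eq// => x _.
by rewrite integral0_eq// => y _; rewrite subrr expr0n mul0r.
Qed.

Lemma test_spaceV (m : R) v : 0 < m -> test v -> spaceV m O v.
Proof.
move=> m0 tv; split; first by split; [exact: div_free_test_L2v|exact: test_sqHm_fin].
move=> e e0; exists v => //.
rewrite (_ : v \- v = fun=> 0) ?Hm_norm0 ?lte_fin//.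
by apply/funext => x /=; rewrite subrr.
Qed.

End sobolev_tests.

(** * Families representing elements of H and V *)

Section H_and_V.
Context {R : realType} {d : nat}.
Local Notation E := 'rV[R]_d.
Local Notation leb := (@rV_lebesgue R d).
Variables (O : set E) (oO : open O).
Let mO : measurable O := open_rV_measurable oO.
Local Notation test := (div_free_test O).
Local Notation nrm := (ip_norm (ipL2 O)).
Let PH {J' : finType} : prehilbert (@L2F R d O J') (@ipL2 R d O J') := L2_prehilbert mO.

Local Notation K1 := (Num.truncn (1 : R)).
Local Notation JV := ('I_d * {ffun 'I_d -> 'I_K1.+1})%type.

(* The derivatives are in reverse order, as they are moved one by one off a test
   function in [weak_derivative]. *)
Definition gradient_fam (v : E -> E) : JV -> E -> R^o := fun p =>
  if (\sum_k p.2 k <= K1)%N then pdiffs (rev (multi_index p.2)) (component p.1 v)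
  else fun=> 0.

Definition index0 (i : 'I_d) : JV := (i, mi0 K1).

Local Notation GH := (test_closure O (@fam R d)).
Local Notation GV := (test_closure O gradient_fam).
Local Notation baseV := (base index0).

Lemma gradient_fam_test v p : test v -> test_function O (gradient_fam v p).
Proof.
move=> tv; rewrite /gradient_fam; case: ifP => _; last exact: test_function0.
exact: test_pdiffs (tv.1 p.1).
Qed.

Lemma gradient_fam_lin (a : R) v w : test v -> test w ->
  gradient_fam (a \*: v \+ w) = a *: gradient_fam v + gradient_fam w.
Proof.
move=> tv tw; apply/funext => p; rewrite !fctE /gradient_fam; case: ifP => _.
  by rewrite component_lin pdiffs_lin//; [exact: (tv.1 p.1).1|exact: (tw.1 p.1).1].
by apply/funext => x; rewrite scaler0 addr0.
Qed.

Lemma gradient_fam_L2 v : test v -> L2F O (gradient_fam v).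
Proof. by move=> tv p; apply: test_L2 (gradient_fam_test p tv). Qed.

Lemma gradient_fam_base v : test v -> forall i, gradient_fam v (index0 i) = component i v.
Proof. by move=> _ i; rewrite /gradient_fam /= sum_mi0 /= multi_index0. Qed.

Lemma index0_inj : injective index0.
Proof. by move=> i k [->]. Qed.

Lemma fam_test_L2 v : test v -> L2F O (fam v).
Proof. exact: div_free_test_L2v. Qed.

Lemma fam_lin_test (a : R) (v w : E -> E) : test v -> test w ->
  fam (a \*: v \+ w) = a *: fam v + fam w.
Proof. by move=> _ _; exact: fam_lin. Qed.

Lemma GV_test_limit h : GV h -> forall p, test_limit O (h p).
Proof.
move=> [Lh hP] p; split => // e /hP [v tv hv]; exists (gradient_fam v p).
  exact: gradient_fam_test.
rewrite (_ : sfam _ - sfam _ = sfam ((h - gradient_fam v) p))//.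
by apply: le_trans hv; exact: sfam_norm_le.
Qed.

Lemma GH_test_limit h : GH h -> forall i, test_limit O (h i).
Proof.
move=> [Lh hP] i; split => // e /hP [v tv hv]; exists (component i v); first exact: tv.1.
rewrite (_ : sfam _ - sfam _ = sfam ((h - fam v) i))//.
by apply: le_trans hv; exact: sfam_norm_le.
Qed.

Lemma GV_base h : GV h -> GH (baseV h).
Proof.
move=> [Lh hP]; split; first exact: base_L2.
move=> e /hP [v tv hv]; exists v => //; apply: le_trans hv.
rewrite (_ : _ - fam v = baseV (h - gradient_fam v)); first exact: base_norm_le index0_inj _.
apply/funext => i; rewrite /base !fctE gradient_fam_base//.
Qed.

Lemma GV_high h (p : JV) : GV h -> ~~ (\sum_k p.2 k <= K1)%N -> sqL2 O (h p) = 0%E.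
Proof.
move=> [Lh hP] pK; rewrite (sqL2_sfam oO (Lh p)).
suff -> : nrm (sfam (h p)) = 0 by rewrite expr0n.
apply/eqP; rewrite eq_le ip_norm_ge0 andbT; apply/ler_addgt0Pr => e /hP [v tv hv].
rewrite add0r; apply: le_trans hv; apply: le_trans (sfam_norm_le O (h - gradient_fam v) p).
rewrite (_ : (h - gradient_fam v) p = h p)//; apply/funext => x.
by rewrite !fctE /gradient_fam (negbTE pK) subr0.
Qed.

(** Pairing with such a family extracts one member, which turns relations between members into
    orthogonality relations. *)
Definition delta_fam (J : finType) (p : J) (g : E -> R) : J -> E -> R^o :=
  fun p' => if p' == p then g else fun=> 0.

Lemma delta_fam_L2 (J : finType) (p : J) g : L2 O g -> L2F O (delta_fam p g).
Proof. by move=> Lg p'; rewrite /delta_fam; case: ifP => // _; exact: L2_0. Qed.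

Lemma ip_delta_fam (J : finType) (h : J -> E -> R^o) p g :
  ipL2 O h (delta_fam p g) = \int[leb]_(x in O) (h p x * g x).
Proof.
rewrite /ipL2 (bigD1 p)//= /delta_fam eqxx big1 ?addr0// => p' /negbTE ->.
by under eq_Rintegral do rewrite mulr0; rewrite /Rintegral integral0.
Qed.

(** Integration by parts says that the families of test fields are orthogonal to the fixed family
    [k], and orthogonality passes to the closure. *)
Lemma GV_derivative h i (a : {ffun 'I_d -> 'I_K1.+1}) phi : GV h ->
  (\sum_k a k <= K1)%N -> test_function O phi ->
  \int[leb]_(x in O) (h (index0 i) x * pdiffs (multi_index a) phi x) =
  (-1) ^+ size (multi_index a) * \int[leb]_(x in O) (h (i, a) x * phi x).
Proof.
move=> Gh aK tphi; set s := multi_index a; set c : R := (-1) ^+ size s.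
have Lp := test_L2 mO tphi; have Ls := test_L2 mO (test_pdiffs s tphi).
have L1 := delta_fam_L2 (index0 i) Ls; have L2' := delta_fam_L2 (i, a) Lp.
pose k := - c *: delta_fam (i, a) phi + delta_fam (index0 i) (pdiffs s phi).
have Lk : L2F O k by exact: (ph_lin PH).
have ipk g : L2F O g -> ipL2 O g k = - c * \int[leb]_(x in O) (g (i, a) x * phi x) +
    \int[leb]_(x in O) (g (index0 i) x * pdiffs s phi x).
  move=> Lg; rewrite (ip_Dr PH)//; last exact: (ph_Z PH).
  by rewrite (ip_Zr PH)// !ip_delta_fam.
have := test_closure_orth mO gradient_fam_L2 Gh Lk; rewrite ipk//; last exact: Gh.1.
move=> h0; apply/eqP; rewrite -subr_eq0 -mulNr addrC; apply/eqP; apply: h0 => v tv.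
rewrite ipk; last exact: gradient_fam_L2.
rewrite gradient_fam_base// {1}/gradient_fam /= aK.
rewrite (test_weak_derivative s (tv.1 i).1 tphi) -/c.
by rewrite mulNr addNr.
Qed.

(** Equality as distributions: it does not depend on the field chosen to represent an element. *)
Definition weakly_eq (f : E -> E) (h : 'I_d -> E -> R^o) : Prop :=
  forall i phi, test_function O phi ->
  \int[leb]_(x in O) (component i f x * phi x) = \int[leb]_(x in O) (h i x * phi x).

(** [h (i, a)] is one of the weak derivatives and, as a limit of test functions, the one of least
    norm. At order 1 there is no fractional term. *)
Lemma GV_sobolev_term h f i (a : {ffun 'I_d -> 'I_K1.+1}) : GV h -> weakly_eq f (baseV h) ->
  (\sum_k a k <= K1)%N -> sobolev_term (m := 1) O f i a = sqL2 O (h (i, a)).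
Proof.
move=> Gh fh aK; have Lh := Gh.1 (i, a); have hl := GV_test_limit Gh (i, a).
rewrite /sobolev_term; under eq_imagel => g _ do rewrite {1}truncn1 ltxx /= adde0.
have sgn2 : (-1 : R) ^+ size (multi_index a) != 0 by rewrite signr_eq0.
apply/eqP; rewrite eq_le; apply/andP; split.
  apply: ereal_inf_lbound; exists (h (i, a)) => //; split => // phi tphi.
  rewrite -(GV_derivative i Gh aK tphi).
  exact: fh i _ (test_pdiffs _ tphi).
apply: le_ereal_inf_tmp => _ [g [Lg wg] <-].
rewrite (sqL2_sfam oO Lh) (sqL2_sfam oO Lg) lee_fin lerXn2r ?nnegrE ?ip_norm_ge0//.
apply: (test_limit_min oO hl Lg) => phi tphi; apply: (mulfI sgn2).
by rewrite -(wg _ tphi) -(GV_derivative i Gh aK tphi) (fh i _ (test_pdiffs _ tphi)).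
Qed.

Lemma GV_sqHm h f : GV h -> weakly_eq f (baseV h) -> sqHm 1 O f = (ipL2 O h h)%:E.
Proof.
move=> Gh fh; rewrite sqHmE (ipL2_diag mO Gh.1).
rewrite (eq_bigr (fun p => sqL2 O (h (p.1, p.2)))); last by case.
rewrite -(pair_bigA _ (fun i a => sqL2 O (h (i, a)))) /=; apply: eq_bigr => i _.
rewrite [LHS]big_mkcond; apply: eq_bigr => a _; case: ifPn => aK.
  exact: GV_sobolev_term.
by rewrite GV_high.
Qed.

Lemma GV_Hm_norm h f : GV h -> weakly_eq f (baseV h) -> Hm_norm 1 O f = (nrm h)%:E.
Proof.
move=> Gh fh; rewrite /Hm_norm (GV_sqHm Gh fh) poweR_EFin powR12_sqrt//.
exact: ipL2_ge0.
Qed.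

Lemma nrm0_pairing (J : finType) (h k : J -> E -> R^o) : L2F O h -> L2F O k -> nrm h = 0 ->
  ipL2 O h k = 0.
Proof.
move=> Lh Lk h0; apply/eqP; rewrite -normr_le0 (le_trans (ip_cauchy_schwarz PH Lh Lk))//.
by rewrite h0 mul0r.
Qed.

Lemma weakly_eq_nrm f (h : 'I_d -> E -> R^o) : L2v O f -> L2F O h ->
  nrm (fam f - h) = 0 -> weakly_eq f h.
Proof.
move=> Lf Lh fh i phi tphi; have Lp := delta_fam_L2 i (test_L2 mO tphi).
have := nrm0_pairing (ph_B PH (Lf : L2F O (fam f)) Lh) Lp fh.
rewrite (ip_Bl PH)// !ip_delta_fam => /eqP; rewrite subr_eq0 => /eqP.
by [].
Qed.

Lemma GV_spaceV h f : GV h -> L2v O f -> nrm (fam f - baseV h) = 0 -> spaceV 1 O f.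
Proof.
move=> Gh Lf fh; have wfh := weakly_eq_nrm Lf (base_L2 index0 Gh.1) fh.
split; first by split => //; rewrite (GV_sqHm Gh wfh) ltry.
move=> e e0; have [v tv hv] := Gh.2 _ (divr_gt0 e0 (ltr0n _ 2)); exists v => //.
have Gv := test_closure_D mO gradient_fam_L2 tv.
have Ghv := test_closure_lin mO gradient_fam_lin (div_free_test_lin (O := O)) gradient_fam_L2 (-1) Gv Gh.
rewrite scaleN1r addrC in Ghv.
have Lfv : L2v O (f \- v).
  have := ph_B PH (Lf : L2F O (fam f)) (fam_test_L2 tv).
  by rewrite -famB.
rewrite (GV_Hm_norm Ghv).
  by rewrite lte_fin (le_lt_trans hv)// ltr_pdivrMr// ltr_pMr// ltr1n.
apply: weakly_eq_nrm => //; first exact: (base_L2 index0 Ghv.1).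
rewrite famB (_ : baseV _ = baseV h - fam v) ?opprB ?addrA ?subrK//.
by apply/funext => i; rewrite /base !fctE gradient_fam_base.
Qed.

Lemma spaceH_GH f : spaceH O f <-> GH (fam f).
Proof.
split=> [[Lf fP]|[Lf fP]]; split => // e e0.
  have [v tv fv] := fP e e0; exists v => //.
  move: fv; rewrite L2_normE// ?famB; last first.
    by have := ph_B PH (Lf : L2F O (fam f)) (fam_test_L2 tv); rewrite -famB.
  by rewrite lte_fin => /ltW.
have [v tv fv] := fP _ (divr_gt0 e0 (ltr0n _ 2)); exists v => //.
rewrite L2_normE// ?famB; last first.
  by have := ph_B PH (Lf : L2F O (fam f)) (fam_test_L2 tv); rewrite -famB.
by rewrite lte_fin (le_lt_trans fv)// ltr_pdivrMr// ltr_pMr// ltr1n.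
Qed.

Lemma GH_eq0 (w : 'I_d -> E -> R^o) : GH w -> (forall i phi, test_function O phi ->
  \int[leb]_(x in O) (w i x * phi x) = 0) -> nrm w = 0.
Proof.
move=> Gw w0; suff : ipL2 O w w = 0 by move=> h; rewrite /ip_norm h sqrtr0.
rewrite /ipL2 big1// => i _; apply: (test_limit_orth oO (GH_test_limit Gw i) (Gw.1 i)).
exact: w0.
Qed.

(* The weak gradients of the approximating tests form a Cauchy sequence, as those
   of the remainders, however chosen, dominate them. *)
Lemma spaceV_GV f : spaceH O f -> spaceV 1 O f ->
  exists2 h, GV h & nrm (fam f - baseV h) = 0.
Proof.
move=> Hf [_ fP]; have Lf := Hf.1.
have /choice[v vP] (n : nat) : exists v, test v /\ (Hm_norm 1 O (f \- v)%R < (n.+1%:R^-1)%:E)%E.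
  have n0 : 0 < n.+1%:R^-1 :> R by rewrite invr_gt0.
  by have [v tv fv] := fP _ n0; exists v.
have n0 n : 0 < n.+1%:R^-1 :> R by rewrite invr_gt0.
have /choice[g gP] (np : nat * JV) : exists g, (\sum_k np.2.2 k <= K1)%N ->
    weak_derivative O (multi_index np.2.2) (component np.2.1 (f \- v np.1)) g /\
    nrm (sfam g) <= np.1.+1%:R^-1.
  case: np => n [i a] /=; have [aK|] := boolP (\sum_k a k <= K1)%N; last by exists (fun=> 0).
  have [g wg ge] := Hm_norm_derivative i aK (n0 n) (vP n).2.
  exists g => _; split => //; rewrite (ip_norm_le PH (sfam_L2 wg.1) (ltW (n0 n))).
  by rewrite -lee_fin ip_sfam -sqL2E// ?ltW//; exact: wg.1.
have Lfv n : L2v O (f \- v n).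
  by have := ph_B PH (Lf : L2F O (fam f)) (fam_test_L2 (vP n).1); rewrite -famB.
have tvv n l : test (v l \- v n).
  have := div_free_test_lin (-1) (vP n).1 (vP l).1.
  by congr (div_free_test O _); apply/funext => x /=; rewrite scaleN1r addrC.
(* The derivative of [v l - v n] has the same pairings as the difference of the weak derivatives
   chosen for the two remainders; being a test function, it has the smaller norm. *)
have step n l p : nrm (sfam (gradient_fam (v l \- v n) p)) <= n.+1%:R^-1 + l.+1%:R^-1.
  case: p => i a; have [aK|aK] := boolP (\sum_k a k <= K1)%N; last first.
    rewrite /gradient_fam /= (negbTE aK) (_ : sfam _ = 0)// (ip_norm0 PH).
    by rewrite addr_ge0// ltW.
  have [[Lgn wgn] hn] := gP (n, (i, a)) aK; have [[Lgl wgl] hl] := gP (l, (i, a)) aK.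
  rewrite /= in Lgn wgn hn Lgl wgl hl.
  have Sn := sfam_L2 Lgn; have Sl := sfam_L2 Lgl.
  apply: (@le_trans _ _ (nrm (sfam (g (n, (i, a))) - sfam (g (l, (i, a)))))).
    rewrite (_ : sfam _ - sfam _ = sfam (g (n, (i, a)) - g (l, (i, a)) : E -> R^o))//.
    apply: (test_limit_min oO).
    - exact: (GV_test_limit (test_closure_D mO gradient_fam_L2 (tvv n l))).
    - exact: (ph_B PH Sn Sl tt).
    move=> phi tphi; have Sp := sfam_L2 (test_L2 mO tphi).
    rewrite -ip_sfam (_ : sfam _ = sfam (g (n, (i, a))) - sfam (g (l, (i, a))))//.
    rewrite (ip_Bl PH)// !ip_sfam.
    have sgn2 : (-1 : R) ^+ size (multi_index a) != 0 by rewrite signr_eq0.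
    apply: (mulfI sgn2); rewrite mulrBr -wgn// -wgl//.
    have Ss := sfam_L2 (test_L2 mO (test_pdiffs (multi_index a) tphi)).
    rewrite /gradient_fam /= aK -(test_weak_derivative _ ((tvv n l).1 i).1 tphi).
    have Sfn := sfam_L2 (Lfv n i); have Sfl := sfam_L2 (Lfv l i).
    rewrite -!ip_sfam -(ip_Bl PH)//; congr (ipL2 O _ _).
    apply/funext => ?; apply/funext => x; rewrite !fctE /sfam /component !mxE.
    by ring.
  by rewrite (le_trans (ip_normB PH Sn Sl))// lerD.
pose c : R := #|{: JV}|%:R.
have cauchy n l : ipL2 O (gradient_fam (v n) - gradient_fam (v l))
    (gradient_fam (v n) - gradient_fam (v l)) <= c * (n.+1%:R^-1 + l.+1%:R^-1) ^+ 2.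
  have -> : gradient_fam (v n) - gradient_fam (v l) = gradient_fam (v n \- v l).
    have -> : v n \- v l = -1 \*: v l \+ v n by apply/funext => x /=; rewrite scaleN1r addrC.
    by rewrite gradient_fam_lin ?scaleN1r 1?addrC//; [exact: (vP l).1|exact: (vP n).1].
  rewrite /ipL2 (le_trans (_ : _ <= \sum_(p : JV) (n.+1%:R^-1 + l.+1%:R^-1) ^+ 2))//; last first.
    by rewrite sumr_const mulr_natl.
  apply: ler_sum => p _; rewrite -ip_sfam.
  have Sg := sfam_L2 (gradient_fam_L2 (tvv l n) p).
  have nl : 0 <= n.+1%:R^-1 + l.+1%:R^-1 :> R by rewrite addr_ge0// ltW.
  by rewrite -(ip_norm_le PH Sg nl) addrC; exact: step.
have [||h Lh hP] := ph_complete (@PH JV) (u := fun n => gradient_fam (v n)).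
- by move=> n; exact: gradient_fam_L2 (vP n).1.
- move=> e e0; have c0 : 0 < 4 * (c + 1) by rewrite mulr_gt0// ltr_wpDl// ler0n.
  (* The cap at 1 gives [(a + b) ^+ 2 <= 2 * (a + b)] for the two inverses. *)
  have ec : 0 < Num.min 1 (e / (4 * (c + 1))) by rewrite lt_min ltr01 divr_gt0.
  have [N hN] := natSinv_lt ec; exists N => n l Nn Nl.
  apply: le_trans (cauchy n l) _.
  have := hN n Nn; have := hN l Nl; rewrite !lt_min.
  have := n0 n; have := n0 l; move: n.+1%:R^-1 l.+1%:R^-1 => a b b0 a0.
  move=> /andP[b1 b2] /andP[a1 a2].
  have ab : (a + b) ^+ 2 <= 4 * (e / (4 * (c + 1))).
    have : (a + b) ^+ 2 <= (a + b) * 2.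
      by rewrite expr2 ler_wpM2l ?addr_ge0 ?ltW// -[2]/(1 + 1)%:R natrD ltrD.
    by move: a2 b2; set z := e / _; lra.
  have cn : 0 <= c by rewrite ler0n.
  rewrite (le_trans (ler_wpM2l cn ab))//.
  have -> : c * (4 * (e / (4 * (c + 1)))) = e * (c / (c + 1)).
    by field; rewrite gt_eqF// ltr_wpDl.
  by rewrite ler_piMr ?ltW// ltr_pdivrMr ?ltr_wpDl// mul1r ltrDl.
have Gh : GV h.
  split => // e e0; have [|N hN] := hP (e ^+ 2); first by rewrite exprn_gt0.
  exists (v N); first exact: (vP N).1.
  have Lv := gradient_fam_L2 (vP N).1.
  by rewrite (ip_norm_distC PH)// (ip_norm_le PH _ (ltW e0))//; [exact: hN|exact: (ph_B PH)].
exists h => //.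
have GHf := (spaceH_GH f).1 Hf; have GHh := GV_base Gh.
have GHd := test_closure_lin mO fam_lin_test (div_free_test_lin (O := O)) fam_test_L2 (-1) GHh GHf.
rewrite scaleN1r addrC in GHd.
apply: (GH_eq0 GHd) => i phi tphi; apply/eqP; rewrite -normr_le0; apply/ler_addgt0Pr => e e0.
rewrite add0r; have Sp := sfam_L2 (test_L2 mO tphi).
have p1 : 0 < nrm (sfam phi) + 1 by rewrite ltr_wpDl// ip_norm_ge0.
have e2 : 0 < e / 2 / (nrm (sfam phi) + 1) by rewrite !divr_gt0.
have [N1 hN1] := natSinv_lt e2.
have [|N2 hN2] := hP ((e / 2 / (nrm (sfam phi) + 1)) ^+ 2); first by rewrite exprn_gt0.
pose n := maxn N1 N2; have h1 := hN1 n (leq_maxl _ _); have h2 := hN2 n (leq_maxr _ _).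
have a0K : (\sum_k (mi0 K1 : {ffun 'I_d -> 'I_K1.+1}) k <= K1)%N by rewrite sum_mi0.
have [[Lg wg] ge] := gP (n, index0 i) a0K; rewrite /= in Lg wg ge.
have Lv := gradient_fam_L2 (vP n).1; have Lvh := ph_B PH Lv Lh.
have Svh := sfam_L2 (Lvh (index0 i)); have Sg := sfam_L2 Lg.
(* Splits [f - h] into [f - v n] and [v n - h]; against [phi], the first may be replaced by its weak
   derivative of order 0, which is small. *)
have -> : \int[leb]_(x in O) ((fam f - baseV h) i x * phi x) =
    ipL2 O (sfam (g (n, index0 i))) (sfam phi) +
    ipL2 O (sfam ((gradient_fam (v n) - h) (index0 i))) (sfam phi).
  have := wg _ tphi; rewrite /= multi_index0 /= expr0 mul1r ip_sfam => <-.
  have Sfn := sfam_L2 (Lfv n i).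
  rewrite -!ip_sfam -(ip_Dl PH)//; congr (ipL2 O _ _).
  apply/funext => ?; apply/funext => x.
  rewrite /base !fctE /sfam gradient_fam_base; last exact: (vP n).1.
  by rewrite /fam /component !mxE addrA subrK.
have key z : L2F O z -> nrm z <= e / 2 / (nrm (sfam phi) + 1) -> `|ipL2 O z (sfam phi)| <= e / 2.
  move=> Lz hz; rewrite (le_trans (ip_cauchy_schwarz PH Lz Sp))//.
  apply: (@le_trans _ _ (nrm z * (nrm (sfam phi) + 1))).
    by rewrite ler_wpM2l ?ip_norm_ge0// lerDl.
  by rewrite -ler_pdivlMr.
rewrite (le_trans (ler_normD _ _))// [leRHS]splitr lerD// key//.
  by rewrite (le_trans ge)// ltW.
by rewrite (le_trans (sfam_norm_le _ _ _))// (ip_norm_le PH)// ltW.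
Qed.

End H_and_V.

(** * The norms of H and V on the dual of U *)

Section dual_norms.
Context {R : realType} {d : nat}.
Local Notation E := 'rV[R]_d.
Local Notation leb := (@rV_lebesgue R d).
Variables (O : set E) (oO : open O) (m : R) (m_gt1 : 1 < m).
Context {U : normedModType R}.
Variables (j : U -> E -> E) (jU : dense_compact_subspace m O j).
Let mO : measurable O := open_rV_measurable oO.
Local Notation test := (div_free_test O).
Local Notation nrm := (ip_norm (ipL2 O)).
Let PH {J' : finType} : prehilbert (@L2F R d O J') (@ipL2 R d O J') := L2_prehilbert mO.
Local Notation GH := (test_closure O (@fam R d)).
Local Notation GV := (test_closure O (@gradient_fam R d)).
Local Notation rep := (represents O (@id 'I_d) j).
Local Notation repV := (represents O (@index0 R d) j).
Local Notation nH := (normH O j O).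
Local Notation nV := (normV O j).

Let m0 : 0 < m. Proof. exact: lt_trans m_gt1. Qed.

Lemma jL2 u : L2v O (j u).
Proof. by case: jU => /(_ u) [[]]. Qed.

Lemma test_density v (e : R) : test v -> 0 < e -> exists u, (Hm_norm m O (v \- j u)%R < e%:E)%E.
Proof. by case: jU => _ _ _ h _ tv e0; exact: h (test_spaceV oO m0 tv) e e0. Qed.

Lemma L2v_sub (f g : E -> E) : L2v O f -> L2v O g -> L2v O (f \- g).
Proof.
move=> Lf Lg; have := ph_B PH (Lf : L2F O (fam f)) (Lg : L2F O (fam g)).
by rewrite -famB.
Qed.

Lemma GH_pairing_le h F (e : R) : GH h -> L2v O F -> 0 < e -> (Hm_norm m O F < e%:E)%E ->
  `|ipL2 O h (fam F)| <= d%:R * nrm h * e.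
Proof. move=> Gh; apply: pairing_le => // i; exact: (GH_test_limit Gh i). Qed.

(** The range of [j] approximates test fields in [H^m], whose norm controls pairings with [h]; so
    [h] is orthogonal to the test fields, hence to itself. *)
Lemma GH_unique h : GH h -> (forall u, ipL2 O h (fam (j u)) = 0) -> nrm h = 0.
Proof.
move=> Gh h0; suff : ipL2 O h h = 0 by move=> e; rewrite /ip_norm e sqrtr0.
have Lh := Gh.1.
apply: (test_closure_orth mO (fam_test_L2 oO) Gh Lh) => v tv.
have Lv := fam_test_L2 oO tv.
apply/eqP; rewrite -normr_le0; apply/ler_addgt0Pr => e e0; rewrite add0r.
have c0 : 0 < d%:R * nrm h + 1 by rewrite ltr_wpDl// mulr_ge0// ip_norm_ge0.
have ec := divr_gt0 e0 c0; have [u hu] := test_density tv ec.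
have := GH_pairing_le Gh (L2v_sub Lv (jL2 u)) ec hu.
rewrite famB (ip_Br PH Lh Lv (jL2 u)) h0 subr0 (ph_C PH Lv Lh) => /le_trans; apply.
by rewrite mulrCA ler_piMr ?(ltW e0)// ler_pdivrMr// mul1r lerDl.
Qed.

Definition unfam (h : 'I_d -> E -> R^o) : E -> E := fun x => \row_i h i x.

Lemma unfamK h : fam (unfam h) = h.
Proof. by apply/funext => i; apply/funext => x; rewrite /fam /component /unfam mxE. Qed.

Lemma fieldsP x f : fields O j x f <-> GH (fam f) /\ rep x (fam f).
Proof.
split=> [[Hf xf]|[Hf xf]].
  split; first exact/(spaceH_GH oO).
  by move=> u; rewrite xf (L2_innerE mO Hf.1 (jL2 u)).
have Hf' : spaceH O f by exact/(spaceH_GH oO).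
by split => // u; rewrite xf (L2_innerE mO Hf'.1 (jL2 u)).
Qed.

Lemma field_ofP x : inH O j x -> GH (fam (field_of O j x)) /\ rep x (fam (field_of O j x)).
Proof. by move=> [f xf]; apply/fieldsP; exact: (xgetPex (cst 0) (ex_intro _ f xf)). Qed.

Lemma GH_sub h k : GH h -> GH k -> GH (h - k).
Proof.
move=> Gh Gk; have := test_closure_lin mO (@fam_lin_test _ _ O)
  (div_free_test_lin (O := O)) (fam_test_L2 oO) (-1) Gk Gh.
by rewrite scaleN1r addrC.
Qed.

Lemma rep_inH x h : GH h -> rep x h -> inH O j x.
Proof. by move=> Gh xh; exists (unfam h); apply/fieldsP; rewrite unfamK. Qed.

Lemma rep_field_of x h : GH h -> rep x h -> nrm (fam (field_of O j x) - h) = 0.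
Proof.
move=> Gh xh; have [Gf xf] := field_ofP (rep_inH Gh xh).
apply: (GH_unique (GH_sub Gf Gh)) => u.
rewrite (ip_Bl PH Gf.1 Gh.1 (jL2 u)); apply/eqP; rewrite subr_eq0; apply/eqP.
by rewrite -[LHS]xf -[RHS]xh.
Qed.

Section subdomain.
Variables (A : set E) (mA : measurable A) (AO : A `<=` O).
Local Notation nrmA := (ip_norm (ipL2 A)).
Let PA {J' : finType} : prehilbert (@L2F R d A J') (@ipL2 R d A J') := L2_prehilbert mA.

Lemma sqL2_subset (g : E -> R) : (sqL2 A g <= sqL2 O g)%E.
Proof.
rewrite /sqL2 [leLHS]integral_mkcond [leRHS]integral_mkcond.
apply: le_nonneg_integral => x _.
  by rewrite /patch; case: ifP => // _; rewrite lee_fin sqr_ge0.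
rewrite /patch; case: ifPn => xA; last by case: ifP => // _; rewrite lee_fin sqr_ge0.
by rewrite mem_set//; apply: AO; exact: set_mem.
Qed.

Lemma L2_subset (g : E -> R) : L2 O g -> L2 A g.
Proof.
move=> [mg fg]; split; last exact: le_lt_trans (sqL2_subset g) fg.
exact: measurable_funS mg.
Qed.

Lemma L2F_subset (J : finType) (h : J -> E -> R^o) : L2F O h -> L2F A h.
Proof. by move=> Lh p; exact: L2_subset. Qed.

Lemma nrm_subset (J : finType) (h : J -> E -> R^o) : L2F O h -> nrmA h <= nrm h.
Proof.
move=> Lh; apply: ler_wsqrtr; rewrite -lee_fin (ipL2_diag mO Lh) (ipL2_diag mA (L2F_subset Lh)).
by apply: lee_sum => p _; exact: sqL2_subset.
Qed.

(** [field_of] is an arbitrary choice, but two fields of the same [x] differ by a field of zero norm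
    over [O], hence over [A]. *)
Lemma normH_rep x h : GH h -> rep x h -> normH O j A x = (nrmA h)%:E.
Proof.
move=> Gh xh; have ix := rep_inH Gh xh; rewrite /normH; case: asboolP => // _.
have [Gf _] := field_ofP ix; set f := field_of O j x in Gf *.
rewrite (L2_normE mA) //; last exact: (L2F_subset Gf.1).
congr (_%:E); have Lf := L2F_subset Gf.1; have Lh := L2F_subset Gh.1.
have fh : nrmA (fam f - h) = 0.
  apply/eqP; rewrite eq_le ip_norm_ge0 andbT -(rep_field_of Gh xh).
  by apply: nrm_subset; exact: (ph_B PH Gf.1 Gh.1).
apply/eqP; rewrite eq_le; apply/andP; split.
  rewrite -[fam f](subrK h) (le_trans (ip_normD PA (ph_B PA Lf Lh) Lh))//.
  by rewrite fh add0r.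
rewrite -[h in leLHS](subKr (fam f)) (le_trans (ip_normB PA Lf (ph_B PA Lf Lh)))//.
by rewrite fh addr0.
Qed.

Lemma normH_ex x : (normH O j A x < +oo)%E -> exists2 h, GH h & rep x h.
Proof.
rewrite /normH; case: asboolP => // ix _; have [Gf xf] := field_ofP ix.
by exists (fam (field_of O j x)).
Qed.

Lemma normH_ext_norm : ext_norm (normH O j A).
Proof.
apply: (@represented_ext_norm R d O mO _ (@fam R d) id (@fam_lin_test _ _ O)
  (div_free_test_lin (O := O)) (fam_test_L2 oO) U j jL2 (div_free_test0 O) _ nrmA).
- by move=> h; exact: ip_norm_ge0.
- by move=> a h Lh; exact: (ip_normZ PA _ (L2F_subset Lh)).
- by move=> h k Lh Lk; exact: (ip_normD PA (L2F_subset Lh) (L2F_subset Lk)).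
- exact: normH_rep.
- exact: normH_ex.
Qed.

End subdomain.

Lemma normH_le (A : set E) (mA : measurable A) (AO : A `<=` O) x :
  (normH O j A x <= nH x)%E.
Proof.
have [|h] := ltP (nH x) +oo%E; last by apply: le_trans h; exact: leey.
move=> /(normH_ex (A := O)) [h Gh xh].
by rewrite (normH_rep mA AO Gh xh) (normH_rep mO _ Gh xh)// lee_fin nrm_subset//; exact: Gh.1.
Qed.

Lemma normH_lty x : (nH x < +oo)%E <-> inH O j x.
Proof.
split=> [/(normH_ex (A := O)) [h Gh xh]|ix]; first exact: rep_inH xh.
have [Gf xf] := field_ofP ix.
by rewrite (normH_rep mO _ Gf xf)// ltry.
Qed.

Lemma normH_ext_hilbert : ext_hilbert nH.
Proof.
exact: (test_closure_ext_hilbert mO (@inj_id 'I_d) (@fam_lin_test _ _ O)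
  (div_free_test_lin (O := O)) (fam_test_L2 oO) jL2 (div_free_test0 O)
  (normH_rep mO (@subset_refl _ O)) (normH_ex (A := O))).
Qed.

Lemma normV_rep x h : GV h -> repV x h -> normV O j x = (nrm h)%:E.
Proof.
move=> Gh xh; have Gb := GV_base Gh; have xb : rep x (base (@index0 R d) h) by exact: xh.
have ix := rep_inH Gb xb; have [Gf xf] := field_ofP ix.
have fb := rep_field_of Gb xb; have Lf : L2v O (field_of O j x) := Gf.1.
rewrite /normV; case: asboolP => [_|]; last first.
  by move=> h0; exfalso; apply: h0; split => //; exact: (GV_spaceV oO Gh).
apply: (GV_Hm_norm oO Gh); apply: (weakly_eq_nrm oO) => //.
exact: Gb.1.
Qed.

Lemma normV_ex x : (nV x < +oo)%E -> exists2 h, GV h & repV x h.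
Proof.
rewrite /normV; case: asboolP => // -[ix Vf] _; have [Gf xf] := field_ofP ix.
have [h Gh fh] := spaceV_GV oO ((spaceH_GH oO _).2 Gf) Vf.
exists h => // u; rewrite xf; apply/eqP; rewrite -subr_eq0.
have Lb := (GV_base Gh).1.
rewrite -(ip_Bl PH Gf.1 Lb (jL2 u)); apply/eqP.
by apply: (nrm0_pairing oO) => //; [exact: (ph_B PH Gf.1 Lb)|exact: jL2].
Qed.

Lemma normV_ext_hilbert : ext_hilbert nV.
Proof.
exact: (test_closure_ext_hilbert mO (@index0_inj R d) (@gradient_fam_lin R d O)
  (div_free_test_lin (O := O)) (gradient_fam_L2 oO) jL2 (div_free_test0 O)
  normV_rep normV_ex).
Qed.

Lemma normH_le_normV x : (nH x <= nV x)%E.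
Proof.
have [|h] := ltP (nV x) +oo%E; last by apply: le_trans h; exact: leey.
move=> /normV_ex [h Gh xh].
have xb : rep x (base (@index0 R d) h) by exact: xh.
rewrite (normV_rep Gh xh) (normH_rep mO _ (GV_base Gh) xb)// lee_fin.
exact: base_norm_le (@index0_inj R d) _.
Qed.

Lemma evaluation_approx x u f (e : R) : (nH x < +oo)%E -> L2v O f -> 0 < e ->
  (Hm_norm m O (j u \- f)%R < e%:E)%E ->
  `|x u - ipL2 O (fam (field_of O j x)) (fam f)| <= d%:R * fine (nH x) * e.
Proof.
move=> /normH_lty ix Lf e0 he; have [Gf xf] := field_ofP ix.
rewrite (normH_rep mO _ Gf xf)//= xf -(ip_Br PH Gf.1 (jL2 u) Lf) -famB.
by apply: GH_pairing_le => //; exact: (L2v_sub (jL2 u) Lf).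
Qed.

(* A sequence in the unit ball of [U] has a subsequence converging in [V_m], along
   which the evaluations become close uniformly in [x]. *)
Lemma finite_net (e : R) : 0 < e -> exists s : seq U, (forall w, w \in s -> `|w| <= 1) /\
  forall u, `|u| <= 1 -> exists2 w, w \in s &
    forall x, (nH x < +oo)%E -> `|x u - x w| <= e * fine (nH x).
Proof.
move=> e0; apply: contrapT => hs.
pose near u w := forall x : dual U, (nH x < +oo)%E -> `|x u - x w| <= e * fine (nH x).
(* If no finite net existed, [F] would greedily build a sequence in the unit ball with no two terms
   near each other. *)
have /choice[F FP] (s : seq U) : exists u, `|u| <= 1 /\
    ((forall w, w \in s -> `|w| <= 1) -> forall w, w \in s -> ~ near u w).
  have [sb|sb] := pselect (forall w, w \in s -> `|w| <= 1); last first.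
    by exists 0; rewrite normr0.
  apply: contrapT => h; apply: hs; exists s; split => // u u1.
  apply: contrapT => h1; apply: h; exists u; split => // _ w ws uw.
  by apply: h1; exists w.
pose S := fix S k : seq U := if k is k'.+1 then F (S k') :: S k' else [::].
pose a k := F (S k).
have Sb k : forall w, w \in S k -> `|w| <= 1.
  elim: k => // k IH w; rewrite inE => /orP[/eqP ->|/IH //].
  exact: (FP _).1.
have aS i k : (i < k)%N -> a i \in S k.
  elim: k => // k IH; rewrite ltnS leq_eqVlt => /orP[/eqP ->|/IH h] /=.
    by rewrite inE eqxx.
  by rewrite inE h orbT.
have far i k : (i < k)%N -> ~ near (a k) (a i).
  by move=> ik; apply: (FP (S k)).2 (Sb k) _ (aS _ _ ik).
case: jU => _ _ _ _ /(_ a (fun _ => I)) [|s [s_incr [f Vf sf]]].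
  by exists 1 => k; rewrite lee_fin; exact: (FP _).1.
have Lf : L2v O f by case: Vf => [[]].
have d0 : 0 < d%:R + 1 :> R by rewrite ltr_wpDl.
pose e' := e / 2 / (d%:R + 1).
have e'0 : 0 < e' by rewrite !divr_gt0.
have [N _ hN] : \forall k \near \oo, (Hm_norm m O (j (a (s k)) \- f)%R < e'%:E)%E.
  apply: (sf [set y | (y < e'%:E)%E]); apply: open_nbhs_nbhs; split => //=.
  exact: open_ereal_lt_ereal.
apply: (far (s N) (s N.+1)) => [|x xH]; first exact: s_incr.
have h1 := evaluation_approx xH Lf e'0 (hN N (leqnn N)).
have h2 := evaluation_approx xH Lf e'0 (hN N.+1 (leqnSn N)).
set c := ipL2 _ _ _ in h1 h2.
rewrite (_ : x (a (s N.+1)) - x (a (s N)) = (x (a (s N.+1)) - c) - (x (a (s N)) - c)); last by ring.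
rewrite (le_trans (ler_normB _ _))//.
have x0 : 0 <= fine (nH x) by rewrite fine_ge0//; exact: (ext_ge0 (normH_ext_norm mO (@subset_refl _ O))).
have h3 : d%:R * fine (nH x) * e' <= e / 2 * fine (nH x).
  rewrite mulrAC ler_wpM2r// /e' mulrCA ler_piMr ?divr_ge0 ?(ltW e0)//.
  by rewrite ler_pdivrMr// mul1r lerDl.
have := lerD (le_trans h2 h3) (le_trans h1 h3).
by rewrite -mulrDl -splitr.
Qed.

End dual_norms.

Lemma mid_sub (R : realType) (M : lmodType R) (a b c : M) :
  mid a b - c = 2^-1 *: ((a - c) + (b - c)).
Proof.
rewrite addrACA -opprD -[c + c]mulr2n -[c *+ 2]scaler_nat /mid scalerBr scalerA mulVf ?pnatr_eq0//.
by rewrite scale1r.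
Qed.

(** * Compactness of the balls of H in the dual of U *)

Section compactness_of_H.
Context {R : realType} {d : nat}.
Local Notation E := 'rV[R]_d.
Local Notation leb := (@rV_lebesgue R d).
Variables (O : set E) (oO : open O) (m : R) (m_gt1 : 1 < m).
Context {U : normedModType R}.
Variables (j : U -> E -> E) (jU : dense_compact_subspace m O j).
Let mO : measurable O := open_rV_measurable oO.
Local Notation test := (div_free_test O).
Local Notation nrm := (ip_norm (ipL2 O)).
Let PH {J' : finType} : prehilbert (@L2F R d O J') (@ipL2 R d O J') := L2_prehilbert mO.
Local Notation GH := (test_closure O (@fam R d)).
Local Notation rep := (represents O (@id 'I_d) j).
Local Notation nH := (normH O j O).
Local Notation nV := (normV O j).

Let nH_hilbert : ext_hilbert nH := normH_ext_hilbert oO m_gt1 jU.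
Let nH_norm : ext_norm nH := nH_hilbert.

Lemma normH_fine_le x (C : R) : (nH x <= C%:E)%E -> (nH x < +oo)%E /\ fine (nH x) <= C.
Proof.
move=> xC; have [a a0 xa] := ext_fin nH_norm (le_lt_trans xC (ltry _)).
by move: xC; rewrite xa lee_fin ltry.
Qed.

Lemma evaluation_le x u (C : R) : (nH x <= C%:E)%E -> `|x u| <= C * nrm (fam (j u)).
Proof.
move=> xC; have [xH xC'] := normH_fine_le xC.
have [h Gh xh] := normH_ex oO jU xH.
have Lj : L2F O (fam (j u)) := jL2 jU u.
move: xC'; rewrite (normH_rep oO m_gt1 jU mO _ Gh xh)//= => hC.
rewrite xh (le_trans (ip_cauchy_schwarz PH Gh.1 Lj))//.
by rewrite ler_wpM2r// ip_norm_ge0.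
Qed.

(** All evaluations are bounded, so they converge along an ultrafilter. The finite nets of the unit
    ball of [U] make the limit bounded and the convergence uniform on that ball, that is, in the
    norm of [U']. *)
Lemma normH_compact (C : R) : compact [set x | (nH x <= C%:E)%E].
Proof.
rewrite compact_ultra => F UF FC.
have FP : ProperFilter F by exact: ultra_proper.
have [C0|C0] := ltP C 0.
  exfalso; have /filter_ex[x /= xC] := FC.
  by have := le_trans (ext_ge0 nH_norm x) xC; rewrite lee_fin leNgt C0.
pose c u := C * nrm (fam (j u)).
have /choice[x xP] (u : U) : exists a : R, (fun y : dual U => y u : R) @ F --> a.
  have [|a _ ha] := @ultra_cvg _ R F (fun y : dual U => y u) `[- c u, c u]%classic UF (@segment_compact _ _ _).
    apply: filterS FC => y /= /(evaluation_le u) h.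
    by rewrite in_itv/= -ler_norml.
  by exists a.
have lin_x : linear (x : U -> R^o).
  move=> a u v; apply: (cvg_unique _ (xP (a *: u + v))) => //.
  have -> : (fun y : dual U => y (a *: u + v) : R) = (fun y => a * y u + y v).
    by apply/funext => y; have [ly _] := dual_bounded_linear y; exact: ly.
  by apply: cvgD; [apply: cvgM; [exact: cvg_cst|exact: xP]|exact: xP].
have net (e : R) : 0 < e -> exists2 s : seq U, (forall w, w \in s -> `|w| <= 1) &
    forall u, `|u| <= 1 -> exists2 w, w \in s &
      (forall y, (nH y <= C%:E)%E -> `|y u - y w| <= e) /\ `|x u - x w| <= e.
  move=> e0; have C1 : 0 < C + 1 by rewrite ltr_wpDl.
  have [s [sb sP]] := finite_net oO m_gt1 jU (divr_gt0 e0 C1).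
  exists s => // u /sP [w ws hw]; exists w => //.
  have key y : (nH y <= C%:E)%E -> `|y u - y w| <= e.
    move=> /normH_fine_le [yH yC]; rewrite (le_trans (hw y yH))//.
    rewrite mulrAC ler_pdivrMr// ler_wpM2l ?ltW//.
    by rewrite (le_lt_trans yC)// ltrDl.
  split => //.
  have cv : (fun y : dual U => `|y u - y w|) @ F --> `|x u - x w|.
    by apply: cvg_norm; apply: cvgB; exact: xP.
  apply: (closed_cvg [set z : R | z <= e] _ _ _ cv); first exact: closed_le.
  by apply: filterS FC => y /= /key.
have bnd_x : bounded_linear (x : U -> R^o).
  split => //; have [s _ sP] := net 1 ltr01.
  pose M := \sum_(w <- s) `|x w| + 1; exists M => u.
  have sum0 (r : seq U) : 0 <= \sum_(w <- r) `|x w| by apply: sumr_ge0 => w _.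
  have sum_le (r : seq U) w : w \in r -> `|x w| <= \sum_(w <- r) `|x w|.
    elim: r => // z r IH; rewrite inE big_cons => /orP[/eqP ->|/IH h].
      by rewrite lerDl.
    by rewrite (le_trans h)// lerDr.
  have xZ a v : x (a *: v) = a * x v.
    have x0 : x 0 = 0 by have := lin_x (- 1) 0 0; rewrite scaler0 addr0 scaleN1r addNr.
    by have := lin_x a v 0; rewrite !addr0 x0 addr0.
  have [->|u0] := eqVneq u 0.
    by rewrite -[X in x X](scale0r (0 : U)) xZ mul0r !normr0 mulr0.
  have un : 0 < `|u| by rewrite normr_gt0.
  have v1 : `|(`|u|^-1 *: u)| <= 1 by rewrite normrZ normfV normr_id mulVf ?gt_eqF.
  have [w ws [_ hw]] := sP _ v1.
  have : `|x (`|u|^-1 *: u)| <= M.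
    rewrite -(subrK (x w) (x (`|u|^-1 *: u))) (le_trans (ler_normD _ _))//.
    rewrite /M addrC lerD//.
    exact: sum_le.
  by rewrite xZ normrM normfV normr_id mulrC ler_pdivrMr.
pose X := Dual (asboolT bnd_x : (x : U -> R^o) \in bounded_linear_pred).
have FX : F --> (X : dual U).
  apply/cvgrPdist_le => e e0; have e4 : 0 < e / 4 by rewrite divr_gt0.
  have [s _ sP] := net _ e4.
  have Fs : F [set y : dual U | forall w, w \in s -> `|x w - y w| <= e / 4].
    elim: s {sP} => [|w s IH]; first by apply: filterS filterT => y _ w; rewrite in_nil.
    have /cvgrPdist_le/(_ _ e4) hw := xP w.
    apply: filterS2 IH hw => y /= h1 h2 z; rewrite inE => /orP[/eqP ->//|].
    exact: h1.
  apply: filterS2 FC Fs => y yC ys; apply: dual_norm_leP => u /sP [w ws [h1 h2]].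
  have := h1 y yC; have := ys w ws; rewrite -[(X - y) u]/(x u - y u).
  have -> : x u - y u = (x u - x w) + (x w - y w) - (y u - y w) by ring.
  move=> h3 h4; rewrite (le_trans (ler_normB _ _))//.
  rewrite (le_trans (lerD (ler_normD _ _) (lexx _)))//; move: h2 h3 h4; lra.
exists X; split => //.
exact: (closed_cvg [set y | (nH y <= C%:E)%E] (ext_closed nH_hilbert (C := C)) FC _ FX).
Qed.

(** Gathers the finite nets for all tolerances [1 / (n + 1)]. Countably many evaluations then decide
    the norm of an element of H, as the measurability of distances requires. *)
Lemma norming_sequence : exists w : nat -> U, (forall k, `|w k| <= 1) /\
  forall (x : dual U) (c : R), (nH x < +oo)%E -> (forall k, `|x (w k)| <= c) -> `|x| <= c.
Proof.
have /choice[s sP] (n : nat) : exists s : seq U, (forall w, w \in s -> `|w| <= 1) /\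
    forall u, `|u| <= 1 -> exists2 w, w \in s &
    forall x : dual U, (nH x < +oo)%E -> `|x u - x w| <= n.+1%:R^-1 * fine (nH x).
  have n0 : 0 < n.+1%:R^-1 :> R by rewrite invr_gt0.
  exact: (finite_net oO m_gt1 jU n0).
pose w k := if @unpickle (nat * nat)%type k is Some p then nth 0 (s p.1) p.2 else 0.
exists w; split => [k|x c xH xc].
  rewrite /w; case: unpickle => [[a b]|] /=; last by rewrite normr0.
  have [bs|bs] := ltnP b (size (s a)); last by rewrite nth_default// normr0.
  by apply: (sP a).1; exact: mem_nth.
apply: dual_norm_leP => u u1; apply/ler_addgt0Pr => e e0.
have x0 : 0 < fine (nH x) + 1 by rewrite ltr_wpDl// fine_ge0// (ext_ge0 nH_norm).
have [N hN] := natSinv_lt (divr_gt0 e0 x0).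
have [v vs hv] := (sP N).2 u u1.
rewrite -(subrK (x v) (x u)) (le_trans (ler_normD _ _))// addrC lerD//.
  have := xc (pickle (N, index v (s N))); rewrite /w pickleK /= nth_index//.
rewrite (le_trans (hv x xH))//.
apply: (@le_trans _ _ (N.+1%:R^-1 * (fine (nH x) + 1))).
  by rewrite ler_wpM2l ?invr_ge0// lerDl.
by rewrite -ler_pdivlMr// ltW// hN.
Qed.

(** The field of [h] is approximated in [L^2] by a test field, and this one in [H^m] by some [j u];
    each step costs half of [e]. *)
Lemma innerH_approx h : inH O j h -> forall e : R, 0 < e ->
  exists w : U, forall x, inH O j x -> `|innerH O j x h - x w| <= e * fine (nH x).
Proof.
move=> ih e e0; have [Gg hg] := field_ofP oO jU ih; set g := field_of O j h in Gg hg *.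
have e2 : 0 < e / 2 by rewrite divr_gt0.
have [v tv gv] := Gg.2 _ e2; have Lv := fam_test_L2 oO tv.
have d0 : 0 < d%:R + 1 :> R by rewrite ltr_wpDl.
pose e' := e / 2 / (d%:R + 1); have e'0 : 0 < e' by rewrite divr_gt0.
have [u hu] := test_density oO m_gt1 jU tv e'0.
exists u => x ix; have [Gf xf] := field_ofP oO jU ix; set f := field_of O j x in Gf xf.
have Lj : L2F O (fam (j u)) := jL2 jU u.
have -> : innerH O j x h = ipL2 O (fam f) (fam g).
  by rewrite /innerH (L2_innerE mO Gf.1 Gg.1).
rewrite xf (normH_rep oO m_gt1 jU mO _ Gf xf)//= -[base id _]/(fam f).
have -> : ipL2 O (fam f) (fam g) - ipL2 O (fam f) (fam (j u)) =
    ipL2 O (fam f) (fam g - fam v) + ipL2 O (fam f) (fam (v \- j u)).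
  have := ph_B PH Lv Lj; rewrite famB => Lvj.
  rewrite (ip_Br PH Gf.1 Gg.1 Lv) (ip_Br PH Gf.1 Lv Lj); ring.
rewrite (le_trans (ler_normD _ _))// (splitr e) mulrDl lerD//.
  rewrite (le_trans (ip_cauchy_schwarz PH Gf.1 (ph_B PH Gg.1 Lv)))//.
  by rewrite mulrC ler_wpM2r ?ip_norm_ge0.
have := GH_pairing_le oO Gf (L2v_sub oO Lv Lj) e'0 hu.
move=> /le_trans; apply; rewrite mulrAC ler_wpM2r ?ip_norm_ge0//.
by rewrite /e' mulrCA ler_piMr ?(ltW e2)// ler_pdivrMr// mul1r lerDl.
Qed.

(** * Ehrling's inequality on a subdomain *)

Section ehrling.
Variables (A : set E) (oA : open A) (AO : A `<=` O).
Hypothesis A_compact : compact_map (spaceV 1 O) (Hm_norm 1 A) id (spaceH O) (L2_norm A).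
Let mA : measurable A := open_rV_measurable oA.
Local Notation nR := (normH O j A).
Local Notation nrmA := (ip_norm (ipL2 A)).
Let PA {J' : finType} : prehilbert (@L2F R d A J') (@ipL2 R d A J') := L2_prehilbert mA.

Lemma integral_test_sub (g phi : E -> R) : test_function A phi ->
  \int[leb]_(x in A) (g x * phi x) = \int[leb]_(x in O) (g x * phi x).
Proof.
by move=> tp; rewrite (integral_test _ tp) (integral_test _ (test_sub AO tp)).
Qed.

Lemma weak_derivative_sub s g h : weak_derivative O s g h -> weak_derivative A s g h.
Proof.
move=> [Lh wh]; split; first exact: (L2_subset oO AO Lh).
move=> phi tp; rewrite (integral_test_sub _ (test_pdiffs s tp)) (integral_test_sub _ tp).
exact: wh (test_sub AO tp).
Qed.

Lemma Hm_norm1_sub f : (Hm_norm 1 A f <= Hm_norm 1 O f)%E.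
Proof.
suff h : (sqHm 1 A f <= sqHm 1 O f)%E.
  rewrite /Hm_norm; apply: gt0_ler_poweR h; first by rewrite invr_ge0.
    by rewrite in_itv/= leey andbT; exact: sqHm_ge0.
  by rewrite in_itv/= leey andbT; exact: sqHm_ge0.
rewrite !sqHmE; apply: lee_sum => i _; apply: lee_sum => a _.
rewrite /sobolev_term; apply: le_ereal_inf_tmp => _ [h wh <-].
have no_frac : ((Num.truncn (1 : R))%:R < 1 :> R) = false by rewrite truncn1 ltxx.
rewrite no_frac /= adde0; apply: ge_ereal_inf.
exists (sqL2 A h); last exact: sqL2_subset.
exists h; first exact: weak_derivative_sub.
by rewrite adde0.
Qed.

(** Otherwise there are elements of V-norm 1 and local norm at least [e] that tend to 0 in [U']. A
    subsequence converges in [L^2 A] to some [g]. Its Banach-Saks means converge in [L^2 O] to a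
    family representing 0, hence of zero norm, and on [A] they converge to [g]. So [g] is null on
    [A], against the bound [e]. *)
Lemma ehrling (e : R) : 0 < e -> exists2 C : R, 0 <= C &
  forall x, (nR x <= e%:E * nV x + (C * `|x|)%:E)%E.
Proof.
move=> e0; apply: contrapT => hC.
have hRn : ext_norm nR := normH_ext_norm oO m_gt1 jU mA AO.
have hVn : ext_norm nV := normV_ext_hilbert oO m_gt1 jU.
have RV x : (nR x <= nV x)%E.
  exact: le_trans (normH_le oO m_gt1 jU mA AO x) (normH_le_normV oO m_gt1 jU x).
have /choice[y yP] (n : nat) : exists y, [/\ nV y = 1%:E, (e%:E <= nR y)%E & `|y| <= n.+1%:R^-1].
  have [x hx] : exists x, (e%:E * nV x + (n.+1%:R * `|x|)%:E < nR x)%E.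
    apply: contrapT => h; apply: hC; exists n.+1%:R => // x; rewrite leNgt.
    by apply/negP => h'; apply: h; exists x.
  have xV : (nV x < +oo)%E.
    rewrite ltNge; apply/negP => h; move: hx.
    have -> : nV x = +oo%E by apply/eqP; rewrite eq_le leey.
    by rewrite gt0_muley ?lte_fin// addye// ltNge leey.
  have [b b0 xb] := ext_fin hVn xV.
  have [c c0 xc] := ext_fin hRn (le_lt_trans (RV x) xV).
  move: hx (RV x); rewrite xb xc -EFinM -EFinD lte_fin lee_fin => hx cb.
  have bp : 0 < b.
    rewrite lt_neqAle b0 andbT; apply/negP => /eqP b0'; move: hx; rewrite -b0' mulr0 add0r.
    by rewrite ltNge (le_trans cb)// -b0' mulr_ge0.
  exists (b^-1 *: x); rewrite (ext_Z hVn) (ext_Z hRn) xb xc gtr0_norm ?invr_gt0// -!EFinM.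
  rewrite normrZ gtr0_norm ?invr_gt0// mulVf ?gt_eqF// lee_fin.
  have nx : 0 <= n.+1%:R * `|x| by rewrite mulr_ge0.
  split => //; rewrite mulrC ?ler_pdivlMr ?ler_pdivrMr//.
    by move: hx nx; lra.
  rewrite mulrC ler_pdivlMr// mulrC; have : 0 <= e * b by rewrite mulr_ge0// ltW.
  by move: hx cb; lra.
have yV k : (nV (y k) < +oo)%E by case: (yP k) => -> _ _; rewrite ltry.
have yH k : inH O j (y k) /\ spaceV 1 O (field_of O j (y k)).
  by have := yV k; rewrite /normV; case: asboolP => // -[].
pose f k := field_of O j (y k).
have fV k : spaceV 1 O (f k) := (yH k).2.
have [|s [s_incr [g Hg sg]]] := A_compact fV.
  exists 1 => k; apply: le_trans (Hm_norm1_sub _) _.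
  have [h _ _] := yP k; move: h; rewrite /normV; case: asboolP => [_ ->//|h0].
  by have := yV k; rewrite /normV; case: asboolP.
have sn k : (k <= s k)%N by elim: k => // k IH; exact: leq_ltn_trans IH (s_incr _ _ (ltnSn k)).
have Gf k : GH (fam (f k)) := (field_ofP oO jU (yH k).1).1.
have yf k : rep (y k) (fam (f k)) := (field_ofP oO jU (yH k).1).2.
have Gg : GH (fam g) by exact/(spaceH_GH oO).
have fB k : ipL2 O (fam (f (s k))) (fam (f (s k))) <= 1.
  have f1 : nrm (fam (f (s k))) <= 1.
    rewrite -lee_fin -(normH_rep oO m_gt1 jU mO (@subset_refl _ O) (Gf (s k)) (yf (s k))).
    by rewrite (le_trans (normH_le_normV oO m_gt1 jU _))//; case: (yP (s k)) => ->.
  rewrite -(ip_norm_sqr PH (Gf (s k)).1) -[leRHS](expr1n _ 2%N).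
  by rewrite ler_pXn2r// nnegrE ?ler01 ?ip_norm_ge0.
have y0 u (r : R) : 0 < r -> exists N, forall k, (N <= k)%N ->
    `|y (s k) u - (0 : dual U) u| <= r.
  move=> r0; have u1 : 0 < `|u| + 1 by rewrite ltr_wpDl.
  have [N hN] := natSinv_lt (divr_gt0 r0 u1); exists N => k Nk.
  rewrite -[y (s k) u - _]/((y (s k) - 0) u) subr0 (le_trans (dual_apply_le _ _))//.
  apply: (@le_trans _ _ (`|y (s k)| * (`|u| + 1))); first by rewrite ler_wpM2l// lerDl.
  rewrite -ler_pdivlMr//; case: (yP (s k)) => _ _ /le_trans; apply; apply: ltW.
  by apply: hN; exact: leq_trans Nk (sn k).
have [p [z [ph Gz rz _ pz]]] := test_closure_weak_limit mO (@inj_id 'I_d) (@fam_lin_test _ _ O)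
  (div_free_test_lin (O := O)) (fam_test_L2 oO) (jL2 jU) (fun k => Gf (s k)) (fun k => yf (s k)) fB y0.
have z0 : nrm z = 0.
  by apply: (GH_unique oO m_gt1 jU Gz) => u; rewrite -[LHS]rz.
have LfA k : L2F A (fam (f k)) := L2F_subset oO AO (Gf k).1.
have LgA : L2F A (fam g) := L2F_subset oO AO Gg.1.
have Lz : L2F A z := L2F_subset oO AO Gz.1.
have sgA (r : R) : 0 < r -> exists N, forall k, (N <= k)%N -> nrmA (fam (f (s k)) - fam g) <= r.
  move=> r0; have [N _ hN] : \forall k \near \oo, (L2_norm A (f (s k) \- g)%R < r%:E)%E.
    apply: (sg [set t | (t < r%:E)%E]); apply: open_nbhs_nbhs; split => //=.
    exact: open_ereal_lt_ereal.
  exists N => k /hN /=; rewrite (L2_normE mA) ?famB ?lte_fin; first exact: ltW.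
  by have := ph_B PA (LfA (s k)) LgA; rewrite -famB.
have pA k : L2F O (p k).
  have := ph k; apply: midhull_sub => [_ [l _ <-]|a b La Lb]; first exact: (Gf _).1.
  by apply: (ph_Z PH); exact: (ph_D PH).
have g0 : nrmA (fam g) = 0.
  apply/eqP; rewrite eq_le ip_norm_ge0 andbT; apply/ler_addgt0Pr => r r0; rewrite add0r.
  have r2 : 0 < r / 2 by rewrite divr_gt0.
  have [N1 hN1] := sgA _ r2; have [N2 hN2] := pz _ r2.
  pose k := maxn N1 N2; have LpA := L2F_subset oO AO (pA k).
  have h1 : nrmA (p k - fam g) <= r / 2.
    suff [] : L2F A (p k) /\ nrmA (p k - fam g) <= r / 2 by [].
    have : midhull (tail (fun k => fam (f (s k))) N1) (p k).
      by apply: midhullS (ph k); apply: tailS; exact: leq_maxl.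
    apply: (@midhull_sub _ _ _ [set h | L2F A h /\ nrmA (h - fam g) <= r / 2]).
      by move=> _ [l /= Nl <-]; split; [exact: LfA|exact: hN1].
    move=> a b /= [La ha] [Lb hb]; split; first by apply: (ph_Z PA); exact: (ph_D PA).
    have -> : mid a b - fam g = 2^-1 *: ((a - fam g) + (b - fam g)).
      exact: mid_sub.
    have Lag := ph_B PA La LgA; have Lbg := ph_B PA Lb LgA.
    rewrite (ip_normZ PA _ (ph_D PA Lag Lbg)).
    have -> : `|2^-1| = 2^-1 :> R by rewrite gtr0_norm ?invr_gt0.
    have := ip_normD PA Lag Lbg; move: ha hb.
    move: (nrmA _) (nrmA _) (nrmA _) => x1 x2 x3; lra.
  have h2 : nrmA (p k) <= r / 2.
    apply: le_trans (nrm_subset oO mA AO (pA k)) _.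
    rewrite -[p k](subrK z) (le_trans (ip_normD PH (ph_B PH (pA k) Gz.1) Gz.1))//.
    by rewrite z0 addr0 hN2// leq_maxr.
  rewrite -[fam g](subKr (p k)) (le_trans (ip_normB PA LpA (ph_B PA LpA LgA)))//.
  by rewrite [leRHS]splitr lerD.
have e2 : 0 < e / 2 by rewrite divr_gt0.
have [N hN] := sgA _ e2.
have [_ + _] := yP (s N); rewrite (normH_rep oO m_gt1 jU mA AO (Gf (s N)) (yf (s N))) lee_fin.
have := hN N (leqnn N); have := ip_normD PA (ph_B PA (LfA (s N)) LgA) LgA.
by rewrite subrK g0; move: e0; lra.
Qed.

End ehrling.

End compactness_of_H.

(** * Oscillations under the Aldous condition *)

Section sigma_algebra_sets.
Context {W : Type} (G : set (set W)) (sG : sigma_algebra setT G).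

Lemma sigC A : G A -> G (~` A).
Proof. by rewrite -setTD; case: sG => _ + _; apply. Qed.

Lemma sig_ex (Q : nat -> set W) : (forall i, G (Q i)) -> G [set w | exists i, Q i w].
Proof.
case: sG => _ _ h /h; congr G; apply/seteqP; split => w; first by move=> [i _]; exists i.
by move=> [i Qi]; exists i.
Qed.

Lemma sig_all (Q : nat -> set W) : (forall i, G (Q i)) -> G [set w | forall i, Q i w].
Proof.
move=> hQ; have := sigC (sig_ex (fun i => sigC (hQ i))); congr G.
apply/seteqP; split => w /=; last by move=> h [i]; apply; exact: h.
by move=> h i; apply: contrapT => Qi; apply: h; exists i.
Qed.

Lemma sigT : G setT.
Proof. by rewrite -setC0; apply: sigC; case: sG. Qed.

(** Lets a deterministic condition [p] be assumed while the rest is shown to be an event. *)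
Lemma sig_and (p : Prop) (Q : set W) : (p -> G Q) -> G [set w | p /\ Q w].
Proof.
case: sG => G0 _ _; have [hp /(_ hp)|np _] := pselect p.
  by congr G; apply/seteqP; split => w //= -[].
by move: G0; congr G; apply/seteqP; split => w //= -[].
Qed.

Lemma sigI A B : G A -> G B -> G (A `&` B).
Proof.
move=> gA gB; have : G [set w | forall i : nat, if i is 0 then A w else B w].
  by apply: (@sig_all (fun i => [set w | if i is 0 then A w else B w])); case.
congr G; apply/seteqP; split => w /=; first by move=> h; split; [exact: (h 0%N)|exact: (h 1%N)].
by move=> [Aw Bw] [|i].
Qed.

Lemma sigU A B : G A -> G B -> G (A `|` B).
Proof.
by move=> gA gB; rewrite -[A `|` B]setCK setCU; apply: sigC; apply: sigI; exact: sigC.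
Qed.

End sigma_algebra_sets.

Lemma sigma_algebra_measurable dd (Om : measurableType dd) :
  sigma_algebra setT (@measurable dd Om).
Proof.
split; first exact: measurable0.
  by move=> A mA; rewrite setTD; exact: measurableC.
by move=> A mA; exact: bigcupT_measurable.
Qed.

Section counting.
Context {R : realType} {dd : measure_display} {Om : measurableType dd}.
Variable P : probability Om R.

(** Markov's inequality for the number of events [B i] that occur. *)
Lemma measure_count_le n (B : 'I_n -> set Om) (A : set Om) (c : nat) :
  measurable A -> (forall i, measurable (B i)) ->
  (forall w, A w -> (c <= \sum_(i < n) `[< B i w >])%N) ->
  (c%:R%:E * P A <= \sum_(i < n) P (B i))%E.
Proof.
move=> mA mB AB.
have hB i : P (B i) = (\int[P]_w (\1_(B i) w)%:E)%E.
  by rewrite integral_indic// setIT.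
under eq_bigr do rewrite hB.
rewrite -ge0_integral_sum//; last first.
  by move=> i; apply/measurable_EFinP; exact: measurable_indic.
have -> : (c%:R%:E * P A = \int[P]_w (c%:R%:E * (\1_A w)%:E))%E.
  rewrite ge0_integralZl//; first by rewrite integral_indic// setIT.
  by apply/measurable_EFinP; exact: measurable_indic.
apply: ge0_le_integral => //.
- apply: measurable_funeM; apply/measurable_EFinP; exact: measurable_indic.
- apply: emeasurable_sum => i; apply/measurable_EFinP; exact: measurable_indic.
move=> w _; rewrite sumEFin -EFinM lee_fin indicE.
have [wA|wA] := boolP (w \in A); last by rewrite mulr0 sumr_ge0.
rewrite mulr1 (eq_bigr (fun i : 'I_n => (`[< B i w >] : nat)%:R)) => [|i _].
  by rewrite -natr_sum ler_nat AB//; exact: set_mem.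
by rewrite indicE; congr (nat_of_bool _)%:R; apply/idP/asboolP => [/set_mem|/mem_set].
Qed.

Lemma probability_setC_ge (A : set Om) (e : R) : measurable A ->
  (P (~` A) <= e%:E)%E -> ((1 - e)%:E <= P A)%E.
Proof.
move=> mA; rewrite probability_setC//.
have : P A \is a fin_num by exact: fin_num_measure.
by move: (P A) => [r| |]//= _; rewrite -EFinB !lee_fin lerBlDr lerBlDl addrC.
Qed.

Lemma probability_setC_le (A : set Om) (e : R) : measurable A ->
  ((1 - e)%:E <= P A)%E -> (P (~` A) <= e%:E)%E.
Proof.
move=> mA; rewrite probability_setC//.
have : P A \is a fin_num by exact: fin_num_measure.
by move: (P A) => [r| |]//= _; rewrite -EFinB !lee_fin lerBlDr lerBlDl addrC.
Qed.

End counting.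

(** * Successive jumps in discrete time *)

Section discrete_aldous.
Context {R : realType} {E : normedModType R} {dd : measure_display} {Om : measurableType dd}.
Variables (P : probability Om R) (N : nat) (G : nat -> set (set Om)) (Y : nat -> Om -> E).
Hypothesis sG : forall a, (a <= N)%N -> sigma_algebra setT (G a).
Hypothesis GM : forall a, (a <= N)%N -> G a `<=` measurable.
Hypothesis Ghomo : forall a b, (a <= b <= N)%N -> G a `<=` G b.
Hypothesis mY : forall a b (c : R), (a <= b <= N)%N -> G b [set w | `|Y a w - Y b w| <= c].
Hypothesis YN : forall a, (N <= a)%N -> Y a = Y N.
Let sM := sigma_algebra_measurable Om.

Definition stop_index (sg : Om -> nat) := (forall w, (sg w <= N)%N) /\
  forall a, (a <= N)%N -> G a [set w | (sg w <= a)%N].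

Lemma stop_index_eq sg a : stop_index sg -> (a <= N)%N -> G a [set w | sg w = a].
Proof.
move=> [_ hs]; case: a => [|a] aN.
  by have := hs 0%N aN; congr G; apply/seteqP; split => w /=; rewrite leqn0 => /eqP.
have h1 : G a.+1 [set w | (sg w <= a)%N].
  by apply: (Ghomo (a := a)); [rewrite leqnSn|apply: hs; exact: ltnW].
have := sigI (sG aN) (hs _ aN) (sigC (sG aN) h1); congr G.
apply/seteqP; split => w /=; first by move=> [h /negP]; rewrite -ltnNge => h'; apply/eqP; rewrite eqn_leq h.
by move=> ->; split => //; rewrite ltnn.
Qed.

Lemma stop_index_cst a : (a <= N)%N -> stop_index (cst a).
Proof.
move=> aN; split => // b bN.
have /= := @sig_and _ _ (sG bN) (a <= b)%N setT (fun=> sigT (sG bN)); congr G.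
by apply/seteqP; split => w //= -[].
Qed.

(** The disjunct [N <= i] makes the minimum exist and caps it at [N], which thus means that there is
    no further jump. *)
Definition next_pred c s w : pred nat :=
  fun i => (N <= i)%N || (s < i)%N && (c < `|Y i w - Y s w|).

Lemma next_pred_ex c s w : exists i, next_pred c s w i.
Proof. by exists N; rewrite /next_pred leqnn. Qed.

Definition next (c : R) (s : nat) (w : Om) : nat := ex_minn (next_pred_ex c s w).

Lemma next_leP c s w a : (next c s w <= a)%N <-> exists2 i, (i <= a)%N & next_pred c s w i.
Proof.
rewrite /next; case: ex_minnP => i hi imin; split; first by exists i.
by move=> [k ka /imin]; move/leq_trans; apply.
Qed.

Lemma next_leN c s w : (next c s w <= N)%N.
Proof. by apply/next_leP; exists N => //; rewrite /next_pred leqnn. Qed.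

Lemma next_ge c s w : (s <= N)%N -> (s <= next c s w)%N.
Proof.
rewrite /next; case: ex_minnP => i /orP[Ni _ sN|/andP[/ltnW]//].
exact: leq_trans Ni.
Qed.

Lemma next_osc c s w i : 0 <= c -> (s <= i < next c s w)%N -> `|Y i w - Y s w| <= c.
Proof.
move=> c0 /andP[]; rewrite leq_eqVlt => /orP[/eqP ->|si]; first by rewrite subrr normr0.
move=> iS; rewrite leNgt; apply/negP => h; move: iS; rewrite ltnNge => /negP; apply.
by apply/next_leP; exists i => //; rewrite /next_pred si h orbT.
Qed.

Lemma next_jump c s w : (next c s w < N)%N -> c < `|Y (next c s w) w - Y s w|.
Proof.
by rewrite /next; case: ex_minnP => i /orP[Ni _|/andP[]//]; rewrite ltnNge Ni.
Qed.

(** Whether the jump has occurred by time [a] is decided by pairs [s < i <= a], hence by [G a]. *)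
Lemma stop_index_next c sg : stop_index sg -> stop_index (fun w => next c (sg w) w).
Proof.
move=> hs; split => [w|a aN]; first exact: next_leN.
have [aE|aN'] := leqP N a.
  by have := sigT (sG aN); congr G; apply/seteqP; split => w //= _; rewrite (leq_trans (next_leN _ _ _)).
have : G a [set w | exists i, exists s, ((i <= a)%N /\ (s < i)%N) /\
    (sg w = s /\ ~ `|Y s w - Y i w| <= c)].
  apply: (sig_ex (sG aN)) => i; apply: (sig_ex (sG aN)) => s.
  apply: (sig_and (sG aN)) => -[ia si]; have iN := leq_trans ia aN.
  apply: (sigI (sG aN)).
    apply: (Ghomo (a := s)); first by rewrite (leq_trans (ltnW si) ia).
    by apply: stop_index_eq => //; exact: leq_trans (ltnW si) iN.
  apply: (sigC (sG aN)); apply: (Ghomo (a := i)); first by rewrite ia.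
  by apply: mY; rewrite (ltnW si).
congr G; apply/seteqP; split => w /=.
  move=> [i [s [[ia si] [E' /negP h]]]]; subst s; apply/next_leP; exists i => //.
  by rewrite /next_pred si ltNge distrC h orbT.
move=> /next_leP[i ia]; rewrite /next_pred => /orP[Ni|/andP[si h]].
  by move: (leq_trans Ni ia); rewrite leqNgt aN'.
exists i, (sg w); split => //; split => //; apply/negP; rewrite -ltNge.
by rewrite distrC.
Qed.

Lemma mdist a b (c : R) : measurable [set w | c <= `|Y a w - Y b w|].
Proof.
wlog ab : a b / (a <= b)%N.
  move=> h; have [/h//|/ltnW/h] := leqP a b; congr measurable.
  by apply/seteqP; split => w /=; rewrite distrC.
wlog bN : a b ab / (b <= N)%N.
  move=> h; have [bN|/ltnW Nb] := leqP b N; first exact: h.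
  rewrite (YN Nb); have [aN|/ltnW Na] := leqP a N; first exact: h.
  by rewrite (YN Na); exact: h.
pose D k : set Om := ~` [set w | `|Y a w - Y b w| <= c - k.+1%:R^-1].
have mD k : measurable (D k).
  by apply: measurableC; apply: (GM bN); apply: mY; rewrite ab.
have := sig_all sM mD; congr measurable; apply/seteqP; split => w /= h; last first.
  move=> k; apply/negP; rewrite -ltNge (lt_le_trans _ h)// ltrBlDr ltrDl invr_gt0.
  by rewrite ltr0n.
apply/ler_addgt0Pr => e e0; have [k hk] := natSinv_lt e0.
have /negP := h k; rewrite -ltNge => /ltW; have := hk k (leqnn k).
by move: (_^-1) `|_| => x y; lra.
Qed.

Lemma mshift sg a (c : R) : stop_index sg ->
  measurable [set w | c <= `|Y (sg w + a) w - Y (sg w) w|].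
Proof.
move=> hs; have : measurable [set w | exists s, (s <= N)%N /\
    (sg w = s /\ c <= `|Y (s + a) w - Y s w|)].
  apply: (sig_ex sM) => s; apply: (sig_and sM) => sN; apply: (sigI sM).
    by apply: (GM sN); exact: stop_index_eq.
  exact: mdist.
congr measurable; apply/seteqP; split => w /=; first by move=> [s [_ [->]]].
by move=> h; exists (sg w); split => //; exact: hs.1.
Qed.

Lemma mstop_event sg tau (Q : nat -> nat -> Prop) : stop_index sg -> stop_index tau ->
  measurable [set w | Q (sg w) (tau w)].
Proof.
move=> hs ht; have : measurable [set w | exists s t, ((s <= N)%N /\ (t <= N)%N /\ Q s t) /\
    (sg w = s /\ tau w = t)].
  apply: (sig_ex sM) => s; apply: (sig_ex sM) => t; apply: (sig_and sM) => -[sN [tN _]].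
  by apply: (sigI sM); [apply: (GM sN)|apply: (GM tN)]; exact: stop_index_eq.
congr measurable; apply/seteqP; split => w /=; first by move=> [s [t [[_ [_ q]] [-> ->]]]].
by move=> q; exists (sg w), (tau w); split => //; split; [exact: hs.1|split => //; exact: ht.1].
Qed.

Definition aldous_at (eta eps : R) (L : nat) := forall sg a, stop_index sg -> (a < L)%N ->
  (P [set w | (eta <= `|Y (sg w + a)%N w - Y (sg w) w|)%R] <= eps%:E)%E.

(* Averaging over a, as the two times are at most L apart, a jump of size 2 eta
   between them is visible in at least L of the 3 L increments. *)
Lemma short_gap eta eps L sg : aldous_at eta eps (L + L) -> (0 < L)%N -> stop_index sg ->
  (P [set w | (next (eta + eta)%R (sg w) w < N)%N /\
              (next (eta + eta)%R (sg w) w <= sg w + L)%N] <= (3 * eps)%:E)%E.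
Proof.
move=> al L0 hs; pose nx w := next (eta + eta) (sg w) w; have hn : stop_index nx by exact: stop_index_next.
set A := [set w | _].
have mA : measurable A := mstop_event (fun s t => (t < N)%N /\ (t <= s + L)%N) hs hn.
(* The first [2 L] events are about increments after [sg w], the last [L] about increments after the
   next jump time [nx w]. *)
pose B (i : 'I_(L + L + L)) : set Om := match fintype.split i with
  | inl a => [set w | eta <= `|Y (sg w + a) w - Y (sg w) w|]
  | inr b => [set w | eta <= `|Y (nx w + b) w - Y (nx w) w|] end.
have mB i : measurable (B i) by rewrite /B; case: fintype.split => a; exact: mshift.
have PB i : (P (B i) <= eps%:E)%E.
  rewrite /B; case: fintype.split => a; apply: al => //.
  by rewrite (leq_trans (ltn_ord a))// leq_addr.
have hAB w : A w -> (L <= \sum_(i < L + L + L) `[< B i w >])%N.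
  move=> [nN nL]; have sn : (sg w <= nx w)%N by apply: next_ge; exact: hs.1.
  rewrite big_split_ord /=.
  pose f (i : nat) : nat := `[< eta <= `|Y (sg w + i) w - Y (sg w) w| >].
  pose g (i : nat) : nat := `[< eta <= `|Y (nx w + i) w - Y (nx w) w| >].
  rewrite (eq_bigr (fun i : 'I_(L + L) => f i)) => [|i _]; last first.
    by rewrite /B /f (unsplitK (inl i)).
  rewrite [X in (_ + X)%N](eq_bigr (fun i : 'I_L => g i)) => [|i _]; last first.
    by rewrite /B /g (unsplitK (inr i)).
  pose r := (nx w - sg w)%N; have rL : (r <= L)%N by rewrite leq_subLR.
  (* [sg w + (r + i)] and [nx w + i] are the same time. The values at [sg w] and [nx w] are more
     than [2 eta] apart, so the value at that time is at least [eta] away from one of them. *)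
  have fg i : (1 <= f (r + i) + g i)%N.
    rewrite /f /g addnA subnKC//.
    case: asboolP => // h1; case: asboolP => // h2.
    move/negP: h1; move/negP: h2; rewrite -!ltNge => h2 h1.
    have := next_jump nN; rewrite -/(nx w) ltNge => /negP; case.
    have := ler_distD (Y (nx w + i) w) (Y (nx w) w) (Y (sg w) w).
    by move: h1 h2; rewrite (distrC (Y (nx w) w) (Y (nx w + i)%N w)); lra.
  have -> : (\sum_(i < L + L) f i = \sum_(0 <= i < L + L) f i)%N by rewrite big_mkord.
  have -> : (\sum_(i < L) g i = \sum_(0 <= i < L) g i)%N by rewrite big_mkord.
  have : (\sum_(0 <= i < L) 1 <= \sum_(0 <= i < L) (f (r + i) + g i))%N.
    by apply: leq_sum => i _; exact: fg.
  rewrite sum_nat_const_nat subn0 muln1 big_split /= => /leq_trans; apply.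
  rewrite leq_add2r.
  have -> : (\sum_(0 <= i < L) f (r + i) = \sum_(r <= i < r + L) f i)%N.
    rewrite -{2}[r]add0n [(r + L)%N]addnC big_addn addnK.
    by apply: eq_bigr => i _; rewrite addnC.
  rewrite (@big_cat_nat _ _ _ r 0 (L + L))//=; last exact: leq_trans rL (leq_addr _ _).
  rewrite (leq_trans _ (leq_addl _ _))//.
  rewrite (@big_cat_nat _ _ _ (r + L) r (L + L))//= ?leq_addr//; last by rewrite leq_add2r.
have := measure_count_le P mA mB hAB.
have : (\sum_(i < L + L + L) P (B i) <= (L%:R * (3 * eps))%:E)%E.
  apply: (@le_trans _ _ (\sum_(i < L + L + L) eps%:E)%E); first by apply: lee_sum => i _.
  by rewrite sumEFin lee_fin sumr_const card_ord -[eps *+ _]mulr_natr !natrD; lra.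
move=> h1 h2; have := le_trans h2 h1.
have : P A \is a fin_num by exact: fin_num_measure.
by move: (P A) => [r| |]//= _; rewrite -EFinM !lee_fin ler_pM2l// ltr0n.
Qed.

Definition jumps (c : R) k w : nat := iter k (fun s => next c s w) 0%N.

Lemma jumps_leN c k w : (jumps c k w <= N)%N.
Proof. by case: k => // k; exact: next_leN. Qed.

Lemma stop_index_jumps c k : stop_index (jumps c k).
Proof. by elim: k => [|k IH]; [exact: stop_index_cst|exact: stop_index_next]. Qed.

Lemma jumps_homo c k l w : (k <= l)%N -> (jumps c k w <= jumps c l w)%N.
Proof.
move=> kl; rewrite -(subnK kl); elim: (l - k)%N => // i IH.
by rewrite addSn (leq_trans IH)// next_ge// jumps_leN.
Qed.

Definition short_jump c L k : set Om :=
  [set w | (jumps c k.+1 w < N)%N /\ (jumps c k.+1 w <= jumps c k w + L)%N].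

Lemma measurable_short_jump c L k : measurable (short_jump c L k).
Proof.
exact: (mstop_event (fun s t => (t < N)%N /\ (t <= s + L)%N)
  (stop_index_jumps c k) (stop_index_jumps c k.+1)).
Qed.

(** If [2 M] jumps occur before [N <= M L], at least [M] of the gaps have length at most [L]. Each
    such short gap has probability at most [3 eps], so counting gives [M P <= 2 M (3 eps)]. *)
Lemma many_jumps eta eps L M : aldous_at eta eps (L + L) -> (0 < L)%N -> (0 < M)%N ->
  (N <= M * L)%N ->
  (P [set w | (jumps (eta + eta) (M + M) w < N)%N] <= (6 * eps)%:E)%E.
Proof.
move=> al L0 M0 NML; set c := eta + eta; set A := [set w | _].
have mA : measurable A.
  exact: (mstop_event (fun s _ => (s < N)%N) (stop_index_jumps c (M + M)) (stop_index_jumps c 0)).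
pose B (k : 'I_(M + M)) := short_jump c L k.
have mB k : measurable (B k) by exact: measurable_short_jump.
have hAB w : A w -> (M <= \sum_(k < M + M) `[< B k w >])%N.
  move=> Aw; pose f k : nat := `[< short_jump c L k w >].
  have key k : (k <= M + M)%N -> (L * (k - \sum_(i < k) f i) <= jumps c k w)%N.
    elim: k => [|k IH] kM; first by rewrite muln0.
    have fk : (\sum_(i < k) f i <= k)%N.
      rewrite -[leqRHS]card_ord -sum1_card; apply: leq_sum => i _; exact: leq_b1.
    rewrite big_ord_recr /= {2}/f; case: asboolP => h /=.
      by rewrite addn1 subSS (leq_trans (IH (ltnW kM)))// next_ge// jumps_leN.
    have kN : (jumps c k.+1 w < N)%N.
      exact: leq_ltn_trans (jumps_homo _ _ kM) Aw.
    rewrite addn0 subSn// mulnSr (leq_trans (leq_add (IH (ltnW kM)) (leqnn L)))//.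
    by rewrite leqNgt; apply/negP => h'; apply: h; split => //; exact: ltnW.
  have := key _ (leqnn _); rewrite leqNgt => /negP h; rewrite leqNgt; apply/negP => h'.
  apply: h; apply: (leq_trans Aw); rewrite (leq_trans NML)// mulnC leq_mul2l.
  apply/orP; right; move: (h' : (\sum_(i < M + M) f i < M)%N).
  by move: (\sum_(i < M + M) f i)%N => S; lia.
have := measure_count_le P mA mB hAB.
have : (\sum_(k < M + M) P (B k) <= (M%:R * (6 * eps))%:E)%E.
  apply: (@le_trans _ _ (\sum_(i < M + M) (3 * eps)%:E)%E).
    by apply: lee_sum => i _; apply: short_gap => //; exact: stop_index_jumps.
  by rewrite sumEFin lee_fin sumr_const card_ord -[(3 * eps) *+ _]mulr_natr natrD; lra.
move=> h1 h2; have := le_trans h2 h1.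
have : P A \is a fin_num by exact: fin_num_measure.
by move: (P A) => [r| |]//= _; rewrite -EFinM !lee_fin ler_pM2l// ltr0n.
Qed.

(** The good event on a grid. The last condition, no move beyond [c] from the value at [N - L],
    allows the last cell to be extended to length [L]. *)
Definition tame c L K : set Om := [set w | [/\ (N <= jumps c K w)%N,
  forall k, (k < K)%N -> ~ short_jump c L k w & (N <= next c (N - L) w)%N]].

Lemma measurable_tame c L K : measurable (tame c L K).
Proof.
have h1 : measurable [set w | (N <= jumps c K w)%N].
  exact: (mstop_event (fun s _ => (N <= s)%N) (stop_index_jumps c K) (stop_index_jumps c 0)).
have h2 : measurable [set w | forall k, (k < K)%N -> ~ short_jump c L k w].
  apply: (sig_all sM) => k; have [kK|Kk] := ltnP k K.
    have := measurableC (measurable_short_jump c L k); congr measurable.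
    by apply/seteqP; split => w //= h; exact: h.
  by have := @measurableT _ Om; congr measurable; apply/seteqP; split.
have hn : stop_index (fun w => next c (N - L)%N w).
  by apply: stop_index_next; apply: stop_index_cst; exact: leq_subr.
have h3 : measurable [set w | (N <= next c (N - L) w)%N].
  exact: (mstop_event (fun s _ => (N <= s)%N) hn hn).
have := sigI sM h1 (sigI sM h2 h3); congr measurable.
by apply/seteqP; split => w /=; [move=> [? [? ?]]|move=> [? ? ?]].
Qed.

(** Two scales: [L] bounds the number of jumps by [2 M]; then [L'], with its own tolerance [eps'],
    excludes a short gap after each of them and a move in the final window, which makes [2 M + 1]
    events. *)
Lemma tame_probability eta eps eps' L L' M :
  aldous_at eta eps (L + L) -> (0 < L)%N -> (0 < M)%N -> (N <= M * L)%N ->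
  aldous_at eta eps' (L' + L') -> (0 < L' <= N)%N ->
  (P (~` tame (eta + eta) L' (M + M)) <= (6 * eps + 3 * (M + M).+1%:R * eps')%:E)%E.
Proof.
move=> al L0 M0 NML al' /andP[L'0 L'N]; set c := eta + eta; set K := (M + M)%N.
set A0 := [set w | (jumps c K w < N)%N].
have mA0 : measurable A0.
  exact: (mstop_event (fun s _ => (s < N)%N) (stop_index_jumps c K) (stop_index_jumps c 0)).
have hs : stop_index (fun=> (N - L')%N) by apply: stop_index_cst; exact: leq_subr.
pose nx w := next c (N - L')%N w.
have hn : stop_index nx by exact: stop_index_next.
pose B (k : 'I_K.+1) : set Om := if (k < K)%N then short_jump c L' k else
  [set w | (nx w < N)%N /\ (nx w <= N - L' + L')%N].
have mB k : measurable (B k).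
  rewrite /B; case: ifP => _; first exact: measurable_short_jump.
  exact: (mstop_event (fun s t => (t < N)%N /\ (t <= s + L')%N) hs hn).
have PB k : (P (B k) <= (3 * eps')%:E)%E.
  rewrite /B; case: ifP => _; apply: (short_gap al' L'0) => //.
  exact: stop_index_jumps.
pose D (k : 'I_(K.+2)) : set Om := if unlift ord0 k is Some i then B i else A0.
have mD k : measurable (D k) by rewrite /D; case: unlift.
have mC : measurable (~` tame c L' K) by apply: measurableC; exact: measurable_tame.
have hD w : (~` tame c L' K) w -> (1 <= \sum_(i < K.+2) `[< D i w >])%N.
  move=> nt; rewrite lt0n; apply/negP => /eqP/eqP.
  rewrite sum_nat_eq0 => /forallP h; apply: nt.
  have nD k : ~ D k w by have /= := h k; rewrite eqb0 => /asboolP.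
  split.
  - by rewrite leqNgt; apply/negP => h'; apply: (nD ord0); rewrite /D unlift_none.
  - move=> k kK; have kK1 : (k < K.+1)%N by exact: ltnW.
    by have := nD (lift ord0 (Ordinal kK1)); rewrite /D liftK /B /= kK.
  - rewrite leqNgt; apply/negP => h'; apply: (nD (lift ord0 ord_max)); rewrite /D liftK /B /=.
    by rewrite ltnn; split => //; rewrite subnK// ltnW.
have := measure_count_le P mC mD hD.
rewrite mul1e big_ord_recl => /le_trans; apply; rewrite EFinD; apply: leeD.
  by rewrite /D unlift_none; exact: many_jumps al L0 M0 NML.
apply: (@le_trans _ _ (\sum_(i < K.+1) (3 * eps')%:E)%E).
  by apply: lee_sum => i _; rewrite /D liftK.
by rewrite sumEFin lee_fin sumr_const card_ord -[(3 * eps') *+ _]mulr_natr; lra.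
Qed.

(** The cuts are the jumps up to the last one at or before [N - L], and then [N]. In the last cell
    the path stays within [c] of its value at the cut up to the next jump, and afterwards within [c]
    of its value at [N - L]: so within [2 c] of the cut value, and [4 c] between two points. *)
Lemma tame_partition c L K w : 0 <= c -> (0 < L <= N)%N -> tame c L K w ->
  exists n s, [/\ s 0%N = 0%N, s n = N, forall i, (i < n)%N -> (s i + L <= s i.+1)%N &
    forall i a b, (i < n)%N -> (s i <= a < s i.+1)%N -> (s i <= b < s i.+1)%N ->
      `|Y a w - Y b w| <= 4 * c].
Proof.
move=> c0 /andP[L0 LN] [KN sj endN].
have [k kP kmax] : exists2 k, (jumps c k w <= N - L)%N & (N - L < jumps c k.+1 w)%N.
  have ex : exists k, (N - L < jumps c k w)%N.
    by exists K; rewrite (leq_trans _ KN)// ltn_subrL L0 (leq_trans L0).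
  case: (ex_minnP ex) => -[//|k] hk hmin; exists k => //.
  by rewrite leqNgt; apply/negP => /hmin; rewrite ltnn.
have kK : (k < K)%N.
  rewrite ltnNge; apply/negP => Kk; have := leq_trans KN (jumps_homo c w Kk).
  by move=> /leq_trans/(_ kP); rewrite leqNgt ltn_subrL L0 (leq_trans L0).
pose s i := if (i <= k)%N then jumps c i w else N.
have osc0 i a : (jumps c i w <= a < jumps c i.+1 w)%N -> `|Y a w - Y (jumps c i w) w| <= c.
  exact: next_osc.
have osc_end a : (N - L <= a < N)%N -> `|Y a w - Y (N - L)%N w| <= c.
  by move=> /andP[a1 a2]; apply: next_osc => //; rewrite a1 (leq_trans a2).
exists k.+1, s; split => //; first by rewrite /s ltnn.
  move=> i; rewrite ltnS /s => ik; rewrite ik; case: (ltnP i k) => ik'.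
    have iK : (i < K)%N by exact: ltn_trans kK.
    have := sj i iK; rewrite /short_jump /= => h; rewrite leqNgt; apply/negP => h'.
    apply: h; split; last exact: ltnW.
    by rewrite (leq_ltn_trans (jumps_homo c w ik'))// (leq_ltn_trans kP)// ltn_subrL L0 (leq_trans L0).
  have -> : i = k by apply/eqP; rewrite eqn_leq ik' ik.
  by rewrite -leq_subRL ?addnC// -?leq_subRL//; lia.
move=> i a b; rewrite ltnS => ik ha hb.
suff near x : (s i <= x < s i.+1)%N -> `|Y x w - Y (jumps c i w) w| <= c + c.
  have := near _ ha; have := near _ hb; have := ler_distD (Y (jumps c i w) w) (Y a w) (Y b w).
  by rewrite (distrC (Y (jumps c i w) w)); lra.
rewrite /s ik; case: (ltnP i k) => ik'.
  by move=> /osc0 h; rewrite (le_trans h)// lerDl.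
have -> : i = k by apply/eqP; rewrite eqn_leq ik' ik.
move=> /andP[x1 x2]; have [xk|kx] := ltnP x (jumps c k.+1 w).
  by rewrite (le_trans (osc0 _ _ _)) ?x1// lerDl.
have h1 : `|Y x w - Y (N - L)%N w| <= c by apply: osc_end; rewrite x2 (leq_trans (ltnW kmax)).
have h2 : `|Y (N - L)%N w - Y (jumps c k w) w| <= c by apply: osc0; rewrite kP.
by have := ler_distD (Y (N - L)%N w) (Y x w) (Y (jumps c k w) w); lra.
Qed.

End discrete_aldous.

Section grid_arithmetic.
Context {R : realType} (T : R) (T0 : 0 < T) (m : nat).
Local Notation N := (2 ^ m)%N.
Local Notation g := (grid T m).
Let N0 : (0 : R) < N%:R. Proof. by rewrite ltr0n expn_gt0. Qed.

Lemma gridD a b : g (a + b)%N = g a + g b.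
Proof. by rewrite /grid natrD mulrDr mulrDl. Qed.

Lemma le_grid a b : (g a <= g b) = (a <= b)%N.
Proof. by rewrite /grid ler_pdivrMr// divfK ?gt_eqF// ler_pM2l// ler_nat. Qed.

Lemma lt_grid a b : (g a < g b) = (a < b)%N.
Proof. by rewrite !ltNge le_grid ltnNge. Qed.

Lemma grid0 : g 0 = 0.
Proof. by rewrite /grid mulr0 mul0r. Qed.

Lemma gridT : g N = T.
Proof. by rewrite /grid mulfK// gt_eqF. Qed.

Lemma grid_ge0 a : 0 <= g a.
Proof. by rewrite -grid0 le_grid. Qed.

Lemma grid_itv a : (a <= N)%N -> g a \in `[0, T].
Proof. by move=> aN; rewrite in_itv/= grid_ge0 -[X in _ <= X]gridT le_grid. Qed.

Lemma gridM a b : g (a * b)%N = a%:R * g b.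
Proof. by rewrite /grid natrM; ring. Qed.

Lemma grid_floor t : 0 <= t -> exists2 a, (a <= N)%N &
  forall b, (b <= N)%N -> (g b <= t) = (b <= a)%N.
Proof.
move=> t0; have ex : exists a, (a <= N)%N && (g a <= t) by exists 0%N; rewrite grid0.
have [|a /andP[aN ga] amax] := @ex_maxnP _ N ex; first by move=> a /andP[].
exists a => // b bN; apply/idP/idP => [gb|ba]; first by apply: amax; rewrite bN.
by rewrite (le_trans _ ga)// le_grid.
Qed.

(** [L] is the integer part of [r / 2] divided by the mesh; a mesh of at most [r / 4] makes it
    positive and keeps the rounding loss below [r / 4]. *)
Lemma grid_steps (r : R) : 0 < r -> g 1 <= r / 4 ->
  exists2 L, (0 < L)%N & g (L + L) <= r /\ r / 4 <= g L.
Proof.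
move=> r0 g1r; have g10 : 0 < g 1 by rewrite -[X in X < _]grid0 lt_grid.
pose L := Num.truncn (r / (2 * g 1)).
have g20 : 0 < 2 * g 1 by rewrite mulr_gt0.
have h1 : L%:R <= r / (2 * g 1) by rewrite truncn_le divr_ge0// ltW.
have h2 : r / (2 * g 1) < L.+1%:R by exact: truncnS_gt.
rewrite ler_pdivlMr// in h1; rewrite ltr_pdivrMr// -natr1 in h2.
have gL : g L = L%:R * g 1 by rewrite -gridM muln1.
exists L; last by rewrite gridD gL; split; lra.
rewrite lt0n; apply/eqP => L0; move: h2; rewrite L0; lra.
Qed.

End grid_arithmetic.

Lemma grid1_small {R : realType} (T r : R) : 0 < T -> 0 < r ->
  exists m0, forall m, (m0 <= m)%N -> grid T m 1 <= r.
Proof.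
move=> T0 r0; have [k hk] := natSinv_lt (divr_gt0 r0 T0).
exists k => m km; rewrite /grid mulr1.
have h : (m.+1 <= 2 ^ m)%N by exact: ltn_expl.
have e0 : (0 : R) < (2 ^ m)%:R by rewrite ltr0n expn_gt0.
rewrite ler_pdivrMr//; have := hk m km.
rewrite ltr_pdivlMr// mulrC ltr_pdivrMr// => /ltW /le_trans; apply.
by rewrite ler_pM2l// ler_nat.
Qed.

Lemma grid_regular_coarse {R : realType} {E : normedModType R} (T dlt eta : R) k m (u : R -> E) :
  (k <= m)%N -> grid_regular T dlt eta m u -> grid_regular T dlt eta k u.
Proof.
move=> km [n [t [ct ut]]]; exists n, t; split => // i a b iN.
have ok (c : 'I_(2 ^ k).+1) : (2 ^ (m - k) * c < (2 ^ m).+1)%N.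
  rewrite ltnS -{2}(subnK km) expnD leq_mul2l; apply/orP; right.
  by rewrite -ltnS.
rewrite !(grid_refine T _ km) => ha hb.
exact: (ut i (Ordinal (ok a)) (Ordinal (ok b))).
Qed.

(** * From grids to cadlag paths *)

Section continuous_aldous.
Context {R : realType} {E : normedModType R} {dd : measure_display} {Om : measurableType dd}.
Variables (P : probability Om R) (T : R) (F : R -> set (set Om)).
Variable X : nat -> R -> Om -> E.
Hypotheses (T0 : 0 < T) (filF : filtration T F).
Hypothesis mX : forall n s t (c : R), 0 <= s -> s <= t -> t <= T ->
  F t [set w | `|X n s w - X n t w| <= c].
Hypothesis cX : forall n, cadlag_process T (X n).
Hypothesis aldX : aldous T F P X.
Let sM := sigma_algebra_measurable Om.
Local Notation Gm m := (fun a => F (grid T m a)).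
Local Notation Ym n m := (fun a w => trajectory T (X n) w (grid T m a)).

Lemma trajectory_id n w t : t \in `[0, T] -> trajectory T (X n) w t = X n t w.
Proof. by move=> tT; rewrite /trajectory extend_id. Qed.

Lemma mGm m a : (a <= 2 ^ m)%N -> sigma_algebra setT (Gm m a).
Proof. by move=> aN; exact: (filF.1 _ (grid_itv T0 aN)).1. Qed.

Lemma GmM m a : (a <= 2 ^ m)%N -> Gm m a `<=` measurable.
Proof. by move=> aN; exact: (filF.1 _ (grid_itv T0 aN)).2. Qed.

Lemma Gm_homo m a b : (a <= b <= 2 ^ m)%N -> Gm m a `<=` Gm m b.
Proof.
move=> /andP[ab bN]; have := grid_itv T0 bN; rewrite in_itv/= => /andP[_ bT].
by apply: filF.2 => //; [exact: grid_ge0|rewrite le_grid].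
Qed.

Lemma mYm n m a b (c : R) : (a <= b <= 2 ^ m)%N ->
  Gm m b [set w | `|Ym n m a w - Ym n m b w| <= c].
Proof.
move=> /andP[ab bN]; have bT := grid_itv T0 bN; have aT := grid_itv T0 (leq_trans ab bN).
have := @mX n (grid T m a) (grid T m b) c (grid_ge0 T0 m a); rewrite le_grid// ab.
move: (bT); rewrite in_itv/= => /andP[_ bT'] => /(_ isT bT'); congr (F _).
by apply/seteqP; split => w /=; rewrite !trajectory_id.
Qed.

Lemma YmN n m a : (2 ^ m <= a)%N -> Ym n m a = Ym n m (2 ^ m)%N.
Proof.
move=> Na; apply/funext => w; rewrite gridT /trajectory !(extend_gt _ (ltW T0))//.
by rewrite -[X in X <= _](gridT T m) le_grid.
Qed.

Lemma stop_index_stopping m sg : stop_index (2 ^ m) (Gm m) sg ->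
  stopping_time T F (fun w => grid T m (sg w)).
Proof.
move=> [sN hs] t; rewrite in_itv/= => /andP[t0 tT].
have [a aN ha] := grid_floor T0 m t0.
have at' : grid T m a <= t by rewrite ha.
have := @filF.2 (grid T m a) t (grid_ge0 T0 m a) at' tT _ (hs a aN); congr (F _).
by apply/seteqP; split => w /=; rewrite ha.
Qed.

Lemma aldous_grid (eps eta : R) : 0 < eps -> 0 < eta -> exists2 dlt : R, 0 < dlt &
  forall n m L, grid T m L <= dlt -> aldous_at P (2 ^ m) (Gm m) (Ym n m) eta eps L.
Proof.
move=> eps0 eta0; have [dlt dlt0 h] := aldX eps0 eta0; exists dlt => // n m L Ld sg a hs aL.
(* The condition is about sequences of stopping times; all but the [n]-th are set to 0. *)
pose tau k w := if k == n then grid T m (sg w) else 0.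
have htau k : stopping_time T F (tau k) /\ forall w, 0 <= tau k w <= T.
  rewrite /tau; case: eqVneq => _; split.
  - exact: stop_index_stopping.
  - by move=> w; have := grid_itv T0 (hs.1 w); rewrite in_itv.
  - move=> t tT; have := sigT (filF.1 t tT).1; congr (F _).
    by apply/seteqP; split => w //= _; move: tT; rewrite in_itv/= => /andP[].
  - by move=> w; rewrite lexx ltW.
apply: le_trans (h tau htau); apply: ereal_sup_ubound; exists n => //.
exists (grid T m a).
  by rewrite /= in_itv/= grid_ge0//= (le_trans _ Ld)// le_grid// ltnW.
by congr (P _); apply/seteqP; split => w /=; rewrite /tau eqxx -gridD.
Qed.

(** The subdivision ranges over an uncountable set, but matters only through the set [b] of pairs of
    grid points that share a cell. The event is a union over the finitely many [b] that contain all
    such pairs for some subdivision. *)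
Lemma measurable_grid_regular n m (dlt eta : R) :
  measurable [set w | grid_regular T dlt eta m (trajectory T (X n) w)].
Proof.
pose I := ('I_(2 ^ m).+1 * 'I_(2 ^ m).+1)%type.
pose B (p : I) := [set w | `|Ym n m p.1 w - Ym n m p.2 w| <= eta].
pose Q (b : {set I}) := exists k t, cut_points T dlt k t /\
  forall i (a a' : 'I_(2 ^ m).+1), (i < k)%N -> t i <= grid T m a < t i.+1 ->
    t i <= grid T m a' < t i.+1 -> (a, a') \in b.
have mB p : measurable (B p).
  case: p => a b; rewrite /B /=; have aN := ltn_ord a; have bN := ltn_ord b.
  have [ab|/ltnW ba] := leqP a b.
    exact: (GmM (bN : (b <= 2 ^ m)%N) (@mYm n m a b eta (introT andP (conj ab bN)))).
  have h : measurable [set w | `|Ym n m b w - Ym n m a w| <= eta].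
    exact: (GmM (aN : (a <= 2 ^ m)%N) (@mYm n m b a eta (introT andP (conj ba aN)))).
  by move: h; congr measurable; apply/seteqP; split => w /=; rewrite distrC.
have : measurable (\bigcup_(b in Q) \bigcap_(p in [set p | p \in b]) B p).
  apply: fin_bigcup_measurable => // b _; exact: fin_bigcap_measurable.
congr measurable; apply/seteqP; split => w /=.
  move=> [b [k [t [ct hb]]] hw]; exists k, t; split => // i a a' ik ha ha'.
  exact: hw (hb i a a' ik ha ha').
move=> [k [t [ct ut]]]; exists [set p : I | `[< B p w >]]%SET.
  exists k, t; split => // i a a' ik ha ha'; rewrite finset.inE; apply/asboolP.
  exact: ut ik ha ha'.
by move=> p /=; rewrite finset.inE => /asboolP.
Qed.

Lemma regular_onE n (dlt eta : R) : 0 < dlt ->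
  [set w | regular_on T dlt eta (trajectory T (X n) w)] =
  \bigcap_m [set w | grid_regular T dlt eta m (trajectory T (X n) w)].
Proof.
move=> d0; apply/seteqP; split => w /=; first by move=> h m _; exact: regular_on_grid.
by move=> h; apply: grid_regularP => //; [exact: cX|move=> m; exact: h].
Qed.

Lemma measurable_regular_on n (dlt eta : R) : 0 < dlt ->
  measurable [set w | regular_on T dlt eta (trajectory T (X n) w)].
Proof.
by move=> d0; rewrite regular_onE//; apply: bigcapT_measurable => m; exact: measurable_grid_regular.
Qed.

Lemma tame_grid_regular n m (eta : R) L K w (dlt : R) : 0 <= eta -> (0 < L <= 2 ^ m)%N ->
  dlt <= grid T m L -> tame (2 ^ m) (Ym n m) eta L K w ->
  grid_regular T dlt (4 * eta) m (trajectory T (X n) w).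
Proof.
move=> eta0 LN dL /(tame_partition eta0 LN) [k [s [s0 sk sL so]]].
exists k, (fun i => grid T m (s i)); split.
  split; rewrite ?s0 ?grid0 ?sk ?gridT// => i ik.
  by rewrite (le_trans (lerD (lexx _) dL))// -gridD le_grid// sL.
move=> i a b ik; rewrite !le_grid// !lt_grid// => ha hb.
exact: so ik ha hb.
Qed.

Theorem aldous_regular (eps eta : R) : 0 < eps -> 0 < eta -> exists2 dlt : R, 0 < dlt &
  forall n, measurable [set w | regular_on T dlt eta (trajectory T (X n) w)] /\
    (P (~` [set w | regular_on T dlt eta (trajectory T (X n) w)]) <= eps%:E)%E.
Proof.
(* Jumps are moves beyond [2 e], and a tame path oscillates by at most [4 (2 e) = eta] on a cell.
   The probability [6 (eps / 12) + 3 (2 M + 1) eps'] is made of two halves of [eps]; [eps'] depends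
   on [M], hence on [d1], so the condition is invoked a second time. *)
move=> eps0 eta0; pose e := eta / 8; have e0 : 0 < e by rewrite divr_gt0.
have eps1 : 0 < eps / 12 by rewrite divr_gt0.
have [d1 d10 al1] := aldous_grid eps1 e0.
pose M := (Num.truncn (4 * T / d1)).+1.
have hM : T <= M%:R * (d1 / 4).
  have : 4 * T / d1 < M%:R by exact: truncnS_gt.
  by rewrite ltr_pdivrMr//; lra.
have K0 : 0 < 3 * (M + M).+1%:R :> R by rewrite mulr_gt0.
pose eps' := eps / 2 / (3 * (M + M).+1%:R).
have eps'0 : 0 < eps' by rewrite !divr_gt0.
have [d2 d20 al2] := aldous_grid eps'0 e0.
(* The cap at [T] ensures [L' <= 2 ^ m]. *)
pose d := Num.min d2 T; have d0 : 0 < d by rewrite lt_min d20.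
have dlt0 : 0 < d / 4 by rewrite divr_gt0.
exists (d / 4) => // n; split; first exact: measurable_regular_on.
have r0 : 0 < Num.min (d1 / 4) (d / 4) by rewrite lt_min dlt0 divr_gt0.
have [m0 hm0] := grid1_small T0 r0.
pose A m := [set w | grid_regular T (d / 4) eta m (trajectory T (X n) w)].
have mA m : measurable (A m) by exact: measurable_grid_regular.
have PA m : (m0 <= m)%N -> ((1 - eps)%:E <= P (A m))%E.
  move=> /hm0; rewrite le_min => /andP[g1 g2].
  have [L L0 [Ld dL]] := grid_steps T0 d10 g1.
  have [L' L'0 [L'd dL']] := grid_steps T0 d0 g2.
  have LN' : (2 ^ m <= M * L)%N.
    rewrite -(le_grid T0 m) gridT// gridM// (le_trans hM)// ler_wpM2l//.
  have L'N : (0 < L' <= 2 ^ m)%N.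
    rewrite L'0 -(le_grid T0 m) gridT//= (@le_trans _ _ d)// ?ge_min ?lexx ?orbT//.
    by rewrite (le_trans _ L'd)// le_grid// leq_addr.
  have L'd2 : grid T m (L' + L') <= d2 by rewrite (le_trans L'd)// ge_min lexx.
  have M0 : (0 < M)%N by [].
  have := tame_probability (@mGm m) (@GmM m) (@Gm_homo m) (@mYm n m) (@YmN n m)
    (al1 n m _ Ld) L0 M0 LN' (al2 n m _ L'd2) L'N.
  have -> : 6 * (eps / 12) + 3 * (M + M).+1%:R * eps' = eps.
    have -> : 3 * (M + M).+1%:R * eps' = eps / 2 by rewrite /eps' mulrC divfK// gt_eqF.
    by lra.
  set t := tame _ _ _ _ _ => Pt.
  have mt : measurable t := measurable_tame (@mGm m) (@GmM m) (@Gm_homo m) (@mYm n m) _ _ _.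
  have := probability_setC_ge mt Pt; move=> /le_trans; apply.
  apply: le_measure; rewrite ?inE//.
  move=> w tw; rewrite /A /=.
  have ee : 0 <= e + e by rewrite addr_ge0// ltW.
  have := tame_grid_regular ee L'N dL' tw.
  by have -> : 4 * (e + e) = eta by rewrite /e; lra.
apply: probability_setC_le; first exact: measurable_regular_on.
rewrite regular_onE//.
(* Finer grids impose more conditions, so the events decrease and the uniform lower bound passes to
   their intersection. *)
have cv : P \o A @ \oo --> P (\bigcap_m A m).
  apply: nonincreasing_cvg_mu => //.
  - by rewrite (le_lt_trans (probability_le1 _ (mA _)))// ltry.
  - exact: bigcapT_measurable.
  - by move=> k l kl; rewrite subsetEset => w; exact: grid_regular_coarse.
rewrite -(cvg_lim _ cv)//; apply: lime_ge; first by apply/cvg_ex; exists (P (\bigcap_m A m)).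
by exists m0 => // m /PA.
Qed.

End continuous_aldous.

(** * Measurability of path events *)

Lemma sig_lt_sub {R : realType} {W : Type} (G : set (set W)) (f g : W -> R) (c : R) :
  sigma_algebra setT G -> (forall r, G [set w | r < f w]) -> (forall r, G [set w | g w < r]) ->
  G [set w | c < f w - g w].
Proof.
move=> sG mf mg; have : G [set w | exists i, (if @unpickle rat i is Some q
    then [set w | ratr q < f w] `&` [set w | g w < ratr q - c] else set0) w].
  apply: (sig_ex sG) => i; case: unpickle => [q|]; last by case: sG.
  exact: (sigI sG).
congr G; apply/seteqP; split => w /=.
  by move=> [i]; case: unpickle => [q|]//= [h1 h2]; lra.
move=> h; have [|q] := @rat_in_itvoo R (g w + c) (f w); first by lra.
by rewrite in_itv/= => /andP[q1 q2]; exists (pickle q); rewrite pickleK /=; split; lra.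
Qed.

Lemma sig_dist_le {R : realType} {W : Type} (G : set (set W)) (f g : W -> R) (c : R) :
  sigma_algebra setT G -> (forall r, G [set w | r < f w]) -> (forall r, G [set w | f w < r]) ->
  (forall r, G [set w | r < g w]) -> (forall r, G [set w | g w < r]) ->
  G [set w | `|f w - g w| <= c].
Proof.
move=> sG f1 f2 g1 g2; have h1 := sigC sG (sig_lt_sub c sG f1 g2).
have h2 := sigC sG (sig_lt_sub c sG g1 f2); have := sigI sG h1 h2; congr G.
apply/seteqP; split => w /=; rewrite ler_norml.
  by move=> [/negP + /negP]; rewrite -!leNgt; lra.
by move=> h; split; apply/negP; rewrite -leNgt; lra.
Qed.

(** * Markov's inequality *)

Section markov.
Context {R : realType} {dd : measure_display} {Om : measurableType dd}.
Variable P : probability Om R.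

(** The integral of [f] is compared with that of [c] times the indicator of [A]; here [f] may be a
    supremum over uncountably many times. *)
Lemma markov_le (f : Om -> \bar R) (A : set Om) (c C : R) :
  (forall w, 0 <= f w)%E -> measurable A -> 0 <= c -> (forall w, A w -> (c%:E <= f w)%E) ->
  (\int[P]_w f w <= C%:E)%E -> (c%:E * P A <= C%:E)%E.
Proof.
move=> f0 mA c0 Af /(le_trans _); apply.
have -> : (c%:E * P A = \int[P]_w (c%:E * (\1_A w)%:E))%E.
  rewrite ge0_integralZl//; first by rewrite integral_indic// setIT.
  by apply/measurable_EFinP; exact: measurable_indic.
apply: le_nonneg_integral => w _; first by rewrite -EFinM lee_fin mulr_ge0.
rewrite indicE; have [/set_mem/Af|_] := boolP (w \in A); first by rewrite mule1.
by rewrite mule0.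
Qed.

Lemma probability_le_div (A : set Om) (c C : R) : measurable A -> 0 < c ->
  (c%:E * P A <= C%:E)%E -> (P A <= (C / c)%:E)%E.
Proof.
move=> mA c0; have : P A \is a fin_num by exact: fin_num_measure.
by move: (P A) => [r| |]//= _; rewrite -EFinM !lee_fin ler_pdivlMr// mulrC.
Qed.

Lemma probability_eq0 (A : set Om) (C : R) : measurable A -> 0 <= C ->
  (forall k : nat, (k%:R%:E * P A <= C%:E)%E) -> P A = 0%E.
Proof.
move=> mA C0 h; apply/eqP; rewrite eq_le measure_ge0 andbT; apply/lee_addgt0Pr => e e0.
rewrite add0e; have [k hk] := natSinv_lt (divr_gt0 e0 (ltr_wpDl C0 ltr01)).
have k0 : 0 < k.+1%:R :> R by [].
apply: le_trans (probability_le_div mA k0 (h k.+1)) _; rewrite lee_fin.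
apply: (@le_trans _ _ ((C + 1) * k.+1%:R^-1)).
  by rewrite ler_wpM2r ?invr_ge0// lerDl.
by have := ltW (hk k (leqnn k)); rewrite ler_pdivlMr ?ltr_wpDl// mulrC.
Qed.

End markov.

(** * Events defined by the trajectories *)

Section adapted_processes.
Context {R : realType} {E : normedModType R} {dd : measure_display} {Om : measurableType dd}.
Variables (T : R) (F : R -> set (set Om)) (X : R -> Om -> E).
Hypotheses (T0 : 0 < T) (filF : filtration T F) (aX : adapted T F X) (cX : cadlag_process T X).
Let sM := sigma_algebra_measurable Om.

Lemma trajectory_open t : open_measurable_map (fun w => trajectory T X w t).
Proof.
move=> G oG; rewrite /trajectory /extend; set s := Num.max 0 (Num.min t T).
have sT : s \in `[0, T].
  by rewrite in_itv/= /s le_max lexx/= ge_max (ltW T0) ge_min lexx orbT.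
exact: (filF.1 s sT).2 (aX sT oG).
Qed.

Lemma measurable_trajectory_closed (B : set E) : closed B ->
  measurable [set p : R * Om | B (trajectory T X p.2 p.1)].
Proof.
move=> cB; apply: (@measurable_cadlag_closed _ _ _ _ (fun t w => trajectory T X w t)) => //.
- by move=> w t; exact: (cX w t).1.
- exact: trajectory_open.
- by move=> w t t0; rewrite /trajectory !extend_lt.
Qed.

(** Right continuity and the closedness of [B] reduce the condition to dyadic times, of which [T] is
    one. *)
Lemma measurable_path_in (B : set E) : closed B ->
  measurable [set w | forall t, B (trajectory T X w t)].
Proof.
move=> cB; have : measurable [set w | forall m a : nat, B (trajectory T X w (grid T m a))].
  apply: (sig_all sM) => m; apply: (sig_all sM) => a.
  by apply: measurable_preimage_closed cB; exact: trajectory_open.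
congr measurable; apply/seteqP; split => w /= h; last by move=> m a; exact: h.
have hT : B (X T w).
  by have := h 0%N (2 ^ 0)%N; rewrite gridT /trajectory extend_gt// ltW.
move=> t; have [Tt|tT] := leP T t; first by rewrite /trajectory extend_gt// ltW.
wlog t0 : t tT / 0 <= t.
  move=> h'; have [|t0] := leP 0 t; first exact: h'.
  have := h' 0 T0 (lexx _); rewrite /trajectory.
  by rewrite !extend_lt// ltW.
apply: cB => A /((cX w t).1 A) [e /= e0 hA].
have [||m [a /andP[ta at']]] := @grid_dense _ T t (Num.min T (t + e)) T0 t0.
- by rewrite lt_min tT ltrDl.
- by rewrite ge_min lexx.
exists (trajectory T X w (grid T m a)); split; first exact: h.
apply: hA => //=; rewrite distrC gtr0_norm ?subr_gt0// ltrBlDl.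
by rewrite (lt_le_trans at')// ge_min lexx orbT.
Qed.

(** Lower semicontinuity of [n] gives joint measurability in time and [w]; Tonelli's theorem then
    makes the energy measurable in [w]. *)
Lemma measurable_energy_le (n : E -> \bar R) (q C : R) :
  (forall C : R, closed [set x | (n x <= C%:E)%E]) ->
  measurable [set w | (energy T q n (trajectory T X w) <= C%:E)%E].
Proof.
move=> cn; pose f (p : R * Om) := (n (trajectory T X p.2 p.1) `^ q)%E.
pose g (p : R * Om) := (f p * (\1_(`[0%R, T]%classic) p.1)%:E)%E.
have mf : measurable_fun setT f.
  apply: (measurableT_comp (measurable_poweR q)).
  by apply: measurable_lsc => c; exact: measurable_trajectory_closed (cn c).
have mg : measurable_fun setT g.
  apply: emeasurable_funM => //; apply/measurable_EFinP.
  exact: (measurableT_comp (measurable_indic _) measurable_fst).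
have g0 p : (0 <= g p)%E by rewrite mule_ge0 ?poweR_ge0.
have := @measurable_fun_fubini_tonelli_G _ _ _ _ R lebesgue_measure g mg g0.
move=> /(_ measurableT [set x | (x <= C%:E)%E]); rewrite setTI /fubini_G => h.
have eg w : energy T q n (trajectory T X w) = (\int[lebesgue_measure]_t g (t, w))%E.
  rewrite /energy integral_mkcond; apply: eq_integral => t _.
  by rewrite /g /f /= patchE indicE; case: ifP => _; rewrite ?mule1 ?mule0.
have -> : [set w | (energy T q n (trajectory T X w) <= C%:E)%E] =
    (fun y => (\int[lebesgue_measure]_x g (x, y))%E) @^-1` [set x | (x <= C%:E)%E].
  by apply/seteqP; split => w /=; rewrite eg.
exact: h (emeasurable_itv `]-oo, C%:E]).
Qed.

End adapted_processes.

Section dual_processes.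
Context {R : realType} {U : normedModType R} {dd : measure_display} {Om : measurableType dd}.
Variables (P : probability Om R) (T : R) (F : R -> set (set Om)) (X : R -> Om -> dual U).
Hypotheses (T0 : 0 < T) (filF : filtration T F) (aX : adapted T F X).

Lemma continuous_apply (u : U) : continuous (fun x : dual U => x u : R).
Proof.
move=> x; apply/(@cvgrPdist_le _ _ _ _ (nbhs_filter x)) => e e0.
have u0 : 0 < `|u| + 1 by rewrite ltr_wpDl.
have h : 0 < e / (`|u| + 1) by rewrite divr_gt0.
have := (@cvgrPdist_le _ _ _ _ (nbhs_filter x) id x).1 (@cvg_id _ (nbhs x)) _ h.
apply: (@filterS _ _ (nbhs_filter x)) => y /= xy.
rewrite -[x u - y u]/((x - y) u) (le_trans (dual_apply_le _ _))//.
apply: (@le_trans _ _ (`|x - y| * (`|u| + 1))); first by rewrite ler_wpM2l// lerDl.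
by rewrite -ler_pdivlMr.
Qed.

(** Where the norm [n] stays finite, the distance is decided by the evaluations at the [v k], which
    are adapted; the exceptional set is null, and it and its subsets belong to [F 0]. *)
Lemma adapted_dist (n : dual U -> \bar R) (v : nat -> U) : ext_norm n ->
  (forall k, `|v k| <= 1) ->
  (forall (x : dual U) (c : R), (n x < +oo)%E -> (forall k, `|x (v k)| <= c) -> `|x| <= c) ->
  (forall A, P.-negligible A -> F 0 A) ->
  P.-negligible (~` [set w | forall t, t \in `[0, T] -> (n (X t w) < +oo)%E]) ->
  forall s t (c : R), 0 <= s -> s <= t -> t <= T -> F t [set w | `|X s w - X t w| <= c].
Proof.
move=> en v1 nv neg; set Z := [set w | _] => nZ s t c s0 st tT.
have tT' : t \in `[0, T] by rewrite in_itv/= tT (le_trans s0).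
have sT' : s \in `[0, T] by rewrite in_itv/= s0 (le_trans st).
have sF := (filF.1 t tT').1.
have F0t : F 0 `<=` F t by apply: filF.2 => //; exact: le_trans st.
have Fst : F s `<=` F t by exact: filF.2.
have gt_open u (r : R) : open [set x : dual U | r < x u].
  exact: (@open_comp _ _ (fun x : dual U => x u : R) [set y | r < y]
    (fun x _ => @continuous_apply u x) (@open_gt _ r)).
have lt_open u (r : R) : open [set x : dual U | x u < r].
  exact: (@open_comp _ _ (fun x : dual U => x u : R) [set y | y < r]
    (fun x _ => @continuous_apply u x) (@open_lt _ r)).
pose D := [set w | forall k, `|X s w (v k) - X t w (v k)| <= c].
have FD : F t D.
  apply: (sig_all sF) => k; apply: (sig_dist_le _ sF) => r.
  - exact: Fst (aX sT' (gt_open _ r)).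
  - exact: Fst (aX sT' (lt_open _ r)).
  - exact: (aX tT' (gt_open _ r)).
  - exact: (aX tT' (lt_open _ r)).
set S := [set w | _].
have FZ : F t (~` Z) by exact/F0t/neg.
have FSZ : F t (S `&` ~` Z) by apply: F0t; apply: neg; apply: negligibleS nZ => w [].
have FZ' : F t Z by rewrite -[Z]setCK; exact: (sigC sF).
have -> : S = (D `&` Z) `|` (S `&` ~` Z).
  apply/seteqP; split => w.
    move=> Sw; have [Zw|Zw] := pselect (Z w); [left|right] => //; split => // k.
    exact: le_trans (dual_ball_le (X s w - X t w) (v1 k)) Sw.
  move=> [[Dw Zw]|[]//]; apply: nv => //.
  by apply: le_lt_trans (ext_B en _ _) _; rewrite lte_add_pinfty//; exact: Zw.
apply: (sigU sF) => //; exact: (sigI sF).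
Qed.

End dual_processes.

(** * Tightness in Z_q *)

Theorem corollary3p5
  (R : realType) (d : nat) (hd : d = 2%N \/ d = 3%N)
  (O : set 'rV[R]_d) (O_open : open O) (O_connected : connected O)
  (O_smooth : has_boundary_of_class smooth O)
  (m : R) (m_gt1 : 1 < m)
  (U : completeNormedModType R) (U_hilbert : hilbert_norm U)
  (j : U -> 'rV[R]_d -> 'rV[R]_d) (jU : dense_compact_subspace m O j)
  (OR : nat -> set 'rV[R]_d)
  (OR_open : forall r, open (OR r))
  (OR_bounded : forall r, bounded_set (OR r))
  (OR_regular : forall r, has_boundary_of_class lipschitzian (OR r))
  (OR_incr : forall r, OR r `<=` OR r.+1)
  (OR_cover : \bigcup_r OR r = O)
  (OR_compact : forall r, compact_map (spaceV 1 O) (Hm_norm 1 (OR r)) id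
                                      (spaceH O) (L2_norm (OR r)))
  (T : R) (T_gt0 : 0 < T) (q : R) (q_gt1 : 1 < q)
  (dd : measure_display) (Omega : measurableType dd) (P : probability Omega R)
  (F : R -> set (set Omega)) (F_filtration : filtration T F)
  (F_usual : usual_hypotheses T F P)
  (X : nat -> R -> Omega -> dual U)
  (X_adapted : forall n, adapted T F (X n))
  (X_cadlag : forall n, cadlag_process T (X n))
  (hyp_a : exists2 C1 : R, 0 < C1 &
     (ereal_sup (range (fun n =>
        \int[P]_w ereal_sup [set normH O j O (X n s w) | s in `[0%R, T]]))
      <= C1%:E)%E)
  (hyp_b : exists2 C2 : R, 0 < C2 &
     (ereal_sup (range (fun n =>
        \int[P]_w \int[lebesgue_measure]_(s in `[0%R, T])
           (normV O j (X n s w) `^ q)))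
      <= C2%:E)%E)
  (hyp_c : aldous T F P X) :
  forall eps : R, 0 < eps ->
  exists2 K : set (Zq O j OR T q), compact K &
    forall n, measurable (path_event (X n) K) /\
              ((1 - eps)%:E <= law P (X n) K)%E.
Proof.
have T_ge0 := ltW T_gt0.
have sub r : OR r `<=` O by rewrite -OR_cover => x ORx; exists r.
have mOR r : measurable (OR r) := open_rV_measurable (OR_open r).
have mO : measurable O := open_rV_measurable O_open.
have hV := normV_ext_hilbert O_open m_gt1 jU.
have hH : ext_norm (normH O j O) := normH_ext_hilbert O_open m_gt1 jU.
have hR r := normH_ext_norm O_open m_gt1 jU (mOR r) (sub r).
have HV := normH_le_normV O_open m_gt1 jU.
have RH r := normH_le O_open m_gt1 jU (mOR r) (sub r).
have inHP := normH_lty O_open m_gt1 jU.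
have HC (C : R) : compact [set x | (normH O j O x <= C%:E)%E] := normH_compact O_open m_gt1 jU (C := C).
have cH (C : R) : closed [set x | (normH O j O x <= C%:E)%E] := HC_closed HC (C := C).
have ehr r (e : R) (e0 : 0 < e) := ehrling O_open m_gt1 jU (OR_open r) (sub r) (OR_compact r) e0.
have app h (ih : inH O j h) (e : R) (e0 : 0 < e) := innerH_approx O_open m_gt1 jU ih e0.
have [C1 C1_gt0 hC1] := hyp_a; have [C2 C2_gt0 hC2] := hyp_b.
have [v [v1 nv]] := norming_sequence O_open m_gt1 jU.
pose A1 n (C : R) := [set w | forall t, (normH O j O (trajectory T (X n) w t) <= C%:E)%E].
have mA1 n C : measurable (A1 n C).
  exact: (measurable_path_in T_gt0 F_filtration (X_adapted n) (X_cadlag n) (cH C)).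
have trajE n w t : t \in `[0, T] -> trajectory T (X n) w t = X n t w.
  by move=> tT; rewrite /trajectory extend_id.
pose sup_H n w := ereal_sup [set normH O j O (X n s w) | s in `[0%R, T]].
have sup_ge0 n w : (0 <= sup_H n w)%E.
  apply: le_trans (ext_ge0 hH (X n 0 w)) _; apply: ereal_sup_ubound; exists 0 => //=.
  by rewrite in_itv/= lexx.
have A1C n (C : R) : 0 <= C -> (C%:E * P (~` A1 n C) <= C1%:E)%E.
  move=> C0; apply: (@markov_le _ _ _ P (sup_H n)) => //; first exact: measurableC.
    move=> w /= h; rewrite leNgt; apply/negP => h'; apply: h => t.
    apply: le_trans (ltW h'); apply: ereal_sup_ubound.
    exists (Num.max 0 (Num.min t T)) => //=.
    by rewrite in_itv/= le_max lexx/= ge_max T_ge0 ge_min lexx orbT.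
  by apply: le_trans hC1; apply: ereal_sup_ubound; exists n.
(* By (a) and Markov's inequality at every integer level, almost every path stays in some ball of
   H. *)
have nH_fin n : P.-negligible
    (~` [set w | forall t, t \in `[0, T] -> (normH O j O (X n t w) < +oo)%E]).
  have sM := sigma_algebra_measurable Omega.
  have mB : measurable (~` [set w | exists k : nat, A1 n k%:R w]).
    by apply: measurableC; apply: (sig_ex sM) => k; exact: mA1.
  exists (~` [set w | exists k : nat, A1 n k%:R w]); split => //.
    apply: (probability_eq0 mB (ltW C1_gt0)) => k.
    apply: le_trans (A1C n k%:R _) => //; apply: lee_wpmul2l; first by rewrite lee_fin.
    apply: le_measure; rewrite ?inE//; first exact: measurableC.
    by apply: subsetC => w Aw; exists k.
  apply: subsetC => w [k Aw] t tT; rewrite -trajE//.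
  exact: le_lt_trans (Aw t) (ltry _).
have dX n := adapted_dist F_filtration (X_adapted n) hH v1 nv F_usual.2 (nH_fin n).
move=> eps eps0; have eps3 : 0 < eps / 3 by rewrite divr_gt0.
(* The tolerance for the modulus [1 / (k + 1)]; over all [k] these sum to [eps / 3]. *)
have pk (k : nat) : 0 < eps / 3 / (2 ^ k.+1)%:R by rewrite divr_gt0// ltr0n expn_gt0.
have ek (k : nat) : 0 < k.+1%:R^-1 :> R by rewrite invr_gt0 ltr0n.
have reg (k : nat) := aldous_regular T_gt0 F_filtration dX X_cadlag hyp_c (pk k) (ek k).
pose dlt k := s2val (cid2 (reg k)).
have dlt_gt0 k : 0 < dlt k := s2valP (cid2 (reg k)).
pose R_ n k := [set w | regular_on T (dlt k) k.+1%:R^-1 (trajectory T (X n) w)].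
have R_P n k : measurable (R_ n k) /\ (P (~` R_ n k) <= (eps / 3 / (2 ^ k.+1)%:R)%:E)%E.
  exact: s2valP' (cid2 (reg k)) n.
have divC (C : R) : 0 < C -> C / (C / (eps / 3)) = eps / 3.
  by move=> C0; rewrite invf_div mulrCA divff ?mulr1// gt_eqF.
(* Levels at which Markov's inequality bounds each failure probability by [eps / 3]. *)
pose a1 := C1 / (eps / 3); pose a2 := C2 / (eps / 3).
have a1_gt0 : 0 < a1 by rewrite divr_gt0.
have a2_gt0 : 0 < a2 by rewrite divr_gt0.
pose A2 n := [set w | (energy T q (normV O j) (trajectory T (X n) w) <= a2%:E)%E].
have mA2 n : measurable (A2 n).
  exact: (measurable_energy_le T_gt0 F_filtration (X_adapted n) (X_cadlag n) q a2 (ext_closed hV)).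
have PA1 n : (P (~` A1 n a1) <= (eps / 3)%:E)%E.
  have := probability_le_div (measurableC (mA1 n a1)) a1_gt0 (A1C n a1 (ltW a1_gt0)).
  by rewrite [X in (_ <= X%:E)%E -> _]divC.
have PA2 n : (P (~` A2 n) <= (eps / 3)%:E)%E.
  have : (a2%:E * P (~` A2 n) <= C2%:E)%E.
    apply: (@markov_le _ _ _ P (fun w => energy T q (normV O j) (trajectory T (X n) w))).
    - by move=> w; exact: energy_ge0.
    - exact: measurableC.
    - exact: ltW.
    - by move=> w /negP; rewrite -ltNge => /ltW.
    have -> : (\int[P]_w energy T q (normV O j) (trajectory T (X n) w) =
        \int[P]_w \int[lebesgue_measure]_(s in `[0%R, T]) (normV O j (X n s w) `^ q))%E.
      apply: eq_integral => w _; apply: eq_integral => t; rewrite inE/= => tT.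
      by rewrite trajE.
    by apply: le_trans hC2; apply: ereal_sup_ubound; exists n.
  move=> /(probability_le_div (measurableC (mA2 n)) a2_gt0).
  by rewrite [X in (_ <= X%:E)%E -> _]divC.
pose A3 n := \bigcap_k R_ n k.
have mA3 n : measurable (A3 n) by apply: bigcapT_measurable => k; exact: (R_P n k).1.
have PA3 n : (P (~` A3 n) <= (eps / 3)%:E)%E.
  apply: le_trans (epsilon_trick0 xpredT (ltW eps3)).
  apply: le_trans (lee_nneseries _ (fun k _ => (R_P n k).2)); last by [].
  apply: measure_sigma_subadditive => //.
  - by move=> k; apply: measurableC; exact: (R_P n k).1.
  - exact: measurableC.
  - by rewrite /A3 setC_bigcap.
pose K : set (Zq O j OR T q) := [set z | [/\ forall t, (normH O j O (Zq_val z t) <= a1%:E)%E,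
    (energy T q (normV O j) (Zq_val z) <= a2%:E)%E &
    forall k, regular_on T (dlt k) k.+1%:R^-1 (Zq_val z)]].
exists K.
  apply: (compact_Zq T_gt0 q_gt1 hV hH hR HV RH inHP HC ehr app dlt_gt0 ek) => e e0.
  by have [k hk] := natSinv_lt e0; exists k; exact: ltW (hk k (leqnn k)).
(* A trajectory that meets the three bounds lies in Z_q, so the path event is exactly the
   intersection of three events, and in particular measurable. *)
move=> n; have KE : path_event (X n) K = A1 n a1 `&` A2 n `&` A3 n.
  apply/seteqP; split => w /=.
    move=> [z [z1 z2 z3] zw]; split; last by move=> k _; rewrite /R_ /= -zw; exact: z3.
    by split; [move=> t; rewrite -zw; exact: z1|rewrite /A2 /= -zw].
  move=> [[w1 w2] w3].
  have fe : finite_energy T q (normV O j) (trajectory T (X n) w).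
    split; [exact: extend_extend|exact: X_cadlag|exact: le_lt_trans w2 (ltry _)].
  have zw := path_in_Zq T_gt0 q_gt1 hV hH hR HV RH inHP HC app fe w1.
  exists (exist (fun u => u \in Zq_set O j OR T q) _ (mem_set zw)) => //.
  by split => // k; exact: w3.
have mK : measurable (path_event (X n) K).
  by rewrite KE; apply: measurableI => //; exact: measurableI.
split => //; apply: probability_setC_ge => //; rewrite KE !setCI.
apply: le_trans (measureU2 _ _ _) _; first by apply: measurableU; exact: measurableC.
  exact: measurableC.
have -> : eps = eps / 3 + eps / 3 + eps / 3 by lra.
rewrite EFinD; apply: leeD; last exact: PA3.
apply: le_trans (measureU2 _ (measurableC (mA1 n a1)) (measurableC (mA2 n))) _.
by rewrite EFinD; apply: leeD; [exact: PA1|exact: PA2].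
Qed.
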